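(* Let $\sigma:\Omega\to\Omega$ be an invertible, ergodic, measure-preserving transformation of a probability space $(\Omega,\mathcal{F},\mathbb{P})$, and let $(\mathcal{T},\sigma)$, $\mathcal{T}=\mathcal{T}_1=(T_\omega)_{\omega\in\Omega}$, be an admissible Blaschke product cocycle. For fixed $\theta\in\mathbb{T}$, let $\mathcal{T}_\theta:=(\theta T_\omega)_{\omega\in\Omega}$, and let $\mu_\theta$ be the random absolutely continuous invariant measure of $\mathcal{T}_\theta$ described in the context. Let $h_{\mathbb{P}}(\sigma)$ be the measure theoretic entropy of the base dynamical system with respect to $\mathbb{P}$. Then the average metric entropy over $\theta\in\mathbb{T}$ of the family of cocycles $(\mathcal{T}_\theta)_{\theta\in\mathbb{T}}$, $$\bar h(\mathcal{T}):=\int_{\mathbb{T}}h^{fib}_{\mu_\theta}(\mathcal{T}_\theta)\,d\theta+h_{\mathbb{P}}(\sigma),$$ is given by $$\bar h(\mathcal{T})=\int_\Omega\int_{\mathbb{T}}\log|T_\omega'|\,dm\,d\mathbb{P}(\omega)+h_{\mathbb{P}}(\sigma).$$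
   Context: $D=\{z\in\mathbb{C}:|z|<1\}$, $\mathbb{T}=\{z\in\mathbb{C}:|z|=1\}$, $m$ is normalized Lebesgue measure on $\mathbb{T}$ ($m(\mathbb{T})=1$); $d\theta$ denotes integration over $\theta\in\mathbb{T}$ with respect to normalized Lebesgue measure. The circle is identified with $[0,1)$ via $t\mapsto e^{2\pi i t}$; the variation $\mathrm{var}$ of a function on $\mathbb{T}$ is the usual total variation of the corresponding function on the interval. Blaschke product cocycle: a pair $(\mathcal{T},\sigma)$ with $\sigma$ an invertible, ergodic, measure-preserving transformation of a probability space $(\Omega,\mathcal{F},\mathbb{P})$ and $\mathcal{T}=(T_\omega)_{\omega\in\Omega}$, where $T_\omega:\hat{\mathbb{C}}\to\hat{\mathbb{C}}$ is $$T_\omega(z)=\rho_\omega\prod_{i=1}^{n_\omega}\frac{z-a_{i,\omega}}{1-\bar a_{i,\omega}z},$$ with $n:\Omega\to\mathbb{N}=\{1,2,\dots\}$ and $\rho:\Omega\to\mathbb{T}$ measurable, $a_{i,\omega}\in D$, and, for each $j\ge1$ for which $\Omega_j:=\{\omega:n_\omega=j\}$ is nonempty, $\omega\mapsto(a_{1,\omega},\dots,a_{j,\omega})\in D^j$ measurable on $\Omega_j$. Write $T^{(n)}_\omega=T_{\sigma^{n-1}\omega}\circ\cdots\circ T_\omega$. Admissible: the Blaschke product cocycle is admissible if (1) $\omega\mapsto\left(\inf_{z\in\mathbb{T}}|T_\omega'(z)|,\ \mathrm{var}(1/|T_\omega'|)\right)$ is measurable on $\Omega$; (2) $\int_\Omega\log\inf_{z\in\mathbb{T}}|T_\omega'(z)|\,d\mathbb{P}(\omega)>0$;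 (3) $\int_\Omega\frac{n_\omega}{\inf_{z\in\mathbb{T}}|T_\omega'(z)|}\,d\mathbb{P}(\omega)<\infty$; (4) $\int_\Omega\int_{\mathbb{T}}\left|\frac{T_\omega''}{(T_\omega')^2}\right|dm\,d\mathbb{P}(\omega)<\infty$. Random invariant ($\mathcal{T}$-invariant) measure: a measure $\mu$ on $\Omega\times\mathbb{T}$ with disintegration $\{\mu_\omega\}_{\omega\in\Omega}$ with respect to $\mathbb{P}$, where each $\mu_\omega$ is a probability measure on $\mathbb{T}$, $\omega\mapsto\mu_\omega$ is measurable, and $(T_\omega)_*\mu_\omega=\mu_{\sigma\omega}$ for $\mathbb{P}$-a.e. $\omega$. The measures $\mu_\theta$: for each $\theta\in\mathbb{T}$, $\mathcal{T}_\theta$ is again an admissible Blaschke product cocycle over $\sigma$, and every admissible cocycle has a unique random invariant measure whose fibre measures are absolutely continuous with respect to $m$; for $\mathcal{T}_\theta$ it is called $\mu_\theta$, with disintegration $\{\mu_{\omega,\theta}\}_{\omega\in\Omega}$. Explicitly, with $T_{\omega,\theta}:=\theta T_\omega$ and $T^{(n)}_{\omega,\theta}:=T_{\sigma^{n-1}\omega,\theta}\circ\cdots\circ T_{\omega,\theta}$, for $\mathbb{P}$-a.e. $\omega$ the limit $x_{\omega,\theta}=\lim_{n\to\infty}T^{(n)}_{\sigma^{-n}\omega,\theta}(z)\in D$ exists and is the same for all $z\in D$, and $\frac{d\mu_{\omega,\theta}}{dm}(z)=\frac{1-|x_{\omega,\theta}|^2}{|z-x_{\omega,\theta}|^2}$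 for $z\in\mathbb{T}$. Fibre entropy: for a random invariant measure $\mu$ of a cocycle $\mathcal{T}$ and a finite measurable partition $\mathcal{P}$ of $\mathbb{T}$, $h^{fib}_\mu(\mathcal{T};\mathcal{P})=\lim_{n\to\infty}\frac1n\int_\Omega H_{\mu_\omega}\left(\bigvee_{i=0}^{n-1}(T^{(i)}_\omega)^{-1}\mathcal{P}\right)d\mathbb{P}(\omega)$ with $H_{\mu_\omega}(\mathcal{P})=-\sum_{A\in\mathcal{P}}\mu_\omega(A)\log\mu_\omega(A)$, and $h^{fib}_\mu(\mathcal{T})=\sup_{\mathcal{P}}h^{fib}_\mu(\mathcal{T};\mathcal{P})$ over all finite partitions $\mathcal{P}$. *)

(* Defs.v *)
From HB Require Import structures.
From mathcomp Require Import all_boot all_order all_algebra.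
From mathcomp Require Import all_classical all_reals all_analysis.
From mathcomp Require Import measurable_realfun complex.

Set Implicit Arguments.
Unset Strict Implicit.
Unset Printing Implicit Defensive.

Import Order.TTheory GRing.Theory Num.Theory.
Import numFieldNormedType.Exports.

Local Open Scope complex_scope.
Local Open Scope classical_set_scope.
Local Open Scope ring_scope.

(* The complex numbers [R[i]] over the reals [R], normed over themselves (so
   that [derive1] is the complex derivative) and with their Borel sets. *)
HB.instance Definition _ (R : realType) := NormedModule.copy R[i] (R[i])^o.
HB.instance Definition _ (R : realType) :=
  Measurable.copy R[i] (g_sigma_algebraType (@open R[i])).

(* The modulus as an element of [R]; the norm [`|z|] is an element of [R[i]]. *)
Notation modulus z := (Normc.normc z).

Section circle.
Variable R : realType.

Definition circle : set R[i] := [set z | modulus z = 1].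

Definition disk : set R[i] := [set z | modulus z < 1].

(* t |-> exp (2 pi i t) *)
Definition expi (t : R) : R[i] := cos (2 * pi * t) +i* sin (2 * pi * t).

Lemma circle_expi t : circle (expi t).
Proof. by rewrite /circle /= cos2Dsin2 sqrtr1. Qed.

Lemma continuous_expi : continuous expi.
Proof.
have cmul : continuous (fun t : R => 2 * pi * t).
  exact: mulrl_continuous.
have sqrt_le (a b : R) : Num.sqrt (a ^+ 2 + b ^+ 2) <= `|a| + `|b|.
  rewrite -[leRHS]ger0_norm ?addr_ge0// -sqrtr_sqr ler_sqrt ?sqr_ge0//.
  rewrite sqrrD -(real_normK (num_real a)) -(real_normK (num_real b)).
  by rewrite lerD2r lerDl mulrn_wge0// mulr_ge0.
move=> t; apply/(@cvgrPdist_lt _ R[i]) => e e0.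
have [e' e'0 ->] : exists2 e' : R, 0 < e' & e = e'%:C.
  case: e e0 => a b; rewrite ltcE/= => /andP[/eqP b0 a0].
  by exists a; rewrite ?b0.
have e2 : 0 < e' / 2 by rewrite divr_gt0.
have : \forall x \near t, `|cos (2 * pi * t) - cos (2 * pi * x)| < e' / 2.
  have /cvgrPdist_lt : (fun x => cos (2 * pi * x)) x @[x --> t] -->
      cos (2 * pi * t).
    by apply: (continuous_comp (cmul t)); exact: continuous_cos.
  by apply.
have : \forall x \near t, `|sin (2 * pi * t) - sin (2 * pi * x)| < e' / 2.
  have /cvgrPdist_lt : (fun x => sin (2 * pi * x)) x @[x --> t] -->
      sin (2 * pi * t).
    by apply: (continuous_comp (cmul t)); exact: continuous_sin.
  by apply.
apply: filterS2 => x hs hc.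
rewrite /expi normc_def ltcR /=.
rewrite (le_lt_trans (sqrt_le _ _))// [ltRHS](splitr e') ltrD//.
Qed.

Lemma measurable_expi : measurable_fun [set: R] expi.
Proof.
apply: (@measurability _ _ _ R[i] _ _ (@open R[i])) => //.
move=> _ [U oU <-]; rewrite setTI; apply: open_measurable.
by move/continuousP: continuous_expi; apply.
Qed.

(* Normalized Lebesgue measure on the circle, as a Borel measure on [R[i]]. *)
Definition circle_measure : set R[i] -> \bar R :=
  pushforward (mrestr lebesgue_measure (measurable_itv `[0, 1[)) expi.

HB.instance Definition _ := Measure.copy circle_measure
  (measure_function_pushforward__canonical__measure_function_Measure
    (mrestr lebesgue_measure (measurable_itv `[0, 1[)) measurable_expi).

Let circle_measure_setT : circle_measure [set: R[i]] = 1%E.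
Proof.
rewrite /circle_measure /pushforward preimage_setT /mrestr setTI.
by rewrite lebesgue_measure_itv /= lte_fin ltr01 oppr0 adde0.
Qed.

HB.instance Definition _ :=
  Measure_isProbability.Build _ _ _ circle_measure circle_measure_setT.

(* Total variation of a function on the circle, read on [0, 1]; the closing
   point 1 does not change the variation of a continuous function. *)
Definition circle_var (f : R[i] -> R) : \bar R :=
  total_variation 0 1 (f \o expi).

End circle.

Section base_dynamics.
Context d (X : measurableType d) (R : realType) (P : probability X R).

Definition measurably_invertible (s : X -> X) : Prop :=
  measurable_fun [set: X] s /\
  exists s' : X -> X,
    [/\ cancel s s', cancel s' s & measurable_fun [set: X] s'].

Definition measure_preserving (s : X -> X) : Prop :=
  forall A, measurable A -> pushforward P s A = P A.

Definition ergodic (s : X -> X) : Prop :=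
  forall A, measurable A -> s @^-1` A = A -> P A = 0%E \/ P A = 1%E.

End base_dynamics.

Section entropy.
Variable R : realType.

(* A partition of [D] is an indexed family of possibly empty cells; empty and
   null cells do not contribute to the entropy since [0 * ln 0 = 0]. *)
Definition finite_partition d (X : measurableType d) (D : set X) (k : nat)
    (A : 'I_k -> set X) : Prop :=
  [/\ forall i, measurable (A i), trivIset [set: 'I_k] A
    & \bigcup_(i in [set: 'I_k]) A i = D].

Definition partition_entropy (X : Type) (I : finType) (mu : set X -> \bar R)
    (A : I -> set X) : R :=
  - \sum_(i : I) fine (mu (A i)) * ln (fine (mu (A i))).

(* The join of the pullbacks of [A] by [f 0, ..., f (n - 1)], its cells being
   indexed by the words of length [n] over the indices of [A]. *)
Definition pullback_join (X Y : Type) (I : finType) (f : nat -> X -> Y)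
    (A : I -> set Y) (n : nat) (w : {ffun 'I_n -> I}) : set X :=
  \bigcap_(i in [set: 'I_n]) f i @^-1` A (w i).

Definition partition_ks_entropy d (X : measurableType d)
    (P : probability X R) (s : X -> X) (k : nat) (A : 'I_k -> set X) : \bar R :=
  limn (fun n => ((n%:R^-1)%:E *
    (partition_entropy P (@pullback_join _ _ _ (fun i => iter i s) A n))%:E)%E).

Definition ks_entropy d (X : measurableType d) (P : probability X R)
    (s : X -> X) : \bar R :=
  ereal_sup [set h | exists k (A : 'I_k -> set X),
    finite_partition [set: X] A /\ h = partition_ks_entropy P s A].

End entropy.

(* The family of maps of a cocycle is a function [F : Omega -> R[i] -> R[i]];
   the measures live on [R[i]] and are carried by the circle. *)
Section cocycle.
Context d (Omega : measurableType d) (R : realType) (P : probability Omega R).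
Variables (sigma : Omega -> Omega) (F : Omega -> R[i] -> R[i]).

Fixpoint cocycle_iter (n : nat) (w : Omega) (z : R[i]) : R[i] :=
  if n is n'.+1 then F (iter n' sigma w) (cocycle_iter n' w z) else z.

(* A random invariant measure is given by its disintegration over [P]. *)
Record random_invariant_measure (mu : R.-pker Omega ~> R[i]) : Prop := {
  rim_circle : forall w, mu w (@circle R) = 1%E;
  rim_invariant : {ae P, forall w, forall A, measurable A ->
    pushforward (mu w) (F w) A = mu (sigma w) A}
}.

Definition random_acim (mu : R.-pker Omega ~> R[i]) : Prop :=
  random_invariant_measure mu /\ {ae P, forall w, mu w `<< @circle_measure R}.

Definition partition_fiber_entropy (mu : R.-pker Omega ~> R[i]) (k : nat)
    (A : 'I_k -> set R[i]) : \bar R :=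
  limn (fun n => ((n%:R^-1)%:E * \int[P]_w (partition_entropy (mu w)
    (@pullback_join _ _ _ (fun i => cocycle_iter i w) A n))%:E)%E).

Definition fiber_entropy (mu : R.-pker Omega ~> R[i]) : \bar R :=
  ereal_sup [set h | exists k (A : 'I_k -> set R[i]),
    finite_partition (@circle R) A /\ h = partition_fiber_entropy mu A].

End cocycle.

(* [zeros w i] is only meaningful for [i < degree w]. *)
Record blaschke_cocycle d (Omega : measurableType d) (R : realType) := {
  degree : Omega -> nat;
  rotation : Omega -> R[i];
  zeros : Omega -> nat -> R[i];
  degree_gt0 : forall w, (0 < degree w)%N;
  rotation_circle : forall w, circle (rotation w);
  zeros_disk : forall w i, (i < degree w)%N -> disk (zeros w i);
  measurable_degree : measurable_fun [set: Omega] degree;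
  measurable_rotation : measurable_fun [set: Omega] rotation;
  measurable_zeros : forall j, (0 < j)%N ->
    measurable_fun [set w | degree w = j] (fun w => [tuple zeros w i | i < j])
}.

(* The values at the poles, which lie off the closed unit disk, are junk. *)
Definition blaschke_map d (Omega : measurableType d) (R : realType)
    (T : blaschke_cocycle Omega R) (w : Omega) (z : R[i]) : R[i] :=
  rotation T w *
  \prod_(i < degree T w) ((z - zeros T w i) / (1 - (zeros T w i)^* * z)).

Coercion blaschke_map : blaschke_cocycle >-> Funclass.

Section admissible.
Context d (Omega : measurableType d) (R : realType) (P : probability Omega R).
Variable T : blaschke_cocycle Omega R.

Definition inf_deriv (w : Omega) : R :=
  inf [set modulus (derive1 (T w) z) | z in @circle R].

Record admissible : Prop := {
  admissible_measurable : measurable_fun [set: Omega] (fun w =>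
    (inf_deriv w, circle_var (fun z => 1 / modulus (derive1 (T w) z))));
  admissible_expanding : (0 < \int[P]_w (ln (inf_deriv w))%:E)%E;
  admissible_degree :
    (\int[P]_w ((degree T w)%:R / inf_deriv w)%:E < +oo)%E;
  admissible_distortion :
    (\int[P]_w \int[@circle_measure R]_(z in @circle R)
      (modulus (derive1n 2 (T w) z / (derive1 (T w) z) ^+ 2))%:E < +oo)%E
}.

End admissible.

(* The family [theta T] of rotated maps. *)
Definition rotate (Omega : Type) (R : realType) (theta : R[i])
    (F : Omega -> R[i] -> R[i]) (w : Omega) (z : R[i]) : R[i] :=
  theta * F w z.

Definition average_entropy d (Omega : measurableType d) (R : realType)
    (P : probability Omega R) (sigma : Omega -> Omega)
    (F : Omega -> R[i] -> R[i]) (mu : R[i] -> R.-pker Omega ~> R[i]) : \bar R :=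
  (\int[@circle_measure R]_(theta in @circle R)
      fiber_entropy P sigma (rotate theta F) (mu theta)
    + ks_entropy P sigma)%E.

(* Main.v *)
(** A Blaschke product of degree at least two contracts the hyperbolic metric of
    the disk, strictly on compact sets. By recurrence the orbits of any two
    points of the disk merge, so that almost every fibre of an absolutely
    continuous invariant measure is the Poisson measure of its barycenter [x w],
    and [x (iter n sigma w)] is hyperbolically asymptotic to [T^n 0].

    Fibre entropy is the mean Lyapunov exponent, the integral of [ln |T'|]
    against the fibre measures. From below, Jensen's inequality compares the
    mass of a cell of the n-th join of the partition into N arcs with the
    Jacobian of [T^n], whose integral over the cell is bounded by the number of
    times [T^n] wraps the cell around the circle. From above, itineraries are
    coded through the arcs visited by [T^M], read in Moebius frames in which the
    fibre measures are uniform: a transition costs about [ln (|(T^M)'| + 2)], the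
    Jacobian is at least 1 by Schwarz-Pick, and the constants disappear after
    division by M.

    Finally [theta |-> T_theta^n 0] is analytic and vanishes at 0, so by the mean
    value property the Poisson densities at these points average to 1 over
    [theta]: the exponents average to the integral of [ln |T'|] against Lebesgue
    measure. *)

(* Integrability is scarce. The log-density means [diff_entropy] enter as a coboundary whose
   transfer function is not known to be integrable: for the lower bound it is cut off
   ([rate_lower_bound]), for the upper bound Fatou's lemma is used ([coboundary_le]). Exponents may
   have infinite mean, in which case both sides are +oo; they are bounded below through the
   integrable quantities (ln inf |T'|)^- and n / inf |T'|, the second giving ln n <= n / inf |T'| +
   exponent.

   The family [mu] consists of arbitrary absolutely continuous invariant measures: neither their
   Poisson form nor measurability in theta is given. The Poisson form follows from stationarity: a
   quantity that tends to 0 along forward orbits and has a stationary law vanishes, so no limit from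
   the past is taken. Measurability in theta follows by writing fibre means as limits of integrals
   against Poisson kernels at the explicit points T_theta^n 0.

   The disk estimates are algebraic: the Gram kernel of a Blaschke product turns Schwarz-Pick into
   Cauchy-Schwarz, and one term of Lagrange's identity measures how strict it is. *)
From HB Require Import structures.
Require Import Defs.
From mathcomp Require Import all_boot all_order all_algebra.
From mathcomp Require Import all_classical all_reals all_analysis.
From mathcomp Require Import measurable_realfun complex ring lra.

Set Implicit Arguments.
Unset Strict Implicit.
Unset Printing Implicit Defensive.

Import Order.TTheory GRing.Theory Num.Theory.
Import numFieldNormedType.Exports.

Local Open Scope complex_scope.
Local Open Scope classical_set_scope.
Local Open Scope ring_scope.

Local Notation Re := complex.Re.
Local Notation Im := complex.Im.

(** * Complex moduli and the parametrization of the circle *)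

Section complex_basics.
Variable R : realType.
Implicit Types (z w a x y : R[i]) (t s : R).

Lemma modulus_ge0 z : 0 <= modulus z.
Proof. by case: z => a b; rewrite /= sqrtr_ge0. Qed.

Lemma modulus_sqr z : modulus z ^+ 2 = Re z ^+ 2 + Im z ^+ 2.
Proof. by case: z => a b; rewrite /= sqr_sqrtr// addr_ge0// sqr_ge0. Qed.

Lemma modulusJ z : modulus z^* = modulus z.
Proof. by case: z => a b; rewrite /= sqrrN. Qed.

Lemma mulJc z : z * z^* = (modulus z ^+ 2)%:C.
Proof. by rewrite modulus_sqr; case: z => a b; simpc; congr (_ +i* _); ring. Qed.

Lemma modulus_real t : modulus t%:C = `|t|.
Proof. by rewrite /= expr0n /= addr0 sqrtr_sqr. Qed.

Lemma modulusB z w : modulus (z - w) = modulus (w - z).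
Proof. by rewrite -normcN opprB. Qed.

Lemma modulus_eq0 z : (modulus z == 0) = (z == 0).
Proof.
apply/eqP/eqP => [/Normc.eq0_normc//|->]; exact: Normc.normc0.
Qed.

Lemma modulus_gt0 z : (0 < modulus z) = (z != 0).
Proof. by rewrite lt_def modulus_ge0 andbT modulus_eq0. Qed.

Lemma modulusX z n : modulus (z ^+ n) = modulus z ^+ n.
Proof. by elim: n => [|n ih]; rewrite ?Normc.normc1// !exprS Normc.normcM ih. Qed.

Lemma modulus_prod (I : Type) (r : seq I) (P : pred I) (F : I -> R[i]) :
  modulus (\prod_(i <- r | P i) F i) = \prod_(i <- r | P i) modulus (F i).
Proof.
elim/big_rec2 : _ => [|i y1 y2 _ <-]; [exact: Normc.normc1|by rewrite Normc.normcM].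
Qed.

Lemma lerB_modulus z w : modulus z - modulus w <= modulus (z - w).
Proof. by rewrite lerBlDr (le_trans _ (le_normcD _ _))// subrK. Qed.

Lemma Re_le_modulus z : `|Re z| <= modulus z.
Proof.
rewrite -(ler_sqr (x := `|Re z|)) ?nnegrE ?modulus_ge0//.
by rewrite modulus_sqr real_normK ?num_real// lerDl sqr_ge0.
Qed.

Lemma Im_le_modulus z : `|Im z| <= modulus z.
Proof.
rewrite -(ler_sqr (x := `|Im z|)) ?nnegrE ?modulus_ge0//.
by rewrite modulus_sqr real_normK ?num_real// lerDr sqr_ge0.
Qed.

Lemma ReB z w : Re (z - w) = Re z - Re w.
Proof. by case: z w => a b [c d]. Qed.
Lemma ImB z w : Im (z - w) = Im z - Im w.
Proof. by case: z w => a b [c d]. Qed.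
Lemma ReD z w : Re (z + w) = Re z + Re w.
Proof. by case: z w => a b [c d]. Qed.
Lemma ImD z w : Im (z + w) = Im z + Im w.
Proof. by case: z w => a b [c d]. Qed.
Lemma ReM z w : Re (z * w) = Re z * Re w - Im z * Im w.
Proof. by case: z w => a b [c d]. Qed.
Lemma ImM z w : Im (z * w) = Re z * Im w + Im z * Re w.
Proof. by case: z w => a b [c d]. Qed.

Lemma complex_eqP z w : Re z = Re w -> Im z = Im w -> z = w.
Proof. by case: z w => a b [c d] /= -> ->. Qed.

Lemma conjcM z w : (z * w)^* = z^* * w^*.
Proof. exact: rmorphM. Qed.
Lemma conjcB z w : (z - w)^* = z^* - w^*.
Proof. exact: rmorphB. Qed.
Lemma conjc_sum (I : Type) (r : seq I) (P : pred I) (F : I -> R[i]) :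
  (\sum_(i <- r | P i) F i)^* = \sum_(i <- r | P i) (F i)^*.
Proof. exact: rmorph_sum. Qed.
Lemma conjcV z : (z^-1)^* = (z^*)^-1.
Proof. exact: fmorphV. Qed.
Lemma conjRtoC (t : R) : (t%:C)^* = t%:C.
Proof. by apply: complex_eqP; rewrite //= oppr0. Qed.
Lemma RtoC_inj (t s : R) : t%:C = s%:C -> t = s.
Proof. by case. Qed.
Lemma RtoCM (t s : R) : (t * s)%:C = t%:C * s%:C.
Proof. exact: (rmorphM (real_complex R)). Qed.
Lemma RtoCB (t s : R) : (t - s)%:C = t%:C - s%:C.
Proof. exact: (rmorphB (real_complex R)). Qed.
Lemma RtoC_sum (I : Type) (r : seq I) (P : pred I) (F : I -> R) :
  (\sum_(i <- r | P i) F i)%:C = \sum_(i <- r | P i) (F i)%:C.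
Proof. exact: (rmorph_sum (real_complex R)). Qed.

Lemma sqr_modulusB z w :
  modulus (z - w) ^+ 2 =
  modulus z ^+ 2 + modulus w ^+ 2 - 2 * (Re z * Re w + Im z * Im w).
Proof. by rewrite !modulus_sqr ReB ImB; ring. Qed.

End complex_basics.

Section expi_theory.
Variable R : realType.
Implicit Types (z w a x y : R[i]) (t s : R).

Lemma expiD t s : expi (t + s) = expi t * expi s.
Proof.
rewrite /expi mulrDr cosD sinD; simpc; congr (_ +i* _).
by rewrite addrC mulrC [X in _ + X]mulrC addrC; ring.
Qed.

Lemma expi0 : expi (0 : R) = 1.
Proof. by rewrite /expi mulr0 cos0 sin0. Qed.

Lemma expi1 : expi (1 : R) = 1.
Proof.
rewrite /expi mulr1 mulr_natl cos2pi.
by rewrite -[pi *+ 2]add0r sinD2pi sin0.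
Qed.

Lemma expi_nat n : expi (n%:R : R) = 1.
Proof.
by elim: n => [|n ih]; rewrite ?expi0// -natr1 expiD ih expi1 mulr1.
Qed.

Lemma expi_modulus t : modulus (expi t) = 1.
Proof. exact: circle_expi. Qed.

Lemma expiN t : expi (- t) = (expi t)^*.
Proof. by rewrite /expi mulrN cosN sinN. Qed.

Lemma expi_int (k : int) : expi (k%:~R : R) = 1.
Proof.
case: k => n; first by rewrite -pmulrn expi_nat.
rewrite NegzE mulrNz -pmulrn expiN expi_nat.
by apply: complex_eqP; rewrite //= oppr0.
Qed.

Lemma expiDint t (k : int) : expi (t + k%:~R) = expi t.
Proof. by rewrite expiD expi_int mulr1. Qed.

Lemma expiMn t n : expi (n%:R * t) = expi t ^+ n.
Proof.
elim: n => [|n ih]; first by rewrite mul0r expi0.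
by rewrite -natr1 mulrDl mul1r expiD ih exprSr.
Qed.

Lemma expi_eq1 t : expi t = 1 -> t = (Num.floor t)%:~R.
Proof.
move=> t1; set k := Num.floor t.
have u0 : 0 <= t - k%:~R by rewrite subr_ge0 /k; exact: ge_floor.
have u1 : t - k%:~R < 1.
  by rewrite ltrBlDr addrC -intrD1; exact: lt_succ_floor.
have := expiDint t (- k); rewrite mulrNz t1; move: u0 u1.
set u := t - _ => u0 u1 [cu _].
apply/eqP; rewrite -subr_eq0 -/u; apply/eqP.
have [//|un0] := eqVneq u 0; exfalso.
have up : 0 < u by rewrite lt_def un0.
have spi : 0 < sin (pi * u).
  apply: sin_gt0_pi; rewrite mulr_gt0 ?pi_gt0//=.
  by rewrite -[ltRHS]mulr1 ltr_pM2l// pi_gt0.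
(* Half-angle formula: cos (2 pi u) = cos^2 (pi u) - sin^2 (pi u), which is below 1 once sin (pi u)
   > 0. *)
move: cu; rewrite -mulrA mulr_natl mulr2n cosD -!expr2 => h.
have := cos2Dsin2 (pi * u); have : 0 < sin (pi * u) ^+ 2 by rewrite exprn_gt0.
lra.
Qed.

Lemma expi_eq t s : expi t = expi s -> exists k : int, t = s + k%:~R.
Proof.
move=> ts; have : expi (t - s) = 1.
  by rewrite expiD ts -expiD subrr expi0.
by move/expi_eq1 => h; exists (Num.floor (t - s)); rewrite -h; ring.
Qed.

Lemma expi_inj01 t s : 0 <= t < 1 -> 0 <= s < 1 -> expi t = expi s -> t = s.
Proof.
move=> /andP[t0 t1] /andP[s0 s1] /expi_eq[k tsk].
suff -> : t = s + 0%:~R by rewrite addr0.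
rewrite tsk; congr (_ + _%:~R).
have : (k%:~R : R) < 1%:~R by rewrite /=; lra.
have : ((-1)%:~R : R) < k%:~R by rewrite mulrNz mulr1z; lra.
rewrite !ltr_int; case: k {tsk} => [[|k]|k] //.
Qed.

Lemma circleE z : circle z -> exists2 t, 0 <= t < 1 & z = expi t.
Proof.
case: z => a b ab.
have {}ab : a ^+ 2 + b ^+ 2 = 1.
  by have := modulus_sqr (a +i* b); rewrite ab expr1n /= => ->.
have a1 : -1 <= a <= 1.
  rewrite -ler_norml -(ler_sqr (x := `|a|)) ?nnegrE// real_normK ?num_real//.
  by rewrite expr1n -ab lerDl sqr_ge0.
have a1' : a \in `[(-1), 1] by rewrite in_itv.
have pi2 : (2 * pi : R) != 0 by rewrite mulf_neq0// gt_eqF// pi_gt0.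
have pi0 := pi_gt0 R.
have sE : sin (acos a) = `|b|.
  by rewrite sin_acos// -ab addrAC subrr add0r sqrtr_sqr.
case: (leP 0 b) => b0.
  exists (acos a / (2 * pi)).
    rewrite divr_ge0 ?acos_ge0 ?mulr_ge0// ?(ltW pi0)//=.
    by rewrite ltr_pdivrMr ?mulr_gt0// mul1r (le_lt_trans (acos_lepi a1))//; lra.
  by rewrite /expi [_ * (_ / _)]mulrC divfK// acosK// sE ger0_norm.
exists (1 - acos a / (2 * pi)).
  (* Here [b < 0] excludes [a = 1], which keeps the parameter strictly below 1. *)
  have ap : 0 < acos a.
    apply: acos_gt0; case/andP: a1 => -> a1; rewrite lt_neqAle a1 andbT /=.
    apply/eqP => a1E; move: ab; rewrite a1E expr1n => ab.
    have : 0 < b ^+ 2 by rewrite exprn_even_gt0//= lt_eqF.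
    lra.
  have al := acos_lepi a1.
  rewrite subr_ge0 ler_pdivrMr ?mulr_gt0// mul1r ltrBlDr ltrDl divr_gt0 ?mulr_gt0//.
  by rewrite andbT; lra.
rewrite expiD expi1 mul1r expiN /expi [_ * (_ / _)]mulrC divfK// acosK// sE ltr0_norm//.
by apply: complex_eqP; rewrite //= opprK.
Qed.

End expi_theory.

(** * Finite Blaschke products and the hyperbolic metric *)

Section blaschke_algebra.
Variable R : realType.
Implicit Types (z w x y : R[i]) (t s : R).

Definition mobius (a z : R[i]) : R[i] := (z - a) / (1 - a^* * z).

Definition bprod (rho : R[i]) (a : nat -> R[i]) (n : nat) (z : R[i]) : R[i] :=
  rho * \prod_(i < n) mobius (a i) z.

Lemma mobius_den (a : R[i]) z : modulus a < 1 -> modulus z <= 1 -> 1 - a^* * z != 0.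
Proof.
move=> a1 z1; rewrite subr_eq0; apply/eqP => /(congr1 (fun u => modulus u)).
rewrite Normc.normc1 Normc.normcM modulusJ => h.
suff : modulus a * modulus z < 1 by rewrite -h ltxx.
by rewrite (le_lt_trans _ a1)// ler_piMr// modulus_ge0.
Qed.

Lemma mobius_kernel (a : R[i]) x y :
    modulus a < 1 -> modulus x <= 1 -> modulus y <= 1 ->
  1 - mobius a x * (mobius a y)^* =
  (1 - modulus a ^+ 2)%:C * (1 - x * y^*) / ((1 - a^* * x) * (1 - a^* * y)^*).
Proof.
move=> a1 x1 y1; have dx := mobius_den a1 x1; have dy := mobius_den a1 y1.
have dy' : 1 - a * y^* != 0.
  move: dy; by rewrite -[1 - _ * y]conjCK conjC_eq0 conjcB conjcM conjC1 !conjCK.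
rewrite /mobius !(conjcM, conjcB, conjcV, conjC1, conjCK).
rewrite RtoCB -mulJc.
by field; rewrite dx dy'.
Qed.

(** The Takenaka-Malmquist system: for i < n, an orthonormal basis of the orthocomplement of B H^2
    in the Hardy space H^2, where B is the Blaschke product with zeros [a 0, ..., a (n - 1)]. *)
Definition takenaka (a : nat -> R[i]) (i : nat) (z : R[i]) : R[i] :=
  (\prod_(j < i) mobius (a j) z) *
  ((Num.sqrt (1 - modulus (a i) ^+ 2))%:C / (1 - (a i)^* * z)).

Lemma one_minus_sqr (a : R[i]) : modulus a < 1 -> 0 < 1 - modulus a ^+ 2.
Proof. by move=> a1; rewrite subr_gt0 expr_lt1// modulus_ge0. Qed.

Lemma one_minus_sqr_ge0 (a : R[i]) : modulus a <= 1 -> 0 <= 1 - modulus a ^+ 2.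
Proof. by move=> a1; rewrite subr_ge0 expr_le1// modulus_ge0. Qed.

(* The Takenaka-Malmquist functions factor the Schwarz-Pick kernel of a finite
   Blaschke product as a Gram kernel. *)
Lemma bprod_kernel rho a n x y : modulus rho = 1 ->
    (forall i, (i < n)%N -> modulus (a i) < 1) ->
    modulus x <= 1 -> modulus y <= 1 ->
  1 - bprod rho a n x * (bprod rho a n y)^* =
  (1 - x * y^*) * \sum_(i < n) takenaka a i x * (takenaka a i y)^*.
Proof.
move=> rho1 + x1 y1; rewrite /bprod conjcM.
have -> (u v : R[i]) : (rho * u) * (rho^* * v) = u * v.
  by rewrite mulrACA mulJc rho1 expr1n mul1r.
elim: n => [|n ih] an; first by rewrite !big_ord0 conjC1 mulr1 subrr mulr0.
rewrite !big_ord_recr/= conjcM.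
have an1 := an n (ltnSn _).
rewrite mulrDr -ih; last by move=> i /ltnW; exact: an.
set B := \prod_(i < n) _; set B' := (\prod_(i < n) _)^*.
have -> : 1 - B * mobius (a n) x * (B' * (mobius (a n) y)^*) =
   1 - B * B' + B * B' * (1 - mobius (a n) x * (mobius (a n) y)^*) by ring.
congr (_ + _); rewrite mobius_kernel//.
rewrite /takenaka -/B !conjcM -/B' conjcV.
have /ltW s0 := one_minus_sqr an1.
have {1}-> : (1 - modulus (a n) ^+ 2)%:C = (Num.sqrt (1 - modulus (a n) ^+ 2))%:C
     * ((Num.sqrt (1 - modulus (a n) ^+ 2))%:C)^* :> R[i].
  by rewrite conjRtoC -RtoCM -expr2 sqr_sqrtr.
rewrite invfM; ring.
Qed.

(** The diagonal case of the kernel identity. All mapping properties of B (closed disk, open disk,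
    circle) are read off from it, without a maximum principle. *)
Lemma bprod_modulus rho a n z : modulus rho = 1 ->
    (forall i, (i < n)%N -> modulus (a i) < 1) -> modulus z <= 1 ->
  1 - modulus (bprod rho a n z) ^+ 2 =
  (1 - modulus z ^+ 2) * \sum_(i < n) modulus (takenaka a i z) ^+ 2.
Proof.
move=> rho1 an z1; apply: RtoC_inj.
have -> (w : R[i]) : (1 - modulus w ^+ 2)%:C = 1 - w * w^*.
  by rewrite mulJc; exact: RtoCB.
rewrite bprod_kernel//.
have -> : \sum_(i < n) takenaka a i z * (takenaka a i z)^* =
    (\sum_(i < n) modulus (takenaka a i z) ^+ 2)%:C.
  by rewrite RtoC_sum; apply: eq_bigr => i _; rewrite mulJc.
have -> : 1 - z * z^* = (1 - modulus z ^+ 2)%:C by rewrite mulJc; exact/esym/RtoCB.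
exact/esym/RtoCM.
Qed.

Lemma bprod_circle rho a n z : modulus rho = 1 ->
    (forall i, (i < n)%N -> modulus (a i) < 1) -> modulus z = 1 ->
  modulus (bprod rho a n z) = 1.
Proof.
move=> rho1 an z1; have z1' : modulus z <= 1 by rewrite z1.
have := bprod_modulus rho1 an z1'; rewrite z1 expr1n subrr mul0r => /eqP.
by rewrite subr_eq0 eq_sym sqrp_eq1 ?modulus_ge0// => /eqP.
Qed.

Lemma bprod_le1 rho a n z : modulus rho = 1 ->
    (forall i, (i < n)%N -> modulus (a i) < 1) -> modulus z <= 1 ->
  modulus (bprod rho a n z) <= 1.
Proof.
move=> rho1 an z1; rewrite -(@expr_le1 _ 2 _ isT (modulus_ge0 _)) -subr_ge0.
rewrite bprod_modulus// mulr_ge0// ?one_minus_sqr_ge0//.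
by apply: sumr_ge0 => i _; rewrite sqr_ge0.
Qed.

Lemma takenaka_gt0 a i z : (forall j, (j <= i)%N -> modulus (a j) < 1) ->
    modulus z <= 1 -> (forall j, (j < i)%N -> z != a j) ->
  0 < modulus (takenaka a i z) ^+ 2.
Proof.
move=> ai z1 za; rewrite exprn_gt0// modulus_gt0 /takenaka mulf_neq0//.
  apply/prodf_neq0 => j _; rewrite /mobius mulf_neq0// ?subr_eq0 ?za//.
  by rewrite invr_eq0 mobius_den// ai// ltnW.
rewrite mulf_neq0 ?invr_eq0 ?mobius_den ?ai//.
rewrite -modulus_gt0 modulus_real normr_gt0 gt_eqF// sqrtr_gt0.
by rewrite one_minus_sqr// ai.
Qed.

Lemma bprod_lt1 rho a n z : (0 < n)%N -> modulus rho = 1 ->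
    (forall i, (i < n)%N -> modulus (a i) < 1) -> modulus z < 1 ->
  modulus (bprod rho a n z) < 1.
Proof.
move=> n0 rho1 an z1; rewrite -(@expr_lt1 _ 2 _ isT (modulus_ge0 _)) -subr_gt0.
rewrite bprod_modulus// ?ltW// mulr_gt0// ?one_minus_sqr//.
case: n n0 an => // n _ an; rewrite big_ord_recl/=.
rewrite ltr_wpDr ?sumr_ge0// => [i _|]; first by rewrite sqr_ge0.
apply: takenaka_gt0 => // [j|]; last exact: ltW.
by rewrite leqn0 => /eqP ->; rewrite an.
Qed.

(** This is cosh^2 (d / 2) for the hyperbolic distance d of curvature -1; a rational expression is
    easier to iterate than d itself. *)
Definition hyp x y : R :=
  modulus (1 - x * y^*) ^+ 2 / ((1 - modulus x ^+ 2) * (1 - modulus y ^+ 2)).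

Lemma hyp_sub1 x y : modulus x < 1 -> modulus y < 1 ->
  hyp x y - 1 = modulus (x - y) ^+ 2 / ((1 - modulus x ^+ 2) * (1 - modulus y ^+ 2)).
Proof.
move=> x1 y1; have /lt0r_neq0 dx := one_minus_sqr x1.
have /lt0r_neq0 dy := one_minus_sqr y1; rewrite /hyp.
have h : modulus (1 - x * y^*) ^+ 2 =
    modulus (x - y) ^+ 2 + (1 - modulus x ^+ 2) * (1 - modulus y ^+ 2).
  rewrite !modulus_sqr !(ReB, ImB, ReM, ImM).
  by case: x y {x1 y1 dx dy} => a b [c d] /=; ring.
by rewrite h; field; rewrite dx dy.
Qed.

Lemma hyp_ge1 x y : modulus x < 1 -> modulus y < 1 -> 1 <= hyp x y.
Proof.
move=> x1 y1; rewrite -subr_ge0 hyp_sub1// divr_ge0 ?sqr_ge0//.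
by rewrite mulr_ge0// ltW// one_minus_sqr.
Qed.

Lemma hypC x y : hyp x y = hyp y x.
Proof.
rewrite /hyp [X in _ / X]mulrC; congr (_ ^+ 2 / _).
by rewrite -modulusJ conjcB conjC1 conjcM conjCK mulrC.
Qed.

Lemma modulus_lagrange (p q r s : R[i]) :
  modulus (p * q - r * s) ^+ 2 <=
  (modulus p ^+ 2 + modulus r ^+ 2) * (modulus q ^+ 2 + modulus s ^+ 2).
Proof.
rewrite -subr_ge0.
rewrite (_ : _ - _ = modulus (p * s^* + r * q^*) ^+ 2) ?sqr_ge0//.
rewrite !modulus_sqr !(ReB, ImB, ReM, ImM, ReD, ImD).
by case: p q r s => p p' [q q'] [r r'] [s s'] /=; ring.
Qed.

(** One term of Lagrange's identity: the defect in Cauchy-Schwarz dominates any single 2x2 minor.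
    The vector [d] is [A] times the component of [v] orthogonal to [u]; replacing [v] by [d]
    multiplies the minor by [A], and the minor is then bounded by the norms of [d] and [u]. *)
Lemma cauchy_schwarz_lagrange n (u v : 'I_n -> R[i]) (i j : 'I_n) :
  0 < \sum_k modulus (u k) ^+ 2 -> i != j ->
  modulus (\sum_k u k * (v k)^*) ^+ 2 + modulus (u i * v j - u j * v i) ^+ 2 <=
  (\sum_k modulus (u k) ^+ 2) * (\sum_k modulus (v k) ^+ 2).
Proof.
set A := \sum_k modulus (u k) ^+ 2; set B := \sum_k modulus (v k) ^+ 2.
set C := \sum_k u k * (v k)^*; move=> A0 ij.
pose d k := A%:C * v k - C^* * u k.
have sumd : \sum_k modulus (d k) ^+ 2 = A * (A * B - modulus C ^+ 2).
  apply: RtoC_inj; rewrite RtoC_sum RtoCM RtoCB RtoCM -!mulJc.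
  have AE : A%:C = \sum_k u k * (u k)^*.
    by rewrite /A RtoC_sum; apply: eq_bigr => k _; rewrite mulJc.
  have BE : B%:C = \sum_k v k * (v k)^*.
    by rewrite /B RtoC_sum; apply: eq_bigr => k _; rewrite mulJc.
  have CE : C^* = \sum_k v k * (u k)^*.
    rewrite /C conjc_sum; apply: eq_bigr => k _.
    by rewrite conjcM conjCK mulrC.
  transitivity (\sum_k (A%:C ^+ 2 * (v k * (v k)^*) - A%:C * C * (v k * (u k)^*)
     - A%:C * C^* * (u k * (v k)^*) + C * C^* * (u k * (u k)^*))).
    apply: eq_bigr => k _; rewrite -mulJc /d conjcB !conjcM conjRtoC conjCK.
    by ring.
  rewrite big_split/= !sumrB -!mulr_sumr -AE -BE -CE -/C; ring.
have ij_sum (f : 'I_n -> R) : (forall k, 0 <= f k) -> f i + f j <= \sum_k f k.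
  move=> f0; rewrite (bigD1 i)//= (bigD1 j) 1?eq_sym//= lerD2l lerDl.
  exact: sumr_ge0.
have h1 : modulus (d i) ^+ 2 + modulus (d j) ^+ 2 <= A * (A * B - modulus C ^+ 2).
  by rewrite -sumd; apply: (ij_sum (fun k => modulus (d k) ^+ 2)) => k; rewrite sqr_ge0.
have h2 : modulus (u i) ^+ 2 + modulus (u j) ^+ 2 <= A.
  by apply: (ij_sum (fun k => modulus (u k) ^+ 2)) => k; rewrite sqr_ge0.
have h3 : (modulus (d j) ^+ 2 + modulus (d i) ^+ 2) *
    (modulus (u i) ^+ 2 + modulus (u j) ^+ 2) >=
    modulus (d j * u i - d i * u j) ^+ 2.
  exact: modulus_lagrange.
have h4 : d j * u i - d i * u j = A%:C * (u i * v j - u j * v i).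
  by rewrite /d; ring.
move: h3; rewrite h4 Normc.normcM modulus_real gtr0_norm// exprMn.
set e := modulus _ => h3.
have h5 : A ^+ 2 * e ^+ 2 <= A * (A * B - modulus C ^+ 2) * A.
  apply: (le_trans h3); rewrite addrC ler_pM// ?addr_ge0 ?sqr_ge0//.
rewrite addrC -lerBrDr -(ler_pM2l (exprn_gt0 2 A0)).
by rewrite (le_trans h5)// expr2; lra.
Qed.

Lemma cauchy_schwarz n (u v : 'I_n -> R[i]) :
  modulus (\sum_k u k * (v k)^*) ^+ 2 <=
  (\sum_k modulus (u k) ^+ 2) * (\sum_k modulus (v k) ^+ 2).
Proof.
have h0 (f : 'I_n -> R[i]) : 0 <= \sum_k modulus (f k) ^+ 2.
  by apply: sumr_ge0 => k _; rewrite sqr_ge0.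
have [/eqP u0|u0] := eqVneq (\sum_k modulus (u k) ^+ 2) 0.
  have {}u0 k : u k = 0.
    move: u0; rewrite psumr_eq0; last by move=> l _; rewrite sqr_ge0.
    by move/allP/(_ k (mem_index_enum _)); rewrite sqrf_eq0 modulus_eq0 => /eqP.
  rewrite big1 => [|k _]; last by rewrite u0 mul0r.
  by rewrite Normc.normc0 expr0n /= mulr_ge0.
case: n u v h0 u0 => [u v h0|[u v _ _|n u v h0 u0]]; first by rewrite big_ord0 eqxx.
  by rewrite !big_ord1 Normc.normcM modulusJ exprMn.
apply: (le_trans _ (@cauchy_schwarz_lagrange _ u v ord0 (lift ord0 ord0) _ _)) => //.
  by rewrite lerDl sqr_ge0.
by rewrite lt_def u0 h0.
Qed.

(** The minor of the first two Takenaka-Malmquist functions at x and y, with the conjugates of the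
    zeros replaced by free variables [b] and [c]. *)
Lemma minor_identity (F : fieldType) (s0 s1 a b c x y : F) :
    1 - b * x != 0 -> 1 - b * y != 0 -> 1 - c * x != 0 -> 1 - c * y != 0 ->
  s0 / (1 - b * x) * ((y - a) / (1 - b * y) * (s1 / (1 - c * y))) -
    (x - a) / (1 - b * x) * (s1 / (1 - c * x)) * (s0 / (1 - b * y)) =
  s0 * s1 * ((y - x) * (1 - a * c)) /
    ((1 - b * x) * (1 - b * y) * ((1 - c * x) * (1 - c * y))).
Proof. by move=> d1 d2 d3 d4; field; rewrite d1 d2 d3 d4. Qed.

(** Origin of the factors: in [minor_identity] the numerator carries the square roots of 1 - |a0|^2
    and 1 - |a1|^2 and the factor 1 - a0 conj a1, of modulus at least 1 - |a0|; each of the four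
    denominators has modulus at most 2, whence 4^4 = 256 after squaring. *)
Definition contraction_cst (a0 a1 : R[i]) : R :=
  (1 - modulus a0 ^+ 2) * (1 - modulus a1 ^+ 2) * (1 - modulus a0) ^+ 2 / 256.

Lemma contraction_cst_gt0 (a0 a1 : R[i]) : modulus a0 < 1 -> modulus a1 < 1 ->
  0 < contraction_cst a0 a1.
Proof.
move=> h0 h1; apply: divr_gt0; last by rewrite ltr0n.
apply: mulr_gt0; first by apply: mulr_gt0; exact: one_minus_sqr.
by rewrite exprn_gt0// subr_gt0.
Qed.

Section contraction.
Variables (rho : R[i]) (a : nat -> R[i]) (n : nat).
Hypothesis rho1 : modulus rho = 1.
Hypothesis an : forall i, (i < n)%N -> modulus (a i) < 1.
Local Notation B := (bprod rho a n).

(** Schwarz-Pick: once |1 - x conj y|^2 is cancelled by the kernel identity, what remains is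
    Cauchy-Schwarz for the vectors of Takenaka-Malmquist functions at x and y. *)
Lemma bprod_hyp_le x y : (0 < n)%N -> modulus x < 1 -> modulus y < 1 ->
  hyp (B x) (B y) <= hyp x y.
Proof.
move=> n0 x1 y1; have Bx := bprod_lt1 n0 rho1 an x1.
have By := bprod_lt1 n0 rho1 an y1.
rewrite /hyp bprod_kernel ?(ltW x1) ?(ltW y1)// Normc.normcM exprMn.
rewrite ler_pdivrMr ?mulr_gt0 ?one_minus_sqr//.
rewrite [leRHS]mulrAC ler_pdivlMr ?mulr_gt0 ?one_minus_sqr//.
set E := modulus (1 - _) ^+ 2; rewrite -[leLHS]mulrA ler_wpM2l ?sqr_ge0//.
rewrite !bprod_modulus ?(ltW x1) ?(ltW y1)//.
set c := \sum_(i < n) modulus (takenaka a i x) ^+ 2.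
set c' := \sum_(i < n) modulus (takenaka a i y) ^+ 2.
rewrite [leRHS](_ : _ = (c * c') * ((1 - modulus x ^+ 2) * (1 - modulus y ^+ 2))).
  by rewrite ler_wpM2r ?cauchy_schwarz// mulr_ge0// ltW// one_minus_sqr.
by ring.
Qed.

Lemma takenaka_minor x y : (1 < n)%N -> modulus x < 1 -> modulus y < 1 ->
  contraction_cst (a 0) (a 1) * modulus (x - y) ^+ 2 <=
  modulus (takenaka a 0 x * takenaka a 1 y - takenaka a 1 x * takenaka a 0 y) ^+ 2.
Proof.
move=> n1 x1 y1; have a0 := an (ltnW n1); have a1 := an n1.
have [d1 d2] := (mobius_den a0 (ltW x1), mobius_den a0 (ltW y1)).
have [d3 d4] := (mobius_den a1 (ltW x1), mobius_den a1 (ltW y1)).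
rewrite /takenaka !big_ord0 !big_ord1 !mul1r /mobius /=.
set s0 := (Num.sqrt _)%:C; set s1 := (Num.sqrt _)%:C.
rewrite (@minor_identity R[i] s0 s1 (a 0) (a 0)^* (a 1)^* x y d1 d2 d3 d4).
rewrite !Normc.normcM !Normc.normcV !Normc.normcM !exprMn -modulusB.
rewrite !modulus_real !ger0_norm ?sqrtr_ge0// !sqr_sqrtr ?(ltW (one_minus_sqr _))//.
have den (b z : R[i]) : modulus b < 1 -> modulus z < 1 -> modulus (1 - b^* * z) <= 2.
  move=> b1 z1; rewrite (le_trans (le_normcD _ _))// Normc.normc1 normcN.
  rewrite Normc.normcM modulusJ [2]mulr2n lerD2l.
  by rewrite mulr_ile1 ?modulus_ge0 ?ltW.
have den_gt (b z : R[i]) : modulus b < 1 -> modulus z < 1 -> 0 < modulus (1 - b^* * z).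
  by move=> b1 z1; rewrite modulus_gt0 mobius_den// ltW.
rewrite exprVn !exprMn.
have q : (1 - modulus (a 0)) ^+ 2 <= modulus (1 - a 0 * (a 1)^*) ^+ 2.
  rewrite ler_sqr ?nnegrE ?subr_ge0 ?modulus_ge0 ?(ltW a0)//.
  apply: le_trans (lerB_modulus _ _); rewrite Normc.normc1 lerD2l lerN2.
  by rewrite Normc.normcM modulusJ ler_piMr ?modulus_ge0// ltW.
have den2 (b z : R[i]) : modulus b < 1 -> modulus z < 1 -> modulus (1 - b^* * z) ^+ 2 <= 4.
  move=> b1 z1; rewrite (_ : 4 = 2 ^+ 2); last by ring.
  by rewrite ler_sqr ?nnegrE ?modulus_ge0// den.
have den2_gt (b z : R[i]) : modulus b < 1 -> modulus z < 1 -> 0 < modulus (1 - b^* * z) ^+ 2.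
  by move=> b1 z1; rewrite exprn_gt0// den_gt.
rewrite ler_pdivlMr; last first.
  by apply: mulr_gt0; apply: mulr_gt0; exact: den2_gt.
rewrite /contraction_cst.
set D := (X in _ * X <= _).
have D256 : D <= 256.
  have h1 := ler_pM (sqr_ge0 _) (sqr_ge0 _) (den2 _ _ a0 x1) (den2 _ _ a0 y1).
  have h2 := ler_pM (sqr_ge0 _) (sqr_ge0 _) (den2 _ _ a1 x1) (den2 _ _ a1 y1).
  have := ler_pM (mulr_ge0 (sqr_ge0 _) (sqr_ge0 _)) (mulr_ge0 (sqr_ge0 _) (sqr_ge0 _)) h1 h2.
  by rewrite -/D => /le_trans; apply; lra.
have D0 : 0 <= D by rewrite /D; apply: mulr_ge0; apply: mulr_ge0; exact: sqr_ge0.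
set p := 1 - modulus (a 0) ^+ 2; set p' := 1 - modulus (a 1) ^+ 2.
have p0 : 0 <= p by rewrite ltW// one_minus_sqr.
have p0' : 0 <= p' by rewrite ltW// one_minus_sqr.
set m := modulus (y - x) ^+ 2; have m0 : 0 <= m by rewrite sqr_ge0.
set q0 := (1 - modulus (a 0)) ^+ 2 in q *.
apply: (@le_trans _ _ (p * p' * q0 * m)).
  rewrite (_ : _ * D = p * p' * q0 * m * (D / 256)); last by ring.
  have K0 : (0 : R) < 256 by rewrite ltr0n.
  apply: ler_piMr; last by rewrite (ler_pdivrMr _ _ K0) mul1r.
  by apply: mulr_ge0 => //; apply: mulr_ge0; [exact: mulr_ge0|exact: sqr_ge0].
rewrite -[leLHS]mulrA; apply: ler_wpM2l; first exact: mulr_ge0.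
by rewrite mulrC; exact: ler_wpM2l.
Qed.

(** In degree at least two there is a minor to feed to [cauchy_schwarz_lagrange], so the quotient of
    Cauchy-Schwarz gains a factor 1 - k |x - y|^2 / (c c'). Each of c, c' is at most 1 / (1 - |.|^2)
    because B maps into the disk, which gives one power of the product X Y; the other comes from |x
    - y|^2 = (hyp - 1) X Y. *)
Lemma bprod_hyp_contract x y : (1 < n)%N -> modulus x < 1 -> modulus y < 1 ->
  hyp (B x) (B y) <= hyp x y * (1 - contraction_cst (a 0) (a 1) * (hyp x y - 1) *
     ((1 - modulus x ^+ 2) * (1 - modulus y ^+ 2)) ^+ 2).
Proof.
move=> n1 x1 y1; have n0 := ltnW n1.
have Bx := bprod_lt1 n0 rho1 an x1; have By := bprod_lt1 n0 rho1 an y1.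
have px := one_minus_sqr x1; have py := one_minus_sqr y1.
have pBx := one_minus_sqr Bx; have pBy := one_minus_sqr By.
have mn := takenaka_minor n1 x1 y1.
have BxE := bprod_modulus rho1 an (ltW x1); have ByE := bprod_modulus rho1 an (ltW y1).
move: (BxE) (ByE).
set c := \sum_(i < n) modulus (takenaka a i x) ^+ 2.
set c' := \sum_(i < n) modulus (takenaka a i y) ^+ 2 => BxE' ByE'.
have c0 : 0 < c by rewrite -(pmulr_rgt0 _ px) -BxE'.
have c0' : 0 < c' by rewrite -(pmulr_rgt0 _ py) -ByE'.
have := @cauchy_schwarz_lagrange n (fun i => takenaka a i x) (fun i => takenaka a i y)
  (Ordinal n0) (Ordinal n1) c0 isT.
rewrite -/c -/c' /=; set S := modulus _ ^+ 2.
move=> /(le_trans (lerD (lexx S) mn)) h.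
rewrite {1}/hyp bprod_kernel ?(ltW x1) ?(ltW y1)// Normc.normcM exprMn -/S BxE' ByE'.
rewrite hyp_sub1// /hyp.
set k := contraction_cst _ _ in h *; set m := modulus (x - y) ^+ 2 in h *.
set e := modulus (1 - _) ^+ 2; set X := 1 - modulus x ^+ 2 in px BxE' *.
set Y := 1 - modulus y ^+ 2 in py ByE' *.
have cX : X * c <= 1 by rewrite -BxE' gerBl sqr_ge0.
have cY : Y * c' <= 1 by rewrite -ByE' gerBl sqr_ge0.
have k0 : 0 <= k.
  by rewrite ltW// contraction_cst_gt0// an.
have m0 : 0 <= m by rewrite sqr_ge0.
rewrite [leRHS](_ : _ = e * (1 - k * m * X * Y) / (X * Y)); last first.
  by field; rewrite !gt_eqF.
rewrite [leLHS](_ : _ = e * (S / (c * c')) / (X * Y)); last first.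
  by field; rewrite !gt_eqF.
rewrite ler_wpM2r ?invr_ge0 ?mulr_ge0 ?(ltW px) ?(ltW py)// ler_wpM2l ?sqr_ge0//.
rewrite ler_pdivrMr ?mulr_gt0// mulrBl mul1r lerBrDr.
apply: le_trans h; rewrite lerD2l.
rewrite (_ : _ * (c * c') = k * m * ((X * c) * (Y * c'))); last by ring.
have cX0 : 0 <= X * c by rewrite mulr_ge0 ?(ltW px) ?(ltW c0).
have cY0 : 0 <= Y * c' by rewrite mulr_ge0 ?(ltW py) ?(ltW c0').
by apply: ler_piMr; [exact: mulr_ge0|exact: mulr_ile1].
Qed.

End contraction.
End blaschke_algebra.

(** * Borel measurability and circle integrals *)

Section density_measure.
Context d (T : measurableType d) (R : realType).
Variables (mu : {measure set T -> \bar R}) (g : T -> R).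
Hypothesis mg : measurable_fun [set: T] g.
Hypothesis g0 : forall x, 0 <= g x.

(** The two proofs are arguments of the function so that its measure structure can be inferred from
    the term alone. *)
Definition density_measure of measurable_fun [set: T] g & (forall x, 0 <= g x) :=
  fun A : set T => (\int[mu]_(x in A) (g x)%:E)%E.

Local Notation nu := (density_measure mg g0).

Let density0 : nu set0 = 0%E.
Proof. by rewrite /density_measure integral_set0. Qed.

Let density_ge0 A : (0 <= nu A)%E.
Proof. by apply: integral_ge0 => x _; rewrite lee_fin. Qed.

Let density_sigma_additive : semi_sigma_additive nu.
Proof.
apply: (@semi_sigma_additive_nng_induced _ _ _ mu (fun x => (g x)%:E)).
  exact/measurable_EFinP.
by move=> x; rewrite lee_fin.
Qed.

HB.instance Definition _ := isMeasure.Build _ _ _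
  nu density0 density_ge0 density_sigma_additive.

End density_measure.

Section integral_density.
Context d (T : measurableType d) (R : realType).
Variables (mu nu : {measure set T -> \bar R}) (g : T -> R).
Hypothesis mg : measurable_fun [set: T] g.
Hypothesis g0 : forall x, 0 <= g x.
Hypothesis nuE : forall A, measurable A -> nu A = (\int[mu]_(x in A) (g x)%:E)%E.
Import HBNNSimple.
Local Open Scope ereal_scope.

(** Monotone approximation by simple functions reduces the formula to indicators, where it is
    [nuE]. *)
Lemma ge0_integral_density (f : T -> \bar R) : measurable_fun [set: T] f ->
  (forall x, 0 <= f x) -> \int[nu]_x f x = \int[mu]_x (f x * (g x)%:E).
Proof.
move=> mf f0; pose h := nnsfun_approx measurableT mf.
have mgE : measurable_fun [set: T] (EFin \o g) by exact/measurable_EFinP.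
have hmono x : {homo (fun n => (h n x)%:E) : n m / (n <= m)%N >-> n <= m}.
  by move=> a b ab; rewrite lee_fin; exact/lefP/nd_nnsfun_approx.
transitivity (limn (fun n => \int[nu]_x (h n x)%:E)).
  rewrite -monotone_convergence//.
  - by apply: eq_integral => x _; apply/esym/cvg_lim => //; exact: cvg_nnsfun_approx.
  - by move=> n; apply/measurable_EFinP.
  - by move=> n x _; rewrite lee_fin.
transitivity (limn (fun n => \int[mu]_x ((h n x)%:E * (g x)%:E))); last first.
  rewrite -monotone_convergence//.
  - apply: eq_integral => x _; apply/cvg_lim => //.
    by apply: cvgeZr => //; exact: cvg_nnsfun_approx.
  - by move=> n; apply: emeasurable_funM => //; exact/measurable_EFinP.
  - by move=> n x _; rewrite mule_ge0 ?lee_fin.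
  - by move=> x _ a b ab; rewrite lee_wpmul2r ?lee_fin ?g0//; exact/lefP/nd_nnsfun_approx.
congr (limn _); apply/funext => n.
transitivity (\int[nu]_x
   (\sum_(y \in range (h n)) (y * \1_(h n @^-1` [set y]) x)%:E)).
  by apply: eq_integral => t tE; rewrite /= fimfunE -fsumEFin.
have indich m r : measurable_fun [set: T] (fun x => (r * \1_(h m @^-1` [set r]) x)%:E).
  by apply: (measurable_comp measurableT) => //; exact: measurable_funM.
rewrite ge0_integral_fsum//; last by move=> m y Ey; exact: nnfun_muleindic_ge0.
transitivity (\int[mu]_x (\sum_(y \in range (h n))
    (y * \1_(h n @^-1` [set y]) x)%:E * (g x)%:E)); last first.
  under eq_integral => x xE.
    rewrite -ge0_mule_fsuml => [|y]; last exact: nnfun_muleindic_ge0.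
    rewrite fsumEFin // -(fimfunE _ x); over.
  by [].
rewrite [RHS]ge0_integral_fsum//; last 2 first.
  - by move=> y; apply: emeasurable_funM.
  - by move=> m y Ey; apply: mule_ge0; rewrite ?lee_fin//; exact: nnfun_muleindic_ge0.
apply: eq_fsbigr => r rhn.
under [LHS]eq_integral do rewrite EFinM.
rewrite integralZl_indic_nnsfun => //.
under [RHS]eq_integral do rewrite EFinM -muleA.
rewrite [RHS]ge0_integralZl//.
- under [in RHS]eq_integral do rewrite muleC.
  have -> : (fun x => (g x)%:E * (\1_(h n @^-1` [set r]) x)%:E) =
      (EFin \o g) \_ (h n @^-1` [set r]) by rewrite epatch_indic.
  by rewrite -integral_mkcond integral_indic// setIT nuE.
- by apply: emeasurable_funM => //; exact/measurable_EFinP.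
- by move=> t Et; rewrite mule_ge0 ?lee_fin ?g0.
- by move: rhn; rewrite inE => -[t _ <-]; rewrite lee_fin.
Qed.

End integral_density.

(** * Measurability of complex-valued maps and of Blaschke products *)

Section complex_measurability.
Variable R : realType.

Lemma measurable_inv : measurable_fun [set: R] (fun x : R => x^-1).
Proof.
have DE : [set: R] = [set x | x != 0] `|` [set 0].
  by apply/seteqP; split => // x _ /=; have [->|] := eqVneq x 0; [right|left].
have oD : open [set x : R | x != 0].
  exact: open_neq.
rewrite DE; apply/measurable_funU; [exact: open_measurable|exact: measurable_set1|split].
  apply: open_continuous_measurable_fun => // x; rewrite inE /= => x0.
  exact: inv_continuous.
exact: measurable_fun_set1.
Qed.

Lemma measurable_funV d (X : measurableType d) (D : set X) (f : X -> R) :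
  measurable_fun D f -> measurable_fun D (fun x => (f x)^-1).
Proof. by move=> mf; apply: (measurableT_comp measurable_inv). Qed.

Lemma measurable_sqrt : measurable_fun [set: R] (@Num.sqrt R).
Proof. by apply: continuous_measurable_fun => x; exact: sqrt_continuous. Qed.

Lemma open_Re_gt (a : R) : open [set z : R[i] | a < Re z].
Proof.
rewrite openE => z /= az; apply/nbhs_ballP.
exists (Re z - a)%:C => /=; first by rewrite ltcR subr_gt0.
move=> w; rewrite -ball_normE /= normc_def ltcR => h.
have : Re z - Re w <= modulus (z - w).
  by rewrite -ReB (le_trans (ler_norm _))// Re_le_modulus.
have -> : modulus (z - w) = Num.sqrt (Re (z - w) ^+ 2 + Im (z - w) ^+ 2).
  by case: (z - w).
lra.
Qed.

Lemma open_Im_gt (a : R) : open [set z : R[i] | a < Im z].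
Proof.
rewrite openE => z /= az; apply/nbhs_ballP.
exists (Im z - a)%:C => /=; first by rewrite ltcR subr_gt0.
move=> w; rewrite -ball_normE /= normc_def ltcR => h.
have : Im z - Im w <= modulus (z - w).
  by rewrite -ImB (le_trans (ler_norm _))// Im_le_modulus.
have -> : modulus (z - w) = Num.sqrt (Re (z - w) ^+ 2 + Im (z - w) ^+ 2).
  by case: (z - w).
lra.
Qed.

Lemma measurable_Re : measurable_fun [set: R[i]] (@complex.Re R).
Proof.
apply: (measurability _ (RGenOInfty.measurableE R)) => _ [_ [a ->] <-].
rewrite setTI; apply: sub_sigma_algebra => /=.
rewrite (_ : _ @^-1` _ = [set z : R[i] | a < Re z]); first exact: open_Re_gt.
by apply/seteqP; split => z /=; rewrite in_itv/= andbT.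
Qed.

Lemma measurable_Im : measurable_fun [set: R[i]] (@complex.Im R).
Proof.
apply: (measurability _ (RGenOInfty.measurableE R)) => _ [_ [a ->] <-].
rewrite setTI; apply: sub_sigma_algebra => /=.
rewrite (_ : _ @^-1` _ = [set z : R[i] | a < Im z]); first exact: open_Im_gt.
by apply/seteqP; split => z /=; rewrite in_itv/= andbT.
Qed.

(** Open sets are unions of rational boxes, a countable family; this reduces complex measurability
    to that of the real and imaginary parts. *)
Lemma open_box (U : set R[i]) (z : R[i]) : open U -> U z ->
  exists q : rat * rat * (rat * rat),
    ratr q.1.1 < Re z < ratr q.1.2 /\ ratr q.2.1 < Im z < ratr q.2.2 /\
    (forall w, ratr q.1.1 < Re w < ratr q.1.2 ->
      ratr q.2.1 < Im w < ratr q.2.2 -> U w).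
Proof.
move=> oU Uz; have /nbhs_ballP[e /= e0 eU] : nbhs z U by exact: open_nbhs_nbhs.
have [e' e'0 eE] : exists2 e' : R, 0 < e' & e = e'%:C.
  case: e e0 {eU} => a b; rewrite ltcE/= => /andP[/eqP b0 a0].
  by exists a; rewrite ?b0.
pose h := e' / 4; have h0 : 0 < h by rewrite divr_gt0.
have rt (x y : R) : x < y -> exists q : rat, x < ratr q < y.
  by move=> xy; have [q] := rat_in_itvoo xy; rewrite in_itv; exists q.
have [q1 /andP[q1l q1r]] := rt (Re z - h) (Re z) ltac:(by rewrite ltrBlDr ltrDl).
have [q2 /andP[q2l q2r]] := rt (Re z) (Re z + h) ltac:(by rewrite ltrDl).
have [q3 /andP[q3l q3r]] := rt (Im z - h) (Im z) ltac:(by rewrite ltrBlDr ltrDl).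
have [q4 /andP[q4l q4r]] := rt (Im z) (Im z + h) ltac:(by rewrite ltrDl).
exists ((q1, q2), (q3, q4)); rewrite /= q1r q2l q3r q4l; split => //; split => //.
move=> w /andP[w1 w2] /andP[w3 w4]; apply: eU.
rewrite -ball_normE /= normc_def eE ltcR.
rewrite -(ltr_sqr (x := Num.sqrt _)) ?nnegrE ?sqrtr_ge0 ?(ltW e'0)//.
rewrite sqr_sqrtr ?addr_ge0 ?sqr_ge0// ReB ImB.
have hE : e' = 4 * h by rewrite /h; field.
have a1 : `|Re z - Re w| <= h * 1 by rewrite ler_norml; lra.
have a2 : `|Im z - Im w| <= h * 1 by rewrite ler_norml; lra.
have b1 : (Re z - Re w) ^+ 2 <= h ^+ 2.
  by rewrite -real_normK ?num_real// ler_sqr ?nnegrE ?(ltW h0)// -[h]mulr1.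
have b2 : (Im z - Im w) ^+ 2 <= h ^+ 2.
  by rewrite -real_normK ?num_real// ler_sqr ?nnegrE ?(ltW h0)// -[h]mulr1.
rewrite hE; nra.
Qed.

Lemma measurable_complex d (X : measurableType d) (D : set X) (f : X -> R[i]) :
  measurable_fun D (fun x => Re (f x)) -> measurable_fun D (fun x => Im (f x)) ->
  measurable_fun D f.
Proof.
move=> mre mim mD.
apply: (@measurability _ _ _ R[i] _ _ (@open R[i])) => // _ [U oU <-].
pose good (q : rat * rat * (rat * rat)) :=
  forall w : R[i], ratr q.1.1 < Re w < ratr q.1.2 ->
    ratr q.2.1 < Im w < ratr q.2.2 -> U w.
pose F (q : rat * rat * (rat * rat)) : set X :=
  if `[< good q >] then
    (D `&` (fun x => Re (f x)) @^-1` `]ratr q.1.1, ratr q.1.2[) `&`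
    (D `&` (fun x => Im (f x)) @^-1` `]ratr q.2.1, ratr q.2.2[) else set0.
have -> : D `&` f @^-1` U = \bigcup_q F q.
  apply/seteqP; split => [x [Dx /(open_box oU)[q [q1 [q2 gq]]]]|x [q _]].
    by exists q => //; rewrite /F; case: asboolP => // _; rewrite /= !in_itv/=.
  by rewrite /F; case: asboolP => // gq; rewrite /= !in_itv /= => -[[? ?] [? ?]]; split => //; exact: gq.
apply: countable_bigcupT_measurable => // q; rewrite /F; case: asboolP => // _.
by apply: measurableI; [apply: mre|apply: mim] => //; exact: measurable_itv.
Qed.

Section ops.
Context d (X : measurableType d) (D : set X).
Implicit Types f g : X -> R[i].

Lemma measurableC_Re f : measurable_fun D f -> measurable_fun D (fun x => Re (f x)).
Proof. exact: measurableT_comp measurable_Re. Qed.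

Lemma measurableC_Im f : measurable_fun D f -> measurable_fun D (fun x => Im (f x)).
Proof. exact: measurableT_comp measurable_Im. Qed.

Lemma measurableC_mul f g : measurable_fun D f -> measurable_fun D g ->
  measurable_fun D (fun x => f x * g x).
Proof.
move=> mf mg; have [rf rg] := (measurableC_Re mf, measurableC_Re mg).
have [jf jg] := (measurableC_Im mf, measurableC_Im mg).
apply: measurable_complex; under eq_fun do rewrite (ReM, ImM).
  by apply: measurable_funB; exact: measurable_funM.
by apply: measurable_funD; exact: measurable_funM.
Qed.

Lemma measurableC_sub f g : measurable_fun D f -> measurable_fun D g ->
  measurable_fun D (fun x => f x - g x).
Proof.
move=> mf mg; have [rf rg] := (measurableC_Re mf, measurableC_Re mg).
have [jf jg] := (measurableC_Im mf, measurableC_Im mg).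
by apply: measurable_complex; under eq_fun do rewrite (ReB, ImB);
  exact: measurable_funB.
Qed.

Lemma measurableC_conj f : measurable_fun D f -> measurable_fun D (fun x => (f x)^*).
Proof.
move=> mf; apply: measurable_complex.
  have -> : (fun x => Re (f x)^*) = (fun x => Re (f x)).
    by apply/funext => x; case: (f x).
  exact: measurableC_Re.
have -> : (fun x => Im (f x)^*) = (fun x => - Im (f x)).
  by apply/funext => x; case: (f x).
by apply: measurable_funN; exact: measurableC_Im.
Qed.

Lemma measurable_modulus f : measurable_fun D f -> measurable_fun D (fun x => modulus (f x)).
Proof.
move=> mf; have -> : (fun x => modulus (f x)) =
    (fun x => Num.sqrt (Re (f x) ^+ 2 + Im (f x) ^+ 2)).
  by apply/funext => x; case: (f x).
apply: (measurableT_comp measurable_sqrt); apply: measurable_funD.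
  by apply: measurable_funX; exact: measurableC_Re.
by apply: measurable_funX; exact: measurableC_Im.
Qed.

Lemma measurableC_inv f : measurable_fun D f -> measurable_fun D (fun x => (f x)^-1).
Proof.
move=> mf; apply: measurable_complex.
  have -> : (fun x => Re (f x)^-1) = (fun x => Re (f x) / modulus (f x) ^+ 2).
    by apply/funext => x; rewrite modulus_sqr; case: (f x).
  apply: measurable_funM; first exact: measurableC_Re.
  by apply: measurable_funV; apply: measurable_funX; exact: measurable_modulus.
have -> : (fun x => Im (f x)^-1) = (fun x => - (Im (f x) / modulus (f x) ^+ 2)).
  by apply/funext => x; rewrite modulus_sqr; case: (f x).
apply: measurable_funN; apply: measurable_funM; first exact: measurableC_Im.
by apply: measurable_funV; apply: measurable_funX; exact: measurable_modulus.
Qed.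

Lemma measurableC_prod (n : nat) (f : nat -> X -> R[i]) :
  (forall i, (i < n)%N -> measurable_fun D (f i)) ->
  measurable_fun D (fun x => \prod_(i < n) f i x).
Proof.
elim: n => [_|n ih h]; first by under eq_fun do rewrite big_ord0; exact: measurable_cst.
under eq_fun do rewrite big_ord_recr /=.
by apply: measurableC_mul; [apply: ih => i /ltnW; exact: h|exact: h].
Qed.

Lemma measurable_mobius f g : measurable_fun D f -> measurable_fun D g ->
  measurable_fun D (fun x => mobius (f x) (g x)).
Proof.
move=> mf mg; apply: measurableC_mul; first exact: measurableC_sub.
apply: measurableC_inv; apply: measurableC_sub; first exact: measurable_cst.
by apply: measurableC_mul => //; exact: measurableC_conj.
Qed.

End ops.

Section blaschke_measurable.
Context d (Omega : measurableType d) (T : blaschke_cocycle Omega R).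

Lemma measurable_zero_on j i : (i < j)%N ->
  measurable_fun [set w | degree T w = j] (fun w => zeros T w i).
Proof.
move=> ij; have j0 : (0 < j)%N by exact: leq_ltn_trans ij.
have := measurableT_comp (measurable_tnth (Ordinal ij)) (@measurable_zeros _ _ _ T _ j0).
by apply: eq_measurable_fun => w _ /=; rewrite tnth_mktuple.
Qed.

Lemma measurable_degree_set j : measurable [set w | degree T w = j].
Proof.
have h := @measurable_degree _ _ _ T measurableT [set j] I.
by rewrite setTI in h.
Qed.

(** Zeros are measurable only on each level set of the degree, so measurability is checked there and
    glued; the level 0 is empty. *)
Lemma measurable_on_degree d' (Y : measurableType d') (f : Omega -> Y) :
  (forall j, (0 < j)%N -> measurable_fun [set w | degree T w = j] f) ->
  measurable_fun [set: Omega] f.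
Proof.
move=> h; have -> : [set: Omega] = \bigcup_j [set w | degree T w = j].
  by apply/seteqP; split => // w _; exists (degree T w).
apply/measurable_fun_bigcup => [j|j]; first exact: measurable_degree_set.
have [->|j0] := posnP j; last exact: h.
suff -> : [set w | degree T w = 0%N] = set0 by exact: measurable_fun_set0.
by apply/seteqP; split => // w /= w0; have := degree_gt0 T w; rewrite w0.
Qed.

Lemma blaschkeE w z : T w z = bprod (rotation T w) (zeros T w) (degree T w) z.
Proof. by []. Qed.

Lemma measurable_blaschke d' (X : measurableType d') (w : X -> Omega) (z : X -> R[i]) :
  measurable_fun [set: X] w -> measurable_fun [set: X] z ->
  measurable_fun [set: X] (fun x => T (w x) (z x)).
Proof.
move=> mw mz; apply: measurableC_mul.
  exact: measurableT_comp (@measurable_rotation _ _ _ T) mw.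
pose E j := [set x | degree T (w x) = j].
have mE j : measurable (E j).
  have h := mw measurableT _ (measurable_degree_set j).
  by rewrite setTI in h.
have -> : [set: X] = \bigcup_j E j.
  by apply/seteqP; split => // x _; exists (degree T (w x)).
apply/measurable_fun_bigcup => // j.
apply: (@eq_measurable_fun _ _ _ _ _
  (fun x => \prod_(i < j) mobius (zeros T (w x) i) (z x))).
  by move=> x; rewrite inE /E /= => <-.
apply: (@measurableC_prod _ _ _ _ (fun i x => mobius (zeros T (w x) i) (z x))) => i ij.
apply: measurable_mobius; last exact: measurable_funTS.
apply: (measurable_comp (F := [set w | degree T w = j])) (measurable_zero_on ij) _.
- exact: measurable_degree_set.
- by move=> _ [x /= xj <-].
- exact: measurable_funTS.
Qed.

End blaschke_measurable.

Lemma measurable_circle : measurable (@circle R).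
Proof.
have mm : measurable_fun [set: R[i]] (fun z : R[i] => modulus z).
  by apply: measurable_modulus; exact: measurable_id.
by have := mm measurableT _ (measurable_set1 1); rewrite setTI.
Qed.

Local Notation leb := (@lebesgue_measure R).
Local Notation I01 := (`[0, 1[%classic : set R).

End complex_measurability.

(** * Lifts of circle maps and Poisson kernels *)

Section real_derivatives.
Variable R : realType.
Implicit Types (f g : R -> R) (t x : R).

Lemma isdeq f t (df df' : R) : is_derive t 1 f df -> df = df' -> is_derive t 1 f df'.
Proof. by move=> h <-. Qed.

Lemma isdC (c t : R) : is_derive t (1 : R) (fun=> c : R) 0.
Proof. exact: is_derive_cst. Qed.

Lemma isdI t : is_derive t (1 : R) (fun x : R => x) 1.
Proof. exact: is_derive_id. Qed.

Lemma isdD f g t df dg : is_derive t 1 f df -> is_derive t 1 g dg ->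
  is_derive t 1 (fun x => f x + g x) (df + dg).
Proof. exact: is_deriveD. Qed.

Lemma isdN f t df : is_derive t 1 f df -> is_derive t 1 (fun x => - f x) (- df).
Proof. exact: is_deriveN. Qed.

Lemma isdM f g t df dg : is_derive t 1 f df -> is_derive t 1 g dg ->
  is_derive t 1 (fun x => f x * g x) (f t * dg + g t * df).
Proof. exact: is_deriveM. Qed.

Lemma isdV f t df : f t != 0 -> is_derive t 1 f df ->
  is_derive t 1 (fun x => (f x)^-1) (- (f t ^- 2 * df)).
Proof.
move=> ft0 h; apply: is_derive_eq.
by rewrite scaleNr.
Qed.

Lemma isd_comp f g t df dg : is_derive (g t) 1 f df -> is_derive t 1 g dg ->
  is_derive t 1 (fun x => f (g x)) (df * dg).
Proof. exact: is_derive1_comp. Qed.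

Lemma is_derive_continuous f t df : is_derive t 1 f df -> {for t, continuous f}.
Proof. by move=> [h _]; apply: differentiable_continuous; exact/derivable1_diffP. Qed.

Lemma mean_value f df a b : a < b -> (forall x, is_derive x 1 f (df x)) ->
  exists2 c, a < c < b & f b - f a = df c * (b - a).
Proof.
move=> ab h.
have hc : {within `[a, b], continuous f}.
  by apply: continuous_subspaceT => x; exact: is_derive_continuous (h x).
have [c] := @MVT R f df a b ab (fun x _ => h x) hc.
by rewrite in_itv/= => ? ?; exists c.
Qed.

Lemma integral_derivative f df a b : a <= b -> (forall x, is_derive x 1 f (df x)) ->
  continuous df ->
  (\int[lebesgue_measure]_(t in `[a, b]) (df t)%:E = (f b - f a)%:E)%E.
Proof.
rewrite le_eqVlt => /predU1P[->|ab] h cdf.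
  by rewrite set_itv1 integral_set1 subrr.
rewrite (@continuous_FTC2 R df f a b ab) ?EFinB//.
- exact: continuous_subspaceT.
- split => [x _||]; first by have [] := h x.
    by apply: cvg_at_right_filter; exact: is_derive_continuous (h a).
  by apply: cvg_at_left_filter; exact: is_derive_continuous (h b).
- by move=> x _; rewrite derive1E; have [] := h x.
Qed.

End real_derivatives.

Section circle_lifts.
Variable R : realType.
Implicit Types (S : R[i] -> R[i]) (g dg : R -> R) (t s : R) (n : nat).

(** An increasing C^1 lift of the circle map [S] to the line, with topological degree [n]. All
    changes of variables on the circle go through lifts, with [dg] in the role of |S'|. *)
Record circle_lift S g dg n : Prop := CircleLift {
  lift_expi : forall t, S (expi t) = expi (g t);
  lift_derive : forall t, is_derive t 1 g (dg t);
  lift_continuous : continuous dg;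
  lift_gt0 : forall t, 0 < dg t;
  lift_period : forall t, g (t + 1) = g t + n%:R
}.

Lemma circle_lift_id : circle_lift id id (fun=> 1) 1.
Proof.
split => //; first by move=> t; exact: is_derive_id.
by move=> t; exact: cvg_cst.
Qed.

Lemma circle_lift_comp S g dg n S' g' dg' n' :
  circle_lift S g dg n -> circle_lift S' g' dg' n' ->
  circle_lift (S' \o S) (g' \o g) (fun t => dg' (g t) * dg t) (n * n').
Proof.
move=> h h'; have gn t k : g' (t + k%:R) = g' t + (k * n')%:R.
  elim: k => [|k ih]; first by rewrite mul0n !addr0.
  by rewrite -natr1 addrA (lift_period h') ih mulSnr natrD addrA.
split.
- by move=> t /=; rewrite (lift_expi h) (lift_expi h').
- by move=> t; apply: isd_comp; [exact: lift_derive h' _|exact: lift_derive h _].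
- move=> t; apply: cvgM; last exact: lift_continuous h t.
  apply: continuous_comp; last exact: lift_continuous h' _.
  exact: is_derive_continuous (lift_derive h t).
- by move=> t; rewrite mulr_gt0// ?(lift_gt0 h) ?(lift_gt0 h').
- by move=> t /=; rewrite (lift_period h) gn.
Qed.

Definition poisson (x z : R[i]) : R := (1 - modulus x ^+ 2) / modulus (z - x) ^+ 2.

Lemma poisson_gt0 (x z : R[i]) : modulus x < 1 -> modulus z = 1 -> 0 < poisson x z.
Proof.
move=> x1 z1; rewrite divr_gt0 ?one_minus_sqr// exprn_gt0// modulus_gt0 subr_eq0.
by apply/eqP => zx; move: x1; rewrite -zx z1 ltxx.
Qed.

Section mobius_lift.
Variable a : R[i].
Hypothesis a1 : modulus a < 1.
Let u t := Re a * cos (2 * pi * t) + Im a * sin (2 * pi * t).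
Let q t := Im a * cos (2 * pi * t) - Re a * sin (2 * pi * t).
Let v t := q t / (1 - u t).

(** On the circle the Moebius map is z conj w / w with w = 1 - conj a z = (1 - u) + i q. As Re w >
    0, atan (q / (1 - u)) is a continuous argument of w, and the lift is t minus twice this argument
    divided by 2 pi. *)
Definition mobius_lift t : R := t - pi^-1 *
  atan ((Im a * cos (2 * pi * t) - Re a * sin (2 * pi * t)) /
    (1 - (Re a * cos (2 * pi * t) + Im a * sin (2 * pi * t)))).

Let uq t : u t ^+ 2 + q t ^+ 2 = modulus a ^+ 2.
Proof.
rewrite modulus_sqr -[RHS]mulr1 -(cos2Dsin2 (2 * pi * t)) /u /q; ring.
Qed.

Let u_gt0 t : 0 < 1 - u t.
Proof.
rewrite subr_gt0; have := uq t; have a0 := modulus_ge0 a.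
case: (ltP (u t) 1) => // u1 uqE; exfalso.
have : modulus a ^+ 2 < 1 by rewrite expr_lt1.
have := sqr_ge0 (q t); nra.
Qed.

Let dcos t : is_derive t 1 (fun x => cos (2 * pi * x)) (- sin (2 * pi * t) * (2 * pi)).
Proof.
apply: isd_comp; apply: (isdeq (isdM (isdC _ _) (isdI _))).
by rewrite mulr0 addr0 mulr1.
Qed.

Let dsin t : is_derive t 1 (fun x => sin (2 * pi * x)) (cos (2 * pi * t) * (2 * pi)).
Proof.
apply: isd_comp; apply: (isdeq (isdM (isdC _ _) (isdI _))).
by rewrite mulr0 addr0 mulr1.
Qed.

Let du t : is_derive t 1 u (2 * pi * q t).
Proof.
apply: (isdeq (isdD (isdM (isdC _ _) (dcos t)) (isdM (isdC _ _) (dsin t)))).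
by rewrite /q; ring.
Qed.

Let dq t : is_derive t 1 q (- (2 * pi * u t)).
Proof.
apply: (isdeq (isdD (isdM (isdC _ _) (dcos t)) (isdN (isdM (isdC _ _) (dsin t))))).
by rewrite /u; ring.
Qed.

Let modE t : modulus (expi t - a) ^+ 2 = (1 - u t) ^+ 2 + q t ^+ 2.
Proof.
rewrite sqr_modulusB expi_modulus expr1n -(uq t) /= -/(u t).
by rewrite [_ * Re a]mulrC [_ * Im a]mulrC -/(u t); ring.
Qed.

Let dmobius_lift t : is_derive t 1 mobius_lift (poisson a (expi t)).
Proof.
have u0 := lt0r_neq0 (u_gt0 t); have p0 := lt0r_neq0 (pi_gt0 R).
have dv : is_derive t 1 v (2 * pi * (q t ^+ 2 - u t * (1 - u t)) / (1 - u t) ^+ 2).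
  have d1u : is_derive t 1 (fun x => 1 - u x) (- (2 * pi * q t)).
    by apply: (isdeq (isdD (isdC _ _) (isdN (du t)))); rewrite add0r.
  by apply: (isdeq (isdM (dq t) (@isdV _ (fun x => 1 - u x) t _ u0 d1u))); field.
have da := @isd_comp R (@atan R) v t _ _ (is_derive1_atan (v t)) dv.
apply: (isdeq (isdD (isdI t) (isdN (isdM (isdC pi^-1 t) da)))).
rewrite /poisson modE -(uq t) /v.
have d0 : (1 - u t) ^+ 2 + q t ^+ 2 != 0.
  by rewrite gt_eqF// ltr_wpDr ?sqr_ge0// exprn_gt0.
have d1 : 1 + (q t / (1 - u t)) ^+ 2 != 0.
  by rewrite gt_eqF// ltr_wpDr ?sqr_ge0.
have -> : 1 + (q t / (1 - u t)) ^+ 2 = ((1 - u t) ^+ 2 + q t ^+ 2) / (1 - u t) ^+ 2.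
  by field.
have key (p x y : R) : p != 0 -> x != 0 -> x ^+ 2 + y ^+ 2 != 0 ->
    1 - p^-1 * (((x ^+ 2 + y ^+ 2) / x ^+ 2)^-1 *
      (2 * p * (y ^+ 2 - (1 - x) * x) / x ^+ 2)) =
    (1 - ((1 - x) ^+ 2 + y ^+ 2)) / (x ^+ 2 + y ^+ 2).
  by move=> p0' x0 xy0; field; rewrite xy0 x0 p0'.
by have := key pi (1 - u t) (q t) p0 u0 d0; rewrite subKr mulr0 addr0.
Qed.

(** The right-hand side is (1 - i y) / (1 + i y), that is conj w / w for w = 1 + i y. *)
Let expi_atan (y : R) : expi (- (pi^-1 * atan y)) =
  ((1 - y ^+ 2) / (1 + y ^+ 2)) -i* (2 * y / (1 + y ^+ 2)).
Proof.
have p0 := lt0r_neq0 (pi_gt0 R).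
have y0 : 0 < 1 + y ^+ 2 by rewrite ltr_wpDr ?sqr_ge0.
rewrite expiN /expi.
have -> : 2 * pi * (pi^-1 * atan y) = atan y + atan y.
  by rewrite mulrA -(mulrA 2) divff// mulr1 mulr_natl.
have cE := cos_atan y.
have c0 : cos (atan y) != 0 by rewrite cE invr_eq0 sqrtr_eq0 -ltNge.
have sE : sin (atan y) = y * cos (atan y).
  by have h := atanK y; rewrite /tan in h; rewrite -[X in X * _]h divfK.
have c2 : cos (atan y) ^+ 2 = (1 + y ^+ 2)^-1.
  by rewrite cE exprVn sqr_sqrtr// ltW.
rewrite cosD sinD sE; apply: complex_eqP => /=.
  by transitivity ((1 - y ^+ 2) * cos (atan y) ^+ 2); [ring|rewrite c2].
by transitivity (- (2 * y * cos (atan y) ^+ 2)); [ring|rewrite c2].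
Qed.

Lemma mobius_circle_lift :
  circle_lift (mobius a) mobius_lift (fun t => poisson a (expi t)) 1.
Proof.
have den t : modulus (expi t - a) ^+ 2 != 0.
  rewrite expf_eq0 /= modulus_eq0 subr_eq0; apply/eqP => ta.
  by move: a1; rewrite -ta expi_modulus ltxx.
split.
- move=> t; rewrite /mobius_lift expiD expi_atan.
  rewrite -/(u t) -/(q t); set X := _ / _; set Y := (X in _ -i* X).
  have u0 := lt0r_neq0 (u_gt0 t).
  have d0 : (1 - u t) ^+ 2 + q t ^+ 2 != 0.
    by rewrite gt_eqF// ltr_wpDr ?sqr_ge0// exprn_gt0.
  have d1E : 1 + (q t / (1 - u t)) ^+ 2 = ((1 - u t) ^+ 2 + q t ^+ 2) / (1 - u t) ^+ 2.
    by field.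
  have XE : X = ((1 - u t) ^+ 2 - q t ^+ 2) / ((1 - u t) ^+ 2 + q t ^+ 2).
    by rewrite /X d1E; field; rewrite d0 u0.
  have YE : Y = 2 * q t * (1 - u t) / ((1 - u t) ^+ 2 + q t ^+ 2).
    by rewrite /Y d1E; field; rewrite d0 u0.
  have wE : 1 - a^* * expi t = (1 - u t) +i* q t.
    by rewrite /u /q /expi; case: (a) => al be; apply: complex_eqP => /=; ring.
  have w0 : 1 - a^* * expi t != 0 by rewrite mobius_den// expi_modulus.
  rewrite /mobius; apply: (mulIf w0); rewrite divfK// wE.
  have zz : expi t * (expi t)^* = 1 by rewrite mulJc expi_modulus expr1n.
  rewrite -mulrA (_ : (X -i* Y) * _ = (1 - a^* * expi t)^*).
    by rewrite conjcB conjcM conjCK conjC1 mulrBr mulr1 mulrCA zz mulr1.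
  by rewrite wE XE YE; apply: complex_eqP => /=; field.
- exact: dmobius_lift.
- move=> t; rewrite /poisson; apply: cvgM; first exact: cvg_cst.
  apply: cvgV; first exact: den.
  have d1u := isdD (isdC 1 t) (isdN (du t)).
  have c := is_derive_continuous (isdD (isdM d1u d1u) (isdM (dq t) (dq t))).
  have -> : (fun x => modulus (expi x - a) ^+ 2) =
      (fun x => (1 - u x) * (1 - u x) + q x * q x) by apply/funext.
  by rewrite modE; exact: c.
- by move=> t; rewrite poisson_gt0// expi_modulus.
- move=> t; rewrite /mobius_lift.
  have -> : 2 * pi * (t + 1) = 2 * pi * t + pi *+ 2 by rewrite mulrDr mulr1 mulr_natl.
  by rewrite cosD2pi sinD2pi addrAC.
Qed.

End mobius_lift.

Lemma circle_lift_mul S g dg n S' g' dg' n' :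
  circle_lift S g dg n -> circle_lift S' g' dg' n' ->
  circle_lift (fun z => S z * S' z) (fun t => g t + g' t) (fun t => dg t + dg' t) (n + n').
Proof.
move=> h h'; split.
- by move=> t; rewrite (lift_expi h) (lift_expi h') expiD.
- by move=> t; apply: isdD; [exact: lift_derive h _|exact: lift_derive h' _].
- by move=> t; apply: cvgD; [exact: lift_continuous h t|exact: lift_continuous h' t].
- by move=> t; rewrite addr_gt0 ?(lift_gt0 h) ?(lift_gt0 h').
- by move=> t; rewrite (lift_period h) (lift_period h') natrD addrACA.
Qed.

Lemma circle_lift_rot rho S g dg n : circle_lift S g dg n ->
  circle_lift (fun z => expi rho * S z) (fun t => rho + g t) dg n.
Proof.
move=> h; split.
- by move=> t; rewrite (lift_expi h) expiD.
- move=> t; apply: is_derive_eq; first exact: isdD (isdC _ _) (lift_derive h t).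
  by rewrite add0r.
- exact: lift_continuous h.
- exact: lift_gt0 h.
- by move=> t; rewrite (lift_period h) addrA.
Qed.

(** On the circle this is |B'| ([bprod_deriveE]): each Moebius factor turns the argument at the
    speed given by its Poisson kernel, and the speeds of a product add up. *)
Definition bprod_deriv (a : nat -> R[i]) (n : nat) (z : R[i]) : R :=
  \sum_(i < n) poisson (a i) z.

Lemma bprod_circle_lift rho (a : nat -> R[i]) n : (0 < n)%N -> modulus rho = 1 ->
  (forall i, (i < n)%N -> modulus (a i) < 1) ->
  exists g, circle_lift (bprod rho a n) g (fun t => bprod_deriv a n (expi t)) n.
Proof.
move=> n0 rho1 an; have [r _ rE] := circleE (rho1 : circle rho).
suff [g hg] : exists g, circle_lift (fun z => \prod_(i < n) mobius (a i) z) g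
   (fun t => bprod_deriv a n (expi t)) n.
  exists (fun t => r + g t); rewrite /bprod rE.
  exact: circle_lift_rot.
case: n n0 an => // n _; rewrite /bprod_deriv; elim: n => [|n ih] an.
  exists (mobius_lift (a 0%N)).
  under eq_fun do rewrite big_ord1; under [X in circle_lift _ _ X]eq_fun do rewrite big_ord1.
  by apply: mobius_circle_lift; exact: an.
have [i /ltnW|g hg] := ih; first exact: an.
exists (fun t => g t + mobius_lift (a n.+1) t).
under eq_fun do rewrite big_ord_recr /=.
under [X in circle_lift _ _ X]eq_fun do rewrite big_ord_recr /=.
rewrite -[n.+2]addn1.
exact: (circle_lift_mul hg (mobius_circle_lift (an n.+1 (ltnSn _)))).
Qed.

End circle_lifts.

Section lift_substitution.
Variable R : realType.
Variables (S : R[i] -> R[i]) (g dg : R -> R) (n : nat).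
Hypotheses (n0 : (0 < n)%N) (hg : circle_lift S g dg n).
Local Notation leb := (@lebesgue_measure R).

Lemma lift_lt a b : a < b -> g a < g b.
Proof.
move=> ab; have [c _ h] := mean_value ab (lift_derive hg).
by rewrite -subr_gt0 h mulr_gt0 ?(lift_gt0 hg)// subr_gt0.
Qed.

Lemma lift_ltE a b : (g a < g b) = (a < b).
Proof.
apply/idP/idP; last exact: lift_lt.
by apply: contraLR; rewrite -!leNgt le_eqVlt => /predU1P[->|/lift_lt/ltW].
Qed.

Lemma lift_leE a b : (g a <= g b) = (a <= b).
Proof. by rewrite leNgt lift_ltE -leNgt. Qed.

Lemma lift_periodn t k : g (t + k%:R) = g t + (k * n)%:R.
Proof.
elim: k => [|k ih]; first by rewrite mul0n !addr0.
by rewrite -natr1 addrA (lift_period hg) ih mulSnr natrD addrA.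
Qed.

Lemma lift_surj s : exists t, g t = s.
Proof.
pose k := (Num.truncn (`|s - g 0|)%R).+1.
have ks : `|s - g 0| <= (k * n)%:R.
  rewrite (@le_trans _ _ k%:R)//; last by rewrite ler_nat leq_pmulr.
  by rewrite /k ltW// truncnS_gt.
have gk := lift_periodn 0 k; rewrite add0r in gk.
have gNk := lift_periodn (- k%:R) k; rewrite addNr in gNk.
move: ks; rewrite ler_norml => /andP[h1 h2].
have ab : - k%:R <= k%:R :> R by rewrite (@le_trans _ _ 0) ?oppr_le0.
have cg : {within `[- k%:R, k%:R], continuous g}.
  by apply: continuous_subspaceT => x; exact: is_derive_continuous (lift_derive hg x).
have [|c _ <-] := @IVT R g (- k%:R) k%:R s ab cg; last by exists c.
have gl : g (- k%:R) <= g k%:R by rewrite lift_leE.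
rewrite (min_l gl) (max_r gl); lra.
Qed.

Lemma measurable_lift : measurable_fun [set: R] g.
Proof.
apply: continuous_measurable_fun => x.
exact: is_derive_continuous (lift_derive hg x).
Qed.

Lemma measurable_lift_deriv : measurable_fun [set: R] dg.
Proof. by apply: continuous_measurable_fun => x; exact: lift_continuous hg x. Qed.

Lemma lift_deriv_ge0 t : 0 <= dg t.
Proof. exact/ltW/(lift_gt0 hg). Qed.

(** The image under [g] of the measure with density [dg] agrees with Lebesgue measure on half-open
    intervals by the fundamental theorem of calculus, hence everywhere by uniqueness; no regularity
    of [f] is involved. *)
Lemma lift_integral (f : R -> \bar R) : measurable_fun [set: R] f ->
  (forall s, 0 <= f s)%E ->
  (\int[leb]_s f s = \int[leb]_t (f (g t) * (dg t)%:E))%E.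
Proof.
move=> mf f0.
pose nu : {measure set (measurableTypeR R) -> \bar R} :=
  density_measure leb measurable_lift_deriv lift_deriv_ge0.
have ml : @measurable_fun _ _ (measurableTypeR R) (measurableTypeR R) setT g.
  exact: measurable_lift.
pose nug : {measure set (measurableTypeR R) -> \bar R} :=
  measure_function_pushforward__canonical__measure_function_Measure nu ml.
transitivity (\int[nug]_s f s)%E.
  apply: eq_measure_integral => A mA _; apply: lebesgue_measure_unique => // _ [[c d] /= _ <-].
  have [u uc] := lift_surj c; have [v vd] := lift_surj d.
  rewrite /nug /= /pushforward /nu /= /density_measure.
  have -> : g @^-1` [set` `]c, d]] = `]u, v]%classic.
    by apply/seteqP; split => t /=; rewrite !in_itv/= -uc -vd lift_ltE lift_leE.
  rewrite -uc -vd; have [uv|vu] := leP u v.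
    rewrite integral_itv_obnd_cbnd; last first.
      by apply/measurable_EFinP/measurable_funTS; exact: measurable_lift_deriv.
    rewrite (integral_derivative uv (lift_derive hg) (lift_continuous hg)).
    rewrite lebesgue_measure_itv /= lte_fin lift_ltE.
    by move: uv; rewrite le_eqVlt => /predU1P[->|->]; rewrite ?ltxx ?subrr ?EFinB.
  rewrite !set_itv_ge ?integral_set0 ?measure0// bnd_simp -leNgt ?ltW//.
  by rewrite lift_ltE.
rewrite /nug (ge0_integral_pushforward ml nu measurableT)//=.
rewrite preimage_setT (@ge0_integral_density _ _ _ leb nu dg)//.
- exact: measurable_lift_deriv.
- exact: lift_deriv_ge0.
- exact: (measurableT_comp mf measurable_lift).
Qed.

End lift_substitution.

(** * Complex derivative of a Blaschke product on the circle *)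

Section complex_derivative.
Variable R : realType.
Implicit Types (f g : R[i] -> R[i]) (z a : R[i]).

Lemma isdV_complex f z d : f z != 0 -> is_derive z (1 : R[i]) f d ->
  is_derive z (1 : R[i]) (fun z => (f z)^-1) (- (f z ^- 2 * d)).
Proof.
move=> f0 [df fd]; split; first exact: derivableV.
by rewrite deriveV// fd scaleNr.
Qed.

Lemma isdM_complex f g z d d' : is_derive z (1 : R[i]) f d ->
  is_derive z (1 : R[i]) g d' ->
  is_derive z (1 : R[i]) (fun z => f z * g z) (f z * d' + g z * d).
Proof. by move=> h h'; exact: is_deriveM. Qed.

Lemma isdB_complex f g z d d' : is_derive z (1 : R[i]) f d ->
  is_derive z (1 : R[i]) g d' ->
  is_derive z (1 : R[i]) (fun z => f z - g z) (d - d').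
Proof. by move=> h h'; exact: is_deriveB. Qed.

Lemma isdC_complex a z : is_derive z (1 : R[i]) (fun=> a) 0.
Proof. exact: is_derive_cst. Qed.

Lemma isdI_complex z : is_derive z (1 : R[i]) (fun z => z) 1.
Proof. exact: is_derive_id. Qed.

Lemma isdeq_complex f z d d' : is_derive z (1 : R[i]) f d -> d = d' ->
  is_derive z (1 : R[i]) f d'.
Proof. by move=> h <-. Qed.

Lemma mobius_derive a z : 1 - a^* * z != 0 ->
  is_derive z (1 : R[i]) (mobius a) ((1 - modulus a ^+ 2)%:C / (1 - a^* * z) ^+ 2).
Proof.
move=> d0; rewrite RtoCB -mulJc.
have h1 := isdB_complex (isdI_complex z) (isdC_complex a z).
have h2 := isdB_complex (isdC_complex 1 z)
  (isdM_complex (isdC_complex a^* z) (isdI_complex z)).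
have h3 := @isdV_complex (fun z => 1 - a^* * z) z _ d0 h2.
by apply: (isdeq_complex (isdM_complex h1 h3)); field.
Qed.

Lemma bprod_derive rho (a : nat -> R[i]) n z :
    (forall i, (i < n)%N -> 1 - (a i)^* * z != 0) ->
    (forall i, (i < n)%N -> z != a i) ->
  is_derive z (1 : R[i]) (bprod rho a n) (bprod rho a n z *
    \sum_(i < n) ((1 - modulus (a i) ^+ 2)%:C / ((1 - (a i)^* * z) * (z - a i)))).
Proof.
move=> d0 za; rewrite /bprod.
suff h : is_derive z (1 : R[i]) (fun z => \prod_(i < n) mobius (a i) z)
    (\prod_(i < n) mobius (a i) z *
    \sum_(i < n) ((1 - modulus (a i) ^+ 2)%:C / ((1 - (a i)^* * z) * (z - a i)))).
  by apply: (isdeq_complex (isdM_complex (isdC_complex rho z) h)); rewrite mulr0 addr0 mulrA.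
elim: n d0 za => [|n ih] d0 za.
  under eq_fun do rewrite big_ord0.
  by rewrite !big_ord0 mulr0; exact: isdC_complex.
under eq_fun do rewrite big_ord_recr /=.
have h := ih (fun i hi => d0 i (ltnW hi)) (fun i hi => za i (ltnW hi)).
have dn := d0 n (ltnSn n); have zn := za n (ltnSn n); rewrite -subr_eq0 in zn.
rewrite !big_ord_recr /=; have h' := mobius_derive dn.
apply: (isdeq_complex (isdM_complex h h')).
set A := \prod_(i < n) _; set B := \sum_(i < n) _.
by rewrite /mobius; field; rewrite dn zn.
Qed.

(** For |z| = 1 the logarithmic derivative z B'(z) / B(z) is a sum of positive Poisson kernels, so
    nothing is lost in taking the modulus. *)
Lemma bprod_deriveE rho (a : nat -> R[i]) n z : modulus rho = 1 ->
    (forall i, (i < n)%N -> modulus (a i) < 1) -> modulus z = 1 ->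
  modulus (derive1 (bprod rho a n) z) = bprod_deriv a n z.
Proof.
move=> rho1 an z1.
have d0 i : (i < n)%N -> 1 - (a i)^* * z != 0.
  by move=> /an ai; rewrite mobius_den// z1.
have za i : (i < n)%N -> z != a i.
  by move=> /an ai; apply/eqP => zai; move: ai; rewrite -zai z1 ltxx.
have h := bprod_derive rho d0 za.
rewrite derive1E (@derive_val _ _ _ _ _ _ _ h) Normc.normcM bprod_circle// mul1r.
have -> : \sum_(i < n) ((1 - modulus (a i) ^+ 2)%:C / ((1 - (a i)^* * z) * (z - a i))) =
    z^* * (bprod_deriv a n z)%:C.
  rewrite /bprod_deriv RtoC_sum mulr_sumr; apply: eq_bigr => i _.
  have zz : z * z^* = 1 by rewrite mulJc z1 expr1n.
  rewrite /poisson RtoCM.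
  have -> : ((modulus (z - a i) ^+ 2)^-1)%:C = ((z - a i) * (z - a i)^*)^-1.
    by rewrite mulJc; exact: (fmorphV (real_complex R)).
  have di := d0 i (ltn_ord i); have zi := za i (ltn_ord i); rewrite -subr_eq0 in zi.
  have dE : 1 - (a i)^* * z = z * (z - a i)^*.
    by rewrite conjcB mulrBr zz [_ * z]mulrC.
  have z0 : z != 0 by rewrite -modulus_gt0 z1.
  have zi' : (z - a i)^* != 0 by rewrite conjC_eq0.
  have -> : z^* = z^-1 by apply: (mulfI z0); rewrite zz divff.
  have gen (u v w x : R[i]) : v != 0 -> w != 0 -> x != 0 ->
      u / (v * w * x) = v^-1 * (u / (x * w)).
    by move=> v0 w0 x0; field; rewrite v0 w0 x0.
  by rewrite dE gen.
rewrite Normc.normcM modulusJ z1 mul1r modulus_real ger0_norm//.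
apply: sumr_ge0 => i _; rewrite ltW// poisson_gt0//; exact: an.
Qed.

End complex_derivative.

(** * Changes of variables on the circle *)

Section circle_substitution.
Variable R : realType.
Local Notation leb := (@lebesgue_measure R).
Local Notation I01 := (`[0, 1[%classic : set R).
Local Open Scope ereal_scope.

Lemma lift_integral_itv S g dg n (a b : R) (f : R -> \bar R) :
    (0 < n)%N -> circle_lift S g dg n ->
    measurable_fun [set: R] f -> (forall s, 0 <= f s) ->
  \int[leb]_(s in `[g a, g b[) f s = \int[leb]_(t in `[a, b[) (f (g t) * (dg t)%:E).
Proof.
move=> n0 hg mf f0; rewrite integral_mkcond [RHS]integral_mkcond.
rewrite (lift_integral n0 hg).
- apply: eq_integral => t _; rewrite !patchE.
  have -> : (g t \in `[g a, g b[%classic) = (t \in `[a, b[%classic).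
    by apply/idP/idP; rewrite !inE /= !in_itv/= (lift_leE hg) (lift_ltE hg).
  by case: ifP => // _; rewrite mul0e.
- by apply/(measurable_restrictT f) => //; exact: measurable_funTS.
- by apply: erestrict_ge0.
Qed.

Lemma integral_shift (a b c : R) (f : R -> \bar R) :
  measurable_fun [set: R] f -> (forall s, 0 <= f s) ->
  \int[leb]_(s in `[(c + a)%R, (c + b)%R[) f s = \int[leb]_(t in `[a, b[) f (c + t)%R.
Proof.
move=> mf f0; rewrite (lift_integral_itv _ _ _ (circle_lift_rot c (@circle_lift_id R)))//.
by apply: eq_integral => t _; rewrite mule1.
Qed.

Lemma ge0_integral_itv_split (a b c : R) (f : R -> \bar R) : (a <= b)%R -> (b <= c)%R ->
  measurable_fun [set: R] f -> (forall s, 0 <= f s) ->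
  \int[leb]_(s in `[a, c[) f s = \int[leb]_(s in `[a, b[) f s + \int[leb]_(s in `[b, c[) f s.
Proof.
move=> ab bc mf f0; rewrite -(ge0_integral_setU)//.
- by rewrite -itv_bndbnd_setU// bnd_simp.
- exact: measurable_funTS.
- apply/disj_setPS => x [] /=; rewrite !in_itv/= => /andP[_ xb] /andP[bx _].
  by move: xb; rewrite ltNge bx.
Qed.

Section periodic.
Variable f : R -> \bar R.
Hypotheses (mf : measurable_fun [set: R] f) (f0 : forall s, 0 <= f s).
Hypothesis fper : forall t, f (t + 1)%R = f t.

Let fperz (k : int) t : f (t + k%:~R)%R = f t.
Proof.
have fn m u : f (u + m%:R)%R = f u.
  by elim: m u => [|m ih] u; rewrite ?addr0// -natr1 addrA fper ih.
case: k => m; first by rewrite -pmulrn fn.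
rewrite NegzE mulrNz -pmulrn -[in RHS](subrK m.+1%:R t) fn//.
Qed.

Lemma integral_period c : \int[leb]_(s in `[c, (c + 1)%R[) f s = \int[leb]_(s in I01) f s.
Proof.
pose k := Num.floor c; have kc : (k%:~R <= c)%R by exact: ge_floor.
have ck : (c <= k%:~R + 1)%R by rewrite ltW// -intrD1; exact: lt_succ_floor.
rewrite (@ge0_integral_itv_split c (k%:~R + 1)%R)//; last by rewrite lerD2r.
rewrite [X in _ + X](_ : _ = \int[leb]_(s in `[k%:~R, c[) f s); last first.
  have -> : (k%:~R + 1)%R = (1 + k%:~R)%R :> R by rewrite addrC.
  have -> : (c + 1)%R = (1 + c)%R by rewrite addrC.
  rewrite integral_shift//.
  by apply: eq_integral => t _; rewrite addrC fper.
rewrite addeC -ge0_integral_itv_split//.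
rewrite -[X in `[X, _[](addr0 k%:~R)%R integral_shift//.
by apply: eq_integral => t _; rewrite addrC fperz.
Qed.

Lemma integral_periodn c n :
  \int[leb]_(s in `[c, (c + n%:R)%R[) f s = n%:R%:E * \int[leb]_(s in I01) f s.
Proof.
elim: n => [|n ih].
  by rewrite addr0 mul0e set_itv_ge ?integral_set0// bnd_simp ltxx.
rewrite -natr1 addrA (@ge0_integral_itv_split c (c + n%:R)%R) ?lerDl//.
by rewrite ih integral_period EFinD ge0_muleDl ?lee_fin// mul1e.
Qed.

End periodic.

Section circle_lift_integral.
Variables (S : R[i] -> R[i]) (g dg : R -> R) (n : nat).
Hypotheses (n0 : (0 < n)%N) (hg : circle_lift S g dg n).
Variable F : R[i] -> \bar R.
Hypotheses (mF : measurable_fun [set: R[i]] F) (F0 : forall z, 0 <= F z).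

Let mFe : measurable_fun [set: R] (F \o @expi R).
Proof. exact: measurableT_comp mF (@measurable_expi R). Qed.

Let Fper t : (F \o @expi R) (t + 1)%R = (F \o @expi R) t.
Proof. by rewrite /= expiD expi1 mulr1. Qed.

(** The lift carries [0, 1) onto an interval of length [n], that is [n] periods of [F \o expi]. *)
Lemma circle_lift_integral :
  \int[leb]_(t in I01) (F (S (expi t)) * (dg t)%:E) =
  n%:R%:E * \int[leb]_(t in I01) F (expi t).
Proof.
transitivity (\int[leb]_(t in `[0%R, 1%R[) ((F \o @expi R) (g t) * (dg t)%:E)).
  by apply: eq_integral => t _; rewrite (lift_expi hg).
rewrite -(lift_integral_itv 0 1 n0 hg mFe); last by move=> s; exact: F0.
have -> : g 1%R = (g 0 + n%:R)%R by rewrite -(lift_period hg) add0r.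
by rewrite integral_periodn// => s; exact: F0.
Qed.

(** An arc that [S] wraps at most once around the circle sees at most one period; this is what later
    bounds the Jacobian over a small arc. *)
Lemma circle_lift_integral_le (a b : R) : (g b <= g a + 1)%R ->
  \int[leb]_(t in `[a, b[) (F (S (expi t)) * (dg t)%:E) <=
  \int[leb]_(t in I01) F (expi t).
Proof.
move=> gab.
have -> : \int[leb]_(t in `[a, b[) (F (S (expi t)) * (dg t)%:E) =
    \int[leb]_(t in `[a, b[) ((F \o @expi R) (g t) * (dg t)%:E).
  by apply: eq_integral => t _; rewrite (lift_expi hg).
have F0e s : 0 <= (F \o @expi R) s by exact: F0.
rewrite -(lift_integral_itv a b n0 hg mFe)//.
rewrite -(integral_period mFe F0e Fper (g a)).
apply: ge0_subset_integral => //; first exact: measurable_funTS.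
by apply: subset_itv; rewrite bnd_simp.
Qed.

End circle_lift_integral.
End circle_substitution.

(** * Bounded measurable functions *)

(** The working class for real integrals: on a probability space such functions are integrable, and
    the class is stable under all operations needed. *)
Definition bmeas d (T : measurableType d) (R : realType) (f : T -> R) : Prop :=
  measurable_fun [set: T] f /\ exists M : R, forall x, `|f x| <= M.

Section bounded_measurable.
Context d (T : measurableType d) (R : realType).
Implicit Types (f g : T -> R) (c : R).

Lemma bmeas_cst c : bmeas (fun _ : T => c).
Proof. by split => //; exists `|c|. Qed.

Lemma bmeasD f g : bmeas f -> bmeas g -> bmeas (fun x => f x + g x).
Proof.
move=> [mf [M hM]] [mg [N hN]]; split; first exact: measurable_funD.
by exists (M + N) => x; rewrite (le_trans (ler_normD _ _))// lerD.
Qed.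

Lemma bmeasN f : bmeas f -> bmeas (fun x => - f x).
Proof.
move=> [mf [M hM]]; split; first exact: measurable_funN.
by exists M => x; rewrite normrN.
Qed.

Lemma bmeasB f g : bmeas f -> bmeas g -> bmeas (fun x => f x - g x).
Proof. by move=> hf hg; apply: bmeasD => //; exact: bmeasN. Qed.

Lemma bmeasM f g : bmeas f -> bmeas g -> bmeas (fun x => f x * g x).
Proof.
move=> [mf [M hM]] [mg [N hN]]; split; first exact: measurable_funM.
by exists (M * N) => x; rewrite normrM ler_pM.
Qed.

Lemma bmeas_norm f : bmeas f -> bmeas (fun x => `|f x|).
Proof.
move=> [mf [M hM]]; split; first exact: measurableT_comp.
by exists M => x; rewrite normr_id.
Qed.

Lemma bmeas_comp d' (T' : measurableType d') (h : T' -> T) f :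
  measurable_fun [set: T'] h -> bmeas f -> bmeas (fun x => f (h x)).
Proof.
move=> mh [mf [M hM]]; split; first exact: measurableT_comp mf mh.
by exists M.
Qed.

Variable mu : probability T R.

Lemma bmeas_integrable f : bmeas f -> mu.-integrable [set: T] (EFin \o f).
Proof.
move=> [mf [M hM]]; apply: measurable_bounded_integrable => //.
  by rewrite (le_lt_trans (probability_le1 _ _))// ltry.
by exists M; split; [rewrite num_real|move=> y My x _; exact: le_trans (hM x) (ltW My)].
Qed.

Lemma bint_EFin f : bmeas f -> (\int[mu]_x (f x)%:E)%E = (\int[mu]_x f x)%:E.
Proof. by move=> /bmeas_integrable hf; rewrite fineK// integrable_fin_num. Qed.

Lemma integral_cst_prob c : (\int[mu]_x c%:E = c%:E)%E.
Proof.
rewrite (integral_cst mu measurableT) -[RHS]mule1; congr (_ * _)%E.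
exact: probability_setT.
Qed.

Lemma bint_cst c : \int[mu]_x c = c.
Proof.
rewrite (_ : \int[mu]_x c = c * fine (mu setT)); last exact: Rintegral_cst.
by rewrite probability_setT mulr1.
Qed.

Lemma bintD f g : bmeas f -> bmeas g ->
  \int[mu]_x (f x + g x) = \int[mu]_x f x + \int[mu]_x g x.
Proof. by move=> hf hg; rewrite RintegralD//; exact: bmeas_integrable. Qed.

Lemma bintB f g : bmeas f -> bmeas g ->
  \int[mu]_x (f x - g x) = \int[mu]_x f x - \int[mu]_x g x.
Proof. by move=> hf hg; rewrite RintegralB//; exact: bmeas_integrable. Qed.

Lemma bintZ c f : bmeas f -> \int[mu]_x (c * f x) = c * \int[mu]_x f x.
Proof. by move=> hf; rewrite RintegralZl//; exact: bmeas_integrable. Qed.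

Lemma bint_le f g : bmeas f -> bmeas g -> (forall x, f x <= g x) ->
  \int[mu]_x f x <= \int[mu]_x g x.
Proof. by move=> hf hg fg; apply: le_Rintegral => //; exact: bmeas_integrable. Qed.

Lemma bint_norm_le f c : bmeas f -> (forall x, `|f x| <= c) -> `|\int[mu]_x f x| <= c.
Proof.
move=> hf fc; apply: (le_trans (le_normr_Rintegral _ _)) => //.
  exact: bmeas_integrable.
rewrite -[leRHS]bint_cst; apply: bint_le => //; first exact: bmeas_norm.
exact: bmeas_cst.
Qed.

Lemma bint_normr f : bmeas f -> `|\int[mu]_x f x| <= \int[mu]_x `|f x|.
Proof. by move=> hf; apply: le_normr_Rintegral => //; exact: bmeas_integrable. Qed.

Lemma bint_ae f g : bmeas f -> bmeas g -> {ae mu, forall x, f x = g x} ->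
  \int[mu]_x f x = \int[mu]_x g x.
Proof.
move=> [mf _] [mg _] fg; congr fine; apply: ae_eq_integral => //.
- exact/measurable_EFinP.
- exact/measurable_EFinP.
- by apply: filterS fg => x fgx _; rewrite fgx.
Qed.

Lemma bounded_convergence (f : nat -> T -> R) (g : T -> R) (M : R) :
    (forall n, measurable_fun [set: T] (f n)) -> measurable_fun [set: T] g ->
    (forall n x, `|f n x| <= M) ->
    {ae mu, forall x, f ^~ x @ \oo --> g x} ->
  (fun n => \int[mu]_x f n x) @ \oo --> \int[mu]_x g x.
Proof.
move=> mf mg fM fg.
have cvE (x : T) : f ^~ x @ \oo --> g x -> (fun n => (f n x)%:E) @ \oo --> (g x)%:E.
  by move=> h; apply: cvg_EFin => //; exact: nearW.
have h1 : {ae mu, forall x, [set: T] x -> (fun n => (f n x)%:E) @ \oo --> (g x)%:E}.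
  by apply: filterS fg => x fx _; exact: cvE.
have h2 : {ae mu, forall x n, [set: T] x -> (`|(f n x)%:E| <= M%:E)%E}.
  by apply: aeW => x n _; rewrite lee_fin.
have [ig _ h] := @dominated_convergence _ _ _ mu setT measurableT
  (fun n x => (f n x)%:E) (fun x => (g x)%:E) (fun=> M%:E)
  (fun n => proj2 (measurable_EFinP _ _) (mf n)) (proj2 (measurable_EFinP _ _) mg)
  h1 (finite_measure_integrable_cst mu M measurableT) h2.
apply: (@fine_cvg _ _ _ _ (fun n => \int[mu]_x (f n x)%:E)%E).
rewrite (_ : (\int[mu]_x g x)%:E = (\int[mu]_x (g x)%:E)%E)//.
by rewrite fineK// integrable_fin_num.
Qed.

End bounded_measurable.

Section bounded_fubini.
Context d d' (T : measurableType d) (T' : measurableType d') (R : realType).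
Variables (mu : probability T R) (nu : probability T' R).
Variable f : T * T' -> R.
Hypothesis hf : bmeas f.

Lemma bmeas_section1 x : bmeas (fun y => f (x, y)).
Proof.
have [mf [M hM]] := hf; split; last by exists M.
exact: (measurableT_comp mf (measurable_pair1 x)).
Qed.

Lemma bmeas_section2 y : bmeas (fun x => f (x, y)).
Proof.
have [mf [M hM]] := hf; split; last by exists M.
exact: (measurableT_comp mf (measurable_pair2 y)).
Qed.

Let prod_integrable : (mu \x nu)%E.-integrable setT (EFin \o f).
Proof.
have [mf [M hM]] := hf; apply/integrable12ltyP; first exact/measurable_EFinP.
have M0 : 0 <= M by exact: le_trans (normr_ge0 _) (hM (point, point)).
apply: (@le_lt_trans _ _ (\int[mu]_x M%:E)%E); last first.
  by rewrite integral_cst_prob ltry.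
apply: ge0_le_integral => //.
- by move=> x _; exact: integral_ge0.
- exact: (@measurable_fun_fubini_tonelli_F _ _ _ _ _ nu (fun z => `|(f z)%:E|%E)
    ltac:(by apply: measurableT_comp => //; exact/measurable_EFinP) ltac:(by [])).
- move=> x _; apply: (@le_trans _ _ (\int[nu]_y M%:E)%E); last first.
    by rewrite integral_cst_prob.
  apply: ge0_le_integral => //.
  + apply: measurableT_comp => //; apply/measurable_EFinP; exact: (bmeas_section1 x).1.
  + by move=> y _; rewrite lee_fin.
Qed.

Lemma bmeas_int1 : bmeas (fun x => \int[nu]_y f (x, y)).
Proof.
have [mf [M hM]] := hf; split.
  apply: (measurableT_comp (@fine_measurable R _ measurableT)).
  exact: (measurable_fubini_F prod_integrable).
by exists M => x; apply: bint_norm_le => //; exact: bmeas_section1.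
Qed.

Lemma bmeas_int2 : bmeas (fun y => \int[mu]_x f (x, y)).
Proof.
have [mf [M hM]] := hf; split.
  apply: (measurableT_comp (@fine_measurable R _ measurableT)).
  exact: (measurable_fubini_G prod_integrable).
by exists M => x; apply: bint_norm_le => //; exact: bmeas_section2.
Qed.

Lemma bint_fubini :
  \int[mu]_x \int[nu]_y f (x, y) = \int[nu]_y \int[mu]_x f (x, y).
Proof.
apply/EFin_inj; rewrite -!bint_EFin; [|exact: bmeas_int2|exact: bmeas_int1].
transitivity (\int[mu]_x \int[nu]_y (f (x, y))%:E)%E.
  by apply: eq_integral => x _; rewrite bint_EFin//; exact: bmeas_section1.
rewrite (Fubini prod_integrable).
by apply: eq_integral => y _; rewrite -bint_EFin//; exact: bmeas_section2.
Qed.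

End bounded_fubini.

(** * The uniform parameter of the circle *)

Section uniform_circle.
Variable R : realType.
Local Notation leb := (@lebesgue_measure R).
Local Notation I01 := (`[0, 1[%classic : set R).

(** Circle integrals are computed in the parameter t; the image of this measure under [expi] is
    [circle_measure]. *)
Definition unif01 : set (measurableTypeR R) -> \bar R :=
  mrestr leb (measurable_itv `[0, 1[).

HB.instance Definition _ := Measure.on unif01.

Let unif01_setT : unif01 setT = 1%E.
Proof.
rewrite /unif01 /mrestr setTI.
by rewrite lebesgue_measure_itv /= lte_fin ltr01 oppr0 adde0.
Qed.

HB.instance Definition _ := Measure_isProbability.Build _ _ _ unif01 unif01_setT.

Lemma ge0_integral_unif01 (f : R -> \bar R) : measurable_fun [set: R] f ->
  (forall x, 0 <= f x)%E -> (\int[unif01]_t f t = \int[leb]_(t in I01) f t)%E.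
Proof.
move=> mf f0; rewrite (@ge0_integral_density _ _ _ leb unif01 (\1_I01)) //.
- by rewrite [RHS]integral_mkcond epatch_indic.
- by move=> A mA; rewrite /= /unif01 /mrestr integral_indic// setIC.
Qed.

Lemma integral_unif01 (f : R -> \bar R) : measurable_fun [set: R] f ->
  (\int[unif01]_t f t = \int[leb]_(t in I01) f t)%E.
Proof.
move=> mf; rewrite integralE [RHS]integralE; congr (_ - _)%E.
  by rewrite ge0_integral_unif01//; exact: measurable_funepos.
by rewrite ge0_integral_unif01//; exact: measurable_funeneg.
Qed.

Lemma circle_lift_bint S g dg n (F : R[i] -> R) : (0 < n)%N ->
    circle_lift S g dg n -> bmeas (dg : measurableTypeR R -> R) ->
    measurable_fun [set: R[i]] F -> (exists M : R, forall t, `|F (expi t)| <= M) ->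
  \int[unif01]_t (F (S (expi t)) * dg t) = n%:R * \int[unif01]_t F (expi t).
Proof.
move=> n0 hg bdg mF [M hM].
have M0 : 0 <= M := le_trans (normr_ge0 _) (hM 0).
have mexpi (G : R[i] -> R) : measurable_fun [set: R[i]] G ->
    measurable_fun [set: measurableTypeR R] (fun t => G (expi t)).
  by move=> mG; exact: measurableT_comp mG (@measurable_expi R).
have mS (G : R[i] -> R) : measurable_fun [set: R[i]] G ->
    measurable_fun [set: measurableTypeR R] (fun t => G (S (expi t))).
  move=> mG; rewrite (_ : (fun t => _) = (fun t => G (expi t)) \o g); last first.
    by apply/funext => t /=; rewrite (lift_expi hg).
  exact: measurableT_comp (mexpi _ mG) (measurable_lift hg).
have dg0 t : 0 <= dg t by rewrite ltW// (lift_gt0 hg).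
(* The function [F] is bounded by [M] on the circle only. Where the bound fails [G] is 0, and adding
   [M] makes it nonnegative. *)
pose G z := if `|F z| <= M then F z + M else 0.
have mG : measurable_fun [set: R[i]] G.
  apply: measurable_fun_if => //; first by apply: measurable_fun_ler => //; exact: measurableT_comp.
  by apply: measurable_funTS; exact: measurable_funD.
have G0 z : 0 <= G z by rewrite /G; case: ifP => // /ler_normlP[]; lra.
have GE t : G (expi t) = F (expi t) + M by rewrite /G hM.
have bG : bmeas (fun t : measurableTypeR R => G (expi t)).
  split; first exact: mexpi; exists (M + M) => t; rewrite GE.
  by rewrite (le_trans (ler_normD _ _))// (ger0_norm M0) lerD2r.
have bF : bmeas (fun t : measurableTypeR R => F (expi t)).
  by split; [exact: mexpi|exists M].
have bFS : bmeas (fun t : measurableTypeR R => F (S (expi t))).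
  by split; [exact: mS|exists M => t; rewrite (lift_expi hg)].
have main (H : R[i] -> R) : measurable_fun [set: R[i]] H -> (forall z, 0 <= H z) ->
    (\int[unif01]_t (H (S (expi t)) * dg t)%:E = n%:R%:E * \int[unif01]_t (H (expi t))%:E)%E.
  move=> mH H0.
  rewrite !ge0_integral_unif01//.
  - exact: (circle_lift_integral n0 hg (proj2 (measurable_EFinP _ _) mH) (fun z => H0 z)).
  - by apply/measurable_EFinP; exact: mexpi.
  - by move=> t; rewrite lee_fin.
  - by apply/measurable_EFinP; apply: measurable_funM; [exact: mS|exact: bdg.1].
  - by move=> t; rewrite lee_fin mulr_ge0.
have mainb (H : R[i] -> R) : measurable_fun [set: R[i]] H -> (forall z, 0 <= H z) ->
    bmeas (fun t : measurableTypeR R => H (expi t)) ->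
    bmeas (fun t : measurableTypeR R => H (S (expi t))) ->
    \int[unif01]_t (H (S (expi t)) * dg t) = n%:R * \int[unif01]_t H (expi t).
  move=> mH H0 b1 b2; apply/EFin_inj; rewrite EFinM -!bint_EFin//; first exact: main.
  exact: bmeasM.
have SE t : G (S (expi t)) = F (S (expi t)) + M by rewrite (lift_expi hg) GE.
have bGS : bmeas (fun t : measurableTypeR R => G (S (expi t))).
  by under [X in bmeas X]eq_fun do rewrite SE; apply: bmeasD => //; exact: bmeas_cst.
have e1 := mainb G mG G0 bG bGS.
have e2 := mainb (fun=> M) (@measurable_cst _ _ _ _ _ _) (fun=> M0) (bmeas_cst _ _) (bmeas_cst _ _).
have : \int[unif01]_t (G (S (expi t)) * dg t) =
    \int[unif01]_t (F (S (expi t)) * dg t) + \int[unif01]_t (M * dg t).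
  rewrite -bintD; [|exact: bmeasM|by apply: bmeasM => //; exact: bmeas_cst].
  by congr Rintegral; apply/funext => t; rewrite SE mulrDl.
have : \int[unif01]_t G (expi t) = \int[unif01]_t F (expi t) + \int[unif01]_t M.
  rewrite -bintD//; last exact: bmeas_cst.
  by congr Rintegral; apply/funext => t; rewrite GE.
by move=> eG eG'; move: e1; rewrite eG' eG e2 mulrDr => /addIr.
Qed.

Lemma bmeas_poisson (w : R[i]) : modulus w < 1 ->
  bmeas (fun t : measurableTypeR R => poisson w (expi t)).
Proof.
move=> w1; split.
  apply: measurable_funM => //; apply: measurable_funV.
  apply: measurable_funX; apply: measurable_modulus.
  by apply: measurableC_sub => //; exact: measurable_expi.
exists ((1 - modulus w ^+ 2) / (1 - modulus w) ^+ 2) => t.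
have d0 : 0 < 1 - modulus w by rewrite subr_gt0.
have h : 1 - modulus w <= modulus (expi t - w).
  by rewrite -(expi_modulus t); exact: lerB_modulus.
rewrite ger0_norm; last by rewrite ltW// poisson_gt0// expi_modulus.
rewrite /poisson ler_wpM2l ?(ltW (one_minus_sqr _))// lef_pV2 ?posrE ?exprn_gt0//.
  by rewrite ler_sqr ?nnegrE ?modulus_ge0// ltW.
exact: lt_le_trans h.
Qed.

End uniform_circle.

(** * The disk algebra *)

Section disk_algebra.
Variable R : realType.
Local Notation unif := (@unif01 R).
Implicit Types (F G : R[i] -> R[i]) (z w : R[i]) (p : {poly R[i]}).

(* Measurable functions on [R[i]] whose restriction to the closed unit disk
   lies in the disk algebra, i.e. is a uniform limit of polynomials. *)
Definition dalg F : Prop := measurable_fun [set: R[i]] F /\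
  forall e : R, 0 < e -> exists p : {poly R[i]},
    forall z, modulus z <= 1 -> modulus (F z - p.[z]) <= e.

Lemma measurableC_add d (X : measurableType d) (D : set X) (f g : X -> R[i]) :
  measurable_fun D f -> measurable_fun D g -> measurable_fun D (fun x => f x + g x).
Proof.
move=> mf mg; under eq_fun do rewrite -[g _]opprK -[- g _]sub0r.
by apply: measurableC_sub => //; apply: measurableC_sub.
Qed.

Lemma measurable_horner p : measurable_fun [set: R[i]] (fun z => p.[z]).
Proof.
elim/poly_ind: p => [|p c ih].
  by under eq_fun do rewrite horner0; exact: measurable_cst.
under eq_fun do rewrite hornerMXaddC.
by apply: measurableC_add => //; apply: measurableC_mul => //.
Qed.

Lemma dalg_poly p : dalg (fun z => p.[z]).
Proof.
split; first exact: measurable_horner.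
by move=> e e0; exists p => z _; rewrite subrr Normc.normc0 ltW.
Qed.

Lemma dalg_cst c : dalg (fun=> c).
Proof. by have := dalg_poly c%:P; under eq_fun do rewrite hornerC. Qed.

Lemma dalg_id : dalg id.
Proof. by have := dalg_poly 'X; under eq_fun do rewrite hornerX. Qed.

Lemma dalg_bounded F : dalg F ->
  exists2 M : R, 0 < M & forall z, modulus z <= 1 -> modulus (F z) <= M.
Proof.
move=> [_ /(_ 1 ltr01)[p hp]].
suff [M M0 hM] : exists2 M : R, 0 < M & forall z, modulus z <= 1 -> modulus p.[z] <= M.
  exists (1 + M); first by rewrite addr_gt0.
  move=> z z1; rewrite -(subrK p.[z] (F z)) (le_trans (le_normcD _ _))// lerD//.
    exact: hp.
  exact: hM.
elim/poly_ind: p {hp} => [|p c [M M0 hM]].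
  by exists 1 => // z _; rewrite horner0 Normc.normc0.
exists (M + (modulus c)); first by rewrite ltr_wpDr// modulus_ge0.
move=> z z1; rewrite hornerMXaddC (le_trans (le_normcD _ _))// lerD2r.
by rewrite Normc.normcM (le_trans _ (hM z z1))// ler_piMr// modulus_ge0.
Qed.

Lemma dalg_lim F : measurable_fun [set: R[i]] F ->
  (forall e : R, 0 < e -> exists2 G, dalg G &
    forall z, modulus z <= 1 -> modulus (F z - G z) <= e) -> dalg F.
Proof.
move=> mF h; split => // e e0; have e2 : 0 < e / 2 by rewrite divr_gt0.
have [G [_ /(_ _ e2)[p hp]] hG] := h _ e2; exists p => z z1.
rewrite (_ : F z - p.[z] = (F z - G z) + (G z - p.[z])); last by rewrite addrA subrK.
by rewrite (le_trans (le_normcD _ _))// [leRHS](splitr e) lerD// ?hG ?hp.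
Qed.

Lemma dalgD F G : dalg F -> dalg G -> dalg (fun z => F z + G z).
Proof.
move=> [mF hF] [mG hG]; split; first exact: measurableC_add.
move=> e e0; have e2 : 0 < e / 2 by rewrite divr_gt0.
have [p hp] := hF _ e2; have [q hq] := hG _ e2; exists (p + q) => z z1.
rewrite hornerD opprD addrACA (le_trans (le_normcD _ _))// [leRHS](splitr e).
by rewrite lerD// ?hp ?hq.
Qed.

Lemma dalgM F G : dalg F -> dalg G -> dalg (fun z => F z * G z).
Proof.
move=> hF hG; have [M M0 hM] := dalg_bounded hF; have [N N0 hN] := dalg_bounded hG.
apply: dalg_lim; first exact: measurableC_mul hF.1 hG.1.
move=> e e0; have [_ aG] := hG; have [_ aF] := hF.
have e1 : 0 < e / 2 / M by rewrite !divr_gt0.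
have [q hq] := aG _ e1; have [Q Q0 hQ] := dalg_bounded (dalg_poly q).
have e2 : 0 < e / 2 / Q by rewrite !divr_gt0.
have [p hp] := aF _ e2; exists (fun z => (p * q).[z]); first exact: dalg_poly.
move=> z z1; rewrite hornerM.
rewrite (_ : _ - _ = F z * (G z - q.[z]) + (F z - p.[z]) * q.[z]); last by ring.
rewrite (le_trans (le_normcD _ _))// [leRHS](splitr e) lerD// Normc.normcM.
  have -> : e / 2 = M * (e / 2 / M) by rewrite mulrCA divff ?gt_eqF// mulr1.
  by rewrite ler_pM ?modulus_ge0 ?hM ?hq.
have -> : e / 2 = (e / 2 / Q) * Q by rewrite divfK// gt_eqF.
by rewrite ler_pM ?modulus_ge0 ?hp ?hQ.
Qed.

Lemma dalgN F : dalg F -> dalg (fun z => - F z).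
Proof.
move=> hF; under eq_fun do rewrite -mulN1r.
by apply: dalgM hF; exact: dalg_cst.
Qed.

Lemma dalgB F G : dalg F -> dalg G -> dalg (fun z => F z - G z).
Proof. by move=> hF hG; apply: dalgD => //; exact: dalgN. Qed.

Lemma dalgX F n : dalg F -> dalg (fun z => F z ^+ n).
Proof.
move=> hF; elim: n => [|n ih].
  by under eq_fun do rewrite expr0; exact: dalg_cst.
by under eq_fun do rewrite exprS; exact: dalgM.
Qed.

Lemma dalg_horner p F : dalg F -> dalg (fun z => p.[F z]).
Proof.
move=> hF; elim/poly_ind: p => [|p c ih].
  by under eq_fun do rewrite horner0; exact: dalg_cst.
under eq_fun do rewrite hornerMXaddC.
by apply: dalgD; [exact: dalgM|exact: dalg_cst].
Qed.

Lemma dalg_comp F G : dalg F -> dalg G ->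
  (forall z, modulus z <= 1 -> modulus (G z) <= 1) -> dalg (fun z => F (G z)).
Proof.
move=> [mF hF] hG G1; apply: dalg_lim; first exact: measurableT_comp mF hG.1.
move=> e e0; have [p hp] := hF _ e0; exists (fun z => p.[G z]).
  exact: dalg_horner.
by move=> z z1; apply: hp; exact: G1.
Qed.

(** Truncated geometric series: the remainder after n terms is F^n / (1 - F), at most r^n / (1 -
    r). *)
Lemma dalg_inv1B F r : dalg F -> r < 1 ->
  (forall z, modulus z <= 1 -> modulus (F z) <= r) -> dalg (fun z => (1 - F z)^-1).
Proof.
move=> hF r1 Fr; have r0 : 0 <= r.
  by apply: le_trans (modulus_ge0 _) (Fr 0 _); rewrite Normc.normc0.
apply: dalg_lim.
  by apply: measurableC_inv; apply: measurableC_sub => //; exact: hF.1.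
move=> e e0; have d0 : 0 < 1 - r by rewrite subr_gt0.
have [n hn] : exists n, r ^+ n <= e * (1 - r).
  have /cvgrPdist_le/(_ _ (mulr_gt0 e0 d0)) : (fun n => r ^+ n) @ \oo --> 0.
    by apply: cvg_expr; rewrite ger0_norm.
  by move=> [n _ /(_ n (leqnn n))]; rewrite /= sub0r normrN ger0_norm ?exprn_ge0//; exists n.
exists (fun z => (\sum_(i < n) 'X^i).[F z]); first exact: dalg_horner.
move=> z z1; have Fz := Fr z z1.
have dz : 1 - r <= modulus (1 - F z).
  by rewrite (le_trans _ (lerB_modulus _ _))// Normc.normc1 lerB.
have dz0 : 1 - F z != 0 by rewrite -modulus_gt0 (lt_le_trans d0).
have -> : (1 - F z)^-1 - (\sum_(i < n) 'X^i).[F z] = F z ^+ n / (1 - F z).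
  have -> : (\sum_(i < n) 'X^i).[F z] = \sum_(i < n) F z ^+ i.
    by rewrite horner_sum; apply: eq_bigr => i _; rewrite hornerXn.
  have := subrXX 1 (F z) n; rewrite expr1n.
  under eq_bigr do rewrite expr1n mul1r.
  move=> h; apply: (mulIf dz0); rewrite mulrBl mulVf// divfK//.
  by rewrite [X in _ - X]mulrC -h opprB addrC subrK.
rewrite Normc.normcM Normc.normcV modulusX ler_pdivrMr ?(lt_le_trans d0)//.
rewrite (@le_trans _ _ (r ^+ n))//; first by rewrite lerXn2r ?nnegrE ?modulus_ge0.
by rewrite (le_trans hn)// ler_wpM2l// ltW.
Qed.

Lemma dalg_mobius a F : modulus a < 1 -> dalg F ->
  (forall z, modulus z <= 1 -> modulus (F z) <= 1) -> dalg (fun z => mobius a (F z)).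
Proof.
move=> a1 hF F1; apply: dalgM; first by apply: dalgB => //; exact: dalg_cst.
apply: (@dalg_inv1B _ (modulus a)) => //; first by apply: dalgM hF; exact: dalg_cst.
by move=> z z1; rewrite Normc.normcM modulusJ ler_piMr ?modulus_ge0 ?F1.
Qed.

Lemma dalg_bprod rho a n F : (forall i, (i < n)%N -> modulus (a i) < 1) -> dalg F ->
  (forall z, modulus z <= 1 -> modulus (F z) <= 1) -> dalg (fun z => bprod rho a n (F z)).
Proof.
move=> an hF F1; apply: dalgM; first exact: dalg_cst.
elim: n an => [|n ih] an.
  by under eq_fun do rewrite big_ord0; exact: dalg_cst.
under eq_fun do rewrite big_ord_recr/=.
apply: dalgM; last by apply: dalg_mobius => //; exact: an.
by apply: ih => i ni; apply: an; exact: ltnW.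
Qed.

Lemma bmeas_dalg F : dalg F -> bmeas (fun t : measurableTypeR R => Re (F (expi t))).
Proof.
move=> hF; have [M M0 hM] := dalg_bounded hF; split.
  by apply: measurableC_Re; exact: measurableT_comp hF.1 (@measurable_expi R).
exists M => t; rewrite (le_trans (Re_le_modulus _))// hM// expi_modulus//.
Qed.

Lemma circle_lift_rotation s :
  circle_lift (fun z => expi s * z) (fun t : R => s + t) (fun=> 1) 1.
Proof. exact: (circle_lift_rot s (@circle_lift_id R)). Qed.

Lemma expi_half : expi (1 / 2) = -1 :> R[i].
Proof.
have key (x : R) : 2 * x * (1 / 2) = x by field.
rewrite /expi key.
by rewrite cospi sinpi; apply/eqP; rewrite eq_complex /= oppr0 !eqxx.
Qed.

(** Rotating by half a period of z^k changes its sign but not its integral. *)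
Lemma mean_value_monomial (c : R[i]) k : (0 < k)%N ->
  \int[unif]_t Re (c * expi t ^+ k) = 0.
Proof.
move=> k0; have hF : dalg (fun z => c * z ^+ k).
  by apply: dalgM; [exact: dalg_cst|apply: dalgX; exact: dalg_id].
pose s : R := 1 / 2 / k%:R.
have ks : k%:R * s = 1 / 2 by rewrite /s mulrC divfK// pnatr_eq0 -lt0n.
have := @circle_lift_bint R _ _ _ 1 (fun z => Re (c * z ^+ k)) isT (circle_lift_rotation s)
  (bmeas_cst _ _) (measurableC_Re hF.1).
rewrite mul1r => /(_ (bmeas_dalg hF).2) h.
have : \int[unif]_t (Re (c * (expi s * expi t) ^+ k) * 1) =
    \int[unif]_t (-1 * Re (c * expi t ^+ k)).
  congr Rintegral; apply/funext => t.
  rewrite exprMn -(expiMn s) ks.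
  by rewrite mulr1 mulN1r expi_half mulN1r mulrN; case: (_ * _).
rewrite h bintZ; last exact: (bmeas_dalg hF).
by move=> hh; lra.
Qed.

Lemma mean_value_poly p : \int[unif]_t Re p.[expi t] = Re p.[0].
Proof.
have main n : \int[unif]_t Re (\sum_(i < n) p`_i * expi t ^+ i) =
    Re (\sum_(i < n) p`_i * 0 ^+ i).
  elim: n => [|n ih].
    by under [X in Rintegral _ _ X]eq_fun do rewrite big_ord0; rewrite big_ord0 bint_cst.
  under [X in Rintegral _ _ X]eq_fun do rewrite big_ord_recr ReD.
  rewrite bintD; last 2 first.
    apply: (@bmeas_dalg (fun z => \sum_(i < n) p`_i * z ^+ i)).
    elim: n {ih} => [|n ih]; first by under eq_fun do rewrite big_ord0; exact: dalg_cst.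
    under eq_fun do rewrite big_ord_recr; apply: dalgD => //.
    by apply: dalgM; [exact: dalg_cst|apply: dalgX; exact: dalg_id].
    apply: (@bmeas_dalg (fun z => p`_n * z ^+ n)).
    by apply: dalgM; [exact: dalg_cst|apply: dalgX; exact: dalg_id].
  rewrite ih big_ord_recr ReD; congr (_ + _).
  case: n {ih} => [|n]; last by rewrite mean_value_monomial//= expr0n/= mulr0.
  by under [X in Rintegral _ _ X]eq_fun do rewrite expr0 mulr1; rewrite bint_cst expr0 mulr1.
rewrite horner_coef -main; congr Rintegral; apply/funext => t.
by rewrite horner_coef.
Qed.

Lemma dalg_mean_value F : dalg F -> \int[unif]_t Re (F (expi t)) = Re (F 0).
Proof.
move=> hF; apply/eqP; rewrite -subr_eq0 -normr_le0; apply/ler_addgt0Pl => e e0.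
have e2 : 0 < e / 2 by rewrite divr_gt0.
have [p hp] := hF.2 _ e2; rewrite addr0.
rewrite (_ : _ - _ = (\int[unif]_t Re (F (expi t)) - \int[unif]_t Re p.[expi t])
   - (Re (F 0) - Re p.[0])); last by rewrite mean_value_poly; ring.
rewrite -bintB; [|exact: bmeas_dalg|by apply: bmeas_dalg; exact: dalg_poly].
rewrite (le_trans (ler_normB _ _))// [leRHS](splitr e) lerD//.
  apply: bint_norm_le.
    by apply: bmeasB; apply: bmeas_dalg => //; exact: dalg_poly.
  by move=> t; rewrite -ReB (le_trans (Re_le_modulus _))// hp// expi_modulus.
by rewrite -ReB (le_trans (Re_le_modulus _))// hp// Normc.normc0.
Qed.

Lemma mobius_bprod a z : mobius a z = bprod 1 (fun=> a) 1 z.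
Proof. by rewrite /bprod big_ord1 mul1r. Qed.

Lemma mobius_le1 a z : modulus a < 1 -> modulus z <= 1 -> modulus (mobius a z) <= 1.
Proof. by move=> a1 z1; rewrite mobius_bprod bprod_le1// Normc.normc1. Qed.

Lemma mobius_circle a z : modulus a < 1 -> modulus z = 1 -> modulus (mobius a z) = 1.
Proof. by move=> a1 z1; rewrite mobius_bprod bprod_circle// Normc.normc1. Qed.

Lemma mobiusK a z : modulus a < 1 -> modulus z <= 1 -> mobius (- a) (mobius a z) = z.
Proof.
move=> a1 z1; rewrite /mobius (_ : (- a)^* = - a^*); last by rewrite -sub0r conjcB conjC0 sub0r.
have d1 := mobius_den a1 z1.
have d2 : 1 - a * a^* != 0 by rewrite [a * _]mulrC mobius_den// ltW.
move: d1 d2; set b := a^*; move=> d1 d2.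
rewrite opprK mulNr opprK.
have -> : (z - a) / (1 - b * z) + a = z * (1 - a * b) / (1 - b * z) by field.
have -> : 1 + b * ((z - a) / (1 - b * z)) = (1 - a * b) / (1 - b * z) by field.
by field; rewrite d1.
Qed.

Lemma mobiusNK a z : modulus a < 1 -> modulus z <= 1 -> mobius a (mobius (- a) z) = z.
Proof. by move=> a1 z1; rewrite -{1}(opprK a) mobiusK// normcN. Qed.

(** Mean value property for [F] composed with the automorphism that sends 0 to [w], transported by
    the lift of [mobius w], whose derivative is the Poisson kernel. *)
Lemma poisson_formula F w : dalg F -> modulus w < 1 ->
  \int[unif]_t (Re (F (expi t)) * poisson w (expi t)) = Re (F w).
Proof.
move=> hF w1; have w1' : modulus (- w) < 1 by rewrite normcN.
have hG : dalg (fun z => F (mobius (- w) z)).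
  apply: dalg_comp => //; first by apply: dalg_mobius => //; exact: dalg_id.
  by move=> z z1; rewrite mobius_le1.
have := @circle_lift_bint R _ _ _ 1 (fun z => Re (F (mobius (- w) z))) isT
  (mobius_circle_lift w1) (bmeas_poisson w1) (measurableC_Re hG.1) (bmeas_dalg hG).2.
rewrite mul1r (dalg_mean_value hG) => h.
have -> : F w = F (mobius (- w) 0).
  by rewrite /mobius mulr0 subr0 divr1 sub0r opprK.
rewrite -h; congr Rintegral; apply/funext => t.
by rewrite mobiusK// expi_modulus.
Qed.

Lemma poisson_int1 w : modulus w < 1 -> \int[unif]_t poisson w (expi t) = 1.
Proof.
move=> w1; rewrite -[RHS](poisson_formula (dalg_cst 1) w1).
by congr Rintegral; apply/funext => t; rewrite mul1r.
Qed.

Lemma ae_unif01 : {ae unif, forall t : measurableTypeR R, 0 <= t < 1}.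
Proof.
exists (~` `[0, 1[%classic); split => /=.
- by apply: measurableC.
- by rewrite /unif01 /mrestr setICl measure0.
- by move=> t /= h h2; apply: h; move: h2; rewrite in_itv.
Qed.

Lemma poissonE x z : modulus x < 1 -> modulus z = 1 ->
  poisson x z = Re ((1 + z^* * x) / (1 - z^* * x)).
Proof.
move=> x1 z1; have zz : z^* * z = 1 by rewrite mulrC mulJc z1 expr1n.
have e1 : modulus (z - x) ^+ 2 = modulus (1 - z^* * x) ^+ 2.
  by rewrite -zz -mulrBr Normc.normcM modulusJ z1 mul1r.
have d0 : modulus (1 - z^* * x) ^+ 2 != 0.
  rewrite -e1 expf_eq0/= modulus_eq0 subr_eq0; apply/eqP => zx.
  by move: x1; rewrite -zx z1 ltxx.
rewrite /poisson e1; have -> : modulus x ^+ 2 = modulus (z^* * x) ^+ 2.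
  by rewrite Normc.normcM modulusJ z1 mul1r.
move: (z^* * x) d0 => u; rewrite !modulus_sqr !ReB !ImB.
by case: u => a b /=; rewrite ?(sub0r,add0r) => d0; field.
Qed.

Lemma poisson_sym (r t s : R) : poisson (r%:C * expi s) (expi t) = poisson (r%:C * expi t) (expi s).
Proof.
rewrite /poisson !Normc.normcM !expi_modulus; congr (_ / _).
rewrite !sqr_modulusB !Normc.normcM !expi_modulus; congr (_ - 2 * _).
rewrite !(ReM, ImM) /=; ring.
Qed.

(** The second moment of the kernel about its centre. It tends to 0 with 1 - r, so the concentration
    needed in [poisson_approx] is a Chebyshev bound. *)
Lemma poisson_expi_sqr (r t : R) : 0 <= r < 1 ->
  \int[unif]_s (modulus (expi s - expi t) ^+ 2 * poisson (r%:C * expi t) (expi s)) = 2 * (1 - r).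
Proof.
move=> /andP[r0 r1].
have rt1 : modulus (r%:C * expi t) < 1.
  by rewrite Normc.normcM expi_modulus mulr1 modulus_real ger0_norm.
have hF : dalg (fun z => 2 - 2 * ((expi t)^* * z)).
  apply: dalgB; first exact: dalg_cst.
  by apply: dalgM; [exact: dalg_cst|apply: dalgM; [exact: dalg_cst|exact: dalg_id]].
transitivity (\int[unif]_s (Re (2 - 2 * ((expi t)^* * expi s)) * poisson (r%:C * expi t) (expi s))).
  congr Rintegral; apply/funext => s; congr (_ * _).
  rewrite sqr_modulusB !expi_modulus expr1n ReB !ReM /=; ring.
rewrite (poisson_formula hF rt1).
have -> : (expi t)^* * (r%:C * expi t) = r%:C.
  by rewrite mulrCA [_^* * _]mulrC mulJc expi_modulus expr1n mulr1.
by rewrite ReB ReM /=; ring.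
Qed.

Definition radius (n : nat) : R := 1 - n.+2%:R^-1.

Lemma radius_itv n : 0 <= radius n < 1.
Proof.
have h : 0 < (n.+2%:R : R)^-1 by rewrite invr_gt0.
rewrite /radius gtrBl h andbT subr_ge0 invf_le1 ?ler1n//.
Qed.

Lemma cvg_radius : radius @ \oo --> (1 : R).
Proof.
rewrite -[X in _ --> X]subr0; apply: cvgB; first exact: cvg_cst.
by have := @cvg_harmonic R; rewrite -cvg_shiftS.
Qed.

Lemma modulus_radius n t : modulus ((radius n)%:C * expi t) < 1.
Proof.
have /andP[r0 r1] := radius_itv n.
by rewrite Normc.normcM expi_modulus mulr1 modulus_real ger0_norm.
Qed.

Lemma cos_le_bound (d u : R) : 0 < d <= 1 / 2 -> d <= `|u| <= 1 - d ->
  cos (2 * pi * u) <= cos (2 * pi * d).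
Proof.
move=> /andP[d0 d2]; have pi0 := @pi_gt0 R.
have main v : d <= v <= 1 / 2 -> cos (2 * pi * v) <= cos (2 * pi * d).
  move=> /andP[dv v2]; rewrite leNgt ltr_cos ?in_itv/=.
  - by rewrite -leNgt ler_pM2l// mulr_gt0.
  - by apply/andP; split; nra.
  - by apply/andP; split; nra.
have -> : cos (2 * pi * u) = cos (2 * pi * `|u|).
  have [u0|u0] := ger0P u; first by [].
  by rewrite mulrN cosN.
move: `|u| => v /andP[dv v1]; have [v2|v2] := leP v (1 / 2).
  by rewrite main// dv.
have -> : cos (2 * pi * v) = cos (2 * pi * (1 - v)).
  rewrite -cosN; have -> : 2 * pi * (1 - v) = - (2 * pi * v) + pi *+ 2 by rewrite mulrBr mulr1 mulr2n; ring.
  by rewrite cosD2pi.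
by rewrite main//; apply/andP; split; lra.
Qed.

Lemma modulus_expiB (s t : R) : modulus (expi s - expi t) ^+ 2 = 2 - 2 * cos (2 * pi * (s - t)).
Proof.
rewrite sqr_modulusB !expi_modulus expr1n mulrBr cosB /expi /=; ring.
Qed.

Lemma poisson_approx (h : R -> R) (t : R) : bmeas (h : measurableTypeR R -> R) -> 0 < t < 1 ->
  {for t, continuous h} ->
  (fun n => \int[unif]_s (h s * poisson ((radius n)%:C * expi s) (expi t))) @ \oo --> h t.
Proof.
move=> bh /andP[t0 t1] ch; have [mh [M hM]] := bh.
have M0 : 0 <= M := le_trans (normr_ge0 _) (hM 0).
(* Outside [0, 1), which [unif01] does not charge, |t - s| says nothing about the distance on the
   circle, so [k] is cut to 0 there and the bound [kle] holds for every s. *)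
pose k (s : R) := if 0 <= s < 1 then h s - h t else 0.
have bk : bmeas (k : measurableTypeR R -> R).
  split.
    apply: measurable_fun_if => //.
      by apply: measurable_and; [exact: measurable_fun_ler|exact: measurable_fun_ltr].
    by apply: measurable_funTS; exact: measurable_funB.
  exists (M + M) => s; rewrite /k; case: ifP => _; last by rewrite normr0 addr_ge0.
  by rewrite (le_trans (ler_normB _ _))// lerD.
have bP n : bmeas (fun s : measurableTypeR R => poisson ((radius n)%:C * expi t) (expi s)).
  exact: bmeas_poisson (modulus_radius n t).
have kE n : \int[unif]_s (h s * poisson ((radius n)%:C * expi s) (expi t)) - h t =
    \int[unif]_s (k s * poisson ((radius n)%:C * expi t) (expi s)).
  have -> : h t = \int[unif]_s (h t * poisson ((radius n)%:C * expi t) (expi s)).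
    by rewrite bintZ// poisson_int1 ?mulr1//; exact: modulus_radius.
  under [X in Rintegral _ _ X - _]eq_fun do rewrite poisson_sym.
  rewrite -bintB; [|exact: bmeasM|by apply: bmeasM => //; exact: bmeas_cst].
  apply: bint_ae.
  - by apply: bmeasB; apply: bmeasM => //; exact: bmeas_cst.
  - exact: bmeasM.
  - by apply: filterS ae_unif01 => s hs; rewrite /k hs mulrBl.
apply/cvgrPdist_le => e e0; have e2 : 0 < e / 2 by rewrite divr_gt0.
have [d d0 hd] : exists2 d : R, 0 < d & forall s, `|t - s| < d -> `|h t - h s| <= e / 2.
  by have /cvgrPdist_le/(_ _ e2)[d /= d0 hd] := ch; exists d.
(* With this choice, s in [0, 1) and |t - s| >= d1 imply |t - s| <= 1 - d1, so s and t are far apart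
   on the circle as well. *)
pose d1 := Num.min d (Num.min t (1 - t)) / 2.
have d10 : 0 < d1 by rewrite divr_gt0// !lt_min d0 t0 subr_gt0.
have d1d : d1 < d.
  by rewrite /d1 ltr_pdivrMr// (@le_lt_trans _ _ d) ?ge_min ?lexx// ltr_pMr// ltr1n.
have [d1t d1t1] : d1 <= t /\ d1 <= 1 - t.
  have h2 : 2 * d1 = Num.min d (Num.min t (1 - t)) by rewrite /d1 mulrC divfK.
  have a1 : Num.min d (Num.min t (1 - t)) <= t by rewrite !ge_min lexx orbT.
  have a2 : Num.min d (Num.min t (1 - t)) <= 1 - t by rewrite !ge_min lexx !orbT.
  by split; lra.
have d12 : 0 < d1 <= 1 / 2 by rewrite d10/=; lra.
pose c : R := 2 - 2 * cos (2 * pi * d1).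
have c0 : 0 < c.
  rewrite subr_gt0 gtr_pMr// -[ltRHS](cos0 R) ltr_cos ?in_itv/=.
  - by rewrite mulr_gt0// mulr_gt0// pi_gt0.
  - by rewrite lexx pi_ge0.
  - have := pi_gt0 R; move: d12 => /andP[_ hh] hp; apply/andP; split; nra.
(* One bound replaces the splitting of the integral: near t continuity gives e / 2, and away from t
   the chord satisfies |expi s - expi t|^2 >= c. *)
have kle s : `|k s| <= e / 2 + (M + M) / c * modulus (expi s - expi t) ^+ 2.
  have MC : 0 <= (M + M) / c by apply: divr_ge0; [exact: addr_ge0|exact: ltW].
  have X0 := mulr_ge0 MC (sqr_ge0 (modulus (expi s - expi t))).
  rewrite /k; case: ifP => [/andP[s0 s1]|_]; last first.
    by rewrite normr0; apply: addr_ge0 => //; exact: ltW.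
  have [st|st] := ltP `|t - s| d1.
    by rewrite ler_wpDr// distrC hd// (lt_trans st).
  rewrite ler_wpDl ?(ltW e2)// (@le_trans _ _ (M + M))//.
    by rewrite (le_trans (ler_normB _ _))// lerD.
  rewrite mulrAC ler_pdivlMr// ler_wpM2l ?addr_ge0// modulus_expiB /c lerB// ler_pM2l//.
  apply: cos_le_bound => //; rewrite distrC st/= ler_norml; apply/andP; split; lra.
have hlim : (fun n => 2 * (1 - radius n) * ((M + M) / c)) @ \oo --> (0 : R).
  rewrite (_ : 0 = 2 * (1 - 1) * ((M + M) / c)); last by rewrite subrr mulr0 mul0r.
  by apply: cvgMl; apply: cvgMr; apply: cvgB; [exact: cvg_cst|exact: cvg_radius].
have /cvgrPdist_le/(_ _ e2) := hlim; apply: filterS => n.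
rewrite sub0r normrN => hn; rewrite distrC kE.
have bsq : bmeas (fun s : measurableTypeR R => modulus (expi s - expi t) ^+ 2).
  split.
    apply: measurable_funX; apply: measurable_modulus; apply: measurableC_sub => //.
    exact: measurable_expi.
  exists 4 => s; rewrite ger0_norm ?sqr_ge0// modulus_expiB.
  have := cos_geN1 (2 * pi * (s - t)); lra.
rewrite (le_trans (bint_normr _ _))//; first exact: bmeasM.
apply: (@le_trans _ _ (\int[unif]_s (e / 2 * poisson ((radius n)%:C * expi t) (expi s) +
    (M + M) / c * (modulus (expi s - expi t) ^+ 2 * poisson ((radius n)%:C * expi t) (expi s))))).
  apply: bint_le.
  - by apply: bmeas_norm; exact: bmeasM.
  - apply: bmeasD; first by apply: bmeasM => //; exact: bmeas_cst.
    by apply: bmeasM; [exact: bmeas_cst|exact: bmeasM].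
  - move=> s; have p0 : 0 <= poisson ((radius n)%:C * expi t) (expi s).
      by rewrite ltW// poisson_gt0 ?modulus_radius ?expi_modulus.
    rewrite normrM [X in _ * X <= _](ger0_norm p0) (le_trans (ler_wpM2r p0 (kle s)))//.
    by rewrite mulrDl -[X in _ + X <= _]mulrA.
rewrite bintD; last 2 first.
- by apply: bmeasM => //; exact: bmeas_cst.
- by apply: bmeasM; [exact: bmeas_cst|exact: bmeasM].
rewrite (bintZ _ _ (bP n)) (poisson_int1 (modulus_radius n t)) mulr1 (bintZ _ _ (bmeasM bsq (bP n))).
rewrite poisson_expi_sqr ?radius_itv// [leRHS](splitr e) lerD2l mulrC.
exact: le_trans (ler_norm _) hn.
Qed.

End disk_algebra.

(** * Harnack inequalities *)

Section harnack.
Variable R : realType.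
Local Notation unif := (@unif01 R).
Implicit Types (x y z w : R[i]).

(** For c = cosh^2 (d / 2) this is (cosh (d / 2) + sinh (d / 2))^2 = e^d, the sharp Harnack constant
    at hyperbolic distance d. *)
Definition harnack_cst (c : R) : R := (Num.sqrt c + Num.sqrt (c - 1)) ^+ 2.

Lemma harnack_cst_ge1 c : 1 <= c -> 1 <= harnack_cst c.
Proof.
move=> c1; rewrite -[leLHS](@expr1n R 2) ler_sqr ?nnegrE ?addr_ge0 ?sqrtr_ge0//.
by rewrite ler_wpDr ?sqrtr_ge0// -[leLHS]sqrtr1 ler_sqrt// (le_trans _ c1).
Qed.

Lemma poisson_harnack x y z : modulus x < 1 -> modulus y < 1 -> modulus z = 1 ->
  poisson x z <= harnack_cst (hyp x y) * poisson y z.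
Proof.
move=> x1 y1 z1; have dx := one_minus_sqr x1; have dy := one_minus_sqr y1.
have zz : z * z^* = 1 by rewrite mulJc z1 expr1n.
have zx0 : 0 < modulus (z - x).
  by rewrite modulus_gt0 subr_eq0; apply/eqP => zx; move: x1; rewrite -zx z1 ltxx.
have zy0 : 0 < modulus (z - y).
  by rewrite modulus_gt0 subr_eq0; apply/eqP => zx; move: y1; rewrite -zx z1 ltxx.
(* The triangle inequality in this decomposition bounds the left side by |z - x| times |1 - x conj
   y| + |x - y|; up to the common factor [s] these two moduli are cosh (d / 2) and sinh (d / 2). *)
have key : (z - y) * (1 - modulus x ^+ 2)%:C =
    (z - x) * (1 - x^* * y) + z * (z - x)^* * (x - y).
  rewrite RtoCB -mulJc conjcB [z * (_ - _)]mulrBr zz; ring.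
have le1 : modulus (z - y) * (1 - modulus x ^+ 2) <=
    modulus (z - x) * (modulus (1 - x * y^*) + modulus (x - y)).
  have -> : modulus (1 - x * y^*) = modulus (1 - x^* * y).
    by rewrite -modulusJ conjcB conjC1 conjcM conjCK.
  have -> : modulus (z - y) * (1 - modulus x ^+ 2) = modulus ((z - y) * (1 - modulus x ^+ 2)%:C).
    by rewrite Normc.normcM modulus_real ger0_norm// ltW.
  rewrite key (le_trans (le_normcD _ _))// !Normc.normcM modulusJ z1 mul1r mulrDr//.
set s := Num.sqrt ((1 - modulus x ^+ 2) * (1 - modulus y ^+ 2)).
have s0 : 0 < s by rewrite sqrtr_gt0 mulr_gt0.
have s2 : s ^+ 2 = (1 - modulus x ^+ 2) * (1 - modulus y ^+ 2).
  by rewrite sqr_sqrtr// ltW// mulr_gt0.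
have h1 : Num.sqrt (hyp x y) * s = modulus (1 - x * y^*).
  rewrite /s -sqrtrM ?(le_trans ler01 (hyp_ge1 x1 y1))// /hyp divfK ?gt_eqF ?mulr_gt0//.
  by rewrite sqrtr_sqr ger0_norm// modulus_ge0.
have h2 : Num.sqrt (hyp x y - 1) * s = modulus (x - y).
  rewrite /s -sqrtrM ?subr_ge0 ?hyp_ge1// hyp_sub1// divfK ?gt_eqF ?mulr_gt0//.
  by rewrite sqrtr_sqr ger0_norm// modulus_ge0.
have le2 : (modulus (z - y) * (1 - modulus x ^+ 2)) ^+ 2 <=
    modulus (z - x) ^+ 2 * harnack_cst (hyp x y) * s ^+ 2.
  rewrite /harnack_cst -!exprMn -mulrA [_ * s]mulrDl h1 h2.
  by rewrite ler_sqr ?nnegrE ?(mulr_ge0 (modulus_ge0 _) (ltW dx))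
    ?(mulr_ge0 (modulus_ge0 _) (addr_ge0 (modulus_ge0 _) (modulus_ge0 _))).
rewrite /poisson ler_pdivrMr ?exprn_gt0//.
rewrite [leRHS](_ : _ = harnack_cst (hyp x y) * (1 - modulus y ^+ 2) * modulus (z - x) ^+ 2 /
  modulus (z - y) ^+ 2); last by ring.
rewrite ler_pdivlMr ?exprn_gt0//.
rewrite -(ler_pM2r dx); move: le2; rewrite s2.
set m := harnack_cst _; move: dx dy (modulus (z - y)) (modulus (z - x)) => dx dy a b.
rewrite exprMn => h; apply: (le_trans (_ : _ <= a ^+ 2 * (1 - modulus x ^+ 2) ^+ 2)).
  by rewrite le_eqVlt; apply/orP; left; apply/eqP; ring.
by apply: (le_trans h); rewrite le_eqVlt; apply/orP; left; apply/eqP; ring.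
Qed.

Lemma poisson_dist x y z : modulus x < 1 -> modulus y < 1 -> modulus z = 1 ->
  `|poisson x z - poisson y z| <= (harnack_cst (hyp x y) - 1) * (poisson x z + poisson y z).
Proof.
move=> x1 y1 z1; have h1 := poisson_harnack x1 y1 z1.
have h2 := poisson_harnack y1 x1 z1; rewrite hypC in h2.
have k0 := harnack_cst_ge1 (hyp_ge1 x1 y1).
have p1 := poisson_gt0 x1 z1; have p2 := poisson_gt0 y1 z1.
by rewrite ler_norml; apply/andP; split; nra.
Qed.

(** Integrated Harnack inequality: Poisson measures of hyperbolically close points are close in
    total variation, even when the points approach the circle. *)
Lemma poisson_int_dist (F : R -> R) (M : R) x y : modulus x < 1 -> modulus y < 1 ->
    measurable_fun [set: measurableTypeR R] F -> (forall t, `|F t| <= M) ->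
  `|\int[unif]_t (F t * poisson x (expi t)) - \int[unif]_t (F t * poisson y (expi t))|
    <= 2 * M * (harnack_cst (hyp x y) - 1).
Proof.
move=> x1 y1 mF hM; have bF : bmeas (F : measurableTypeR R -> R) by split => //; exists M.
have M0 : 0 <= M := le_trans (normr_ge0 _) (hM 0).
have [bx by_] := (bmeas_poisson x1, bmeas_poisson y1).
rewrite -bintB; [|exact: bmeasM|exact: bmeasM].
apply: le_trans (bint_normr _ _) _; first by apply: bmeasB; exact: bmeasM.
set K := harnack_cst _ - 1; have K0 : 0 <= K by rewrite subr_ge0 harnack_cst_ge1// hyp_ge1.
apply: (@le_trans _ _ (\int[unif]_t (M * K * (poisson x (expi t) + poisson y (expi t))))).
  apply: bint_le.
  - by apply: bmeas_norm; apply: bmeasB; exact: bmeasM.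
  - by apply: bmeasM; [exact: bmeas_cst|exact: bmeasD].
  - move=> t; rewrite -mulrBr normrM -mulrA ler_pM//.
    by apply: poisson_dist => //; exact: expi_modulus.
rewrite bintZ; last exact: bmeasD.
by rewrite bintD// !poisson_int1//; lra.
Qed.

Lemma cvg_harnack_cst (c : nat -> R) : c @ \oo --> (1 : R) ->
  (fun n => harnack_cst (c n) - 1) @ \oo --> (0 : R).
Proof.
move=> c1; have -> : (0 : R) = harnack_cst 1 - 1.
  by rewrite /harnack_cst sqrtr1 subrr sqrtr0 addr0 expr1n subrr.
apply: cvgB; last exact: cvg_cst.
have h : (fun n => Num.sqrt (c n) + Num.sqrt (c n - 1)) @ \oo -->
    Num.sqrt 1 + Num.sqrt (1 - 1 : R).
  apply: cvgD; first by apply: (continuous_cvg _ _ c1); exact: sqrt_continuous.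
  have c2 : (fun n => c n - 1) @ \oo --> (1 - 1 : R) by apply: cvgB => //; exact: cvg_cst.
  by apply: (continuous_cvg _ _ c2); exact: sqrt_continuous.
rewrite (_ : (fun n => _) = (fun n => (Num.sqrt (c n) + Num.sqrt (c n - 1)) *
  (Num.sqrt (c n) + Num.sqrt (c n - 1)))); last by apply/funext => n; rewrite /harnack_cst expr2.
by rewrite [harnack_cst 1]expr2; exact: (cvgM h h).
Qed.

(* Boundary case of the Schwarz-Pick lemma. *)
Lemma bprod_deriv_ge rho a n x z : (0 < n)%N -> modulus rho = 1 ->
    (forall i, (i < n)%N -> modulus (a i) < 1) -> modulus x < 1 -> modulus z = 1 ->
  poisson x z <= bprod_deriv a n z * poisson (bprod rho a n x) (bprod rho a n z).
Proof.
move=> n0 rho1 an x1 z1; have Bx1 := bprod_lt1 n0 rho1 an x1.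
have Bz1 := bprod_circle rho1 an z1.
have keyp (u v : R[i]) : modulus u < 1 -> modulus v = 1 -> modulus (v - u) = modulus (1 - v * u^*).
  move=> u1 v1; have vv : v * v^* = 1 by rewrite mulJc v1 expr1n.
  by rewrite -vv -mulrBr -conjcB Normc.normcM v1 mul1r modulusJ.
have gt0 (u v : R[i]) : modulus u < 1 -> modulus v = 1 -> 0 < modulus (v - u) ^+ 2.
  move=> u1 v1; rewrite exprn_gt0// modulus_gt0 subr_eq0.
  by apply/eqP => zx; move: u1; rewrite -zx v1 ltxx.
(* On the circle the Moebius factors have modulus 1, so the squared modulus of the i-th
   Takenaka-Malmquist function is the Poisson kernel at [a i]. *)
have hD : bprod_deriv a n z = \sum_(i < n) modulus (takenaka a i z) ^+ 2.
  apply: eq_bigr => i _; have ai := an i (ltn_ord i).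
  rewrite /takenaka Normc.normcM exprMn modulus_prod big1 ?expr1n ?mul1r; last first.
    by move=> j _; rewrite mobius_circle// an// (ltn_trans (ltn_ord j)).
  rewrite Normc.normcM Normc.normcV modulus_real exprMn real_normK ?num_real//.
  rewrite sqr_sqrtr ?(ltW (one_minus_sqr ai))// exprVn /poisson keyp//.
  by rewrite [(a i)^* * z]mulrC.
have z1' : modulus z <= 1 by rewrite z1.
have h1 := bprod_kernel rho1 an z1' (ltW x1).
have h2 := bprod_modulus rho1 an (ltW x1).
have h3 := @cauchy_schwarz _ n (fun i => takenaka a i z) (fun i => takenaka a i x).
move: h1 h2 h3; rewrite -hD.
set S := \sum_(i < n) modulus (takenaka a i x) ^+ 2.
set C := \sum_(i < n) _ * _ => h1 h2 h3.
rewrite /poisson mulrA ler_pdivlMr ?gt0// mulrAC ler_pdivrMr ?gt0//.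
rewrite (keyp _ _ x1 z1) (keyp _ _ Bx1 Bz1) h1 h2 Normc.normcM exprMn.
have dx := one_minus_sqr x1; have A0 := sqr_ge0 (modulus (1 - z * x^*)).
rewrite (_ : _ * _ * modulus (1 - z * x^*) ^+ 2 =
  (1 - modulus x ^+ 2) * (modulus (1 - z * x^*) ^+ 2 * (bprod_deriv a n z * S))); last by ring.
by apply: (ler_wpM2l (ltW dx)); exact: ler_wpM2l.
Qed.

End harnack.

(** * Stationary sequences *)

Section stationarity.
Context d (X : measurableType d) (R : realType) (P : probability X R).
Variable s : X -> X.
Hypothesis ms : measurable_fun [set: X] s.
Hypothesis mp : measure_preserving P s.

Lemma measurable_iter n : measurable_fun [set: X] (iter n s).
Proof.
elim: n => [|n ih]; first exact: measurable_id.
exact: measurableT_comp ms ih.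
Qed.

Lemma measure_preserving_iter n : measure_preserving P (iter n s).
Proof.
elim: n => [//|n ih] A mA; have msA : measurable (s @^-1` A).
  by rewrite -[X in measurable X]setTI; exact: ms.
by rewrite -(mp mA); exact: (ih _ msA).
Qed.

Lemma ge0_integral_preserving (f : X -> \bar R) : measurable_fun [set: X] f ->
  (forall x, 0 <= f x)%E -> (\int[P]_x f (s x) = \int[P]_x f x)%E.
Proof.
move=> mf f0; have e : (\int[pushforward P s]_x f x = \int[P]_x f x)%E.
  by apply: eq_measure_integral => A mA _; exact: mp.
by rewrite -e (ge0_integral_pushforward ms) ?preimage_setT.
Qed.

Lemma ae_preserving (A : set X) : {ae P, forall x, A x} -> {ae P, forall x, A (s x)}.
Proof.
move=> [N [mN PN AN]]; exists (s @^-1` N); split.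
- by rewrite -[X in measurable X]setTI; exact: ms.
- by have := mp mN; rewrite /pushforward PN.
- by move=> x Ax; apply: AN.
Qed.

End stationarity.

Lemma ae_all_nat d (X : measurableType d) (R : realType) (P : {measure set X -> \bar R})
    (A : nat -> set X) : (forall n, {ae P, forall x, A n x}) -> {ae P, forall x, forall n, A n x}.
Proof.
move=> h; have /= := @ae_foralln _ _ _ _ _ h.
by apply.
Qed.

Section stationarity_iter.
Context d (X : measurableType d) (R : realType) (P : probability X R).
Variable s : X -> X.
Hypothesis ms : measurable_fun [set: X] s.
Hypothesis mp : measure_preserving P s.

Lemma ae_preserving_iter (A : set X) : {ae P, forall x, A x} ->
  {ae P, forall x, forall n, A (iter n s x)}.
Proof.
move=> hA; apply: ae_all_nat => n.
by apply: (ae_preserving (measurable_iter ms n) (measure_preserving_iter ms mp n)).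
Qed.

Lemma ge0_integral_iter n (f : X -> \bar R) : measurable_fun [set: X] f ->
  (forall x, 0 <= f x)%E -> (\int[P]_x f (iter n s x) = \int[P]_x f x)%E.
Proof.
exact: (ge0_integral_preserving (measurable_iter ms n) (measure_preserving_iter ms mp n)).
Qed.

Lemma bint_iter n (f : X -> R) : bmeas f -> \int[P]_x f (iter n s x) = \int[P]_x f x.
Proof.
move=> bf; have [mf [M hM]] := bf.
have M0 x : 0 <= f x + M by have := hM x; move/ler_normlP => []; lra.
have bfn : bmeas (fun x => f (iter n s x)) by apply: bmeas_comp bf; exact: measurable_iter.
have h : \int[P]_x (f (iter n s x) + M) = \int[P]_x (f x + M).
  apply/EFin_inj; rewrite -!bint_EFin; last 2 first.
    by apply: bmeasD => //; exact: bmeas_cst.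
    by apply: bmeasD => //; exact: bmeas_cst.
  apply: (ge0_integral_iter n (f := fun x => (f x + M)%:E)).
    by apply/measurable_EFinP; exact: measurable_funD.
  by move=> x; rewrite lee_fin.
by move: h; rewrite !bintD//; [exact: addIr|exact: bmeas_cst|exact: bmeas_cst].
Qed.

Lemma bint_eq0 (f : X -> R) : bmeas f -> (forall x, 0 <= f x) -> \int[P]_x f x = 0 ->
  {ae P, forall x, f x = 0}.
Proof.
move=> bf f0 h; have := bint_EFin P bf; rewrite h => h'.
have : (\int[P]_x `|(f x)%:E| = 0)%E.
  by rewrite -[RHS]h'; apply: eq_integral => x _; rewrite gee0_abs ?lee_fin.
move/(ae_eq_integral_abs P measurableT (proj2 (measurable_EFinP _ _) bf.1)).
by apply: filterS => x /(_ I) [].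
Qed.

(** By stationarity the mean of f along the orbit does not depend on n, while bounded convergence
    sends it to 0. This converts forward asymptotics into exact identities on almost every fibre. *)
Lemma stationary_cvg0 (f : X -> R) : bmeas f -> (forall x, 0 <= f x) ->
  {ae P, forall x, (fun n => f (iter n s x)) @ \oo --> (0 : R)} ->
  {ae P, forall x, f x = 0}.
Proof.
move=> bf f0 hf; apply: bint_eq0 => //.
have [mf [M hM]] := bf.
have := @bounded_convergence _ _ _ P (fun n x => f (iter n s x)) (fun=> 0) M
  (fun n => measurableT_comp mf (measurable_iter ms n)) (measurable_cst _)
  (fun n x => hM _) hf.
rewrite bint_cst => h.
have h2 : (fun n => \int[P]_x f (iter n s x)) @ \oo --> \int[P]_x f x.
  rewrite (_ : (fun n => _) = fun=> \int[P]_x f x); first exact: cvg_cst.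
  by apply/funext => n; rewrite bint_iter.
have <- := cvg_lim (@Rhausdorff R) h2; exact: (cvg_lim (@Rhausdorff R) h).
Qed.

Hypothesis erg : ergodic P s.

(** The event of infinitely many visits is invariant and at least as likely as [G], hence almost
    sure by ergodicity. *)
Lemma recurrence (G : set X) : measurable G -> (0 < P G)%E ->
  {ae P, forall x, forall m, exists2 n, (m <= n)%N & G (iter n s x)}.
Proof.
move=> mG PG; pose E m := \bigcup_n (iter (m + n) s @^-1` G).
have mE m : measurable (E m).
  apply: bigcup_measurable => n _; rewrite -[X in measurable X]setTI.
  exact: (measurable_iter ms).
pose L := \bigcap_m E m; have mL : measurable L by exact: bigcap_measurableType.
have EP m x : E m x <-> exists2 n, (m <= n)%N & G (iter n s x).
  split=> [[n _ h]|[n mn h]]; first by exists (m + n)%N => //; exact: leq_addr.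
  by exists (n - m)%N => //=; rewrite subnKC.
have LE : s @^-1` L = L.
  apply/seteqP; split=> x /= hx m _; apply/EP.
    have /EP[n mn h] := hx m I; exists n.+1; first exact: leqW.
    by rewrite iterSr.
  have /EP[n mn h] := hx m.+1 I; exists n.-1; first by rewrite -ltnS (ltn_predK mn).
  by rewrite -iterSr (ltn_predK mn).
have Pm m : (P G <= P (E m))%E.
  rewrite -(measure_preserving_iter ms mp m mG) /pushforward.
  apply: le_measure; rewrite ?inE//.
    by rewrite -[X in measurable X]setTI; exact: (measurable_iter ms).
  by move=> x h; exists 0%N => //=; rewrite addn0.
have PL : (P G <= P L)%E.
  have hc : (P \o E) x @[x --> \oo] --> P L.
    apply: nonincreasing_cvg_mu => //.
      by rewrite (le_lt_trans (probability_le1 _ _))// ltry.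
    move=> n m nm; apply/subsetPset => x /EP[k mk h]; apply/EP; exists k => //.
    exact: leq_trans mk.
  rewrite -(cvg_lim _ hc)//; apply: lime_ge; first by apply/cvg_ex; exists (P L).
  exact: nearW.
have PL1 : P L = 1%E.
  by have [h|//] := erg mL LE; move: PL; rewrite h leNgt PG.
have : {ae P, forall x, L x}.
  exists (~` L); split => //; first exact: measurableC.
  by rewrite probability_setC// PL1 subee.
by apply: filterS => x hx m; apply/EP; exact: hx.
Qed.

End stationarity_iter.

(** * Iterates of the cocycle *)

Section cocycle_iterates.
Context d (Omega : measurableType d) (R : realType).
Variables (T : blaschke_cocycle Omega R) (sigma : Omega -> Omega).
Implicit Types (w : Omega) (z : R[i]).
Local Notation It := (cocycle_iter sigma T).

Lemma blaschke_le1 w z : modulus z <= 1 -> modulus (T w z) <= 1.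
Proof.
move=> z1; rewrite blaschkeE; apply: bprod_le1 => // [|i]; last exact: zeros_disk.
exact: rotation_circle.
Qed.

Lemma blaschke_lt1 w z : modulus z < 1 -> modulus (T w z) < 1.
Proof.
move=> z1; rewrite blaschkeE; apply: bprod_lt1 => // [||i]; first exact: degree_gt0.
  exact: rotation_circle.
exact: zeros_disk.
Qed.

Lemma blaschke_circle w z : modulus z = 1 -> modulus (T w z) = 1.
Proof.
move=> z1; rewrite blaschkeE; apply: bprod_circle => // [|i]; last exact: zeros_disk.
exact: rotation_circle.
Qed.

Lemma iter_le1 n w z : modulus z <= 1 -> modulus (It n w z) <= 1.
Proof. by move=> z1; elim: n => //= n ih; exact: blaschke_le1. Qed.

Lemma iter_lt1 n w z : modulus z < 1 -> modulus (It n w z) < 1.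
Proof. by move=> z1; elim: n => //= n ih; exact: blaschke_lt1. Qed.

Lemma iter_circle n w z : modulus z = 1 -> modulus (It n w z) = 1.
Proof. by move=> z1; elim: n => //= n ih; exact: blaschke_circle. Qed.

Lemma dalg_iter n w : dalg (It n w).
Proof.
elim: n => [|n ih] /=; first exact: dalg_id.
have -> : (fun z => T (iter n sigma w) (It n w z)) = (fun z => bprod
    (rotation T (iter n sigma w)) (zeros T (iter n sigma w)) (degree T (iter n sigma w)) (It n w z)).
  by apply/funext => z; rewrite blaschkeE.
apply: dalg_bprod => //; last by move=> z; exact: iter_le1.
by move=> i; exact: zeros_disk.
Qed.

Lemma cocycle_iterD n m w z : It (n + m) w z = It m (iter n sigma w) (It n w z).
Proof.
elim: m => [|m ih]; first by rewrite addn0.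
by rewrite addnS /= ih -iterD addnC.
Qed.

Lemma hyp_iter_le n w z z' : modulus z < 1 -> modulus z' < 1 ->
  hyp (It n.+1 w z) (It n.+1 w z') <= hyp (It n w z) (It n w z').
Proof.
move=> z1 z1' /=; rewrite !blaschkeE; apply: bprod_hyp_le; try exact: iter_lt1.
- exact: rotation_circle.
- by move=> i; exact: zeros_disk.
- exact: degree_gt0.
Qed.

(** On the circle this is |T_w'| ([blaschke_derivE]); elsewhere it is only a measurable nonnegative
    extension. *)
Definition deriv_modulus w z : R := bprod_deriv (zeros T w) (degree T w) z.

Lemma deriv_modulus_gt0 w z : modulus z = 1 -> 0 < deriv_modulus w z.
Proof.
move=> z1; rewrite /deriv_modulus /bprod_deriv; case: (degree T w) (degree_gt0 T w) (@zeros_disk _ _ _ T w) => // n _ zd.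
rewrite big_ord_recl ltr_wpDr//; last by apply: poisson_gt0 => //; exact: zd.
by apply: sumr_ge0 => i _; apply/ltW/poisson_gt0 => //; exact: zd.
Qed.

Lemma blaschke_derivE w z : modulus z = 1 -> modulus (derive1 (T w) z) = deriv_modulus w z.
Proof.
move=> z1; rewrite (_ : blaschke_map T w = bprod (rotation T w) (zeros T w) (degree T w)); last first.
  by apply/funext => u; rewrite blaschkeE.
apply: bprod_deriveE => //; first exact: rotation_circle.
by move=> i; exact: zeros_disk.
Qed.

Lemma blaschke_lift w :
  exists g, circle_lift (T w) g (fun t => deriv_modulus w (expi t)) (degree T w).
Proof.
rewrite (_ : blaschke_map T w = bprod (rotation T w) (zeros T w) (degree T w)); last first.
  by apply/funext => u; rewrite blaschkeE.
apply: bprod_circle_lift; first exact: degree_gt0.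
  exact: rotation_circle.
by move=> i; exact: zeros_disk.
Qed.

Definition iter_deriv n w z : R := \prod_(i < n) deriv_modulus (iter i sigma w) (It i w z).

Definition iter_degree n w : nat := \prod_(i < n) degree T (iter i sigma w).

Lemma iter_degree_gt0 n w : (0 < iter_degree n w)%N.
Proof. by rewrite prodn_gt0// => i; exact: degree_gt0. Qed.

Lemma iter_deriv_gt0 n w z : modulus z = 1 -> 0 < iter_deriv n w z.
Proof. by move=> z1; apply: prodr_gt0 => i _; apply: deriv_modulus_gt0; exact: iter_circle. Qed.

Lemma ln_iter_deriv n w z : modulus z = 1 ->
  ln (iter_deriv n w z) = \sum_(i < n) ln (deriv_modulus (iter i sigma w) (It i w z)).
Proof.
move=> z1; elim: n => [|n ih]; first by rewrite /iter_deriv !big_ord0 ln1.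
rewrite big_ord_recr -ih /iter_deriv big_ord_recr lnM// posrE.
  exact: iter_deriv_gt0.
by apply: deriv_modulus_gt0; exact: iter_circle.
Qed.

Lemma iter_lift n w :
  exists g, circle_lift (It n w) g (fun t => iter_deriv n w (expi t)) (iter_degree n w).
Proof.
elim: n => [|n [g hg]].
  exists id; rewrite /iter_degree big_ord0.
  have -> : (fun t => iter_deriv 0 w (expi t)) = fun=> 1.
    by apply/funext => t; rewrite /iter_deriv big_ord0.
  by have -> : It 0 w = id by []; exact: circle_lift_id.
have [h hh] := blaschke_lift (iter n sigma w); exists (h \o g).
rewrite /iter_degree big_ord_recr/=.
rewrite (_ : (fun t => _) = (fun t => deriv_modulus (iter n sigma w) (expi (g t)) * iter_deriv n w (expi t))).
  exact: circle_lift_comp hg hh.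
by apply/funext => t; rewrite /iter_deriv big_ord_recr/= -(lift_expi hg) mulrC.
Qed.

Section measurability.
Hypothesis ms : measurable_fun [set: Omega] sigma.
Context d' (X : measurableType d') (w : X -> Omega) (z : X -> R[i]).
Hypothesis mw : measurable_fun [set: X] w.
Hypothesis mz : measurable_fun [set: X] z.

Lemma measurable_iter_comp n : measurable_fun [set: X] (fun x => iter n sigma (w x)).
Proof. by apply: (measurableT_comp (measurable_iter ms n) mw). Qed.

Lemma measurable_cocycle_iter n : measurable_fun [set: X] (fun x => It n (w x) (z x)).
Proof.
by elim: n => [//|n ih] /=; apply: measurable_blaschke => //; exact: measurable_iter_comp.
Qed.

End measurability.

Lemma measurable_poisson d' (X : measurableType d') (D : set X) (x z : X -> R[i]) :
  measurable_fun D x -> measurable_fun D z ->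
  measurable_fun D (fun u => poisson (x u) (z u)).
Proof.
move=> mx mz; apply: measurable_funM.
  by apply: measurable_funB => //; apply: measurable_funX; exact: measurable_modulus.
by apply: measurable_funV; apply: measurable_funX; apply: measurable_modulus; exact: measurableC_sub.
Qed.

Lemma measurable_deriv_modulus d' (X : measurableType d') (w : X -> Omega) (z : X -> R[i]) :
  measurable_fun [set: X] w -> measurable_fun [set: X] z ->
  measurable_fun [set: X] (fun x => deriv_modulus (w x) (z x)).
Proof.
move=> mw mz.
have mDj j : measurable (w @^-1` [set v | degree T v = j]).
  by rewrite -[X in measurable X]setTI; apply: mw => //; exact: measurable_degree_set.
have -> : [set: X] = \bigcup_j (w @^-1` [set v | degree T v = j]).
  by apply/seteqP; split => // x _; exists (degree T (w x)).
apply/measurable_fun_bigcup => // j.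
apply: (eq_measurable_fun (fun x => \sum_(i < j) poisson (zeros T (w x) i) (z x))).
  by move=> x; rewrite inE /= /deriv_modulus /bprod_deriv => ->.
apply: measurable_sum => i; apply: measurable_poisson; last exact: measurable_funTS.
apply: (@measurable_comp _ _ _ _ _ _ [set v | degree T v = j] (fun v => zeros T v i) _ w).
- exact: measurable_degree_set.
- by move=> _ [x hx <-].
- have := @measurable_zero_on _ _ _ T j i (ltn_ord i); exact.
- exact: measurable_funTS.
Qed.

Lemma measurable_iter_deriv d' (X : measurableType d') (w : X -> Omega) (z : X -> R[i]) n :
  measurable_fun [set: Omega] sigma ->
  measurable_fun [set: X] w -> measurable_fun [set: X] z ->
  measurable_fun [set: X] (fun x => iter_deriv n (w x) (z x)).
Proof.
move=> ms mw mz; rewrite /iter_deriv; elim: n => [|n ih].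
  by under eq_fun do rewrite big_ord0; exact: measurable_cst.
under eq_fun do rewrite big_ord_recr/=; apply: measurable_funM => //.
by apply: measurable_deriv_modulus; [exact: measurable_iter_comp|exact: measurable_cocycle_iter].
Qed.

End cocycle_iterates.

(** * Densities on the circle *)

Lemma integrable_realD d (X : measurableType d) (R : realType) (m : {measure set X -> \bar R})
    (f g : X -> R) : m.-integrable setT (EFin \o f) -> m.-integrable setT (EFin \o g) ->
  m.-integrable setT (EFin \o (fun x => f x + g x)).
Proof.
move=> hf hg; rewrite (_ : _ \o _ = (fun x => (EFin \o f) x + (EFin \o g) x)%E).
  exact: integrableD.
by apply/funext => x; rewrite /= EFinD.
Qed.

Lemma integrable_realB d (X : measurableType d) (R : realType) (m : {measure set X -> \bar R})
    (f g : X -> R) : m.-integrable setT (EFin \o f) -> m.-integrable setT (EFin \o g) ->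
  m.-integrable setT (EFin \o (fun x => f x - g x)).
Proof.
move=> hf hg; rewrite (_ : _ \o _ = (fun x => (EFin \o f) x - (EFin \o g) x)%E).
  exact: integrableB.
by apply/funext => x; rewrite /= EFinB.
Qed.

Section tail_integral.
Context d (X : measurableType d) (R : realType) (P : probability X R) (f : X -> R).
Hypothesis mf : measurable_fun [set: X] f.
Hypothesis f0 : forall x, 0 <= f x.
Hypothesis intf : P.-integrable [set: X] (EFin \o f).

Let r (n : nat) (x : X) : R := Num.max (f x - n%:R) 0.

Lemma tail_integral : (forall n, P.-integrable [set: X] (EFin \o r n)) /\
  (fun n => \int[P]_x r n x) @ \oo --> (0 : R).
Proof.
have mr n : measurable_fun [set: X] (r n).
  by apply: measurable_maxr => //; exact: measurable_funB.
have r0 n t : 0 <= r n t by rewrite le_max lexx orbT.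
have rf n t : r n t <= f t by rewrite ge_max f0 andbT gerBl.
split=> [n|].
  apply: (@le_integrable _ _ _ _ _ _ _ (EFin \o f)) => //; first exact/measurable_EFinP.
  by move=> t _; rewrite lee_fin !ger0_norm.
have h1 : {ae P, forall t, [set: X] t -> (fun n => (r n t)%:E) @ \oo --> 0%:E}.
  apply: aeW => t _; apply: cvg_EFin; first exact: nearW.
  have [k hk] : exists k : nat, f t <= k%:R by exists (Num.truncn (f t)).+1; exact/ltW/truncnS_gt.
  apply: (cvg_near_cst); exists k => // n /= kn.
  apply/max_idPr; rewrite subr_le0 (le_trans hk)// ler_nat//.
have h2 : {ae P, forall t n, [set: X] t -> (`|(r n t)%:E| <= (f t)%:E)%E}.
  by apply: aeW => t n _; rewrite lee_fin ger0_norm.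
have [_ _ h] := @dominated_convergence _ _ _ P setT measurableT
  (fun n t => (r n t)%:E) (fun=> 0%:E) (EFin \o f)
  (fun n => proj2 (measurable_EFinP _ _) (mr n)) (@measurable_cst _ _ _ _ _ _) h1 intf h2.
apply: (@fine_cvg _ _ _ _ (fun n => \int[P]_t (r n t)%:E)%E).
by move: h; rewrite integral0.
Qed.

End tail_integral.

Section circle_density.
Variable R : realType.
Local Notation unif := (@unif01 R).
Local Notation mR := (measurableTypeR R).

Lemma poisson_le (x z : R[i]) : modulus x < 1 -> modulus z = 1 ->
  poisson x z <= (1 - modulus x ^+ 2) / (1 - modulus x) ^+ 2.
Proof.
move=> x1 z1; have d0 : 0 < 1 - modulus x by rewrite subr_gt0.
have h : 1 - modulus x <= modulus (z - x) by rewrite -z1; exact: lerB_modulus.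
rewrite /poisson ler_wpM2l ?(ltW (one_minus_sqr _))// lef_pV2 ?posrE ?exprn_gt0//.
  by rewrite ler_sqr ?nnegrE ?modulus_ge0// ltW.
exact: lt_le_trans h.
Qed.

Lemma density_exists (nu : {finite_measure set R[i] -> \bar R}) : nu `<< @circle_measure R ->
  exists f : mR -> R, [/\ measurable_fun [set: mR] f, forall t, 0 <= f t &
    forall F : R[i] -> \bar R, measurable_fun [set: R[i]] F -> (forall z, 0 <= F z)%E ->
      (\int[nu]_z F z = \int[unif]_t (F (expi t) * (f t)%:E))%E].
Proof.
move=> dom; pose g := Radon_Nikodym_SigmaFinite.f nu (@circle_measure R).
have mg : measurable_fun [set: R[i]] g.
  exact: measurable_int (Radon_Nikodym_SigmaFinite.f_integrable dom).
have g0 := Radon_Nikodym_SigmaFinite.f_ge0 dom.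
have gfin := Radon_Nikodym_SigmaFinite.f_fin_num dom.
exists (fun t => fine (g (expi t))); split.
- apply: (measurableT_comp (@fine_measurable R _ measurableT)).
  by apply: (measurableT_comp mg); exact: measurable_expi.
- by move=> t; rewrite fine_ge0.
- move=> F mF F0; rewrite -(Radon_Nikodym_SigmaFinite.change_of_variables dom F0 measurableT mF).
  pose m : {measure set mR -> \bar R} := unif.
  transitivity (\int[pushforward m (@expi R)]_x (F x * g x))%E; first by [].
  rewrite (@ge0_integral_pushforward _ _ mR _ _ _ (@measurable_expi R)) ?preimage_setT//.
  + by apply: eq_integral => t _ /=; rewrite fineK.
  + exact: emeasurable_funM.
  + by move=> y _; rewrite mule_ge0.
Qed.

Variable f : mR -> R.
Hypothesis mf : measurable_fun [set: mR] f.
Hypothesis f0 : forall t, 0 <= f t.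
Hypothesis f1 : (\int[unif]_t (f t)%:E = 1)%E.

Let intf : unif.-integrable [set: mR] (EFin \o f).
Proof.
apply/integrableP; split; first exact/measurable_EFinP.
under eq_integral do rewrite /= ger0_norm//.
by rewrite f1 ltry.
Qed.

Lemma density_integrable (G : mR -> R) : bmeas G ->
  unif.-integrable [set: mR] (EFin \o (fun t => G t * f t)).
Proof.
move=> [mG [M hM]]; apply: (@le_integrable _ _ _ _ _ _ _ (EFin \o (fun t => M * f t))) => //.
- by apply/measurable_EFinP; exact: measurable_funM.
- move=> t _ /=; rewrite lee_fin !normrM (ger0_norm (f0 t)) ler_wpM2r//.
  by rewrite (le_trans (hM t))// ler_norm.
- rewrite (_ : _ \o _ = (fun t => M%:E * (EFin \o f) t)%E); first exact: integrableZl.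
  by apply/funext => t; rewrite /= EFinM.
Qed.

Lemma density_int1 : \int[unif]_t f t = 1.
Proof. by rewrite /Rintegral f1. Qed.

(** Cut [f] at a level beyond which its excess has mean at most [e]; the level is the constant [C],
    uniform over the test functions. *)
Lemma density_uniform_integrable (e : R) : 0 < e -> exists2 C : R, 0 < C &
  forall G : mR -> R, bmeas G -> (forall t, 0 <= G t <= 1) ->
    \int[unif]_t (G t * f t) <= C * \int[unif]_t G t + e.
Proof.
move=> e0; pose r (n : nat) (t : mR) : R := Num.max (f t - n%:R) 0.
have [ir0 cr] := tail_integral mf f0 intf.
have ir n : unif.-integrable [set: mR] (EFin \o r n) := ir0 n.
have r0 n t : 0 <= r n t by rewrite le_max lexx orbT.
have /cvgrPdist_le/(_ _ e0)[k _ /(_ k.+1 (leqnSn k))] := cr.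
rewrite /= sub0r normrN => /(le_trans (ler_norm _)) hk.
exists k.+1%:R => // G bG G01; have [mG _] := bG.
apply: (@le_trans _ _ (\int[unif]_t (k.+1%:R * G t + r k.+1 t))).
  apply: le_Rintegral => //; first exact: density_integrable.
    apply: integrable_realD => //.
    by apply: bmeas_integrable; apply: bmeasM => //; exact: bmeas_cst.
  move=> t _; have /andP[G0 G1] := G01 t; have := r0 k.+1 t.
  have : f t - k.+1%:R <= r k.+1 t by rewrite le_max lexx.
  by move=> h1 h2; nra.
rewrite RintegralD//; last first.
  by apply: bmeas_integrable; apply: bmeasM => //; exact: bmeas_cst.
by rewrite bintZ// lerD2l.
Qed.

(** Approximation of [f] in L^1 by a continuous function, expressed through bounded test functions
    [G] since only such pairings occur. Cutting [h] to 0 outside [0, 1) costs the continuity at the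
    endpoints. *)
Lemma density_continuous (e : R) : 0 < e -> exists h : R -> R,
  [/\ bmeas (h : mR -> R), forall t, 0 < t < 1 -> {for t, continuous h} &
   forall G : mR -> R, bmeas G -> (forall t, `|G t| <= 1) ->
    `|\int[unif]_t (G t * f t) - \int[unif]_t (G t * h t)| <= e].
Proof.
move=> e0; pose I := `[0, 1[%classic : set R.
have mI : measurable (I : set mR) by exact: measurable_itv.
have I1 : (lebesgue_measure I < +oo)%E by rewrite lebesgue_measure_itv /= lte_fin ltr01 ltry.
have intI : lebesgue_measure.-integrable I (EFin \o f).
  apply/integrableP; split; first exact/measurable_EFinP/measurable_funTS.
  under eq_integral do rewrite /= ger0_norm//.
  rewrite -ge0_integral_unif01 ?f1 ?ltry//.
  exact/measurable_EFinP.
have [g_ [cg ig hg]] := approximation_continuous_integrable mI I1 intI.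
have [n hn] : exists n, (\int[lebesgue_measure]_(z in I) `|(f z - g_ n z)%:E| <= e%:E)%E.
  have /fine_cvgP[hfin /cvgrPdist_le/(_ _ e0)] := hg.
  move=> [k1 _ h1]; case: hfin => k2 _ h2; exists (maxn k1 k2).
  have := h1 (maxn k1 k2) (leq_maxl _ _); rewrite /= sub0r normrN => h.
  rewrite -(fineK (h2 (maxn k1 k2) (leq_maxr _ _))) lee_fin.
  exact: le_trans (ler_norm _) h.
pose h t := if 0 <= t < 1 then g_ n t else 0.
have mg : measurable_fun [set: mR] (g_ n) by apply: continuous_measurable_fun; exact: cg.
have mh : measurable_fun [set: mR] (h : mR -> R).
  apply: measurable_fun_if => //.
    by apply: measurable_and; [exact: measurable_fun_ler|exact: measurable_fun_ltr].
  exact: measurable_funTS.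
have bh : bmeas (h : mR -> R).
  split => //.
  have [M hM] : exists M : R, forall t, 0 <= t <= 1 -> `|g_ n t| <= M.
    have cN : {within `[0, 1], continuous (fun t => `|g_ n t|)}.
      apply: continuous_subspaceT => t; apply: (continuous_comp (cg n t)).
      exact: norm_continuous.
    have [c _ hc] := EVT_max (@ler01 R) cN; exists (`|g_ n c|) => t tI.
    by apply: hc; rewrite in_itv.
  have M0 : 0 <= M by apply: le_trans (normr_ge0 _) (hM 0 _); rewrite lexx ler01.
  exists M => t; rewrite /h; case: ifP => [/andP[t0 t1]|_]; last by rewrite normr0.
  by apply: hM; rewrite t0 ltW.
exists h; split => // [t /andP[t0 t1]|G bG G1].
  rewrite /prop_for /continuous_at {2}/h (ltW t0) t1/=; apply/cvgrPdist_le => e' e'0.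
  have /cvgrPdist_le/(_ _ e'0) := cg n t.
  have hin : \forall s \near t, 0 <= s < 1.
    have : \forall s \near t, s \in `]0, 1[ by apply: near_in_itvoo; rewrite in_itv/= t0.
    by apply: filterS => s; rewrite in_itv/= => /andP[/ltW -> ->].
  by apply: filterS2 hin => s hs; rewrite /h hs.
have iGh : unif.-integrable setT (EFin \o (fun t => G t * h t)).
  by apply: bmeas_integrable; exact: bmeasM.
rewrite -RintegralB//; last exact: density_integrable.
have id : unif.-integrable setT (EFin \o (fun t => f t - h t)).
  by apply: integrable_realB => //; exact: bmeas_integrable.
have idG : unif.-integrable setT (EFin \o (fun t => G t * f t - G t * h t)).
  by apply: integrable_realB => //; exact: density_integrable.
apply: (le_trans (le_normr_Rintegral _ _)) => //.
have idn : unif.-integrable setT (EFin \o (fun t => `|f t - h t|)) by exact: (integrable_norm id).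
apply: (@le_trans _ _ (\int[unif]_t `|f t - h t|)).
  apply: le_Rintegral => //; first exact: (integrable_norm idG).
  by move=> t _; rewrite -mulrBr normrM ler_piMl.
rewrite -lee_fin fineK; last exact: integrable_fin_num.
rewrite ge0_integral_unif01//; last first.
  by apply/measurable_EFinP; apply: measurableT_comp => //; exact: measurable_funB.
apply: le_trans hn; rewrite le_eqVlt; apply/orP; left; apply/eqP.
apply: eq_integral => t; rewrite inE /I /= in_itv/= => ht.
by rewrite /h ht.
Qed.

Lemma bmeas_poisson_prod (r : R) (G h : mR -> R) : 0 <= r < 1 -> bmeas G -> bmeas h ->
  bmeas (fun st : mR * mR => G st.2 * (h st.1 * poisson (r%:C * expi st.1) (expi st.2))).
Proof.
move=> /andP[r0 r1] bG bh; apply: bmeasM; first by apply: (bmeas_comp _ bG); exact: measurable_snd.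
apply: bmeasM; first by apply: (bmeas_comp _ bh); exact: measurable_fst.
have me1 : measurable_fun [set: mR * mR] (fun st : mR * mR => expi (st.1 : R)).
  by apply: (measurableT_comp (@measurable_expi R)); exact: measurable_fst.
have me2 : measurable_fun [set: mR * mR] (fun st : mR * mR => expi (st.2 : R)).
  by apply: (measurableT_comp (@measurable_expi R)); exact: measurable_snd.
have rE (s : R) : modulus (r%:C * expi s) = r.
  by rewrite Normc.normcM expi_modulus mulr1 modulus_real ger0_norm.
split.
  by apply: measurable_poisson => //; apply: measurableC_mul => //; exact: measurable_cst.
exists ((1 - r ^+ 2) / (1 - r) ^+ 2) => st.
rewrite ger0_norm; last by rewrite ltW// poisson_gt0 ?rE// expi_modulus.
by have := @poisson_le (r%:C * expi st.1) (expi st.2); rewrite rE expi_modulus; exact.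
Qed.

(* Averages of Poisson kernels are dense in L^1 of the circle. *)
Lemma density_poisson (e : R) : 0 < e -> exists (n : nat) (h : R -> R),
  bmeas (h : mR -> R) /\
   forall G : mR -> R, bmeas G -> (forall t, `|G t| <= 1) ->
    `|\int[unif]_t (G t * f t) -
      \int[unif]_s (h s * \int[unif]_t (G t * poisson ((radius R n)%:C * expi s) (expi t)))| <= e.
Proof.
move=> e0; have e2 : 0 < e / 2 by rewrite divr_gt0.
have [h [bh ch hG]] := density_continuous e2.
pose H n (t : mR) : R := \int[unif]_s (h s * poisson ((radius R n)%:C * expi s) (expi t)).
have [mh [M hM]] := bh; have M0 : 0 <= M := le_trans (normr_ge0 _) (hM 0).
have r01 := @radius_itv R.
have bP n t : bmeas (fun s : mR => poisson ((radius R n)%:C * expi t) (expi s)).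
  by apply: bmeas_poisson; exact: modulus_radius.
have bHp n (G : mR -> R) : bmeas G ->
    bmeas (fun st : mR * mR => G st.2 * (h st.1 * poisson ((radius R n)%:C * expi st.1) (expi st.2))).
  by move=> bG; apply: bmeas_poisson_prod.
have HM n t : `|H n t| <= M.
  rewrite /H; under eq_Rintegral do rewrite poisson_sym.
  apply: (le_trans (bint_normr _ _)); first exact: bmeasM.
  apply: (@le_trans _ _ (\int[unif]_s (M * poisson ((radius R n)%:C * expi t) (expi s)))).
    apply: bint_le; [by apply: bmeas_norm; exact: bmeasM|by apply: bmeasM => //; exact: bmeas_cst|].
    move=> s; have p0 : 0 <= poisson ((radius R n)%:C * expi t) (expi s).
      by rewrite ltW// poisson_gt0 ?modulus_radius ?expi_modulus.
    by rewrite normrM [X in _ * X](ger0_norm p0) ler_wpM2r.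
  by rewrite bintZ// poisson_int1 ?mulr1//; exact: modulus_radius.
have bH n : bmeas (H n).
  have := bmeas_int2 unif unif (bHp n _ (bmeas_cst mR 1)); rewrite /=.
  by under [X in bmeas X]eq_fun do under eq_Rintegral do rewrite mul1r.
have cH : (fun n => \int[unif]_t `|h t - H n t|) @ \oo --> (0 : R).
  rewrite (_ : 0 = \int[unif]_t (0 : R)); last by rewrite bint_cst.
  apply: (@bounded_convergence _ _ _ _ _ _ (M + M)).
  - by move=> n; apply: measurableT_comp => //; apply: measurable_funB => //; have [] := bH n.
  - exact: measurable_cst.
  - by move=> n t; rewrite normr_id (le_trans (ler_normB _ _))// lerD.
  - apply: filterS2 (@ae_unif01 R) (_ : {ae unif, forall t : mR, t != 0 :> R}).
      move=> t /andP[t0 t1] tn0; have t01 : 0 < t < 1 by rewrite lt_neqAle eq_sym tn0 t0.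
      have := poisson_approx bh t01 (ch t t01) => hc.
      rewrite -[X in _ --> X](normr0 R); apply: cvg_norm; rewrite -(subrr (h t)).
      by apply: cvgB => //; exact: cvg_cst.
    exists ([set (0 : R)] : set mR); split; [by []| |].
      rewrite /unif01 /mrestr; apply/eqP; rewrite -measure_le0.
      apply: (@le_trans _ _ (lebesgue_measure [set (0 : R)])); last by rewrite lebesgue_measure_set1.
      by apply: le_measure; rewrite ?inE//; apply: measurableI => //; exact: measurable_itv.
    by move=> t /= /negP; rewrite negbK => /eqP.
have /cvgrPdist_le/(_ _ e2)[n _ /(_ n (leqnn n))] := cH.
rewrite /= sub0r normrN => /(le_trans (ler_norm _)) hn.
exists n, h; split => // G bG G1.
have -> : \int[unif]_s (h s * \int[unif]_t (G t * poisson ((radius R n)%:C * expi s) (expi t))) =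
    \int[unif]_t (G t * H n t).
  transitivity (\int[unif]_s \int[unif]_t (G t * (h s * poisson ((radius R n)%:C * expi s) (expi t)))).
    apply: eq_Rintegral => s _; rewrite -bintZ; last by apply: bmeasM => //; apply: bmeas_poisson; exact: modulus_radius.
    by apply: eq_Rintegral => t _; rewrite mulrCA.
  rewrite (bint_fubini unif unif (bHp n G bG)); apply: eq_Rintegral => t _ /=.
  rewrite bintZ//; apply: bmeasM => //.
  by under [X in bmeas X]eq_fun do rewrite poisson_sym.
rewrite (_ : _ - _ = (\int[unif]_t (G t * f t) - \int[unif]_t (G t * h t)) +
  (\int[unif]_t (G t * h t) - \int[unif]_t (G t * H n t))); last by ring.
rewrite (le_trans (ler_normD _ _))// [leRHS](splitr e) lerD ?hG//.
rewrite -bintB; [|exact: bmeasM|exact: bmeasM].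
apply: le_trans hn; apply: (le_trans (bint_normr _ _)); first by apply: bmeasB; exact: bmeasM.
apply: bint_le; [by apply: bmeas_norm; apply: bmeasB; exact: bmeasM|by apply: bmeas_norm; exact: bmeasB|].
by move=> t; rewrite -mulrBr normrM ler_piMl.
Qed.

(** Functions bounded by 1 that become constant inside the disk also become constant on the circle,
    weakly against L^1 densities: against a Poisson kernel the pairing is the value at an interior
    point, and [density_poisson] replaces [f] by an average of such kernels at one fixed radius. *)
Lemma density_dalg_cvg (U : nat -> R[i] -> R[i]) :
    (forall n, dalg (U n)) -> (forall n z, modulus z <= 1 -> modulus (U n z) <= 1) ->
    (forall z, modulus z < 1 -> (fun n => modulus (U n z - U n 0)) @ \oo --> (0 : R)) ->
  (fun n => \int[unif]_t (Re (U n (expi t)) * f t) - Re (U n 0)) @ \oo --> (0 : R).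
Proof.
move=> dU U1 cU; apply/cvgrPdist_le => e e0; have e4 : 0 < e / 4 by rewrite divr_gt0.
have [k [h [bh hG]]] := density_poisson e4.
have [mh [M hM]] := bh; have M0 : 0 <= M := le_trans (normr_ge0 _) (hM 0).
have dcst c : dalg (fun=> c : R[i]) by exact: dalg_cst.
pose r := radius R k.
have inner n s : \int[unif]_t (Re (U n (expi t)) * poisson (r%:C * expi s) (expi t)) =
    Re (U n (r%:C * expi s)).
  by rewrite poisson_formula//; exact: modulus_radius.
have bU n : bmeas (fun s : mR => Re (U n (r%:C * expi s))).
  split; last first.
    by exists 1 => s; rewrite (le_trans (Re_le_modulus _))// U1// ltW// modulus_radius.
  apply: measurableC_Re; apply: (measurableT_comp (dU n).1).
  by apply: measurableC_mul; [exact: measurable_cst|exact: measurable_expi].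
have Re1 n t : `|Re (U n (expi t))| <= 1.
  by rewrite (le_trans (Re_le_modulus _))// U1// expi_modulus.
have Re0 n : `|Re (U n 0)| <= 1.
  by rewrite (le_trans (Re_le_modulus _))// U1// Normc.normc0.
have e1 n : `|\int[unif]_t (Re (U n (expi t)) * f t) - \int[unif]_s (h s * Re (U n (r%:C * expi s)))| <= e / 4.
  rewrite -(_ : \int[unif]_s (h s * \int[unif]_t (Re (U n (expi t)) * poisson (r%:C * expi s) (expi t))) =
    \int[unif]_s (h s * Re (U n (r%:C * expi s)))).
    by apply: hG => //; exact: bmeas_dalg.
  by apply: eq_Rintegral => s _; rewrite inner.
have e5 : `|1 - \int[unif]_s h s| <= e / 4.
  have := hG (fun=> 1) (bmeas_cst _ _) (fun=> ltac:(by rewrite normr1)).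
  rewrite (_ : \int[unif]_t (1 * f t) = 1); last by rewrite -[RHS]density_int1; apply: eq_Rintegral => t _; rewrite mul1r.
  rewrite (_ : \int[unif]_s (h s * _) = \int[unif]_s h s)//.
  apply: eq_Rintegral => s _; rewrite -[RHS](mulr1 (h s)); congr (_ * _).
  rewrite -[RHS](poisson_int1 (modulus_radius k s)).
  by apply: eq_Rintegral => t _; rewrite mul1r.
have c2 : (fun n => \int[unif]_s (h s * (Re (U n (r%:C * expi s)) - Re (U n 0)))) @ \oo --> (0 : R).
  rewrite (_ : 0 = \int[unif]_t (0 : R)); last by rewrite bint_cst.
  apply: (@bounded_convergence _ _ _ _ _ _ (M * 2)).
  - move=> n; apply: measurable_funM => //; apply: measurable_funB => //.
    by have [] := bU n.
  - exact: measurable_cst.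
  - move=> n s; rewrite normrM ler_pM// (le_trans (ler_normB _ _))// [leRHS]mulr2n lerD//.
    by rewrite (le_trans (Re_le_modulus _))// U1// ltW// modulus_radius.
  - apply: aeW => s; rewrite -(mulr0 (h s)); apply: cvgM; first exact: cvg_cst.
    apply/cvgrPdist_le => e' e'0; have /cvgrPdist_le/(_ _ e'0) := cU _ (modulus_radius k s).
    apply: filterS => n; rewrite !sub0r !normrN (ger0_norm (modulus_ge0 _)) -ReB.
    exact: le_trans (Re_le_modulus _).
have /cvgrPdist_le/(_ _ e4) := c2; apply: filterS => n.
rewrite !sub0r !normrN => h2.
have hh : \int[unif]_s (h s * (Re (U n (r%:C * expi s)) - Re (U n 0))) =
   \int[unif]_s (h s * Re (U n (r%:C * expi s))) - Re (U n 0) * \int[unif]_s h s.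
  rewrite -bintZ// -bintB; last 2 first.
  - by apply: bmeasM.
  - by apply: bmeasM => //; exact: bmeas_cst.
  by apply: eq_Rintegral => s _; ring.
rewrite (_ : _ - _ = (\int[unif]_t (Re (U n (expi t)) * f t) - \int[unif]_s (h s * Re (U n (r%:C * expi s))))
  + \int[unif]_s (h s * (Re (U n (r%:C * expi s)) - Re (U n 0))) - Re (U n 0) * (1 - \int[unif]_s h s)); last first.
  by rewrite hh; ring.
have h3 : `|Re (U n 0) * (1 - \int[unif]_s h s)| <= e / 4.
  by rewrite normrM (le_trans _ e5)// ler_piMl.
rewrite (le_trans (ler_normB _ _))// (_ : e = e / 4 + e / 4 + (e / 2)); last by field.
rewrite lerD//; first by rewrite (le_trans (ler_normD _ _))// lerD.
by apply: (le_trans h3); lra.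
Qed.

End circle_density.

(** * Barycenters of fibre measures *)

Lemma aeS d (X : measurableType d) (R : realType) (m : {measure set X -> \bar R}) (A B : set X) :
  {ae m, forall x, A x} -> (forall x, A x -> B x) -> {ae m, forall x, B x}.
Proof. by move=> [N [mN N0 AN]] AB; exists N; split => // x Bx; apply: AN => /AB. Qed.

Lemma aeS2 d (X : measurableType d) (R : realType) (m : {measure set X -> \bar R}) (A B C : set X) :
  {ae m, forall x, A x} -> {ae m, forall x, B x} -> (forall x, A x -> B x -> C x) ->
  {ae m, forall x, C x}.
Proof. by move=> hA hB ABC; apply: filterS2 hA hB. Qed.

Lemma ae_ex d (X : measurableType d) (R : realType) (m : probability X R) (A : set X) :
  {ae m, forall x, A x} -> exists x, A x.
Proof.
move=> [N [mN N0 AN]]; apply: contrapT => hA; have : N = setT.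
  by apply/seteqP; split => // x _; apply: AN => Ax; apply: hA; exists x.
by move=> NT; move: N0; rewrite NT probability_setT => /eqP; rewrite onee_eq0.
Qed.

Section as_probability.
Context d (X : measurableType d) (R : realType).
Variable m : {measure set X -> \bar R}.
Hypothesis m1 : m [set: X] = 1%E.

Definition as_probability of m [set: X] = 1%E := m : set X -> \bar R.

HB.instance Definition _ := Measure.copy (as_probability m1) m.

Let as_probability1 : as_probability m1 [set: X] = 1%E := m1.

HB.instance Definition _ :=
  Measure_isProbability.Build _ _ _ (as_probability m1) as_probability1.

End as_probability.

Section moments.
Variable R : realType.
Local Notation unif := (@unif01 R).
Local Notation mR := (measurableTypeR R).
Variable nu : probability R[i] R.
Hypothesis nu_circle : nu (@circle R) = 1%E.
Hypothesis nu_dom : nu `<< @circle_measure R.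

Lemma ae_circle : {ae nu, forall z, modulus z = 1}.
Proof.
exists (~` @circle R); split.
- by apply: measurableC; exact: (@measurable_circle R).
- have := probability_setC nu (@measurable_circle R).
  by rewrite nu_circle subee.
- by [].
Qed.

Lemma bmeas_circle (F : R[i] -> R) : measurable_fun [set: R[i]] F ->
  (exists M : R, forall z, modulus z <= 1 -> `|F z| <= M) ->
  bmeas (fun z => if modulus z <= 1 then F z else 0).
Proof.
move=> mF [M hM]; split.
  apply: measurable_fun_if => //; last exact: measurable_funTS.
  by apply: measurable_fun_ler => //; apply: measurable_modulus; exact: measurable_id.
have M0 : 0 <= M by apply: le_trans (normr_ge0 _) (hM 0 _); rewrite Normc.normc0.
by exists M => z; case: ifP => [/hM//|_]; rewrite normr0.
Qed.

End moments.

Section integral_transport.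
Context d d' (X : measurableType d) (Y : measurableType d') (R : realType).

Lemma bint_pushforward (p : probability X R) (q : probability Y R) (phi : X -> Y) (F : Y -> R) :
  measurable_fun [set: X] phi -> (forall A, measurable A -> q A = p (phi @^-1` A)) ->
  bmeas F -> \int[q]_y F y = \int[p]_x F (phi x).
Proof.
move=> mphi pq bF; have [mF [M hM]] := bF.
have M0 y : 0 <= F y + M by have := hM y; move/ler_normlP => []; lra.
have bFp : bmeas (fun x => F (phi x)) by exact: bmeas_comp bF.
have h : \int[p]_x (F (phi x) + M) = \int[q]_y (F y + M).
  apply/EFin_inj; rewrite -!bint_EFin; last 2 first.
    by apply: bmeasD => //; exact: bmeas_cst.
    by apply: bmeasD => //; exact: bmeas_cst.
  have e : (\int[pushforward p phi]_y (F y + M)%:E = \int[q]_y (F y + M)%:E)%E.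
    by apply: eq_measure_integral => A mA _; exact: (esym (pq A mA)).
  rewrite -e (ge0_integral_pushforward mphi) ?preimage_setT//.
    by apply/measurable_EFinP; exact: measurable_funD.
  by move=> y _; rewrite lee_fin.
rewrite bintD// in h; last exact: bmeas_cst.
rewrite bintD// in h; last exact: bmeas_cst.
by apply/esym; move: h; rewrite !bint_cst => /addIr.
Qed.

Variable k : R.-pker X ~> Y.

Lemma kernel1 x : k x [set: Y] = 1%E.
Proof. by rewrite prob_kernel. Qed.

Definition kernel_prob x : probability Y R := as_probability (kernel1 x).

Lemma bmeas_kernel_int (F : Y -> R) : bmeas F -> bmeas (fun x => \int[kernel_prob x]_y F y).
Proof.
move=> bF; have [mF [M hM]] := bF.
have M0 y : 0 <= F y + M by have := hM y; move/ler_normlP => []; lra.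
split; last by exists M => x; exact: bint_norm_le.
have -> : (fun x => \int[kernel_prob x]_y F y) = (fun x => fine (\int[k x]_y (F y + M)%:E)%E - M).
  apply/funext => x.
  have -> : (\int[k x]_y (F y + M)%:E = \int[kernel_prob x]_y (F y + M)%:E)%E by [].
  rewrite -[fine _]/(\int[kernel_prob x]_y (F y + M)) bintD//; last exact: bmeas_cst.
  by rewrite bint_cst addrK.
apply: measurable_funB => //; apply: (measurableT_comp (@fine_measurable R _ measurableT)).
apply: measurable_fun_integral_kernel.
- by move=> U mU; exact: measurable_kernel.
- by move=> z; rewrite lee_fin.
- by apply/measurable_EFinP; exact: measurable_funD.
Qed.

End integral_transport.

(** * Merging of orbits in the hyperbolic metric *)

Section hyperbolic_contraction.
Context d (Omega : measurableType d) (R : realType).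
Variables (T : blaschke_cocycle Omega R) (sigma : Omega -> Omega).
Variables (w : Omega) (z z' : R[i]).
Hypotheses (z1 : modulus z < 1) (z1' : modulus z' < 1).
Local Notation It := (cocycle_iter sigma T).
Variables (kappa eta : R).
Hypotheses (kappa0 : 0 < kappa) (eta0 : 0 < eta).

Let good n := [/\ kappa <= 1 - modulus (It n w z') ^+ 2, (1 < degree T (iter n sigma w))%N &
  eta <= contraction_cst (zeros T (iter n sigma w) 0) (zeros T (iter n sigma w) 1)].

Let b n := hyp (It n w z) (It n w z').

(** The sequence decreases by Schwarz-Pick. If its limit L exceeded 1, every good time would lower
    it by at least the fixed amount zeta (L - 1), which a convergent sequence cannot afford
    infinitely often. *)
Lemma hyp_iter_cvg : (forall m, exists2 n, (m <= n)%N & good n) -> b @ \oo --> (1 : R).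
Proof.
move=> hgood.
have [x1 y1] : (forall n, modulus (It n w z) < 1) /\ (forall n, modulus (It n w z') < 1).
  by split=> n; exact: iter_lt1.
have b1 n : 1 <= b n by rewrite /b hyp_ge1.
have b0 : 0 < b 0%N by exact: lt_le_trans ltr01 (b1 0%N).
have bdec : nonincreasing_seq b.
  by apply/nonincreasing_seqP => n; exact: hyp_iter_le.
have bcvg : cvgn b by apply: nonincreasing_is_cvgn => //; exists 1 => _ [n _ <-].
pose L := limn b.
have Lb n : L <= b n by exact: nonincreasing_cvgn_ge.
have L1 : 1 <= L by apply: limr_ge => //; exact: nearW.
suff LE : L = 1 by move: bcvg; rewrite -/L -[X in _ --> X]LE.
apply/eqP; rewrite eq_le L1 andbT leNgt; apply/negP => Lgt1.
(* Only the orbit of z' is known to stay away from the circle. As [b n <= b 0] and |1 - z conj z'|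
   >= 1 - |z'| >= kappa / 2 at good times, the orbit of z then satisfies 1 - |z|^2 >= delta. *)
pose delta := (kappa / 2) ^+ 2 / b 0%N.
have delta0 : 0 < delta by rewrite divr_gt0// exprn_gt0// divr_gt0.
pose zeta := eta * (delta * kappa) ^+ 2.
have zeta0 : 0 < zeta by rewrite mulr_gt0// exprn_gt0// mulr_gt0.
have step n : good n -> b n.+1 <= b n - zeta * (L - 1).
  move=> [h1 h2 h3].
  have hb : b n.+1 <= b n * (1 - contraction_cst (zeros T (iter n sigma w) 0)
      (zeros T (iter n sigma w) 1) * (b n - 1) *
      ((1 - modulus (It n w z) ^+ 2) * (1 - modulus (It n w z') ^+ 2)) ^+ 2).
    rewrite /b /= !blaschkeE; apply: bprod_hyp_contract => //.
      exact: rotation_circle.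
    by move=> i; exact: zeros_disk.
  apply: (le_trans hb).
  have dx := one_minus_sqr (x1 n); have dy := one_minus_sqr (y1 n).
  have hd : delta <= 1 - modulus (It n w z) ^+ 2.
    rewrite ler_pdivrMr//.
    have e1 : modulus (1 - It n w z * (It n w z')^*) ^+ 2 =
        b n * ((1 - modulus (It n w z) ^+ 2) * (1 - modulus (It n w z') ^+ 2)).
      by rewrite /b /hyp divfK// gt_eqF// mulr_gt0.
    have e2 : kappa / 2 <= modulus (1 - It n w z * (It n w z')^*).
      apply: le_trans (lerB_modulus _ _).
      rewrite Normc.normc1 Normc.normcM modulusJ.
      have m0 := modulus_ge0 (It n w z'); have m1 := y1 n; have m2 := x1 n.
      have m3 := modulus_ge0 (It n w z); nra.
    have e3 : (kappa / 2) ^+ 2 <= modulus (1 - It n w z * (It n w z')^*) ^+ 2.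
      by rewrite ler_sqr ?nnegrE ?modulus_ge0// divr_ge0// ltW.
    apply: (le_trans e3); rewrite e1 mulrCA ler_wpM2l ?(ltW dx)//.
    have bn0 : b n <= b 0%N by exact: bdec.
    apply: le_trans bn0; rewrite ler_piMr//; first exact: le_trans ler01 (b1 n).
    by rewrite gerBl sqr_ge0.
  set X := (1 - modulus (It n w z) ^+ 2) * _.
  have hX : delta * kappa <= X by rewrite ler_pM// ltW.
  have hX2 : (delta * kappa) ^+ 2 <= X ^+ 2.
    by rewrite ler_sqr ?nnegrE// ?(ltW (mulr_gt0 delta0 kappa0))// (le_trans _ hX)// ltW// mulr_gt0.
  set c := contraction_cst _ _.
  have h4 : zeta <= c * X ^+ 2 by apply: ler_pM => //; [exact: ltW|exact: sqr_ge0].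
  have h5 : zeta * (L - 1) <= c * X ^+ 2 * (b n - 1).
    by apply: ler_pM => //; [exact: ltW|rewrite subr_ge0|rewrite lerB].
  have h6 : 0 <= c * X ^+ 2 * (b n - 1).
    by apply: mulr_ge0; [exact: le_trans (ltW zeta0) h4|rewrite subr_ge0].
  have := b1 n; rewrite -/X; move: h5 h6.
  rewrite (_ : c * (b n - 1) * X ^+ 2 = c * X ^+ 2 * (b n - 1)); last by ring.
  by move: (c * X ^+ 2 * (b n - 1)) => Y h5 h6 h7; nra.
have e0 : 0 < zeta * (L - 1) by rewrite mulr_gt0// subr_gt0.
have /cvgrPdist_lt/(_ _ e0)[m _ hm] := bcvg.
have [n mn gn] := hgood m.
have := hm n mn; rewrite /= distrC ger0_norm ?subr_ge0// -/L => hn.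
have := step n gn; have := Lb n.+1; lra.
Qed.

End hyperbolic_contraction.

Lemma sqr_dist_le_hyp (R : realType) (x y : R[i]) : modulus x < 1 -> modulus y < 1 ->
  modulus (x - y) ^+ 2 <= hyp x y - 1.
Proof.
move=> x1 y1; rewrite hyp_sub1//; have dx := one_minus_sqr x1; have dy := one_minus_sqr y1.
rewrite ler_pdivlMr ?mulr_gt0// ler_piMr ?sqr_ge0//.
have := sqr_ge0 (modulus x); have := sqr_ge0 (modulus y) => h1 h2.
by apply: mulr_ile1; rewrite ?(ltW dx) ?(ltW dy)// gerBl.
Qed.

Lemma modulus_subX (R : realType) (x y : R[i]) k : modulus x <= 1 -> modulus y <= 1 ->
  modulus (x ^+ k - y ^+ k) <= k%:R * modulus (x - y).
Proof.
move=> x1 y1; elim: k => [|k ih]; first by rewrite !expr0 subrr Normc.normc0 mul0r.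
rewrite !exprS (_ : _ - _ = x * (x ^+ k - y ^+ k) + (x - y) * y ^+ k); last by ring.
rewrite (le_trans (le_normcD _ _))// !Normc.normcM -natr1 mulrDl mul1r lerD//.
  by rewrite (le_trans _ ih)// ler_piMl// modulus_ge0.
by rewrite ler_piMr ?modulus_ge0// modulusX exprn_ile1 ?modulus_ge0.
Qed.

(** * Means and barycenter of a measure on the circle *)

Section identification_fiber.
Variable R : realType.
Local Notation unif := (@unif01 R).
Local Notation mR := (measurableTypeR R).

(** Fibre measures live on the plane but charge only the circle; cutting off outside the closed disk
    makes disk-algebra functions bounded everywhere. *)
Definition on_disk (F : R[i] -> R) (z : R[i]) : R := if modulus z <= 1 then F z else 0.

Lemma bmeas_dalg_disk (F : R[i] -> R[i]) : dalg F -> bmeas (on_disk (fun z => Re (F z))).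
Proof.
move=> hF; apply: bmeas_circle; first exact: measurableC_Re hF.1.
have [M M0 hM] := dalg_bounded hF; exists M => z z1.
exact: le_trans (Re_le_modulus _) (hM z z1).
Qed.

Variable nu : probability R[i] R.
Hypothesis nu_circle : nu (@circle R) = 1%E.

Definition disk_mean (F : R[i] -> R[i]) : R := \int[nu]_z on_disk (fun z => Re (F z)) z.

Lemma disk_mean_ext F G : dalg F -> dalg G -> (forall z, modulus z <= 1 -> F z = G z) ->
  disk_mean F = disk_mean G.
Proof.
move=> hF hG FG; apply: eq_Rintegral => z _; rewrite /on_disk; case: ifP => // z1.
by rewrite FG.
Qed.

Lemma disk_meanD F G : dalg F -> dalg G ->
  disk_mean (fun z => F z + G z) = disk_mean F + disk_mean G.
Proof.
move=> hF hG; rewrite /disk_mean -bintD; [|exact: bmeas_dalg_disk|exact: bmeas_dalg_disk].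
apply: eq_Rintegral => z _; rewrite /on_disk; case: ifP => _; first exact: ReD.
by rewrite addr0.
Qed.

Lemma disk_mean_real (a : R) F : dalg F -> disk_mean (fun z => a%:C * F z) = a * disk_mean F.
Proof.
move=> hF; rewrite /disk_mean -bintZ; last exact: bmeas_dalg_disk.
apply: eq_Rintegral => z _; rewrite /on_disk; case: ifP => _; last by rewrite mulr0.
by rewrite ReM /=; ring.
Qed.

Lemma disk_mean_le (M : R) F : dalg F -> (forall z, modulus z <= 1 -> modulus (F z) <= M) ->
  `|disk_mean F| <= M.
Proof.
move=> hF FM; apply: bint_norm_le; first exact: bmeas_dalg_disk.
move=> z; rewrite /on_disk; case: ifP => [z1|_].
  by rewrite (le_trans (Re_le_modulus _))// FM.
by rewrite normr0 (le_trans (modulus_ge0 (F 0)))// FM// Normc.normc0.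
Qed.

Lemma disk_mean_cst c : disk_mean (fun=> c) = Re c.
Proof.
rewrite -[RHS](bint_cst nu); apply: bint_ae.
- by apply: bmeas_dalg_disk; exact: dalg_cst.
- exact: bmeas_cst.
by apply: (aeS (ae_circle nu_circle)) => z z1; rewrite /on_disk z1 lexx.
Qed.

(** The mean of z. As [disk_mean] keeps real parts only, the imaginary part is obtained as the mean
    of Re (- i z). *)
Definition barycenter : R[i] :=
  (disk_mean id)%:C + 'i * (disk_mean (fun z => - 'i * z))%:C.

Lemma dalg_lin c : dalg (fun z : R[i] => c * z).
Proof. by apply: dalgM; [exact: dalg_cst|exact: dalg_id]. Qed.

Lemma disk_mean_barycenter c : disk_mean (fun z => c * z) = Re (c * barycenter).
Proof.
have hb : barycenter = disk_mean id +i* disk_mean (fun z => - 'i * z).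
  by apply: complex_eqP; rewrite !(ReD, ImD, ReM, ImM) /=; ring.
rewrite hb; case: c => a b.
transitivity (disk_mean (fun z => a%:C * z + (- b)%:C * (- 'i * z))).
  apply: disk_mean_ext; first exact: dalg_lin.
    apply: dalgD; first exact: dalg_lin.
    by apply: dalgM; [exact: dalg_cst|exact: dalg_lin].
  by move=> [u v] _; apply: complex_eqP; rewrite !(ReD, ImD, ReM, ImM) /=; ring.
rewrite disk_meanD; last 2 first.
- exact: dalg_lin.
- by apply: dalgM; [exact: dalg_cst|exact: dalg_lin].
rewrite (disk_mean_real _ (dalg_id R)) disk_mean_real; last exact: dalg_lin.
by rewrite ReM /=; ring.
Qed.

Lemma bmeas_sqr_dist y : bmeas (on_disk (fun z => modulus (z - y) ^+ 2)).
Proof.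
apply: bmeas_circle.
  by apply: measurable_funX; apply: measurable_modulus; apply: measurableC_sub.
exists ((1 + modulus y) ^+ 2) => z z1; rewrite ger0_norm ?sqr_ge0//.
rewrite ler_sqr ?nnegrE ?modulus_ge0 ?addr_ge0 ?modulus_ge0//.
by rewrite (le_trans (le_normcD _ _))// normcN lerD2r.
Qed.

Lemma mean_sqr_dist y : \int[nu]_z on_disk (fun z => modulus (z - y) ^+ 2) z =
  1 + modulus y ^+ 2 - 2 * Re (y^* * barycenter).
Proof.
rewrite -(disk_mean_barycenter (y^*)) /disk_mean.
have hl := bmeas_dalg_disk (dalg_lin (y^*)).
rewrite -(bintZ nu 2 hl) -(bint_cst nu (1 + modulus y ^+ 2)) -bintB; last 2 first.
- exact: bmeas_cst.
- by apply: bmeasM => //; exact: bmeas_cst.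
apply: bint_ae; first exact: bmeas_sqr_dist.
  apply: bmeasB; first exact: bmeas_cst.
  by apply: bmeasM => //; exact: bmeas_cst.
apply: (aeS (ae_circle nu_circle)) => z z1; rewrite /on_disk z1 lexx.
by rewrite sqr_modulusB z1 expr1n; case: (z) (y) => a b [c e]; rewrite ReM /=; ring.
Qed.

Lemma barycenter_sqr : \int[nu]_z on_disk (fun z => modulus (z - barycenter) ^+ 2) z =
  1 - modulus barycenter ^+ 2.
Proof.
by rewrite mean_sqr_dist [_^* * _]mulrC mulJc /=; ring.
Qed.

Lemma barycenter_min y : 1 - modulus barycenter ^+ 2 <=
  \int[nu]_z on_disk (fun z => modulus (z - y) ^+ 2) z.
Proof.
rewrite mean_sqr_dist; have := sqr_ge0 (modulus (y - barycenter)).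
rewrite sqr_modulusB (_ : Re (y^* * barycenter) = Re y * Re barycenter + Im y * Im barycenter).
  by move=> h; lra.
by case: y => a b; rewrite ReM /=; ring.
Qed.

Lemma barycenter_le1 : modulus barycenter <= 1.
Proof.
have : 0 <= 1 - modulus barycenter ^+ 2.
  rewrite -barycenter_sqr; apply: Rintegral_ge0 => z _.
  by rewrite /on_disk; case: ifP => // _; exact: sqr_ge0.
by rewrite subr_ge0 -[leRHS](@expr1n R 2) ler_sqr ?nnegrE// modulus_ge0.
Qed.

(** A barycenter on the circle has zero variance around it, so the measure would be a Dirac mass,
    contradicting absolute continuity. *)
Lemma barycenter_lt1 : nu `<< @circle_measure R -> modulus barycenter < 1.
Proof.
move=> dom; rewrite lt_neqAle barycenter_le1 andbT; apply/negP => /eqP x1.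
have := barycenter_sqr; rewrite x1 expr1n subrr => h0.
have h1 : {ae nu, forall z, on_disk (fun z => modulus (z - barycenter) ^+ 2) z = 0}.
  apply: bint_eq0 => //; first exact: bmeas_sqr_dist.
  by move=> z; rewrite /on_disk; case: ifP => // _; exact: sqr_ge0.
have nx : {ae nu, forall z, z != barycenter}.
  exists [set barycenter]; have mb : measurable [set barycenter].
    have mm : measurable_fun [set: R[i]] (fun z : R[i] => modulus (z - barycenter)).
      by apply: measurable_modulus; apply: measurableC_sub; [exact: measurable_id|exact: measurable_cst].
    have := mm measurableT _ (measurable_set1 0); rewrite setTI.
    rewrite (_ : _ @^-1` _ = [set barycenter])//; apply/seteqP; split => z /=.
      by move/eqP; rewrite modulus_eq0 subr_eq0 => /eqP.
    by move=> ->; rewrite subrr Normc.normc0.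
  split => //; last by move=> z /= /negP; rewrite negbK => /eqP.
  have /null_content_dominatesP hd := dom; apply: hd => //.
  have [t0 t01 tE] := circleE (x1 : circle barycenter).
  rewrite /circle_measure /pushforward /mrestr; apply/eqP; rewrite -measure_le0.
  apply: (@le_trans _ _ (lebesgue_measure [set t0])); last by rewrite lebesgue_measure_set1.
  apply: le_measure; rewrite ?inE//.
    apply: measurableI; last exact: measurable_itv.
    by rewrite -[X in measurable X]setTI; exact: measurable_expi.
  move=> t [/= te]; rewrite in_itv/= => ht.
  by apply: expi_inj01 => //; rewrite te.
have h2 := aeS2 h1 nx (C := fun z => on_disk (fun z => modulus (z - barycenter) ^+ 2) z = 0 /\
  z != barycenter) (fun z a b => conj a b).
have h3 := aeS2 h2 (ae_circle nu_circle) (C := fun z =>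
  (on_disk (fun z => modulus (z - barycenter) ^+ 2) z = 0 /\ z != barycenter) /\ modulus z = 1)
  (fun z a b => conj a b).
have [z [[hz zn] z1]] := ae_ex h3.
move: hz; rewrite /on_disk z1 lexx => /eqP.
by rewrite expf_eq0/= modulus_eq0 subr_eq0 (negbTE zn).
Qed.

End identification_fiber.

Section density_bint.
Variable R : realType.
Local Notation unif := (@unif01 R).
Local Notation mR := (measurableTypeR R).
Variables (nu : probability R[i] R) (f : mR -> R).
Hypothesis mf : measurable_fun [set: mR] f.
Hypothesis f0 : forall t, 0 <= f t.
Hypothesis hf : forall F : R[i] -> \bar R, measurable_fun [set: R[i]] F ->
  (forall z, 0 <= F z)%E -> (\int[nu]_z F z = \int[unif]_t (F (expi t) * (f t)%:E))%E.

Lemma density_total : (\int[unif]_t (f t)%:E = 1)%E.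
Proof.
have := hf (@measurable_cst _ _ _ _ _ 1%E) (fun=> lee01).
rewrite (integral_cst_prob nu 1) => ->.
by apply: eq_integral => t _; rewrite mul1e.
Qed.

Lemma density_bint (G : R[i] -> R) : bmeas G ->
  \int[nu]_z G z = \int[unif]_t (G (expi t) * f t).
Proof.
move=> bG; have [mG [M hM]] := bG.
have M0 y : 0 <= G y + M by have := hM y; move/ler_normlP => []; lra.
have bGe : bmeas (fun t : mR => G (expi t)).
  by apply: bmeas_comp bG; exact: measurable_expi.
have h : \int[nu]_z (G z + M) = \int[unif]_t ((G (expi t) + M) * f t).
  congr fine; rewrite (@hf (fun z => (G z + M)%:E)).
  - by apply: eq_integral => t _; rewrite -EFinM.
  - by apply/measurable_EFinP; exact: measurable_funD.
  - by move=> z; rewrite lee_fin.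
rewrite bintD// in h; last exact: bmeas_cst.
move: h; rewrite bint_cst (_ : \int[unif]_t _ = \int[unif]_t (G (expi t) * f t) + M).
  exact: addIr.
rewrite -[X in _ + X](mulr1 M) -(density_int1 density_total).
have hM1 : unif.-integrable [set: mR] (EFin \o (fun t => M * f t)).
  by apply: (density_integrable mf f0 density_total); exact: bmeas_cst.
have hf1 : unif.-integrable [set: mR] (EFin \o f).
  have := density_integrable mf f0 density_total (bmeas_cst mR 1).
  by rewrite (_ : (fun t => 1 * f t) = f)//; apply/funext => t; rewrite mul1r.
rewrite -RintegralZl// -RintegralD//; last exact: (density_integrable mf f0 density_total).
by apply: eq_Rintegral => t _; rewrite mulrDl.
Qed.

End density_bint.

(** * Fibre measures evaluate the disk algebra at their barycenter *)

Section identification.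
Context d (Omega : measurableType d) (R : realType) (P : probability Omega R).
Variables (sigma : Omega -> Omega) (T : blaschke_cocycle Omega R).
Variable mu : R.-pker Omega ~> R[i].
Hypothesis ms : measurable_fun [set: Omega] sigma.
Hypothesis mp : measure_preserving P sigma.
Hypothesis erg : ergodic P sigma.
Hypothesis acim : random_acim P sigma T mu.
Hypothesis deg2 : (0 < P [set w | (1 < degree T w)%N])%E.
Local Notation unif := (@unif01 R).
Local Notation mR := (measurableTypeR R).
Local Notation It := (cocycle_iter sigma T).
Local Notation p := (kernel_prob mu).
Local Notation x w := (barycenter (p w)).

Lemma kernel_circle w : p w (@circle R) = 1%E.
Proof. exact: (rim_circle acim.1). Qed.

Lemma measurable_It n w : measurable_fun [set: R[i]] (It n w).
Proof. exact: (dalg_iter T sigma n w).1. Qed.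

Definition regular_fiber w :=
  (forall n, p (iter n sigma w) `<< @circle_measure R) /\
  (forall n A, measurable A -> p (iter n sigma w) A = p w (It n w @^-1` A)).

Lemma ae_regular_fiber : {ae P, forall w, regular_fiber w}.
Proof.
have h1 := ae_preserving_iter ms mp acim.2.
have h2 := ae_preserving_iter ms mp (rim_invariant acim.1).
apply: (aeS2 h1 h2) => w hw1 hw2; split => // n A mA.
elim: n A mA => [|n ih] A mA //=.
have -> : p (sigma (iter n sigma w)) A = p (iter n sigma w) (T (iter n sigma w) @^-1` A).
  by rewrite -(hw2 n A mA).
rewrite ih//; have mT : measurable_fun [set: R[i]] (T (iter n sigma w)).
  exact: (measurable_blaschke T (@measurable_cst _ _ _ _ _ _) (@measurable_id _ _ _)).
by rewrite -[X in measurable X]setTI; exact: mT.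
Qed.

Lemma measurable_barycenter : measurable_fun [set: Omega] (fun w => x w).
Proof.
have hm F : dalg F -> measurable_fun [set: Omega] (fun w => disk_mean (p w) F).
  by move=> hF; have [] := bmeas_kernel_int mu (bmeas_dalg_disk hF).
apply: measurable_complex.
  rewrite (_ : (fun w => Re (x w)) = (fun w => disk_mean (p w) id)).
    by apply: hm; exact: dalg_id.
  by apply/funext => w; rewrite /barycenter !(ReD, ReM) /=; ring.
rewrite (_ : (fun w => Im (x w)) = (fun w => disk_mean (p w) (fun z => - 'i * z))).
  by apply: hm; exact: dalg_lin.
by apply/funext => w; rewrite /barycenter !(ImD, ImM) /=; ring.
Qed.

Section fiber.
Variable w : Omega.
Hypothesis hw : regular_fiber w.

Let density_w : exists f : mR -> R, [/\ measurable_fun [set: mR] f, forall t, 0 <= f t,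
   (\int[unif]_t (f t)%:E = 1)%E &
   forall n (G : R[i] -> R), bmeas G ->
     \int[p (iter n sigma w)]_z G z = \int[unif]_t (G (It n w (expi t)) * f t)].
Proof.
have [f [mf f0 hf]] := density_exists (hw.1 0%N).
exists f; split => //; first exact: density_total hf.
move=> n G bG; rewrite (bint_pushforward (measurable_It n w) (hw.2 n) bG).
rewrite (density_bint mf f0 hf)//.
by apply: bmeas_comp bG; exact: measurable_It.
Qed.

(* The barycenter minimizes the mean square distance, and the part of the
   density below [C] only sees a multiple of [1 - |T^n 0|^2]. *)
Lemma barycenter_nonescape (e : R) : 0 < e -> exists2 C : R, 0 < C & forall n,
  1 - modulus (x (iter n sigma w)) ^+ 2 <= C * (1 - modulus (It n w 0) ^+ 2) + e.
Proof.
have key (a b C q : R) : b <= C * a + q / 4 -> 4 * b <= C * (4 * a) + q by move=> h; lra.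
move=> e0; have [f [mf f0 f1 hf]] := density_w.
have e4 : 0 < e / 4 by rewrite divr_gt0.
have [C C0 hC] := density_uniform_integrable mf f0 f1 e4.
exists C => // n; set y := It n w 0.
have y1 : modulus y < 1 by apply: iter_lt1; rewrite Normc.normc0.
apply: (le_trans (barycenter_min (kernel_circle _) y)).
rewrite (hf n _ (bmeas_sqr_dist y)).
pose G (t : mR) := modulus (It n w (expi t) - y) ^+ 2 / 4.
have It1 (t : R) : modulus (It n w (expi t)) = 1 by apply: iter_circle; exact: expi_modulus.
have G01 t : 0 <= G t <= 1.
  rewrite /G divr_ge0 ?sqr_ge0//= ler_pdivrMr// mul1r.
  rewrite (_ : 4 = (2 : R) ^+ 2); last by rewrite -natrX.
  rewrite ler_sqr ?nnegrE ?modulus_ge0// (le_trans (le_normcD _ _))// normcN It1 [2]mulr2n.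
  by rewrite lerD2l ltW.
have mG : measurable_fun [set: mR] G.
  apply: measurable_funM => //; apply: measurable_funX; apply: measurable_modulus.
  apply: measurableC_sub; last exact: measurable_cst.
  exact: measurableT_comp (measurable_It n w) (@measurable_expi R).
have bG : bmeas G.
  by split => //; exists 1 => t; have /andP[a b] := G01 t; rewrite ger0_norm.
have -> : \int[unif]_t (on_disk (fun z => modulus (z - y) ^+ 2) (It n w (expi t)) * f t) =
    4 * \int[unif]_t (G t * f t).
  rewrite -RintegralZl//; last exact: density_integrable.
  by apply: eq_Rintegral => t _; rewrite /on_disk It1 lexx /G mulrA mulrC [4 * _]mulrC divfK// mulrC.
(* For Lebesgue measure [y = It n w 0] is the mean of T^n, so this is the variance of a
   circle-valued function with mean [y]. *)
have hG : 4 * \int[unif]_t G t = 1 - modulus y ^+ 2.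
  rewrite -bintZ//.
  have dF : dalg (fun z => 2 * (y^* * It n w z)).
    by apply: dalgM; [exact: dalg_cst|apply: dalgM; [exact: dalg_cst|exact: dalg_iter]].
  have hmv := dalg_mean_value dF.
  transitivity (\int[unif]_t ((1 + modulus y ^+ 2) - Re (2 * (y^* * It n w (expi t))))).
    apply: eq_Rintegral => t _; rewrite /G mulrC divfK// sqr_modulusB It1 expr1n.
    by case: (It n w (expi t)) (y) => a b [c q]; rewrite !ReM /=; ring.
  rewrite bintB; [|exact: bmeas_cst|exact: (bmeas_dalg dF)].
  rewrite bint_cst hmv -/y [y^* * y]mulrC mulJc ReM /=; ring.
by rewrite -hG; apply: key; exact: hC.
Qed.

Lemma disk_mean_iter_cvg c k : modulus c <= 1 ->
    (forall z, modulus z < 1 -> (fun n => hyp (It n w z) (It n w 0)) @ \oo --> (1 : R)) ->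
  (fun n => disk_mean (p (iter n sigma w)) (fun z => c * z ^+ k) - Re (c * It n w 0 ^+ k)) @ \oo
    --> (0 : R).
Proof.
move=> c1 hc; have [f [mf f0 f1 hf]] := density_w.
have dF : dalg (fun z : R[i] => c * z ^+ k).
  by apply: dalgM; [exact: dalg_cst|apply: dalgX; exact: dalg_id].
have z0 : modulus (0 : R[i]) < 1 by rewrite Normc.normc0.
have := density_dalg_cvg mf f0 f1 (U := fun n z => c * It n w z ^+ k).
have -> : (fun n => disk_mean (p (iter n sigma w)) (fun z => c * z ^+ k) - Re (c * It n w 0 ^+ k)) =
   (fun n => \int[unif]_t (Re (c * It n w (expi t) ^+ k) * f t) - Re (c * It n w 0 ^+ k)).
  apply/funext => n; congr (_ - _); rewrite /disk_mean (hf n _ (bmeas_dalg_disk dF)).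
  apply: eq_Rintegral => t _; rewrite /on_disk iter_circle ?lexx//.
  exact: expi_modulus.
apply.
- move=> n; apply: dalgM; [exact: dalg_cst|apply: dalgX; exact: dalg_iter].
- move=> n z z1; rewrite Normc.normcM modulusX mulr_ile1 ?modulus_ge0 ?exprn_ge0 ?modulus_ge0//.
  by rewrite exprn_ile1 ?modulus_ge0// iter_le1.
- move=> z z1; have hz := hc z z1.
  have hs : (fun n => k%:R * Num.sqrt (hyp (It n w z) (It n w 0) - 1)) @ \oo --> (0 : R).
    have h0 : 0 = k%:R * Num.sqrt (1 - 1) :> R by rewrite subrr sqrtr0 mulr0.
    rewrite [X in _ --> X]h0; apply: cvgMr.
    have h1 : (fun n => hyp (It n w z) (It n w 0) - 1) @ \oo --> (1 - 1 : R).
      by apply: cvgB => //; exact: cvg_cst.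
    by apply: (continuous_cvg _ _ h1); exact: sqrt_continuous.
  apply: (squeeze_cvgr _ (cvg_cst 0) hs); apply: nearW => n.
  rewrite modulus_ge0/= -mulrBr Normc.normcM.
  apply: (@le_trans _ _ (modulus (It n w z ^+ k - It n w 0 ^+ k))).
    by rewrite ler_piMl// modulus_ge0.
  apply: (le_trans (modulus_subX _ _ _)); rewrite ?iter_le1 ?(ltW z1) ?(ltW z0)//.
  rewrite ler_wpM2l// -[leLHS]ger0_norm ?modulus_ge0// -sqrtr_sqr ler_sqrt.
    by rewrite sqr_dist_le_hyp ?iter_lt1.
  by rewrite subr_ge0 hyp_ge1 ?iter_lt1.
Qed.

End fiber.

(** Fibres where the hypotheses of [hyp_iter_cvg] can be met with a common threshold. As k grows
    these sets exhaust almost all fibres of degree at least two, so one of them has positive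
    probability. *)
Definition contracting_set (k : nat) : set Omega :=
  [set w | [/\ modulus (x w) ^+ 2 <= 1 - k.+1%:R^-1, (1 < degree T w)%N &
     k.+1%:R^-1 <= contraction_cst (zeros T w 0) (zeros T w 1)]].

Lemma measurable_contracting_set k : measurable (contracting_set k).
Proof.
have m1 : measurable [set w | modulus (x w) ^+ 2 <= 1 - k.+1%:R^-1].
  have mf : measurable_fun [set: Omega] (fun w => modulus (x w) ^+ 2).
    by apply: measurable_funX; apply: measurable_modulus; exact: measurable_barycenter.
  rewrite (_ : [set w | _] = (fun w => modulus (x w) ^+ 2) @^-1` `]-oo, (1 - k.+1%:R^-1)]).
    by rewrite -[X in measurable X]setTI; apply: mf => //; exact: measurable_itv.
  by apply/seteqP; split => w /=; rewrite in_itv.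
pose c w := if (1 < degree T w)%N then contraction_cst (zeros T w 0) (zeros T w 1) else 0 : R.
have mc : measurable_fun [set: Omega] c.
  apply: (@measurable_on_degree _ _ _ T) => j j0.
  have [j1|j1] := leqP j 1.
    apply: (eq_measurable_fun (fun=> 0 : R)); last exact: measurable_cst.
    by move=> w; rewrite inE /= /c => ->; rewrite ltnNge j1.
  apply: (eq_measurable_fun (fun w => contraction_cst (zeros T w 0) (zeros T w 1))).
    by move=> w; rewrite inE /= /c => ->; rewrite j1.
  have z0 := @measurable_zero_on _ _ _ T j 0 j0.
  have z1 := @measurable_zero_on _ _ _ T j 1 j1.
  have mz0 := measurable_modulus z0; have mz1 := measurable_modulus z1.
  apply: measurable_funM => //; apply: measurable_funM; last first.
    by apply: measurable_funX; exact: measurable_funB.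
  by apply: measurable_funM; apply: measurable_funB => //; exact: measurable_funX.
have k0 : 0 < (k.+1%:R : R)^-1 by rewrite invr_gt0.
rewrite (_ : contracting_set k = [set w | modulus (x w) ^+ 2 <= 1 - k.+1%:R^-1] `&`
   c @^-1` `[k.+1%:R^-1, +oo[).
  apply: measurableI => //; rewrite -[X in measurable X]setTI; exact: mc.
apply/seteqP; split => w /=; rewrite in_itv/= andbT /c.
  by move=> [-> -> ->].
by move=> [h1]; case: ifP => // _; rewrite leNgt k0.
Qed.

Lemma contracting_set_pos : exists k, (0 < P (contracting_set k))%E.
Proof.
apply: contrapT => hk.
have h0 k : P (contracting_set k) = 0%E.
  apply/eqP; rewrite eq_le measure_ge0 andbT leNgt; apply/negP => h.
  by apply: hk; exists k.
have hU : {ae P, forall w, forall k, ~ contracting_set k w}.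
  apply: ae_all_nat => k; exists (contracting_set k); split.
  - exact: measurable_contracting_set.
  - exact: h0.
  - by move=> w /= /contrapT.
have hN : {ae P, forall w, ~ (1 < degree T w)%N}.
  apply: (aeS2 hU ae_regular_fiber) => w hw rw dw.
  have x1 : modulus (x w) < 1 by apply: barycenter_lt1 (rw.1 0%N); exact: kernel_circle.
  have px := one_minus_sqr x1.
  have pc : 0 < contraction_cst (zeros T w 0) (zeros T w 1).
    apply: contraction_cst_gt0; apply: (@zeros_disk _ _ _ T) => //; exact: ltnW.
  pose e := Num.min (1 - modulus (x w) ^+ 2) (contraction_cst (zeros T w 0) (zeros T w 1)).
  have e0 : 0 < e by rewrite lt_min px.
  pose k := Num.truncn e^-1.
  have ek : (k.+1%:R : R)^-1 <= e.
    rewrite -[leRHS]invrK lef_pV2 ?posrE ?invr_gt0//; apply/ltW.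
    exact: truncnS_gt.
  apply: (hw k); split => //.
    by rewrite lerBrDl -lerBrDr (le_trans ek)// ge_min lexx.
  by rewrite (le_trans ek)// ge_min lexx orbT.
move: deg2; have [N [mN N0 AN]] := hN; rewrite ltNge => /negP; apply.
have md : measurable [set w | (1 < degree T w)%N].
  have := @measurable_degree _ _ _ T measurableT [set j | (1 < j)%N] I; rewrite setTI.
  exact.
rewrite -N0; apply: le_measure; rewrite ?inE// => w dw.
by apply: AN => /=; apply.
Qed.

(** Orbits return to a contracting set infinitely often. At such times the barycenter is away from
    the circle, and [barycenter_nonescape], with error half the threshold, transfers this to the
    orbit of 0. *)
Lemma ae_hyp_cvg : {ae P, forall w, forall z, modulus z < 1 ->
  (fun n => hyp (It n w z) (It n w 0)) @ \oo --> (1 : R)}.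
Proof.
have key (a b c C : R) : b <= 1 - a -> 1 - b <= C * (1 - c) + a / 2 -> a / 2 <= (1 - c) * C.
  by move=> h1 h4; lra.
have [k hk] := contracting_set_pos.
have hrec := recurrence ms mp erg (measurable_contracting_set k) hk.
apply: (aeS2 hrec ae_regular_fiber) => w hv rw z z1.
have k0 : 0 < (k.+1%:R : R)^-1 by rewrite invr_gt0.
have k20 : 0 < (k.+1%:R : R)^-1 / 2 by rewrite divr_gt0.
have [C C0 hC] := barycenter_nonescape rw k20.
apply: (@hyp_iter_cvg _ _ _ T sigma w z 0 z1 _ (k.+1%:R^-1 / 2 / C) (k.+1%:R^-1)) => //.
- by rewrite Normc.normc0.
- by rewrite divr_gt0.
move=> m; have [n mn [h1 h2 h3]] := hv m; exists n => //; split => //.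
by rewrite ler_pdivrMr//; exact: key h1 (hC n).
Qed.

(** Along the orbit the k-th moment of the fibre measure and the k-th power of its barycenter are
    both asymptotic to (T^n 0)^k, the second because the barycenter is the moment k = 1. Their
    difference is a function of the fibre, so [stationary_cvg0] makes it 0. *)
Lemma ae_moment c k : modulus c <= 1 ->
  {ae P, forall w, disk_mean (p w) (fun z => c * z ^+ k) = Re (c * x w ^+ k)}.
Proof.
move=> c1; have dF c' k' : dalg (fun z : R[i] => c' * z ^+ k').
  by apply: dalgM; [exact: dalg_cst|apply: dalgX; exact: dalg_id].
have x1 w : modulus (x w) <= 1 by apply: barycenter_le1; exact: kernel_circle.
have mX k' : measurable_fun [set: Omega] (fun w => x w ^+ k').
  elim: k' => [|k' ih]; first by under eq_fun do rewrite expr0; exact: measurable_cst.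
  by under eq_fun do rewrite exprS; apply: measurableC_mul => //; exact: measurable_barycenter.
pose Phi w : R := `|disk_mean (p w) (fun z => c * z ^+ k) - Re (c * x w ^+ k)|.
have bPhi : bmeas Phi.
  apply: bmeas_norm; apply: bmeasB; first exact: (bmeas_kernel_int mu (bmeas_dalg_disk (dF c k))).
  split.
    by apply: measurableC_Re; apply: measurableC_mul => //; exact: measurable_cst.
  exists 1 => w; rewrite (le_trans (Re_le_modulus _))// Normc.normcM modulusX.
  by rewrite mulr_ile1 ?modulus_ge0 ?exprn_ge0 ?modulus_ge0// exprn_ile1 ?modulus_ge0.
have : {ae P, forall w, Phi w = 0}.
  apply: (stationary_cvg0 ms mp bPhi); first by move=> w; exact: normr_ge0.
  apply: (aeS2 ae_hyp_cvg ae_regular_fiber) => w hh rw.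
  pose y n := It n w 0.
  have y1 n : modulus (y n) <= 1 by apply: iter_le1; rewrite Normc.normc0.
  have hk := disk_mean_iter_cvg rw k c1 hh.
  have hx c' : modulus c' <= 1 ->
      (fun n => Re (c' * (x (iter n sigma w) - y n))) @ \oo --> (0 : R).
    move=> c1'; have := disk_mean_iter_cvg rw 1 c1' hh.
    rewrite (_ : (fun n => _ - _) = (fun n => Re (c' * (x (iter n sigma w) - y n))))//.
    apply/funext => n; rewrite mulrBr ReB expr1; congr (_ - _).
    by rewrite -disk_mean_barycenter.
  have hmod : (fun n => modulus (x (iter n sigma w) - y n)) @ \oo --> (0 : R).
    have i1 : modulus (- 'i : R[i]) <= 1 by rewrite normcN /= expr0n expr1n add0r sqrtr1.
    have one1 : modulus (1 : R[i]) <= 1 by rewrite Normc.normc1.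
    have hs : (fun n => `|Re (1 * (x (iter n sigma w) - y n))| +
        `|Re (- 'i * (x (iter n sigma w) - y n))|) @ \oo --> (0 : R).
      have h0 : 0 = `|0 : R| + `|0 : R| by rewrite normr0 addr0.
      rewrite [X in _ --> X]h0.
      by apply: cvgD; apply: cvg_norm; exact: hx.
    apply: (squeeze_cvgr _ (cvg_cst 0) hs); apply: nearW => n; rewrite modulus_ge0/=.
    case: (x (iter n sigma w) - y n) => a b.
    have -> : Re (- 'i * (a +i* b)) = b by rewrite ReM /=; ring.
    rewrite mul1r /=.
    rewrite -[leRHS]ger0_norm ?addr_ge0// -sqrtr_sqr ler_sqrt ?sqr_ge0//.
    by rewrite sqrrD -(real_normK (num_real a)) -(real_normK (num_real b)) lerD2r lerDl
      mulrn_wge0// mulr_ge0.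
  have hb : (fun n => `|disk_mean (p (iter n sigma w)) (fun z => c * z ^+ k) - Re (c * y n ^+ k)| +
      k%:R * modulus (x (iter n sigma w) - y n)) @ \oo --> (0 : R).
    have h0 : 0 = `|0 : R| + k%:R * 0 by rewrite normr0 mulr0 addr0.
    rewrite [X in _ --> X]h0.
    by apply: cvgD; [exact: cvg_norm hk|exact: cvgMr].
  apply: (squeeze_cvgr _ (cvg_cst 0) hb); apply: nearW => n; rewrite normr_ge0/= /Phi.
  rewrite (_ : _ - _ = (disk_mean (p (iter n sigma w)) (fun z => c * z ^+ k) - Re (c * y n ^+ k))
    - Re (c * (x (iter n sigma w) ^+ k - y n ^+ k))); last by rewrite mulrBr ReB; ring.
  rewrite (le_trans (ler_normB _ _))// lerD2l (le_trans (Re_le_modulus _))// Normc.normcM.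
  rewrite (@le_trans _ _ (modulus (x (iter n sigma w) ^+ k - y n ^+ k)))//.
    by rewrite ler_piMl// modulus_ge0.
  exact: modulus_subX.
by move=> h; apply: (aeS h) => w /eqP; rewrite normr_eq0 subr_eq0 => /eqP.
Qed.

(** Countably many moments are settled on one set of full measure; density of polynomials then gives
    all of the disk algebra on that same set. *)
Lemma ae_disk_mean : {ae P, forall w, forall F, dalg F -> disk_mean (p w) F = Re (F (x w))}.
Proof.
have i1 : modulus ('i : R[i]) <= 1 by rewrite /= expr0n expr1n add0r sqrtr1.
have one1 : modulus (1 : R[i]) <= 1 by rewrite Normc.normc1.
have h1 := ae_all_nat (fun k => ae_moment k one1).
have h2 := ae_all_nat (fun k => ae_moment k i1).
apply: (aeS2 h1 h2) => w m1 m2 F hF.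
have dM k : dalg (fun z : R[i] => z ^+ k) by apply: dalgX; exact: dalg_id.
have dc c k : dalg (fun z : R[i] => c * z ^+ k) by apply: dalgM => //; exact: dalg_cst.
have x1 : modulus (x w) <= 1 by apply: barycenter_le1; exact: kernel_circle.
have hmono c k : disk_mean (p w) (fun z => c * z ^+ k) = Re (c * x w ^+ k).
  case: c => a b.
  transitivity (disk_mean (p w) (fun z => a%:C * (1 * z ^+ k) + b%:C * ('i * z ^+ k))).
    apply: disk_mean_ext; first exact: dc.
      by apply: dalgD; apply: dalgM => //; exact: dalg_cst.
    by move=> z _; case: (z ^+ k) => u v; apply: complex_eqP; rewrite !(ReD, ImD, ReM, ImM) /=; ring.
  rewrite disk_meanD; [|by apply: dalgM => //; exact: dalg_cst|by apply: dalgM => //; exact: dalg_cst].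
  rewrite (disk_mean_real _ _ (dc 1 k)) (disk_mean_real _ _ (dc 'i k)) m1 m2.
  by case: (x w ^+ k) => u v; rewrite !ReM /=; ring.
have hpoly (q : {poly R[i]}) : disk_mean (p w) (fun z => q.[z]) = Re q.[x w].
  have main n : dalg (fun z => \sum_(i < n) q`_i * z ^+ i) /\
      disk_mean (p w) (fun z => \sum_(i < n) q`_i * z ^+ i) = Re (\sum_(i < n) q`_i * x w ^+ i).
    elim: n => [|n [d1 ih]].
      split; first by under eq_fun do rewrite big_ord0; exact: dalg_cst.
      by under [X in disk_mean _ X]eq_fun do rewrite big_ord0; rewrite big_ord0 disk_mean_cst//; exact: kernel_circle.
    split; first by under eq_fun do rewrite big_ord_recr; exact: dalgD.
    under [X in disk_mean _ X]eq_fun do rewrite big_ord_recr.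
    by rewrite disk_meanD// ih hmono big_ord_recr ReD.
  have [_] := main (size q); rewrite -horner_coef => <-.
  by congr disk_mean; apply/funext => z; rewrite horner_coef.
apply/eqP; rewrite -subr_eq0 -normr_le0; apply/ler_addgt0Pl => e e0.
have e2 : 0 < e / 2 by rewrite divr_gt0.
have [q hq] := hF.2 _ e2; rewrite addr0.
have dq := dalg_poly q.
have hd : disk_mean (p w) F = disk_mean (p w) (fun z => F z - q.[z]) + disk_mean (p w) (fun z => q.[z]).
  rewrite -disk_meanD//; last exact: dalgB.
  by congr disk_mean; apply/funext => z; rewrite subrK.
rewrite hd hpoly -addrA -ReB (le_trans (ler_normD _ _))// [leRHS](splitr e) lerD//.
  by apply: disk_mean_le => //; exact: dalgB.
by rewrite (le_trans (Re_le_modulus _))// modulusB hq.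
Qed.

End identification.

(** * Measures are determined by their Poisson integrals *)

Section poisson_uniqueness.
Variable R : realType.
Local Notation unif := (@unif01 R).
Local Notation mR := (measurableTypeR R).

Lemma poissonE_conj (x z : R[i]) : modulus x < 1 -> modulus z = 1 ->
  poisson x z = Re ((1 + x^* * z) / (1 - x^* * z)).
Proof.
move=> x1 z1; rewrite poissonE//.
have h (u : R[i]) : Re ((1 + u) / (1 - u)) = Re ((1 + u^*) / (1 - u^*)).
  rewrite -[1 + u^*](_ : (1 + u)^* = _); last by case: u => a b; apply: complex_eqP => /=; ring.
  have -> : 1 - u^* = (1 - u)^* by rewrite conjcB conjC1.
  rewrite -conjcV -conjcM.
  by case: ((1 + u) / (1 - u)).
by rewrite h conjcM conjCK [z * _]mulrC.
Qed.

Lemma dalg_cayley (x : R[i]) : modulus x < 1 ->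
  dalg (fun z => (1 + x^* * z) / (1 - x^* * z)).
Proof.
move=> x1; apply: dalgM; first by apply: dalgD; [exact: dalg_cst|exact: dalg_lin].
apply: (@dalg_inv1B _ _ (modulus x)) => //; first exact: dalg_lin.
by move=> z z1; rewrite Normc.normcM modulusJ ler_piMr// modulus_ge0.
Qed.

Lemma bmeas_indic (B : set mR) : measurable B -> bmeas (\1_B : mR -> R).
Proof.
move=> mB; split; first exact: measurable_indic.
by exists 1 => t; rewrite indicE; case: (t \in B); rewrite ?normr1 ?normr0.
Qed.

Lemma bint_indic (l : probability mR R) B : measurable B -> (\int[l]_t \1_B t)%:E = l B.
Proof. by move=> mB; rewrite -bint_EFin ?integral_indic ?setIT//; exact: bmeas_indic. Qed.

Lemma ae_unif01_neq (a : R) : {ae unif, forall t : mR, t != a}.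
Proof.
exists ([set a] : set mR); split; first by [].
  rewrite /unif01 /mrestr; apply/eqP; rewrite -measure_le0.
  apply: (@le_trans _ _ (lebesgue_measure [set a])); last by rewrite lebesgue_measure_set1.
  by apply: le_measure; rewrite ?inE//; apply: measurableI => //; exact: measurable_itv.
by move=> t /= /negP; rewrite negbK => /eqP.
Qed.

(** Averaging Poisson kernels over s in a ray B approximates the indicator of B, except at the
    boundary points of B and of [0, 1), which are null for both measures. Fubini's theorem moves the
    average outside, where the two measures cannot be told apart. *)
Lemma poisson_integrals_unique (l1 l2 : probability mR R) :
    (forall A : set mR, {ae unif, forall t, A t} -> {ae l1, forall t, A t}) ->
    (forall A : set mR, {ae unif, forall t, A t} -> {ae l2, forall t, A t}) ->
    (forall z, modulus z < 1 ->
      \int[l1]_t poisson z (expi t) = \int[l2]_t poisson z (expi t)) ->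
  forall B, measurable B -> l1 B = l2 B.
Proof.
move=> d1 d2 hP; apply: (@measure_unique _ R mR (@RGenOInfty.G R : set (set mR))
  (fun k => (`]- k%:R, +oo[%classic : set mR))).
- exact: RGenOInfty.measurableE.
- move=> _ _ [a ->] [b ->]; exists (Num.max a b); apply/seteqP; split => t /=.
    by rewrite !in_itv/= !andbT gt_max => -[-> ->].
  by rewrite !in_itv/= !andbT gt_max => /andP[].
- by move=> k; exists (- k%:R).
- apply/seteqP; split => // t _; exists (Num.truncn `|t|).+1 => //=.
  rewrite in_itv/= andbT ltrNl (le_lt_trans _ (truncnS_gt _))//.
  by rewrite -normrN ler_norm.
- move=> _ [a ->]; set B := `]a, +oo[%classic.
  have mB : measurable (B : set mR) by exact: measurable_itv.
  have bB := bmeas_indic mB.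
  apply: etrans (esym (bint_indic l1 mB)) _; apply: etrans _ (bint_indic l2 mB); congr EFin.
  pose H n (t : mR) : R := \int[unif]_s (\1_B s * poisson ((radius R n)%:C * expi s) (expi t)).
  have bHp n : bmeas (fun st : mR * mR => 1 * (\1_B st.1 * poisson ((radius R n)%:C * expi st.1) (expi st.2))).
    apply: (@bmeas_poisson_prod R (radius R n) (fun=> 1) (\1_B)) => //; last exact: bmeas_cst.
    exact: radius_itv.
  have bH n : bmeas (H n).
    have := bmeas_int2 unif unif (bHp n); rewrite /=.
    by under [X in bmeas X]eq_fun do under eq_Rintegral do rewrite mul1r.
  have H1 n t : `|H n t| <= 1.
    rewrite /H; under eq_Rintegral do rewrite poisson_sym.
    have bP : bmeas (fun s : mR => poisson ((radius R n)%:C * expi t) (expi s)).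
      by apply: bmeas_poisson; exact: modulus_radius.
    apply: (le_trans (bint_normr _ _)); first exact: bmeasM.
    rewrite -(poisson_int1 (modulus_radius n t)); apply: bint_le => //.
      by apply: bmeas_norm; exact: bmeasM.
    move=> s; have p0 : 0 <= poisson ((radius R n)%:C * expi t) (expi s).
      by rewrite ltW// poisson_gt0 ?modulus_radius ?expi_modulus.
    rewrite normrM [X in _ * X](ger0_norm p0) ler_piMl//.
    by rewrite indicE; case: (s \in B); rewrite ?normr1 ?normr0.
  have cH : {ae unif, forall t : mR, H ^~ t @ \oo --> (\1_B t : R)}.
    have a2 := aeS2 (@ae_unif01 R) (ae_unif01_neq 0)
      (C := fun t : mR => (0 <= (t : R) < 1) /\ (t : R) != 0) (fun t => @conj _ _).
    apply: (aeS2 a2 (ae_unif01_neq a)).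
    move=> t [/andP[t0 t1] tn0] tna.
    have t01 : 0 < t < 1 by rewrite lt_neqAle eq_sym tn0 t0.
    apply: (poisson_approx bB t01).
    have := neq_lt t a; rewrite tna => /esym/orP[ta|ta].
      have hn : \forall s \near t, \1_B s = (0 : R).
        have := @lt_nbhsl _ t a ta; apply: filterS => s sa.
        by rewrite indicE memNset// /B /= in_itv/= andbT => h; have := lt_trans sa h; rewrite ltxx.
      rewrite /prop_for /continuous_at (nbhs_singleton hn).
      by apply: cvg_near_cst; exact: hn.
    have hn : \forall s \near t, \1_B s = (1 : R).
      have := @lt_nbhsr _ a t ta; apply: filterS => s sa.
      by rewrite indicE mem_set// /B /= in_itv/= sa.
    rewrite /prop_for /continuous_at (nbhs_singleton hn).
    by apply: cvg_near_cst; exact: hn.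
  have lim (l : probability mR R) :
      (forall A : set mR, {ae unif, forall t, A t} -> {ae l, forall t, A t}) ->
      (fun n => \int[l]_t H n t) @ \oo --> \int[l]_t (\1_B t : R).
    move=> dl; apply: (@bounded_convergence _ _ _ _ _ _ 1) => //.
    - by move=> n; have [] := bH n.
    - exact: (dl _ cH).
  have swap (l : probability mR R) n : \int[l]_t H n t =
      \int[unif]_s (\1_B s * \int[l]_t poisson ((radius R n)%:C * expi s) (expi t)).
    transitivity (\int[l]_t \int[unif]_s (1 * (\1_B s * poisson ((radius R n)%:C * expi s) (expi t)))).
      by apply: eq_Rintegral => t _; apply: eq_Rintegral => s _; rewrite mul1r.
    rewrite -(bint_fubini unif l (bHp n)); apply: eq_Rintegral => s _ /=.
    rewrite -bintZ; last by apply: bmeas_poisson; exact: modulus_radius.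
    by apply: eq_Rintegral => t _; rewrite mul1r.
  have e : (fun n => \int[l1]_t H n t) = (fun n => \int[l2]_t H n t).
    apply/funext => n; rewrite !swap; apply: eq_Rintegral => s _.
    by rewrite hP//; exact: modulus_radius.
  have L1 := lim l1 d1; have L2 := lim l2 d2; rewrite e in L1.
  by rewrite -(cvg_lim (@Rhausdorff R) L1) -(cvg_lim (@Rhausdorff R) L2).
- by move=> k; rewrite (le_lt_trans (probability_le1 _ _))// ltry.
Qed.

Lemma density_ae (f : mR -> R) (mf : measurable_fun [set: mR] f) (f0 : forall t, 0 <= f t)
    (A : set mR) : {ae unif, forall t, A t} -> {ae density_measure unif mf f0, forall t, A t}.
Proof.
move=> [N [mN N0 AN]]; exists N; split => //.
have : null_set unif N by move=> B mB BN; apply/eqP; rewrite -measure_le0 -N0 le_measure ?inE.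
rewrite /= /density_measure => hN.
apply: (null_set_integral _ _ N0) => //.
by apply/measurable_EFinP; exact: measurable_funTS.
Qed.

Section fiber_measure.
Variable nu : probability R[i] R.
Hypothesis nu_circle : nu (@circle R) = 1%E.
Hypothesis nu_dom : nu `<< @circle_measure R.
Variable x : R[i].
Hypothesis x1 : modulus x < 1.
Hypothesis nu_mean : forall F, dalg F -> disk_mean nu F = Re (F x).

Lemma measurable_poisson_expi : measurable_fun [set: mR] (fun t : mR => poisson x (expi t)).
Proof. by have [] := bmeas_poisson x1. Qed.

Lemma poisson_expi_ge0 (t : mR) : 0 <= poisson x (expi t).
Proof. by rewrite ltW// poisson_gt0// expi_modulus. Qed.

(** As a function of its boundary variable the Poisson kernel is the real part of a function of the
    disk algebra, so [nu_mean] computes the Poisson integrals of [nu]; the Poisson formula computes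
    those of the candidate. *)
Lemma poisson_measureE A : measurable A ->
  nu A = density_measure unif measurable_poisson_expi poisson_expi_ge0 (@expi R @^-1` A).
Proof.
have [f [mf f0 hf]] := density_exists nu_dom.
have f1 := density_total hf.
have fT : density_measure unif mf f0 setT = 1%E by exact: f1.
have pT : density_measure unif measurable_poisson_expi poisson_expi_ge0 setT = 1%E.
  rewrite /density_measure bint_EFin ?poisson_int1//.
  exact: bmeas_poisson.
pose l1 : probability mR R := as_probability (m := density_measure unif mf f0) fT.
pose l2 : probability mR R := as_probability
  (m := density_measure unif measurable_poisson_expi poisson_expi_ge0) pT.
have nul B : measurable B -> nu B = l1 (@expi R @^-1` B).
  move=> mA; have mE : measurable (@expi R @^-1` B : set mR).
    by rewrite -[X in measurable X]setTI; exact: measurable_expi.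
  have := hf (fun z => (\1_B z)%:E) _ _; rewrite integral_indic// setIT => ->.
  - rewrite /l1 /as_probability /= /density_measure [RHS]integral_mkcond.
    apply: eq_integral => t _; rewrite patchE /= indicE.
    rewrite (_ : (expi t \in B) = (t \in @expi R @^-1` B))//.
    by case: ifP => _; rewrite ?mul1e ?mul0e.
  - by apply/measurable_EFinP; exact: measurable_indic.
  - by move=> z; rewrite lee_fin.
move=> mA; transitivity (l2 (@expi R @^-1` A)); last by [].
rewrite nul//; apply: poisson_integrals_unique.
- by move=> B hB; exact: (density_ae mf f0 hB).
- by move=> B hB; exact: (density_ae measurable_poisson_expi poisson_expi_ge0 hB).
- move=> z z1; have dC := dalg_cayley z1.
  have e1 : \int[l1]_t poisson z (expi t) = disk_mean nu (fun u => (1 + z^* * u) / (1 - z^* * u)).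
    rewrite /disk_mean (@bint_pushforward _ _ mR R[i] R l1 nu (@expi R) _ (@measurable_expi R) nul
      (bmeas_dalg_disk dC)).
    apply: eq_Rintegral => t _; rewrite /on_disk expi_modulus lexx.
    by rewrite poissonE_conj// expi_modulus.
  rewrite e1 nu_mean// -(poisson_formula dC x1).
  have bz := bmeas_poisson z1; have bx := bmeas_poisson x1.
  apply/EFin_inj; rewrite -!bint_EFin//; last first.
    by apply: bmeasM => //; exact: (bmeas_dalg dC).
  rewrite (@ge0_integral_density _ _ _ unif l2 _ measurable_poisson_expi poisson_expi_ge0)//.
  - apply: eq_integral => t _; rewrite EFinM; congr (_ * _)%E.
    by rewrite poissonE_conj// expi_modulus.
  - by apply/measurable_EFinP; have [] := bz.
  - by move=> t; rewrite lee_fin ltW// poisson_gt0// expi_modulus.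
- by rewrite -[X in measurable X]setTI; exact: measurable_expi.
Qed.

Lemma ge0_integral_poisson (F : R[i] -> \bar R) : measurable_fun [set: R[i]] F ->
  (forall z, 0 <= F z)%E ->
  (\int[nu]_z F z = \int[unif]_t (F (expi t) * (poisson x (expi t))%:E))%E.
Proof.
move=> mF F0.
pose m : {measure set mR -> \bar R} := density_measure unif measurable_poisson_expi poisson_expi_ge0.
have e : (\int[pushforward m (@expi R)]_z F z = \int[nu]_z F z)%E.
  apply: eq_measure_integral; first exact: measurable_expi.
  by move=> mexpi A mA _; exact: (esym (poisson_measureE mA)).
rewrite -e (@ge0_integral_pushforward _ _ mR _ _ _ (@measurable_expi R)) ?preimage_setT//.
rewrite (@ge0_integral_density _ _ _ unif m _ measurable_poisson_expi poisson_expi_ge0)//.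
  exact: measurableT_comp mF (@measurable_expi R).
by move=> t; exact: F0.
Qed.

End fiber_measure.

End poisson_uniqueness.

(** * Fibres with Poisson measures *)

Section good_fibers.
Context d (Omega : measurableType d) (R : realType) (P : probability Omega R).
Variables (sigma : Omega -> Omega) (T : blaschke_cocycle Omega R).
Variable mu : R.-pker Omega ~> R[i].
Local Notation unif := (@unif01 R).
Local Notation It := (cocycle_iter sigma T).
Local Notation p := (kernel_prob mu).
Local Notation x w := (barycenter (p w)).

(** The almost sure facts, at all times of the orbit of [w], from which the entropy estimates on a
    fibre become deterministic. *)
Record good_fiber (w : Omega) : Prop := GoodFiber {
  good_circle : forall n, p (iter n sigma w) (@circle R) = 1%E;
  good_disk : forall n, modulus (x (iter n sigma w)) < 1;
  good_iter : forall n, x (iter n sigma w) = It n w (x w);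
  good_pushforward : forall n A, measurable A -> p (iter n sigma w) A = p w (It n w @^-1` A);
  good_hyp : (fun n => hyp (x (iter n sigma w)) (It n w 0)) @ \oo --> (1 : R);
  good_poisson : forall n (F : R[i] -> \bar R), measurable_fun [set: R[i]] F ->
    (forall z, 0 <= F z)%E -> (\int[p (iter n sigma w)]_z F z =
      \int[unif]_t (F (expi t) * (poisson (x (iter n sigma w)) (expi t))%:E))%E
}.

Hypothesis ms : measurable_fun [set: Omega] sigma.
Hypothesis mp : measure_preserving P sigma.
Hypothesis erg : ergodic P sigma.
Hypothesis acim : random_acim P sigma T mu.
Hypothesis deg2 : (0 < P [set w | (1 < degree T w)%N])%E.

Lemma ae_good_fiber : {ae P, forall w, good_fiber w}.
Proof.
have h0 w : p w (@circle R) = 1%E := kernel_circle acim w.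
have h1 := ae_preserving_iter ms mp (ae_disk_mean ms mp erg acim deg2).
have h2 := ae_hyp_cvg ms mp erg acim deg2.
have h3 := ae_regular_fiber ms mp acim.
apply: (aeS2 (aeS2 h1 h2 (fun w => @conj _ _)) h3) => w [hm hh] [hdom hpush].
have hd n : modulus (x (iter n sigma w)) < 1.
  exact: barycenter_lt1 (h0 _) (hdom n).
have hit n : x (iter n sigma w) = It n w (x w).
  (* The iterate T^n is itself in the disk algebra: pulling the linear function back by invariance
     and evaluating at the barycenter of the initial fibre shows that barycenters form an orbit. *)
  have key c : Re (c * x (iter n sigma w)) = Re (c * It n w (x w)).
    have dc : dalg (fun z => c * z) by exact: dalg_lin.
    have dcI : dalg (fun z => c * It n w z).
      by apply: dalgM; [exact: dalg_cst|exact: dalg_iter].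
    rewrite -(hm n _ dc) -(hm 0%N _ dcI) /disk_mean.
    rewrite (bint_pushforward (measurable_It sigma T n w) (hpush n) (bmeas_dalg_disk dc)).
    apply: bint_ae.
    - by apply: (bmeas_comp _ (bmeas_dalg_disk dc)); exact: measurable_It.
    - exact: bmeas_dalg_disk.
    - apply: (aeS (ae_circle (h0 w))) => z z1.
      by rewrite /on_disk iter_circle// z1.
  apply: complex_eqP; first by have := key 1; rewrite !mul1r.
  by have := key (- 'i); rewrite !ReM /=; lra.
split => //.
- have := hh _ (hd 0%N); rewrite (_ : (fun n => hyp (It n w (x (iter 0 sigma w))) _) =
    (fun n => hyp (x (iter n sigma w)) (It n w 0)))//.
  by apply/funext => n; congr (hyp _ _); exact: (esym (hit n)).
- by move=> n F mF F0; apply: ge0_integral_poisson => //; exact: hm.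
Qed.

End good_fibers.

(** * Exponents and log-densities of the fibre measures *)

Section good_fiber_theory.
Context d (Omega : measurableType d) (R : realType).
Variables (sigma : Omega -> Omega) (T : blaschke_cocycle Omega R).
Variable mu : R.-pker Omega ~> R[i].
Local Notation unif := (@unif01 R).
Local Notation mR := (measurableTypeR R).
Local Notation It := (cocycle_iter sigma T).
Local Notation p := (kernel_prob mu).
Local Notation x w := (barycenter (p w)).

Lemma bint_good w n (G : R[i] -> R) : good_fiber sigma T mu w -> bmeas G ->
  \int[p (iter n sigma w)]_z G z = \int[p w]_z G (It n w z).
Proof.
move=> gw bG; apply: bint_pushforward => //; first exact: measurable_It.
exact: good_pushforward gw n.
Qed.

Definition on_circle (F : R[i] -> R) (z : R[i]) : R := if modulus z == 1 then F z else 0.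

Lemma measurable_circle_pred d' (X : measurableType d') (z : X -> R[i]) :
  measurable_fun [set: X] z -> measurable_fun [set: X] (fun u => modulus (z u) == 1).
Proof.
by move=> mz; apply: measurable_fun_eqr; [exact: measurable_modulus|exact: measurable_cst].
Qed.

Lemma measurable_on_circle d' (X : measurableType d') (F : X -> R) (z : X -> R[i]) :
  measurable_fun [set: X] z -> measurable_fun [set: X] F ->
  measurable_fun [set: X] (fun u => if modulus (z u) == 1 then F u else 0).
Proof.
move=> mz mF; apply: measurable_fun_if => //; first exact: measurable_circle_pred.
exact: measurable_funTS.
Qed.

Lemma deriv_modulus_le w z : modulus z = 1 -> deriv_modulus T w z <=
  \sum_(i < degree T w) (1 - modulus (zeros T w i) ^+ 2) / (1 - modulus (zeros T w i)) ^+ 2.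
Proof. by move=> z1; apply: ler_sum => i _; apply: poisson_le => //; exact: zeros_disk. Qed.

(** Stands in for the supremum of |T_w'| over the circle; it is measurable in [w] term by term. *)
Definition deriv_bound w : R :=
  \sum_(i < degree T w) (1 - modulus (zeros T w i) ^+ 2) / (1 - modulus (zeros T w i)) ^+ 2.

Lemma poisson_ge (y z : R[i]) : modulus y < 1 -> modulus z = 1 ->
  (1 - modulus y ^+ 2) / 4 <= poisson y z.
Proof.
move=> y1 z1; rewrite /poisson ler_wpM2l ?(ltW (one_minus_sqr _))//.
have h : modulus (z - y) ^+ 2 <= 4.
  rewrite (_ : 4 = (2 : R) ^+ 2); last by rewrite -natrX.
  rewrite ler_sqr ?nnegrE ?modulus_ge0// (le_trans (le_normcD _ _))// normcN z1 [2]mulr2n.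
  by rewrite lerD2l ltW.
rewrite lef_pV2 ?posrE// exprn_gt0// modulus_gt0 subr_eq0.
by apply/eqP => zy; move: y1; rewrite -zy z1 ltxx.
Qed.

Lemma zero_disk0 w : modulus (zeros T w 0) < 1.
Proof. by apply: (@zeros_disk _ _ _ T); exact: degree_gt0. Qed.

Lemma deriv_modulus_ge w z : modulus z = 1 ->
  (1 - modulus (zeros T w 0) ^+ 2) / 4 <= deriv_modulus T w z.
Proof.
move=> z1; apply: le_trans (poisson_ge (zero_disk0 w) z1) _.
rewrite /deriv_modulus /bprod_deriv; have := degree_gt0 T w; have := @zeros_disk _ _ _ T w.
case: (degree T w) => // n zd _; rewrite big_ord_recl lerDl sumr_ge0// => i _.
by rewrite ltW// poisson_gt0//; exact: zd.
Qed.

Lemma deriv_lb_gt0 w : 0 < (1 - modulus (zeros T w 0) ^+ 2) / 4.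
Proof. by rewrite divr_gt0// one_minus_sqr// zero_disk0. Qed.

Let derivE w : [set modulus (derive1 (T w) z) | z in @circle R] =
  [set deriv_modulus T w z | z in @circle R].
Proof. by apply/seteqP; split => _ [z z1 <-]; exists z => //; rewrite blaschke_derivE. Qed.

Let circle1 : @circle R 1. Proof. exact: Normc.normc1. Qed.

Lemma inf_deriv_gt0 w : 0 < inf_deriv T w.
Proof.
apply: lt_le_trans (deriv_lb_gt0 w) _; rewrite /inf_deriv derivE; apply: lb_le_inf.
  by exists (deriv_modulus T w 1); exists 1.
by move=> _ [z z1 <-]; exact: deriv_modulus_ge.
Qed.

Lemma inf_deriv_le w z : modulus z = 1 -> inf_deriv T w <= deriv_modulus T w z.
Proof.
move=> z1; rewrite /inf_deriv derivE; apply: ge_inf; last by exists z.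
by exists ((1 - modulus (zeros T w 0) ^+ 2) / 4) => _ [u u1 <-]; exact: deriv_modulus_ge.
Qed.

Lemma measurable_deriv_bound : measurable_fun [set: Omega] deriv_bound.
Proof.
apply: (@measurable_on_degree _ _ _ T) => j j0.
apply: (eq_measurable_fun (fun w => \sum_(i < j)
   (1 - modulus (zeros T w i) ^+ 2) / (1 - modulus (zeros T w i)) ^+ 2)).
  by move=> w; rewrite inE /= /deriv_bound => ->.
apply: measurable_sum => i.
have mz := measurable_modulus (@measurable_zero_on _ _ _ T j i (ltn_ord i)).
apply: measurable_funM; first by apply: measurable_funB => //; exact: measurable_funX.
by apply: measurable_funV; apply: measurable_funX; exact: measurable_funB.
Qed.

Lemma measurable_degreeR : measurable_fun [set: Omega] (fun w => (degree T w)%:R : R).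
Proof.
apply: (@measurable_on_degree _ _ _ T) => j j0.
apply: (eq_measurable_fun (fun=> j%:R : R)); last exact: measurable_cst.
by move=> w; rewrite inE /= => ->.
Qed.

Lemma ln_bounds (a b y : R) : 0 < a -> a <= y -> y <= b -> `|ln y| <= `|ln a| + `|ln b|.
Proof.
move=> a0 ay yb; have y0 := lt_le_trans a0 ay; have b0 := lt_le_trans y0 yb.
have h1 : ln a <= ln y by rewrite ler_ln.
have h2 : ln y <= ln b by rewrite ler_ln.
have := ler_norm (ln b); have := ler_norm (- ln a); rewrite normrN => h3 h4.
have := normr_ge0 (ln a); have := normr_ge0 (ln b) => h5 h6.
by rewrite ler_norml; apply/andP; split; lra.
Qed.

Definition ln_deriv w : R[i] -> R := on_circle (fun z => ln (deriv_modulus T w z)).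

Definition ln_poisson w : R[i] -> R := on_circle (fun z => ln (poisson (x w) z)).

Lemma measurable_ln_comp d' (X : measurableType d') (f : X -> R) :
  measurable_fun [set: X] f -> measurable_fun [set: X] (fun u => ln (f u)).
Proof. exact: measurableT_comp (@measurable_ln R). Qed.

Lemma measurable_ln_deriv2 : measurable_fun [set: Omega * R[i]] (fun u => ln_deriv u.1 u.2).
Proof.
apply: measurable_on_circle => //; apply: measurable_ln_comp.
by apply: measurable_deriv_modulus; [exact: measurable_fst|exact: measurable_snd].
Qed.

Lemma bmeas_ln_deriv w : bmeas (ln_deriv w).
Proof.
split; first exact: (measurableT_comp measurable_ln_deriv2 (measurable_pair1 w)).
exists (`|ln ((1 - modulus (zeros T w 0) ^+ 2) / 4)| + `|ln (deriv_bound w)|) => z.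
rewrite /ln_deriv /on_circle; case: eqP => [z1|_]; last by rewrite normr0 addr_ge0.
by apply: ln_bounds; [exact: deriv_lb_gt0|exact: deriv_modulus_ge|exact: deriv_modulus_le].
Qed.

Lemma measurable_ln_poisson2 : measurable_fun [set: Omega * R[i]] (fun u => ln_poisson u.1 u.2).
Proof.
apply: measurable_on_circle => //; apply: measurable_ln_comp; apply: measurable_poisson => //.
exact: measurableT_comp (measurable_barycenter mu) measurable_fst.
Qed.

Lemma bmeas_ln_poisson w : modulus (x w) < 1 -> bmeas (ln_poisson w).
Proof.
move=> x1; split; first exact: (measurableT_comp measurable_ln_poisson2 (measurable_pair1 w)).
exists (`|ln ((1 - modulus (x w) ^+ 2) / 4)| + `|ln ((1 - modulus (x w) ^+ 2) / (1 - modulus (x w)) ^+ 2)|) => z.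
rewrite /ln_poisson /on_circle; case: eqP => [z1|_]; last by rewrite normr0 addr_ge0.
by apply: ln_bounds; [rewrite divr_gt0// one_minus_sqr|exact: poisson_ge|exact: poisson_le].
Qed.

Definition exponent w : R := \int[p w]_z ln_deriv w z.
(** On a good fibre this is the relative entropy of the fibre measure with respect to Lebesgue
    measure, equal to - ln (1 - |x w|^2). Nothing bounds its mean over [Omega]. *)
Definition diff_entropy w : R := \int[p w]_z ln_poisson w z.

Lemma measurable_kernel_Rint (k : Omega * R[i] -> R) : measurable_fun [set: Omega * R[i]] k ->
  measurable_fun [set: Omega] (fun w => \int[p w]_z k (w, z)).
Proof.
move=> mk; have mkE : measurable_fun [set: Omega * R[i]] (fun u => (k u)%:E) by exact/measurable_EFinP.
pose kp := ((fun u => (k u)%:E)^\+)%E; pose kn := ((fun u => (k u)%:E)^\-)%E.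
rewrite (_ : (fun w => \int[p w]_z k (w, z)) = (fun w => fine
    (\int[mu w]_z kp (w, z) - \int[mu w]_z kn (w, z))%E)); last first.
  apply/funext => w; rewrite /Rintegral integralE; congr (fine (_ - _)%E);
  by apply: eq_integral => z _; rewrite /kp /kn ?funeposE ?funenegE.
apply: (measurableT_comp (@fine_measurable R _ measurableT)); apply: emeasurable_funB.
  apply: (@measurable_fun_integral_finite_kernel _ _ _ _ _ kp mu).
    by move=> u; exact: funepos_ge0.
  exact: (measurable_funepos mkE).
apply: (@measurable_fun_integral_finite_kernel _ _ _ _ _ kn mu).
  by move=> u; exact: funeneg_ge0.
exact: (measurable_funeneg mkE).
Qed.

Lemma measurable_exponent : measurable_fun [set: Omega] exponent.
Proof. exact: (measurable_kernel_Rint measurable_ln_deriv2). Qed.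

Lemma measurable_diff_entropy : measurable_fun [set: Omega] diff_entropy.
Proof. exact: (measurable_kernel_Rint measurable_ln_poisson2). Qed.

Lemma circle_bint_le (nu : probability R[i] R) (f g : R[i] -> R) : nu (@circle R) = 1%E ->
  bmeas f -> bmeas g -> (forall z, modulus z = 1 -> f z <= g z) ->
  \int[nu]_z f z <= \int[nu]_z g z.
Proof.
move=> nu1 bf bg fg.
have bm : bmeas (fun z => Num.max (f z) (g z)).
  have [mf [M hM]] := bf; have [mg [N hN]] := bg; split; first exact: measurable_maxr.
  exists (M + N) => z; have M0 : 0 <= M := le_trans (normr_ge0 _) (hM z).
  have N0 : 0 <= N := le_trans (normr_ge0 _) (hN z).
  rewrite /Num.max; case: ifP => _.
    by rewrite (le_trans (hN z))// lerDr.
  by rewrite (le_trans (hM z))// lerDl.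
rewrite [leRHS](_ : _ = \int[nu]_z Num.max (f z) (g z)).
  by apply: bint_le => // z; rewrite le_max lexx.
apply: bint_ae => //; apply: (aeS (ae_circle nu1)) => z z1.
by apply/esym/max_idPr; exact: fg.
Qed.

Lemma exponent_ge w : p w (@circle R) = 1%E -> ln (inf_deriv T w) <= exponent w.
Proof.
move=> w1; rewrite -[leLHS](bint_cst (p w)); apply: circle_bint_le => //.
- exact: bmeas_cst.
- exact: bmeas_ln_deriv.
move=> z z1; rewrite /ln_deriv /on_circle z1 eqxx ler_ln ?posrE ?inf_deriv_gt0//.
  exact: inf_deriv_le.
exact: deriv_modulus_gt0.
Qed.

Lemma exponent_le w (M : R) : p w (@circle R) = 1%E -> deriv_bound w <= M ->
  exponent w <= ln M.
Proof.
move=> w1 hM; rewrite -[leRHS](bint_cst (p w)); apply: circle_bint_le => //.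
- exact: bmeas_ln_deriv.
- exact: bmeas_cst.
move=> z z1; rewrite /ln_deriv /on_circle z1 eqxx.
have h0 := deriv_modulus_gt0 T w z1; have h1 := deriv_modulus_le w z1.
have h2 := le_trans h1 hM; rewrite ler_ln ?posrE//.
exact: lt_le_trans h2.
Qed.

Definition ln_iter_deriv_on n w : R[i] -> R := on_circle (fun z => ln (iter_deriv T sigma n w z)).

Lemma ln_iter_deriv_onE n w z : modulus z = 1 ->
  ln_iter_deriv_on n w z = \sum_(i < n) ln_deriv (iter i sigma w) (It i w z).
Proof.
move=> z1; rewrite /ln_iter_deriv_on /on_circle z1 eqxx ln_iter_deriv//.
by apply: eq_bigr => i _; rewrite /ln_deriv /on_circle iter_circle// eqxx.
Qed.

Lemma bmeas_sum d' (X : measurableType d') n (f : 'I_n -> X -> R) :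
  (forall i, bmeas (f i)) -> bmeas (fun u => \sum_(i < n) f i u).
Proof.
elim: n f => [|n ih] f hf; first by under eq_fun do rewrite big_ord0; exact: bmeas_cst.
under eq_fun do rewrite big_ord_recl; apply: bmeasD => //.
exact: ih.
Qed.

Lemma bint_sum d' (X : measurableType d') (nu : probability X R) n (f : 'I_n -> X -> R) :
  (forall i, bmeas (f i)) ->
  \int[nu]_u (\sum_(i < n) f i u) = \sum_(i < n) \int[nu]_u f i u.
Proof.
elim: n f => [|n ih] f hf.
  by under eq_Rintegral do rewrite big_ord0; rewrite bint_cst big_ord0.
under eq_Rintegral do rewrite big_ord_recl; rewrite bintD//; last exact: bmeas_sum.
by rewrite ih// big_ord_recl.
Qed.

Hypothesis ms : measurable_fun [set: Omega] sigma.

Lemma bmeas_ln_iter_deriv_on n w : bmeas (ln_iter_deriv_on n w).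
Proof.
have hb : bmeas (fun z => \sum_(i < n) ln_deriv (iter i sigma w) (It i w z)).
  apply: bmeas_sum => i; apply: (bmeas_comp _ (bmeas_ln_deriv _)); exact: measurable_It.
have [mb [M hM]] := hb; split.
  apply: measurable_on_circle => //; apply: measurable_ln_comp.
  exact: (measurable_iter_deriv T n ms (@measurable_cst _ _ _ _ _ w) (@measurable_id _ _ _)).
exists M => z; rewrite /ln_iter_deriv_on /on_circle; case: eqP => [z1|_].
  by have := hM z; rewrite -ln_iter_deriv_onE// /ln_iter_deriv_on /on_circle z1 eqxx.
by rewrite normr0 (le_trans (normr_ge0 _) (hM z)).
Qed.

Lemma exponent_sum n w : good_fiber sigma T mu w ->
  \int[p w]_z ln_iter_deriv_on n w z = \sum_(i < n) exponent (iter i sigma w).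
Proof.
move=> gw; have w1 := good_circle gw 0%N.
have hb (i : 'I_n) : bmeas (fun z => ln_deriv (iter i sigma w) (It i w z)).
  by apply: (bmeas_comp _ (bmeas_ln_deriv _)); exact: measurable_It.
transitivity (\int[p w]_z \sum_(i < n) ln_deriv (iter i sigma w) (It i w z)).
  apply: bint_ae; [exact: bmeas_ln_iter_deriv_on|exact: bmeas_sum|].
  by apply: (aeS (ae_circle w1)) => z z1; exact: ln_iter_deriv_onE.
rewrite bint_sum//; apply: eq_bigr => i _.
by rewrite /exponent (bint_good _ gw)//; exact: bmeas_ln_deriv.
Qed.

End good_fiber_theory.

(** * Entropy of finite partitions *)

Section finite_sums.
Variable R : realType.

Lemma ln_le_sub1 (y : R) : 0 < y -> ln y <= y - 1.
Proof. by move=> y0; have := expR_ge1Dx (ln y); rewrite lnK ?posrE//; lra. Qed.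

Lemma gibbs (I : finType) (p v : I -> R) : (forall i, 0 <= p i) -> \sum_i p i = 1 ->
    (forall i, 0 <= v i) -> \sum_i v i <= 1 -> (forall i, 0 < p i -> 0 < v i) ->
  - \sum_i p i * ln (p i) <= \sum_i p i * - ln (v i).
Proof.
move=> p0 p1 v0 v1 pv; rewrite -sumrN -subr_le0 -sumrB.
apply: (@le_trans _ _ (\sum_i (v i - p i))); last by rewrite sumrB p1 subr_le0.
apply: ler_sum => i _; have [pi0|/eqP pi0] := eqVneq (p i) 0.
  by rewrite pi0 !mul0r !subr0 oppr0 v0.
have pi : 0 < p i by rewrite lt_neqAle eq_sym p0 andbT; apply/eqP.
have vi := pv i pi.
have h := ln_le_sub1 (divr_gt0 vi pi); rewrite ln_div ?posrE// in h.
have := ler_wpM2l (p0 i) h; rewrite !mulrBr mulr1 mulrCA divff ?mulr1 ?gt_eqF//.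
lra.
Qed.

Lemma sum_inj_le (I J : finType) (h : I -> J) (F : J -> R) : injective h ->
  (forall j, 0 <= F j) -> \sum_i F (h i) <= \sum_j F j.
Proof.
move=> hi F0; rewrite (partition_big h xpredT)//=; apply: ler_sum => j _.
have [i /eqP hij|none] := pickP (fun i => h i == j); last by rewrite big_pred0.
by rewrite (big_pred1 i) ?hij// => k; rewrite /= -hij (inj_eq hi).
Qed.

Lemma fekete (a : nat -> R) : (forall n, 0 <= a n) ->
    (forall n m, a (n + m)%N <= a n + a m) ->
  exists l : R, [/\ (fun n => n%:R^-1 * a n) @ \oo --> l, 0 <= l &
    forall n, (0 < n)%N -> l <= n%:R^-1 * a n].
Proof.
move=> a0 asub; pose S := [set n.+1%:R^-1 * a n.+1 | n in [set: nat]].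
have S0 : S !=set0 by exists (1%:R^-1 * a 1%N), 0%N.
have Slb : has_lbound S by exists 0 => _ [n _ <-]; rewrite mulr_ge0// invr_ge0.
pose l := inf S; have ln n : (0 < n)%N -> l <= n%:R^-1 * a n.
  by case: n => // n _; apply: ge_inf => //; exists n.
exists l; split => //; last by apply: lb_le_inf => // _ [n _ <-]; rewrite mulr_ge0// invr_ge0.
apply/cvgrPdist_le => e e0; have e2 : 0 < e / 2 by rewrite divr_gt0.
have [_ [k _ <-] hk] := inf_adherent e2 (conj S0 Slb).
have amul q r : a (q * k.+1 + r)%N <= q%:R * a k.+1 + a r.
  elim: q => [|q ih]; first by rewrite mul0n add0n mul0r add0r.
  rewrite mulSn -addnA (le_trans (asub _ _))// -natr1 mulrDl mul1r [_ + a k.+1]addrC -addrA.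
  by rewrite lerD2l.
pose M := \sum_(r < k.+1) a r.
have aM (r : nat) : (r < k.+1)%N -> a r <= M.
  by move=> rk; rewrite /M (bigD1 (Ordinal rk))//= lerDl sumr_ge0.
have M0 : 0 <= M by apply: sumr_ge0.
(* Beyond this time the cost [M] of the incomplete last block is at most e / 2 per unit of time. *)
exists (Num.truncn (M / (e / 2))).+1 => // n /= hn.
have n0 : (0 < n)%N by exact: leq_ltn_trans hn.
have nR : 0 < n%:R :> R by rewrite ltr0n.
rewrite distrC ger0_norm ?subr_ge0 ?ln// lerBlDl.
have h1 : a n <= (n %/ k.+1)%:R * a k.+1 + M.
  by rewrite {1}(divn_eq n k.+1) (le_trans (amul _ _))// lerD2l aM// ltn_mod.
have h2 : (n %/ k.+1)%:R <= n%:R * k.+1%:R^-1 :> R.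
  by rewrite ler_pdivlMr// -natrM ler_nat leq_divM.
have h3 : (n %/ k.+1)%:R * a k.+1 <= n%:R * (l + e / 2).
  rewrite (@le_trans _ _ (n%:R * k.+1%:R^-1 * a k.+1))//; first by rewrite ler_wpM2r.
  by rewrite -mulrA ler_wpM2l// ltW.
have h4 : M <= n%:R * (e / 2).
  rewrite -ler_pdivrMr// (le_trans (ltW (truncnS_gt _)))// ler_nat//.
rewrite mulrC ler_pdivrMr// (le_trans h1)// (le_trans (lerD h3 h4))//.
by rewrite le_eqVlt; apply/orP; left; apply/eqP; field.
Qed.

End finite_sums.

Section entropy_of_partitions.
Context d (X : measurableType d) (R : realType) (nu : probability X R).

(* A finite measurable partition up to a null set; cells may be empty. *)
Record ae_partition (I : finType) (B : I -> set X) : Prop := AePartition {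
  ae_partition_measurable : forall i, measurable (B i);
  ae_partition_unique : {ae nu, forall x, exists i, B i x /\ forall j, B j x -> j = i}
}.

Lemma bmeas_indicator (A : set X) : measurable A -> bmeas (\1_A : X -> R).
Proof.
move=> mA; split; first exact: measurable_indic.
by exists 1 => t; rewrite indicE; case: (t \in A); rewrite ?normr1 ?normr0.
Qed.

Lemma bint_indicator (A : set X) : measurable A -> \int[nu]_t (\1_A t : R) = fine (nu A).
Proof. by move=> mA; rewrite /Rintegral integral_indic// setIT. Qed.

Definition cell_prob (I : finType) (B : I -> set X) i : R := fine (nu (B i)).

Lemma cell_prob_ge0 (I : finType) (B : I -> set X) i : 0 <= cell_prob B i.
Proof. by rewrite fine_ge0. Qed.

Section partition.
Variables (I : finType) (B : I -> set X).
Hypothesis hB : ae_partition B.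
Let mB := ae_partition_measurable hB.

Lemma sum_indicator x (F : I -> R) i : B i x -> (forall j, B j x -> j = i) ->
  \sum_j F j * \1_(B j) x = F i.
Proof.
move=> Bi uB; rewrite (bigD1 i)//= indicE mem_set// mulr1 big1 ?addr0// => j ji.
by rewrite indicE memNset ?mulr0// => /uB /eqP; rewrite (negbTE ji).
Qed.

Lemma bmeas_fsum (J : finType) (f : J -> X -> R) : (forall i, bmeas (f i)) ->
  bmeas (fun x => \sum_i f i x).
Proof.
move=> hf; under eq_fun do rewrite big_enum_val/=.
exact: (@bmeas_sum R _ X _ (fun i => f (enum_val i))).
Qed.

Lemma bint_fsum (J : finType) (f : J -> X -> R) : (forall i, bmeas (f i)) ->
  \int[nu]_x (\sum_i f i x) = \sum_i \int[nu]_x f i x.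
Proof.
move=> hf; under eq_Rintegral do rewrite big_enum_val/=.
by rewrite (@bint_sum R _ X nu _ (fun i => f (enum_val i)))// [RHS]big_enum_val.
Qed.

Lemma bint_cells (F : I -> R) : \sum_i F i * cell_prob B i = \int[nu]_x \sum_i F i * \1_(B i) x.
Proof.
rewrite bint_fsum; last first.
  by move=> i; apply: bmeasM; [exact: bmeas_cst|exact: bmeas_indicator].
by apply: eq_bigr => i _; rewrite bintZ ?bint_indicator//; exact: bmeas_indicator.
Qed.

Lemma sum_cell_prob : \sum_i cell_prob B i = 1.
Proof.
transitivity (\sum_i 1 * cell_prob B i); first by apply: eq_bigr => i _; rewrite mul1r.
rewrite bint_cells -[RHS](bint_cst nu); apply: bint_ae.
- by apply: bmeas_fsum => i; apply: bmeasM; [exact: bmeas_cst|exact: bmeas_indicator].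
- exact: bmeas_cst.
by apply: (aeS (ae_partition_unique hB)) => x [i [Bi uB]]; exact: sum_indicator Bi uB.
Qed.

Lemma bint_split (u : X -> R) : bmeas u ->
  \int[nu]_x u x = \sum_i \int[nu]_x (u x * \1_(B i) x).
Proof.
move=> bu; have bi i : bmeas (fun x => u x * \1_(B i) x).
  by apply: bmeasM => //; exact: bmeas_indicator.
rewrite -bint_fsum//; apply: bint_ae => //; first exact: bmeas_fsum.
by apply: (aeS (ae_partition_unique hB)) => x [i [Bi uB]]; rewrite (sum_indicator (fun=> u x) Bi uB).
Qed.

Lemma cell_prob_le1 i : cell_prob B i <= 1.
Proof.
rewrite -sum_cell_prob (bigD1 i)//= lerDl; apply: sumr_ge0 => j _.
exact: cell_prob_ge0.
Qed.

Lemma entropyE : partition_entropy nu B = - \sum_i cell_prob B i * ln (cell_prob B i).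
Proof. by []. Qed.

Lemma entropy_ge0 : 0 <= partition_entropy nu B.
Proof.
rewrite entropyE -sumrN; apply: sumr_ge0 => i _; rewrite -mulrN mulr_ge0 ?cell_prob_ge0//.
by rewrite oppr_ge0 ln_le0// cell_prob_le1.
Qed.

Lemma entropy_gibbs (v : I -> R) : (forall i, 0 <= v i) -> \sum_i v i <= 1 ->
    (forall i, 0 < cell_prob B i -> 0 < v i) ->
  partition_entropy nu B <= \sum_i cell_prob B i * - ln (v i).
Proof.
by move=> v0 v1 pv; rewrite entropyE; apply: gibbs => //; [exact: cell_prob_ge0|exact: sum_cell_prob].
Qed.

Lemma entropy_le_ln : partition_entropy nu B <= ln (#|I|%:R).
Proof.
have I0 : (0 < #|I|)%N.
  have [i _] : exists i : I, true by have [x [i _]] := ae_ex (ae_partition_unique hB); exists i.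
  by apply/card_gt0P; exists i.
apply: (le_trans (entropy_gibbs (v := fun=> #|I|%:R^-1) _ _ _)) => //.
- by rewrite sumr_const -[leLHS]mulr_natr mulVf// pnatr_eq0 -lt0n.
- by move=> i _; rewrite invr_gt0 ltr0n.
rewrite -mulr_suml sum_cell_prob mul1r lnV ?opprK// posrE ltr0n//.
Qed.

(* Jensen's inequality on each cell. *)
Lemma entropy_lower (u : X -> R) (C : R) : bmeas u -> bmeas (fun x => expR (u x)) -> 0 < C ->
    (forall i, \int[nu]_x (expR (u x) * \1_(B i) x) <= C) ->
  \int[nu]_x u x - ln C <= partition_entropy nu B.
Proof.
move=> bu be C0 hC; rewrite (bint_split bu) entropyE -[ln C]mul1r -sum_cell_prob mulr_suml -sumrB -sumrN.
apply: ler_sum => i _; set m := cell_prob B i.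
have bi := bmeas_indicator (mB i).
have m0 : 0 <= m := cell_prob_ge0 B i.
have [mz|mn0] := eqVneq m 0.
  rewrite mz !mul0r oppr0 addr0 le_eqVlt; apply/orP; left; apply/eqP.
  rewrite -[RHS](bint_cst nu); apply: bint_ae; [exact: bmeasM|exact: bmeas_cst|].
  exists (B i); split => //.
    by have := mz; rewrite /m /cell_prob => /eqP; rewrite fine_eq0 ?fin_num_measure// => /eqP.
  by move=> x nx; apply: contrapT => Bx; apply: nx; rewrite /= indicE memNset// mulr0.
have mp : 0 < m by rewrite lt_neqAle eq_sym mn0.
have -> : - (m * ln m) = m * ln (C / m) - m * ln C by rewrite ln_div ?posrE//; ring.
rewrite lerD2r.
(* Jensen in tangent-line form: ln v <= v - 1 at v = exp (u) m / C. Integrated over a cell of mass m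
   it gives at most m ln (C / m). *)
have pw y : u y <= expR (u y) * (m / C) - 1 + ln (C / m).
  have h := ln_le_sub1 (mulr_gt0 (expR_gt0 (u y)) (divr_gt0 mp C0)).
  rewrite lnM ?posrE ?expR_gt0 ?divr_gt0// expRK in h.
  have e : ln (m / C) = - ln (C / m) by rewrite -lnV ?posrE ?divr_gt0// invf_div.
  by rewrite e in h; lra.
apply: (@le_trans _ _ (\int[nu]_x (expR (u x) * \1_(B i) x * (m / C) +
    (ln (C / m) - 1) * \1_(B i) x))).
  have b1 := bmeasM be bi.
  apply: bint_le; first exact: bmeasM.
    apply: bmeasD; first by apply: bmeasM => //; exact: bmeas_cst.
    by apply: bmeasM => //; exact: bmeas_cst.
  move=> x; rewrite indicE; case: (x \in B i); rewrite ?mulr1 ?mulr0 ?mul0r ?addr0//.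
  by have := pw x; lra.
rewrite bintD; last 2 first.
- by apply: bmeasM; [exact: bmeasM|exact: bmeas_cst].
- by apply: bmeasM => //; exact: bmeas_cst.
under eq_Rintegral do rewrite mulrC.
rewrite bintZ ?bintZ//; last exact: bmeasM.
rewrite bint_indicator//.
have h1 : m / C * \int[nu]_x (expR (u x) * \1_(B i) x) <= m.
  by rewrite -mulrA ler_piMr// ler_pdivrMl// mulr1.
by rewrite -/(cell_prob B i) -/m; lra.
Qed.

End partition.

(** Gibbs' inequality with the product of the two cell probabilities as trial vector. Injectivity is
    required of the labels only, since cells may be empty; it makes the trial vector sum to at most
    1. *)
Lemma entropy_join (I J K : finType) (B : I -> set X) (C : J -> set X) (D : K -> set X)
    (f : K -> I) (g : K -> J) :
  ae_partition B -> ae_partition C -> ae_partition D -> injective (fun k => (f k, g k)) ->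
  (forall k, D k `<=` B (f k) `&` C (g k)) ->
  partition_entropy nu D <= partition_entropy nu B + partition_entropy nu C.
Proof.
move=> hB hC hD fg sub.
pose v k := cell_prob B (f k) * cell_prob C (g k).
have mono k : cell_prob D k <= cell_prob B (f k) /\ cell_prob D k <= cell_prob C (g k).
  have mD := ae_partition_measurable hD; have mB := ae_partition_measurable hB.
  have mC := ae_partition_measurable hC.
  split; rewrite /cell_prob fine_le ?fin_num_measure// le_measure ?inE//;
    by move=> x /sub[].
have v0 k : 0 <= v k by rewrite mulr_ge0 ?cell_prob_ge0.
have pv k : 0 < cell_prob D k -> 0 < cell_prob B (f k) /\ 0 < cell_prob C (g k).
  by move=> h; have [h1 h2] := mono k; split; exact: lt_le_trans h _.
apply: (le_trans (entropy_gibbs hD v0 _ _)).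
- rewrite /v (le_trans (sum_inj_le (F := fun ij => cell_prob B ij.1 * cell_prob C ij.2) fg _))//.
    by move=> ij; rewrite mulr_ge0 ?cell_prob_ge0.
  rewrite -(pair_bigA _ (fun i j => cell_prob B i * cell_prob C j))/=.
  under eq_bigr do rewrite -mulr_sumr (sum_cell_prob hC) mulr1.
  by rewrite sum_cell_prob.
- by move=> k /pv[h1 h2]; exact: mulr_gt0.
have -> : \sum_k cell_prob D k * - ln (v k) =
    \sum_k cell_prob D k * - ln (cell_prob B (f k)) + \sum_k cell_prob D k * - ln (cell_prob C (g k)).
  rewrite -big_split; apply: eq_bigr => k _ /=.
  have [/pv[h1 h2]|h] := ltP 0 (cell_prob D k).
    by rewrite /v lnM ?posrE// opprD mulrDr.
  have -> : cell_prob D k = 0 by apply/eqP; rewrite eq_le h cell_prob_ge0.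
  by rewrite !mul0r addr0.
suff key (L : finType) (E : L -> set X) (h : K -> L) : ae_partition E ->
    (forall k, D k `<=` E (h k)) ->
    \sum_k cell_prob D k * - ln (cell_prob E (h k)) = partition_entropy nu E.
  by rewrite (key _ B f hB) ?(key _ C g hC)// => k x /sub[].
move=> hE DE; rewrite entropyE -sumrN.
under eq_bigr do rewrite mulrC; under [RHS]eq_bigr do rewrite -mulrN mulrC.
rewrite (bint_cells hD (fun k => - ln (cell_prob E (h k)))).
rewrite (bint_cells hE (fun l => - ln (cell_prob E l))).
have bs (L' : finType) (E' : L' -> set X) (F : L' -> R) : ae_partition E' ->
    bmeas (fun x => \sum_i F i * \1_(E' i) x).
  move=> hE'; apply: bmeas_fsum => i; apply: bmeasM; first exact: bmeas_cst.
  by apply: bmeas_indicator; exact: ae_partition_measurable hE' i.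
apply: bint_ae; [exact: bs|exact: bs|].
apply: (aeS2 (ae_partition_unique hD) (ae_partition_unique hE)) => x [k [Dk uD]] [l [El uE]].
rewrite (sum_indicator (fun k => - ln (cell_prob E (h k))) Dk uD).
rewrite (sum_indicator (fun l => - ln (cell_prob E l)) El uE).
by rewrite (uE _ (DE _ _ Dk)).
Qed.

End entropy_of_partitions.

(** * Entropy of the joins along the fibres *)

Section fiber_joins.
Context d (Omega : measurableType d) (R : realType) (P : probability Omega R).
Variables (sigma : Omega -> Omega) (T : blaschke_cocycle Omega R).
Variable mu : R.-pker Omega ~> R[i].
Hypothesis ms : measurable_fun [set: Omega] sigma.
Hypothesis mp : measure_preserving P sigma.
Hypothesis mu_circle : forall w, kernel_prob mu w (@circle R) = 1%E.
Hypothesis ae_good : {ae P, forall w, good_fiber sigma T mu w}.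
Local Notation It := (cocycle_iter sigma T).
Local Notation p := (kernel_prob mu).
Variables (k : nat) (A : 'I_k -> set R[i]).
Hypothesis hA : finite_partition (@circle R) A.

Definition join_cell n w (b : {ffun 'I_n -> 'I_k}) : set R[i] :=
  pullback_join (fun i => It i w) A b.

Lemma measurable_join_cell n w b : measurable (@join_cell n w b).
Proof.
apply: fin_bigcap_measurable => // i _; rewrite -[X in measurable X]setTI.
by apply: measurable_It => //; case: hA.
Qed.

Lemma circle_cell z : modulus z = 1 -> exists i, A i z.
Proof.
case: hA => _ _ cA z1; have : (@circle R) z by [].
by rewrite -cA => -[i _ Ai]; exists i.
Qed.

Lemma cell_unique i j z : A i z -> A j z -> i = j.
Proof.
by case: hA => _ tA _ Ai Aj; exact: (tA i j I I (ex_intro _ z (conj Ai Aj))).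
Qed.

Lemma join_cell_unique n w z : modulus z = 1 ->
  exists b, @join_cell n w b z /\ forall b', @join_cell n w b' z -> b' = b.
Proof.
move=> z1; have hi (i : 'I_n) : exists j, A j (It i w z).
  by apply: circle_cell; exact: iter_circle.
exists [ffun i => projT1 (cid (hi i))]; split.
  by move=> i _ /=; rewrite ffunE; exact: projT2 (cid (hi i)).
move=> b' hb'; apply/ffunP => i; rewrite ffunE.
exact: cell_unique (hb' i I) (projT2 (cid (hi i))).
Qed.

Lemma join_partition (nu : probability R[i] R) n w : nu (@circle R) = 1%E ->
  ae_partition nu (@join_cell n w).
Proof.
move=> nu1; split; first exact: measurable_join_cell.
by apply: (aeS (ae_circle nu1)) => z z1; exact: join_cell_unique.
Qed.

Definition join_entropy n w : R := partition_entropy (mu w) (@join_cell n w).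

Lemma bmeas_join_entropy n : bmeas (join_entropy n).
Proof.
split.
  apply: measurable_funN; apply: measurable_sum => b.
  have mc : measurable_fun [set: Omega] (fun w => fine (mu w (@join_cell n w b))).
    apply: (measurableT_comp (@fine_measurable R _ measurableT)).
    pose D := [set u : Omega * R[i] | @join_cell n u.1 b u.2].
    have mD : measurable D.
      rewrite (_ : D = \bigcap_(i in [set: 'I_n]) ((fun u : Omega * R[i] => It i u.1 u.2) @^-1` A (b i)))//.
      apply: fin_bigcap_measurable => // i _; rewrite -[X in measurable X]setTI.
      have mI : measurable_fun [set: Omega * R[i]] (fun u => It i u.1 u.2).
        exact: measurable_cocycle_iter.
      by apply: mI => //; case: hA.
    have := @measurable_fun_xsection_finite_kernel _ _ _ _ _ mu D (mem_set mD).
    rewrite (_ : (fun w => mu w (@join_cell n w b)) = (fun x => mu x (xsection D x)))//.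
    by apply/funext => w; congr (mu w _); apply/seteqP; split => z; rewrite /xsection /= inE.
  by apply: measurable_funM => //; exact: measurable_ln_comp.
exists (ln (#|{ffun 'I_n -> 'I_k}|%:R)) => w.
have hp := join_partition n w (mu_circle w).
by rewrite ger0_norm; [exact: entropy_le_ln hp|exact: entropy_ge0 hp].
Qed.

Lemma join_entropy_ge0 n w : 0 <= join_entropy n w.
Proof. exact: entropy_ge0 (join_partition n w (mu_circle w)). Qed.

Lemma join_entropy_sub n m w : good_fiber sigma T mu w ->
  join_entropy (n + m) w <= join_entropy n w + join_entropy m (iter n sigma w).
Proof.
move=> gw; pose E (c : {ffun 'I_m -> 'I_k}) := It n w @^-1` (@join_cell m (iter n sigma w) c).
have mE c : measurable (E c).
  by rewrite -[X in measurable X]setTI; apply: measurable_It => //; exact: measurable_join_cell.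
have -> : join_entropy m (iter n sigma w) = partition_entropy (p w) E.
  rewrite /join_entropy /partition_entropy; congr (- _); apply: eq_bigr => c _.
  have e : mu (iter n sigma w) (@join_cell m (iter n sigma w) c) = p w (E c).
    exact: (good_pushforward gw n (measurable_join_cell (iter n sigma w) c)).
  by rewrite e.
apply: (entropy_join (nu := p w) (f := fun b : {ffun 'I_(n + m) -> 'I_k} => [ffun i => b (lshift m i)])
  (g := fun b : {ffun 'I_(n + m) -> 'I_k} => [ffun i => b (rshift n i)])).
- exact: join_partition.
- split => //; apply: (aeS (ae_circle (mu_circle w))) => z z1.
  by apply: join_cell_unique; exact: iter_circle.
- exact: join_partition.
- move=> b b' [/ffunP hl /ffunP hr]; apply/ffunP => i.
  case: (split_ordP i) => j ->; first by have := hl j; rewrite !ffunE.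
  by have := hr j; rewrite !ffunE.
- move=> b z hz; split => i _ /=; rewrite ffunE; first exact: (hz (lshift m i) I).
  by have := hz (rshift n i) I; rewrite /= cocycle_iterD.
Qed.

Definition mean_join_entropy n : R := \int[P]_w join_entropy n w.

Lemma mean_join_entropy_sub n m :
  mean_join_entropy (n + m) <= mean_join_entropy n + mean_join_entropy m.
Proof.
have b1 := bmeas_join_entropy n; have b2 := bmeas_join_entropy m.
have b3 : bmeas (fun w => join_entropy m (iter n sigma w)).
  by apply: (bmeas_comp _ b2); exact: measurable_iter.
rewrite /mean_join_entropy -(bint_iter ms mp n b2) -bintD//.
have bD := bmeasD b1 b3; have bS := bmeas_join_entropy (n + m).
(* Subadditivity holds on almost every fibre only; the minimum of both sides is a version for which
   it holds everywhere. *)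
have bmin : bmeas (fun w => Num.min (join_entropy (n + m) w)
    (join_entropy n w + join_entropy m (iter n sigma w))).
  have [mS [M hM]] := bS; have [mD [N hN]] := bD; split; first exact: measurable_minr.
  exists (M + N) => w; have M0 : 0 <= M := le_trans (normr_ge0 _) (hM w).
  have N0 : 0 <= N := le_trans (normr_ge0 _) (hN w).
  rewrite /Num.min; case: ifP => _; first by rewrite (le_trans (hM w))// lerDl.
  by rewrite (le_trans (hN w))// lerDr.
rewrite (@bint_ae _ _ _ P _ _ bS bmin).
  by apply: bint_le => // w; rewrite ge_min lexx orbT.
apply: (aeS ae_good) => w gw; apply/esym/min_idPl.
exact: join_entropy_sub.
Qed.

(** Fekete's lemma makes the [limn] of the definition a true limit, used for the lower bound, and an
    infimum over n, which the upper bound evaluates along multiples of a block length. *)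
Lemma partition_fiber_entropyE : exists l : R,
  [/\ partition_fiber_entropy P sigma T mu A = l%:E,
      (fun n => n%:R^-1 * mean_join_entropy n) @ \oo --> l, 0 <= l &
      forall n, (0 < n)%N -> l <= n%:R^-1 * mean_join_entropy n].
Proof.
have a0 n : 0 <= mean_join_entropy n.
  by apply: Rintegral_ge0 => w _; exact: join_entropy_ge0.
have [l [cl l0 ll]] := fekete a0 mean_join_entropy_sub.
exists l; split => //; rewrite /partition_fiber_entropy.
rewrite (_ : (fun n => _) = (fun n => (n%:R^-1 * mean_join_entropy n)%:E)); last first.
  apply/funext => n; rewrite EFinM; congr (_ * _)%E.
  by rewrite -(bint_EFin P (bmeas_join_entropy n)).
apply/cvg_lim => //; apply: cvg_EFin => //; exact: nearW.
Qed.

End fiber_joins.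

(** * The lower bound for the fibre entropy *)

Section arcs.
Variable R : realType.
Local Notation unif := (@unif01 R).
Local Notation mR := (measurableTypeR R).
Variable N : nat.
Hypothesis N0 : (0 < N)%N.

Definition arc (i : 'I_N) : set R[i] :=
  [set expi t | t in (`[i%:R / N%:R, i.+1%:R / N%:R[%classic : set R)].

Let NR : 0 < (N%:R : R). Proof. by rewrite ltr0n. Qed.

Lemma arc_sub01 (i : 'I_N) (t : R) : i%:R / N%:R <= t < i.+1%:R / N%:R -> 0 <= t < 1.
Proof.
move=> /andP[h1 h2]; apply/andP; split; first by apply: le_trans h1; rewrite divr_ge0.
by apply: lt_le_trans h2 _; rewrite ler_pdivrMr// mul1r ler_nat.
Qed.

(** A half-open arc is a countable union of continuous images of segments, which are compact, hence
    closed. *)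
Lemma measurable_arc i : measurable (arc i).
Proof.
have -> : arc i = \bigcup_k [set expi t | t in (`[i%:R / N%:R, i.+1%:R / N%:R - k.+1%:R^-1]%classic : set R)].
  apply/seteqP; split => z.
    move=> [t]; rewrite /= in_itv/= => /andP[h1 h2] <-.
    have d0 : 0 < i.+1%:R / N%:R - t by rewrite subr_gt0.
    exists (Num.truncn (i.+1%:R / N%:R - t)^-1) => //; exists t => //=.
    rewrite in_itv/= h1/= lerBrDl -lerBrDr -[leRHS]invrK lef_pV2 ?posrE ?invr_gt0//.
    exact/ltW/truncnS_gt.
  move=> [k _ [t]]; rewrite /= in_itv/= => /andP[h1 h2] <-; exists t => //=.
  by rewrite in_itv/= h1 (le_lt_trans h2)// gtrBl.
apply: bigcup_measurable => k _.
set K := [set expi t | t in _].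
have cK : closed K.
  apply: compact_closed; first exact: norm_hausdorff.
  apply: continuous_compact; last exact: segment_compact.
  by apply: continuous_subspaceT; exact: continuous_expi.
rewrite -[K]setCK; apply: measurableC; apply: sub_sigma_algebra.
exact: closed_openC.
Qed.

Lemma arc_partition : finite_partition (@circle R) arc.
Proof.
split; first exact: measurable_arc.
- move=> i j _ _ [z [[t ti tz] [s sj sz]]]; move: ti sj; rewrite /= !in_itv/= => ti sj.
  have ts : t = s by apply: expi_inj01 (arc_sub01 ti) (arc_sub01 sj) _; rewrite tz sz.
  move: ti sj; rewrite -ts => /andP[h1 h2] /andP[h3 h4].
  have lt1 (a b : 'I_N) : a%:R / N%:R <= t -> t < b.+1%:R / N%:R -> (a <= b)%N.
    by move=> ha hb; have := le_lt_trans ha hb; rewrite ltr_pM2r ?invr_gt0// ltr_nat ltnS.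
  by apply: val_inj; apply/eqP; rewrite eqn_leq !lt1.
- apply/seteqP; split => [z [i _ [t _ <-]]|z z1]; first exact: circle_expi.
  have [t t01 ->] := circleE z1; have /andP[t0 t1] := t01.
  have hk : (Num.truncn (t * N%:R) < N)%N.
    by rewrite -(ltr_nat R) (@le_lt_trans _ _ (t * N%:R))// ?truncn_le ?mulr_ge0// gtr_pMl.
  exists (Ordinal hk) => //; exists t => //=; rewrite in_itv/=.
  rewrite ler_pdivrMr// ltr_pdivlMr//.
  by rewrite truncn_le ?truncnS_gt// mulr_ge0.
Qed.

Lemma arc_expi (i : 'I_N) (t : R) : 0 <= t < 1 ->
  arc i (expi t) <-> i%:R / N%:R <= t < i.+1%:R / N%:R.
Proof.
move=> t01; split=> [[s]|h]; last by exists t => //=; rewrite in_itv.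
by rewrite /= in_itv/= => hs st; rewrite -(expi_inj01 (arc_sub01 hs) t01 st).
Qed.

(** With speed at most [N], an arc of length 1 / N is wrapped at most once around the circle. *)
Lemma arc_lift_integral S g dg n (F : R[i] -> \bar R) i : (0 < n)%N ->
    circle_lift S g dg n -> (forall t, dg t <= N%:R) ->
    measurable_fun [set: R[i]] F -> (forall z, 0 <= F z)%E ->
  (\int[unif]_t ((\1_(arc i) (expi t))%:E * F (S (expi t)) * (dg t)%:E) <=
    \int[unif]_t F (expi t))%E.
Proof.
move=> n0 hg dgN mF F0.
have mexpi (G : R[i] -> \bar R) : measurable_fun [set: R[i]] G ->
    measurable_fun [set: mR] (fun t => G (expi t)).
  by move=> mG; exact: measurableT_comp mG (@measurable_expi R).
have mFS : measurable_fun [set: mR] (fun t => F (S (expi t)) * (dg t)%:E)%E.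
  apply: emeasurable_funM; last by apply/measurable_EFinP; exact: measurable_lift_deriv hg.
  rewrite (_ : (fun t => F (S (expi t))) = (fun t => F (expi t)) \o g); last first.
    by apply/funext => t /=; rewrite (lift_expi hg).
  exact: measurableT_comp (mexpi _ mF) (measurable_lift hg).
have FS0 t : (0 <= F (S (expi t)) * (dg t)%:E)%E.
  by rewrite mule_ge0// lee_fin (lift_deriv_ge0 hg).
pose a : R := i%:R / N%:R; pose b : R := i.+1%:R / N%:R.
have m1 : measurable_fun [set: mR] (fun t => (\1_(arc i) (expi t))%:E : \bar R).
  apply: (mexpi (fun z => (\1_(arc i) z)%:E)); apply/measurable_EFinP.
  by apply: measurable_indic; exact: measurable_arc.
rewrite !ge0_integral_unif01//; last 3 first.
- exact: mexpi.
- by under eq_fun do rewrite -muleA; exact: emeasurable_funM.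
- by move=> t; rewrite -muleA mule_ge0// lee_fin indicE.
have gab : g b <= g a + 1.
  have ab : a < b by rewrite ltr_pM2r ?invr_gt0// ltr_nat.
  have [c _ h] := mean_value ab (lift_derive hg).
  rewrite -lerBlDl h (_ : b - a = N%:R^-1); last by rewrite /a /b -natr1 mulrDl mul1r addrAC subrr add0r.
  by rewrite ler_pdivrMr// mul1r.
apply: le_trans (circle_lift_integral_le n0 hg mF F0 gab).
rewrite [leLHS]integral_mkcond [leRHS]integral_mkcond le_eqVlt; apply/orP; left; apply/eqP.
apply: eq_integral => t _; rewrite !patchE.
have [t01|t01] := boolP (0 <= t < 1).
  have -> : t \in `[0%R, 1%R[%classic by rewrite inE /= in_itv.
  have [hab|hab] := boolP (a <= t < b).
    have -> : t \in `[a, b[%classic by rewrite inE /= in_itv.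
    by rewrite indicE mem_set ?mul1e//; apply/arc_expi.
  have -> : t \in `[a, b[%classic = false by apply/negbTE; rewrite notin_setE /= in_itv; exact/negP.
  by rewrite indicE memNset ?mul0e// => /(arc_expi _ t01); exact/negP.
have -> : t \in `[0%R, 1%R[%classic = false by apply/negbTE; rewrite notin_setE /= in_itv; exact/negP.
have -> // : t \in `[a, b[%classic = false.
by apply/negbTE; rewrite notin_setE /= in_itv => /arc_sub01; exact/negP.
Qed.

Lemma full_lift_integral S g dg n (F : R[i] -> \bar R) : (0 < n)%N ->
    circle_lift S g dg n -> measurable_fun [set: R[i]] F -> (forall z, 0 <= F z)%E ->
  (\int[unif]_t (F (S (expi t)) * (dg t)%:E) = n%:R%:E * \int[unif]_t F (expi t))%E.
Proof.
move=> n0 hg mF F0.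
have mexpi : measurable_fun [set: mR] (fun t => F (expi t)).
  exact: measurableT_comp mF (@measurable_expi R).
rewrite !ge0_integral_unif01//; first exact: (circle_lift_integral n0 hg mF F0).
- apply: emeasurable_funM; last by apply/measurable_EFinP; exact: measurable_lift_deriv hg.
  rewrite (_ : (fun t => F (S (expi t))) = (fun t => F (expi t)) \o g); last first.
    by apply/funext => t /=; rewrite (lift_expi hg).
  exact: measurableT_comp mexpi (measurable_lift hg).
- by move=> t; rewrite mule_ge0// lee_fin (lift_deriv_ge0 hg).
Qed.

End arcs.

(** * Wrapping numbers of the cells of a join *)

Section multiplicity.
Context d (Omega : measurableType d) (R : realType).
Variables (sigma : Omega -> Omega) (T : blaschke_cocycle Omega R).
Hypothesis ms : measurable_fun [set: Omega] sigma.
Local Notation unif := (@unif01 R).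
Local Notation mR := (measurableTypeR R).
Local Notation It := (cocycle_iter sigma T).
Variable N : nat.
Hypothesis N0 : (0 < N)%N.
Local Notation A := (@arc R N).

(** An upper bound for how often T_w wraps an arc of length 1 / N around the circle: once if the arc
    resolves the derivative, and trivially the degree otherwise. *)
Definition multiplicity w : nat := if deriv_bound T w <= N%:R then 1 else degree T w.

Lemma multiplicity_gt0 w : (0 < multiplicity w)%N.
Proof. by rewrite /multiplicity; case: ifP => // _; exact: degree_gt0. Qed.

Lemma deriv_modulus_ge0 w z : 0 <= deriv_modulus T w z.
Proof.
apply: sumr_ge0 => i _; rewrite /poisson divr_ge0 ?sqr_ge0//.
by rewrite ltW// one_minus_sqr//; exact: zeros_disk.
Qed.

Lemma iter_deriv_ge0 n w z : 0 <= iter_deriv T sigma n w z.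
Proof. by apply: prodr_ge0 => i _; exact: deriv_modulus_ge0. Qed.

Lemma measurable_deriv_modulus1 w : measurable_fun [set: R[i]] (deriv_modulus T w).
Proof. exact: (measurable_deriv_modulus T (@measurable_cst _ _ _ _ _ w) (@measurable_id _ _ _)). Qed.

Lemma measurable_iter_deriv1 n w : measurable_fun [set: R[i]] (iter_deriv T sigma n w).
Proof. exact: (measurable_iter_deriv T n ms (@measurable_cst _ _ _ _ _ w) (@measurable_id _ _ _)). Qed.

Lemma arc_step w i (F : R[i] -> \bar R) : measurable_fun [set: R[i]] F ->
  (forall z, 0 <= F z)%E ->
  (\int[unif]_t ((\1_(A i) (expi t))%:E * F (T w (expi t)) * (deriv_modulus T w (expi t))%:E) <=
    (multiplicity w)%:R%:E * \int[unif]_t F (expi t))%E.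
Proof.
move=> mF F0; have [g hg] := blaschke_lift T w; have n0 := degree_gt0 T w.
rewrite /multiplicity; case: ifP => hN.
  rewrite mul1e; apply: (arc_lift_integral N0 i n0 hg) => // t.
  by apply: le_trans hN; apply: deriv_modulus_le; exact: expi_modulus.
have mG : measurable_fun [set: mR] (fun t => F (T w (expi t)) * (deriv_modulus T w (expi t))%:E)%E.
  apply: emeasurable_funM.
    apply: (measurableT_comp mF); apply: (@measurableT_comp _ _ _ _ _ _ (T w)).
      exact: (@measurable_It _ _ _ sigma T 1 w).
    exact: measurable_expi.
  apply/measurable_EFinP; exact: (measurableT_comp (measurable_deriv_modulus1 w) (@measurable_expi R)).
rewrite -(full_lift_integral n0 hg mF F0); apply: ge0_le_integral => //.
- by move=> t _; rewrite !mule_ge0// ?lee_fin ?indicE// deriv_modulus_ge0.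
- under eq_fun do rewrite -muleA; apply: emeasurable_funM => //.
  apply/measurable_EFinP; apply: (measurableT_comp _ (@measurable_expi R)).
  by apply: measurable_indic; exact: measurable_arc.
- move=> t _; rewrite -muleA indicE; case: (_ \in _); rewrite ?mul1e// mul0e.
  by rewrite mule_ge0// lee_fin deriv_modulus_ge0.
Qed.

(** Induction from the last letter: one step is absorbed into the test function, [F'] being [F]
    pulled back by the last map with its Jacobian, restricted to the last arc, and [arc_step] pays
    for it. Hence [F] has to be general. *)
Lemma join_multiplicity n w (b : {ffun 'I_n -> 'I_N}) (F : R[i] -> \bar R) :
  measurable_fun [set: R[i]] F -> (forall z, 0 <= F z)%E ->
  (\int[unif]_t ((\1_(join_cell sigma T A w b) (expi t))%:E * F (It n w (expi t)) *
      (iter_deriv T sigma n w (expi t))%:E) <=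
    (\prod_(i < n) (multiplicity (iter i sigma w))%:R)%:E * \int[unif]_t F (expi t))%E.
Proof.
have hA := arc_partition R N0.
elim: n b F => [|n ih] b F mF F0.
  rewrite big_ord0 mul1e le_eqVlt; apply/orP; left; apply/eqP.
  apply: eq_integral => t _; rewrite /iter_deriv big_ord0 mule1 indicE mem_set ?mul1e//.
  by move=> [].
pose b' : {ffun 'I_n -> 'I_N} := [ffun i => b (widen_ord (leqnSn n) i)].
pose j := b ord_max; set wn := iter n sigma w.
pose F' z := ((\1_(A j) z)%:E * F (T wn z) * (deriv_modulus T wn z)%:E)%E.
have mF' : measurable_fun [set: R[i]] F'.
  apply: emeasurable_funM; last by apply/measurable_EFinP; exact: measurable_deriv_modulus1.
  apply: emeasurable_funM.
    by apply/measurable_EFinP; apply: measurable_indic; exact: measurable_arc.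
  exact: measurableT_comp mF (@measurable_It _ _ _ sigma T 1 wn).
have F'0 z : (0 <= F' z)%E by rewrite !mule_ge0// ?lee_fin ?indicE// deriv_modulus_ge0.
have cellE z : join_cell sigma T A w b z <-> join_cell sigma T A w b' z /\ A j (It n w z).
  split=> [h|[h1 h2] i _].
    by split=> [i _ /=|]; [rewrite ffunE; exact: (h (widen_ord (leqnSn n) i) I)|exact: (h ord_max I)].
  have [iord|iord] := ltnP i n.
    have := h1 (Ordinal iord) I; rewrite /= ffunE.
    by rewrite (_ : widen_ord _ _ = i)//; exact: val_inj.
  have -> : i = ord_max by apply: val_inj => /=; apply/eqP; rewrite eqn_leq iord -ltnS ltn_ord.
  exact: h2.
apply: (@le_trans _ _ (\int[unif]_t ((\1_(join_cell sigma T A w b') (expi t))%:E *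
    F' (It n w (expi t)) * (iter_deriv T sigma n w (expi t))%:E)))%E.
  rewrite le_eqVlt; apply/orP; left; apply/eqP; apply: eq_integral => t _.
  rewrite /iter_deriv big_ord_recr/= EFinM /F' !indicE.
  have [h1|h1] := boolP (expi t \in join_cell sigma T A w b').
    have [h2|h2] := boolP (It n w (expi t) \in A j).
      have -> : expi t \in join_cell sigma T A w b.
        by rewrite inE; apply/cellE; move: h1 h2; rewrite !inE.
      by rewrite !mul1e muleA; rewrite -!muleA; congr (_ * _)%E; rewrite muleC.
    have -> : (expi t \in join_cell sigma T A w b) = false.
      by apply/negbTE; move: h2; rewrite !notin_setE => h2 /cellE[].
    by rewrite !mul0e mule0 mul0e.
  have -> : (expi t \in join_cell sigma T A w b) = false.
    by apply/negbTE; move: h1; rewrite !notin_setE => h1 /cellE[].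
  by rewrite !mul0e.
apply: (le_trans (ih b' F' mF' F'0)).
rewrite big_ord_recr/= EFinM -muleA lee_wpmul2l//; last exact: arc_step.
by rewrite lee_fin prodr_ge0.
Qed.

End multiplicity.

(** * Growth rates along stationary sequences *)

Section integrable_stationary.
Context d (X : measurableType d) (R : realType) (P : probability X R).

Lemma integrable_le (f g : X -> R) : measurable_fun [set: X] f ->
  (forall x, `|f x| <= g x) -> P.-integrable setT (EFin \o g) -> P.-integrable setT (EFin \o f).
Proof.
move=> mf fg ig; apply: (le_integrable measurableT _ _ ig); first exact/measurable_EFinP.
by move=> x _ /=; rewrite lee_fin (le_trans (fg x))// ler_norm.
Qed.

Lemma Rint_le_ae (f g : X -> R) : P.-integrable setT (EFin \o f) ->
  P.-integrable setT (EFin \o g) -> {ae P, forall x, f x <= g x} ->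
  \int[P]_x f x <= \int[P]_x g x.
Proof.
move=> hf hg fg; rewrite -subr_ge0 -RintegralB//.
have hB := integrable_realB hg hf.
rewrite (_ : \int[P]_x (g x - f x) = \int[P]_x `|g x - f x|); first exact: Rintegral_ge0.
congr fine; apply: ae_eq_integral => //.
- exact: measurable_int hB.
- exact: measurable_int (integrable_norm hB).
by apply: (aeS fg) => x h _; rewrite ger0_norm// subr_ge0.
Qed.

Lemma integrable_fsum n (f : 'I_n -> X -> R) : (forall i, P.-integrable setT (EFin \o f i)) ->
  P.-integrable setT (EFin \o (fun x => \sum_(i < n) f i x)) /\
  \int[P]_x (\sum_(i < n) f i x) = \sum_(i < n) \int[P]_x f i x.
Proof.
elim: n f => [|n ih] f hf.
  split; first by under eq_fun do rewrite big_ord0; exact/bmeas_integrable/bmeas_cst.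
  by under eq_Rintegral do rewrite big_ord0; rewrite bint_cst big_ord0.
have [h1 h2] := ih (fun i => f (lift ord0 i)) (fun i => hf _).
split; first by under eq_fun do rewrite big_ord_recl; exact: integrable_realD.
under eq_Rintegral do rewrite big_ord_recl.
by rewrite RintegralD// h2 big_ord_recl.
Qed.

Variable s : X -> X.
Hypothesis ms : measurable_fun [set: X] s.
Hypothesis mp : measure_preserving P s.

Lemma integrable_iter n (f : X -> R) : P.-integrable setT (EFin \o f) ->
  P.-integrable setT (EFin \o (fun x => f (iter n s x))) /\
  \int[P]_x f (iter n s x) = \int[P]_x f x.
Proof.
move=> hf; have mf := measurable_int _ hf.
have mi := measurable_iter ms n.
split.
  apply/integrableP; split; first exact: (measurableT_comp mf mi).
  rewrite (ge0_integral_iter ms mp n (f := fun x => `|(f x)%:E|%E)).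
  - by have /integrableP[_] := hf.
  - exact: measurableT_comp.
  - by move=> x.
rewrite /Rintegral; congr fine; rewrite integralE [RHS]integralE; congr (_ - _)%E.
  have := ge0_integral_iter ms mp n (measurable_funepos mf) (fun x => funepos_ge0 _ x).
  by move=> <-; apply: eq_integral => x _; rewrite !funeposE.
have := ge0_integral_iter ms mp n (measurable_funeneg mf) (fun x => funeneg_ge0 _ x).
by move=> <-; apply: eq_integral => x _; rewrite !funenegE.
Qed.

(* The Birkhoff sums of [g] bound the rate of growth of [H] from below; the
   error [e] need not be integrable since [H] is nonnegative. *)
Lemma rate_lower_bound (H : nat -> X -> R) (e g : X -> R) (l : R) :
    (forall n, bmeas (H n)) -> (forall n x, 0 <= H n x) -> measurable_fun [set: X] e ->
    P.-integrable setT (EFin \o g) ->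
    {ae P, forall x, forall n, \sum_(i < n) g (iter i s x) - e x <= H n x} ->
    (fun n => n%:R^-1 * \int[P]_x H n x) @ \oo --> l ->
  \int[P]_x g x <= l.
Proof.
move=> bH H0 me ig hH hl; apply/ler_addgt0Pl => eps eps0.
have mg : measurable_fun [set: X] g by apply/measurable_EFinP; exact: measurable_int ig.
have mng : measurable_fun [set: X] (fun x => `|g x|) by exact: measurableT_comp.
have [ir cr] := tail_integral mng (fun x => normr_ge0 (g x)) (integrable_norm ig).
have e3 : 0 < eps / 3 by rewrite divr_gt0.
have /cvgrPdist_le/(_ _ e3)[K _ /(_ K (leqnn K))] := cr.
rewrite /= sub0r normrN => /(le_trans (ler_norm _)); set rho := \int[P]_x _ => hrho.
pose r x : R := Num.max (`|g x| - K%:R) 0.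
(* Indicator of e > C. Off this set the hypothesis holds with error C; on it H >= 0 is used instead,
   at a cost of at most n K since g - r <= K. The constant C is then taken so large that K times the
   mean of J is at most eps / 3. *)
pose J (C : nat) (x : X) : R := if e x <= C%:R then 0 else 1.
have bJ C : bmeas (J C).
  split; last by exists 1 => x; rewrite /J; case: ifP; rewrite ?normr0 ?normr1.
  by apply: measurable_fun_if => //; apply: measurable_fun_ler.
have cJ : (fun C => \int[P]_x J C x) @ \oo --> (0 : R).
  rewrite -(bint_cst P 0); apply: (@bounded_convergence _ _ _ _ _ _ 1).
  - by move=> C; have [] := bJ C.
  - exact: measurable_cst.
  - by move=> C x; rewrite /J; case: ifP; rewrite ?normr0 ?normr1.
  - apply: aeW => x; apply: cvg_near_cst; exists (Num.truncn `|e x|).+1 => // C /= hC.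
    rewrite /J; case: ifP => // /negP[]; apply: (le_trans (ler_norm _)).
    by apply: (le_trans (ltW (truncnS_gt _))); rewrite ler_nat.
have e3K : 0 < eps / 3 / K.+1%:R by rewrite divr_gt0.
have /cvgrPdist_le/(_ _ e3K)[C _ /(_ C (leqnn C))] := cJ.
rewrite /= sub0r normrN => /(le_trans (ler_norm _)) hC.
have irx : P.-integrable setT (EFin \o r) := ir K.
have iphi := integrable_realB ig irx.
have step n : n%:R * (\int[P]_x g x - rho) <= \int[P]_x H n x + C%:R + n%:R * (K%:R * \int[P]_x J C x).
  have bR : bmeas (fun x => H n x + C%:R + n%:R * (K%:R * J C x)).
    apply: bmeasD; first by apply: bmeasD => //; exact: bmeas_cst.
    by apply: bmeasM; [exact: bmeas_cst|apply: bmeasM => //; exact: bmeas_cst].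
  have hs (i : 'I_n) := integrable_iter i iphi.
  have [is1 is2] := integrable_fsum (fun i => (hs i).1).
  have -> : n%:R * (\int[P]_x g x - rho) = \int[P]_x \sum_(i < n) (g (iter i s x) - r (iter i s x)).
    rewrite is2; under eq_bigr do rewrite (hs _).2.
    by rewrite sumr_const card_ord RintegralB// -[RHS]mulr_natl.
  have -> : \int[P]_x H n x + C%:R + n%:R * (K%:R * \int[P]_x J C x) =
      \int[P]_x (H n x + C%:R + n%:R * (K%:R * J C x)).
    have bc := bmeas_cst X (C%:R : R); have bKJ := bmeasM (bmeas_cst X (K%:R : R)) (bJ C).
    rewrite bintD; [|exact: bmeasD|by apply: bmeasM => //; exact: bmeas_cst].
    by rewrite bintD// bint_cst bintZ// bintZ.
  apply: Rint_le_ae => //; first exact: bmeas_integrable.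
  apply: (aeS hH) => x /(_ n) hx; have Hx := H0 n x.
  have C0 : 0 <= C%:R :> R by [].
  have rx y : 0 <= r y by rewrite le_max lexx orbT.
  have gr y : `|g y| <= K%:R + r y by rewrite -lerBlDl le_max lexx.
  rewrite /J; case: ifPn => [eC|_].
    have h1 : \sum_(i < n) (g (iter i s x) - r (iter i s x)) <= \sum_(i < n) g (iter i s x).
      by apply: ler_sum => i _; rewrite gerBl.
    by rewrite mulr0 mulr0 addr0; lra.
  have h1 : \sum_(i < n) (g (iter i s x) - r (iter i s x)) <= \sum_(i < n) K%:R.
    by apply: ler_sum => i _; rewrite lerBlDr (le_trans (ler_norm _)).
  rewrite sumr_const card_ord -mulr_natl in h1.
  by rewrite mulr1; lra.
have hl2 : (fun n => n%:R^-1 * \int[P]_x H n x + C%:R * n%:R^-1) @ \oo --> l.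
  have h0 : l = l + C%:R * 0 by rewrite mulr0 addr0.
  rewrite [X in _ --> X]h0; apply: cvgD => //; apply: cvgMr.
  by rewrite -(cvg_shiftS (fun n : nat => n%:R^-1 : R)); exact: cvg_harmonic.
have hK : K%:R * \int[P]_x J C x <= eps / 3.
  have J0 : 0 <= \int[P]_x J C x by apply: Rintegral_ge0 => x _; rewrite /J; case: ifP.
  apply: (@le_trans _ _ (K.+1%:R * \int[P]_x J C x)).
    by rewrite ler_wpM2r// ler_nat.
  by rewrite mulrC -ler_pdivlMr.
have : \int[P]_x g x - rho - eps / 3 <= l.
  apply: (ler_cvg_to (cvg_cst _) hl2); exists 1%N => // n /= n1.
  have nR : 0 < n%:R :> R by rewrite ltr0n.
  have -> : n%:R^-1 * \int[P]_x H n x + C%:R * n%:R^-1 = (\int[P]_x H n x + C%:R) / n%:R.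
    by rewrite mulrDl [n%:R^-1 * _]mulrC.
  have h1 := step n; have h2 : n%:R * (K%:R * \int[P]_x J C x) <= n%:R * (eps / 3) by rewrite ler_pM2l.
  rewrite ler_pdivlMr// mulrBl [(_ - rho) * _]mulrC [eps / 3 * _]mulrC.
  rewrite lerBlDr; apply: (le_trans h1); exact: lerD.
by lra.
Qed.

End integrable_stationary.

(** * Fibre entropy bounded below by the mean exponent *)

Section lower_bound.
Context d (Omega : measurableType d) (R : realType) (P : probability Omega R).
Variables (sigma : Omega -> Omega) (T : blaschke_cocycle Omega R).
Variable mu : R.-pker Omega ~> R[i].
Hypothesis ms : measurable_fun [set: Omega] sigma.
Hypothesis mp : measure_preserving P sigma.
Hypothesis mu_circle : forall w, kernel_prob mu w (@circle R) = 1%E.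
Hypothesis ae_good : {ae P, forall w, good_fiber sigma T mu w}.
Local Notation It := (cocycle_iter sigma T).
Local Notation p := (kernel_prob mu).
Local Notation x w := (barycenter (p w)).

(** Apply [entropy_lower] to u = ln |(T^n)'| minus the log-density of the fibre measure: integrating
    exp u against that measure is integrating the Jacobian against Lebesgue measure, which
    [join_multiplicity] bounds on each cell. *)
Lemma join_entropy_lower N (N0 : (0 < N)%N) n w : good_fiber sigma T mu w ->
  \sum_(i < n) (exponent T mu (iter i sigma w) - ln (multiplicity T N (iter i sigma w))%:R)
    - diff_entropy mu w <= join_entropy sigma T mu (@arc R N) n w.
Proof.
move=> gw; have x1 : modulus (x w) < 1 := good_disk gw 0%N.
have hA := arc_partition R N0.
have b1 := bmeas_ln_iter_deriv_on T ms n w; have b2 := bmeas_ln_poisson x1.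
pose u z := ln_iter_deriv_on sigma T n w z - ln_poisson mu w z.
have bu : bmeas u by exact: bmeasB.
have beu : bmeas (fun z => expR (u z)).
  have [mu_ [M hM]] := bu; split; first exact: measurableT_comp.
  exists (expR M) => z; rewrite ger0_norm ?expR_ge0// ler_expR.
  exact: le_trans (ler_norm _) (hM z).
pose C : R := \prod_(i < n) (multiplicity T N (iter i sigma w))%:R.
have C0 : 0 < C by apply: prodr_gt0 => i _; rewrite ltr0n multiplicity_gt0.
have lnC : ln C = \sum_(i < n) ln (multiplicity T N (iter i sigma w))%:R.
  rewrite /C {C0}; elim: n {b1 u bu beu C} => [|n ih]; first by rewrite !big_ord0 ln1.
  rewrite !big_ord_recr/= lnM ?ih// posrE ?ltr0n ?multiplicity_gt0//.
  by apply: prodr_gt0 => i _; rewrite ltr0n multiplicity_gt0.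
have -> : \sum_(i < n) (exponent T mu (iter i sigma w) - ln (multiplicity T N (iter i sigma w))%:R)
    - diff_entropy mu w = \int[p w]_z u z - ln C.
  rewrite sumrB -lnC -(exponent_sum ms n gw) /u bintB// -/(diff_entropy mu w); ring.
apply: (entropy_lower (join_partition sigma T hA n w (mu_circle w)) bu beu C0) => b.
have mB := measurable_join_cell sigma T hA w b.
have bB := bmeasM beu (bmeas_indicator R mB).
rewrite -lee_fin -bint_EFin//.
have hp := good_poisson gw 0%N; rewrite /= in hp; rewrite hp; last 2 first.
- by apply/measurable_EFinP; have [] := bB.
- by move=> z; rewrite lee_fin mulr_ge0 ?expR_ge0// indicE.
have := join_multiplicity sigma T N0 w b (F := cst 1%E) (@measurable_cst _ _ _ _ _ 1%E) (fun=> lee01).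
rewrite [X in (_ <= _ * X)%E](_ : _ = 1%E) ?mule1; last exact: (integral_cst_prob (@unif01 R) 1).
 apply: le_trans; rewrite le_eqVlt; apply/orP; left; apply/eqP.
apply: eq_integral => t _; rewrite /cst mule1 -!EFinM; congr EFin.
have e1 := expi_modulus t; have dpos := iter_deriv_gt0 T sigma n w e1.
have ppos := poisson_gt0 x1 e1.
rewrite /u /ln_iter_deriv_on /ln_poisson /on_circle e1 eqxx.
rewrite expRB !lnK ?posrE//; field; exact: lt0r_neq0.
Qed.

Hypothesis lam_neg : P.-integrable setT (EFin \o (fun w => Num.max (- ln (inf_deriv T w)) 0)).
Hypothesis deg_lam : P.-integrable setT (EFin \o (fun w => (degree T w)%:R / inf_deriv T w)).

Let m w : R := Num.max (- ln (inf_deriv T w)) 0 + (degree T w)%:R / inf_deriv T w.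

Let m_integrable : P.-integrable setT (EFin \o m).
Proof. exact: integrable_realD. Qed.

Let m_ge w : - ln (inf_deriv T w) <= m w /\ (degree T w)%:R / inf_deriv T w <= m w.
Proof.
rewrite /m; split.
  by rewrite ler_wpDr ?divr_ge0 ?(ltW (inf_deriv_gt0 T w))// le_max lexx.
by rewrite lerDr le_max lexx orbT.
Qed.

Lemma exponent_ge_neg w : - m w <= exponent T mu w.
Proof.
have [h _] := m_ge w; apply: le_trans (exponent_ge T (mu_circle w)).
by rewrite lerNl.
Qed.

(** The exponent where arcs of length 1 / N resolve the map, and an integrable lower bound
    elsewhere; it increases to the exponent with [N]. *)
Let g N w : R := if deriv_bound T w <= N%:R then exponent T mu w else - m w.

Let mg N : measurable_fun [set: Omega] (g N).
Proof.
have mm : measurable_fun [set: Omega] m by apply/measurable_EFinP; exact: measurable_int m_integrable.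
apply: measurable_fun_if => //.
- by apply: measurable_fun_ler => //; exact: measurable_deriv_bound.
- by apply: measurable_funTS; exact: measurable_exponent.
- by apply: measurable_funTS; exact: measurable_funN.
Qed.

Let g_integrable N : P.-integrable setT (EFin \o g N).
Proof.
apply: (integrable_le (mg N) (g := fun w => m w + `|ln N%:R|)).
  move=> w; have m0 : 0 <= m w.
    have [_ h] := m_ge w; apply: le_trans h; rewrite divr_ge0// ltW// inf_deriv_gt0//.
  rewrite /g; case: ifP => hN; last by rewrite normrN ger0_norm// lerDl.
  have h1 := exponent_ge_neg w; have h2 := exponent_le (mu_circle w) hN.
  have h3 := ler_norm (ln N%:R : R); have h4 := normr_ge0 (ln N%:R : R).
  by rewrite ler_norml; apply/andP; split; lra.
by apply: integrable_realD => //; apply: bmeas_integrable; exact: bmeas_cst.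
Qed.

(** Where the resolution fails the degree is paid: exponent - ln n >= - ln (n / inf |T'|) >= 1 - n /
    inf |T'|. This is one use of the integrability of n / inf |T'|. *)
Let g_le N w : g N w <= exponent T mu w - ln (multiplicity T N w)%:R.
Proof.
rewrite /g /multiplicity; case: ifP => _; first by rewrite ln1 subr0.
have l0 := inf_deriv_gt0 T w; have d0 : 0 < (degree T w)%:R :> R by rewrite ltr0n degree_gt0.
have h1 := exponent_ge T (mu_circle w); have [_ h2] := m_ge w.
have := ln_le_sub1 (divr_gt0 d0 l0); rewrite ln_div ?posrE//; lra.
Qed.

(** For each resolution the entropy dominates the mean of [g N]. If it is finite, monotone
    convergence of [g N + m] makes the exponent integrable and passes the bound to the limit; the
    index [N.+1] avoids an empty partition. *)
Lemma fiber_entropy_ge : (\int[P]_w (exponent T mu w)%:E <= fiber_entropy P sigma T mu)%E.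
Proof.
set h := fiber_entropy _ _ _ _.
have step N : (0 < N)%N -> ((\int[P]_w g N w)%:E <= h)%E.
  move=> N0; have hA := arc_partition R N0.
  have [l [hl cl l0 ll]] := partition_fiber_entropyE ms mp mu_circle ae_good hA.
  apply: (@le_trans _ _ l%:E); last first.
    by apply: ereal_sup_ubound; exists N, (@arc R N); split.
  rewrite lee_fin.
  apply: (rate_lower_bound ms mp (H := join_entropy sigma T mu (@arc R N)) (e := diff_entropy mu)) => //.
  - by move=> n; exact: bmeas_join_entropy.
  - by move=> n w; exact: join_entropy_ge0.
  - exact: measurable_diff_entropy.
  apply: (aeS (B := fun w => forall n, \sum_(i < n) g N (iter i sigma w) - diff_entropy mu w <= join_entropy sigma T mu (@arc R N) n w) ae_good) => w gw n; apply: le_trans (join_entropy_lower N0 n gw).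
    by rewrite lerD2r; apply: ler_sum => i _; exact: g_le.
have m0 w : 0 <= m w.
  have [_ h1] := m_ge w; apply: le_trans h1; rewrite divr_ge0// ltW// inf_deriv_gt0//.
have [->|hfin] := eqVneq h +oo%E; first exact: leey.
have [r hr] : exists r : R, h = r%:E.
  move: (step 1%N isT) hfin; case: h {step} => [r _ _|_|].
  - by exists r.
  - by rewrite eqxx.
  - by rewrite leeNy_eq.
rewrite hr in step *.
pose q w := exponent T mu w + m w.
have q0 w : 0 <= q w by rewrite /q -lerBlDr sub0r exponent_ge_neg.
have mq : measurable_fun [set: Omega] q.
  apply: measurable_funD; first exact: measurable_exponent.
  by apply/measurable_EFinP; exact: measurable_int m_integrable.
pose G N w := g N.+1 w + m w.
have mG N : measurable_fun [set: Omega] (G N).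
  by apply: measurable_funD => //; apply/measurable_EFinP; exact: measurable_int m_integrable.
have G0 N w : 0 <= G N w.
  rewrite /G /g; case: ifP => _; last by rewrite addNr.
  exact: q0.
have Gmono w : {homo (fun N => (G N w)%:E) : a b / (a <= b)%N >-> (a <= b)%E}.
  move=> a b ab; rewrite lee_fin lerD2r /g; case: ifP => ha.
    by rewrite (le_trans ha)// ler_nat ltnS.
  by case: ifP => // _; exact: exponent_ge_neg.
have Gcvg w : (fun N => (G N w)%:E) @ \oo --> (q w)%:E.
  apply: cvg_near_cst; exists (Num.truncn `|deriv_bound T w|).+1 => // N /= hN.
  rewrite /G /g; case: ifP => // /negP[]; apply: (le_trans (ler_norm _)).
  by apply: (le_trans (ltW (truncnS_gt _))); rewrite ler_nat leqW.
have Gint N : (\int[P]_w (G N w)%:E <= (r + \int[P]_w m w)%:E)%E.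
  have iG := integrable_realD (g_integrable N.+1) m_integrable.
  rewrite (_ : (\int[P]_w (G N w)%:E)%E = (\int[P]_w (g N.+1 w + m w))%:E); last first.
    by rewrite fineK// integrable_fin_num.
  by rewrite RintegralD// lee_fin lerD2r -lee_fin step.
have qint : (\int[P]_w (q w)%:E <= (r + \int[P]_w m w)%:E)%E.
  have hc := @cvg_monotone_convergence _ _ _ P setT measurableT (fun N w => (G N w)%:E)
    (fun N => proj2 (measurable_EFinP _ _) (mG N)) (fun N w _ => G0 N w) (fun w _ => Gmono w).
  rewrite (_ : (\int[P]_w (q w)%:E)%E = (\int[P]_w limn (fun N => (G N w)%:E))%E); last first.
    by apply: eq_integral => w _; apply/esym/cvg_lim => //; exact: Gcvg.
  rewrite -(cvg_lim _ hc)//; apply: lime_le; first by apply/cvg_ex; eexists; exact: hc.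
  exact: nearW.
have iq : P.-integrable setT (EFin \o q).
  apply/integrableP; split; first exact/measurable_EFinP.
  under eq_integral do rewrite /= ger0_norm//.
  by rewrite (le_lt_trans qint)// ltry.
have ie : P.-integrable setT (EFin \o (exponent T mu)).
  have := integrable_realB iq m_integrable.
  by rewrite (_ : (fun w => q w - m w) = exponent T mu)//; apply/funext => w; rewrite /q addrK.
have -> : (\int[P]_w (exponent T mu w)%:E)%E = (\int[P]_w exponent T mu w)%:E.
  by rewrite fineK// integrable_fin_num.
have qE : \int[P]_w q w = \int[P]_w exponent T mu w + \int[P]_w m w by rewrite RintegralD.
have : (\int[P]_w q w)%:E = (\int[P]_w (q w)%:E)%E by rewrite fineK// integrable_fin_num.
by move=> hq; move: qint; rewrite -hq qE !lee_fin lerD2r.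
Qed.

End lower_bound.

(** * The upper bound for the fibre entropy *)

Section coding.
Variable R : realType.

(** Path weights of a substochastic chain: summing out the last state first leaves the number of
    initial states. *)
Lemma chain_sum_le N n (q : nat -> 'I_N -> 'I_N -> R) :
    (forall j y y', 0 <= q j y y') -> (forall j y, \sum_y' q j y y' <= 1) ->
  \sum_(y : {ffun 'I_n.+1 -> 'I_N}) \prod_(j < n) q j (y (inord j)) (y (inord j.+1)) <= N%:R.
Proof.
move=> q0 q1; elim: n => [|n ih].
  under eq_bigr do rewrite big_ord0.
  by rewrite sumr_const card_ffun !card_ord expn1.
pose F (v : {ffun 'I_n.+1 -> 'I_N} * 'I_N) : R :=
  \prod_(j < n) q j (v.1 (inord j)) (v.1 (inord j.+1)) * q n (v.1 (inord n)) v.2.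
pose h (y : {ffun 'I_n.+2 -> 'I_N}) : {ffun 'I_n.+1 -> 'I_N} * 'I_N :=
  ([ffun i : 'I_n.+1 => y (inord i)], y (inord n.+1)).
have hF (y : {ffun 'I_n.+2 -> 'I_N}) : \prod_(j < n.+1) q j (y (inord j)) (y (inord j.+1)) = F (h y).
  rewrite big_ord_recr /F /h /= !ffunE !inordK//; congr (_ * _).
  by apply: eq_bigr => j _; rewrite !ffunE !inordK// ltnS// ltnW.
have hinj : injective h.
  move=> y y' [e1 e2]; apply/ffunP => i.
  have [hi|hi] := ltnP i n.+1.
    by move/ffunP/(_ (Ordinal hi)) : e1; rewrite !ffunE/= inord_val.
  have -> : i = inord n.+1 by apply: val_inj; rewrite /= inordK//; apply/eqP; rewrite eqn_leq hi -ltnS ltn_ord.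
  exact: e2.
under eq_bigr do rewrite hF.
have F0 v : 0 <= F v by rewrite mulr_ge0// prodr_ge0.
apply: (le_trans (sum_inj_le hinj F0)).
rewrite -(pair_bigA _ (fun a b => F (a, b)))/=; apply: le_trans ih.
apply: ler_sum => y _; rewrite /F/= -mulr_sumr ler_piMr// prodr_ge0//.
Qed.

(* The summand is the weight of the word [b] in a Markov code with hidden states [y]. *)
Lemma code_sum_le1 N n k L (q : nat -> 'I_N -> 'I_N -> R) (r : nat -> 'I_N -> 'I_k -> R)
    (c : nat -> nat) : (0 < N)%N ->
    (forall j y y', 0 <= q j y y') -> (forall j y, \sum_y' q j y y' <= 1) ->
    (forall l y a, 0 <= r l y a) -> (forall l y, \sum_a r l y a <= 1) ->
  \sum_(b : {ffun 'I_L -> 'I_k}) \sum_(y : {ffun 'I_n.+1 -> 'I_N})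
    N%:R^-1 * \prod_(j < n) q j (y (inord j)) (y (inord j.+1)) *
      \prod_(l < L) r l (y (inord (c l))) (b l) <= 1.
Proof.
move=> N0 q0 q1 r0 r1; rewrite exchange_big/=.
have NR : 0 < N%:R :> R by rewrite ltr0n.
apply: (@le_trans _ _ (\sum_(y : {ffun 'I_n.+1 -> 'I_N})
    N%:R^-1 * \prod_(j < n) q j (y (inord j)) (y (inord j.+1)))).
  apply: ler_sum => y _; rewrite -mulr_sumr ler_piMr ?mulr_ge0 ?invr_ge0 ?prodr_ge0//.
  rewrite -(bigA_distr_bigA (fun (l : 'I_L) a => r l (y (inord (c l))) a)).
  by apply: prodr_ile1 => l _; rewrite r1 andbT sumr_ge0.
by rewrite -mulr_sumr mulrC ler_pdivrMr// mul1r chain_sum_le.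
Qed.

End coding.

(** Gibbs' inequality with the trial vector obtained by summing V over hidden labels. Keeping only
    the label [Y x] of the actual point bounds the code length pointwise by [c], although [Y] need
    not be a function of the cell. *)
Lemma entropy_code d (X : measurableType d) (R : realType) (nu : probability X R)
    (I J : finType) (B : I -> set X) (V : I -> J -> R) (Y : X -> J) (c : X -> R) :
    ae_partition nu B -> (forall i j, 0 <= V i j) -> \sum_i \sum_j V i j <= 1 -> bmeas c ->
    {ae nu, forall x, forall i, B i x -> 0 < V i (Y x) /\ - ln (V i (Y x)) <= c x} ->
  partition_entropy nu B <= \int[nu]_x c x.
Proof.
move=> hB V0 V1 bc hV; have mB := ae_partition_measurable hB.
pose v i := \sum_j V i j.
have v0 i : 0 <= v i by apply: sumr_ge0.
have Vv i j : V i j <= v i by rewrite /v (bigD1 j)//= lerDl sumr_ge0.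
have vpos i : 0 < cell_prob nu B i -> 0 < v i.
  move=> hi; rewrite lt_neqAle v0 andbT; apply/negP => /eqP vi0.
  have : {ae nu, forall x, ~ B i x}.
    apply: (aeS hV) => x /(_ i) h Bx; have [h1 _] := h Bx.
    by have := lt_le_trans h1 (Vv i _); rewrite -vi0 ltxx.
  case=> N [mN N0 NB]; have : nu (B i) = 0%E.
    by apply/eqP; rewrite -measure_le0 -N0 le_measure ?inE// => x Bx; apply: NB => /=; exact.
  by move=> h0; move: hi; rewrite /cell_prob h0 ltxx.
apply: (le_trans (entropy_gibbs hB v0 V1 vpos)).
under eq_bigr do rewrite mulrC.
rewrite (bint_cells hB).
have bs : bmeas (fun x => \sum_i - ln (v i) * \1_(B i) x).
  by apply: bmeas_fsum => i; apply: bmeasM; [exact: bmeas_cst|exact: bmeas_indicator].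
apply: Rint_le_ae; [exact: bmeas_integrable|exact: bmeas_integrable|].
apply: (aeS2 hV (ae_partition_unique hB)) => x hx [i [Bi ui]].
rewrite (sum_indicator _ Bi ui).
have [h1 h2] := hx i Bi; apply: le_trans h2; rewrite lerN2 ler_ln ?posrE//.
by exact: (lt_le_trans h1 (Vv i (Y x))).
Qed.

(** * Arcs met by the image of an arc *)

Section arc_counting.
Variable R : realType.
Variable N : nat.
Hypothesis N0 : (0 < N)%N.
Variables (S : R[i] -> R[i]) (g dg : R -> R) (n : nat).
Hypothesis hg : circle_lift S g dg n.

Definition reach (i : 'I_N) : {set 'I_N} :=
  [set j | `[< exists z, @arc R N i z /\ arc j (S z) >]].

Lemma reachP i j z : arc i z -> arc j (S z) -> j \in reach i.
Proof. by move=> hi hj; rewrite inE; apply/asboolP; exists z. Qed.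

Lemma arc_floor (j : 'I_N) (s : R) : arc j (expi s) ->
  exists k : int, Num.floor (N%:R * s) = (k * N%:Z + j%:Z)%R.
Proof.
have NR : 0 < N%:R :> R by rewrite ltr0n.
move=> [t]; rewrite /= in_itv/= => /andP[h1 h2] /esym/expi_eq[k ->]; exists k.
apply: floor_def; rewrite mulrDr.
rewrite ler_pdivrMr// in h1; rewrite ltr_pdivlMr// in h2.
have e1 : (k * N%:Z + j%:Z)%:~R = k%:~R * N%:R + j%:R :> R by rewrite rmorphD rmorphM.
have e2 : (k * N%:Z + j%:Z + 1)%:~R = k%:~R * N%:R + j.+1%:R :> R by rewrite rmorphD/= e1 -natr1 addrA.
rewrite e1 e2; move: h1 h2; rewrite -!natr1.
set a : R := k%:~R * N%:R; set b : R := t * N%:R => h1 h2.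
have -> : N%:R * t + N%:R * k%:~R = b + a by rewrite /a /b; ring.
by apply/andP; split; lra.
Qed.

(** Arcs met by the lifted image [u, v] correspond to integers from floor (N u) to floor (N v).
    There are at most N (v - u) + 2 of them, the 2 accounting for the two ends. *)
Lemma card_reach (i : 'I_N) :
  #|reach i|%:R <= N%:R * (g (i.+1%:R / N%:R) - g (i%:R / N%:R)) + 2.
Proof.
have NR : 0 < N%:R :> R by rewrite ltr0n.
pose u := g (i%:R / N%:R); pose v := g (i.+1%:R / N%:R).
have ab : i%:R / N%:R < i.+1%:R / N%:R :> R by rewrite ltr_pM2r ?invr_gt0// ltr_nat.
have uv : u <= v by rewrite (lift_leE hg) ltW.
pose fu := Num.floor (N%:R * u); pose fv := Num.floor (N%:R * v).
have fuv : fu <= fv by apply: le_floor; rewrite ler_pM2l.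
pose L : nat := `|fv - fu|%N.
have LE : L%:R = (fv - fu)%:~R :> R by rewrite /L natr_absz ger0_norm// subr_ge0.
have hsel (j : 'I_N) : exists m : int, j \in reach i -> exists k : int,
    [/\ fu <= m, m <= fv & m = (k * N%:Z + j%:Z)%R].
  have [|hj] := boolP (j \in reach i); last by exists 0.
  rewrite inE => /asboolP[z [[t]]]; rewrite /= in_itv/= => /andP[h1 h2] <-.
  rewrite (lift_expi hg) => hj; have [k hk] := arc_floor hj.
  exists (Num.floor (N%:R * g t)) => _; exists k; split => //.
    by apply: le_floor; rewrite ler_pM2l// (lift_leE hg).
  by apply: le_floor; rewrite ler_pM2l// (lift_leE hg) ltW.
pose m j := projT1 (cid (hsel j)).
pose f (j : 'I_N) : 'I_L.+1 := inord `|m j - fu|%N.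
have finj : {in reach i &, injective f}.
  move=> j j' hj hj' /(congr1 val).
  have [k [m1 m2 m3]] := projT2 (cid (hsel j)) hj.
  have [k' [m1' m2' m3']] := projT2 (cid (hsel j')) hj'.
  rewrite -/(m j) in m1 m2 m3; rewrite -/(m j') in m1' m2' m3'.
  rewrite /= !inordK ?ltnS; last 2 first.
  - by rewrite -lez_nat !gez0_abs ?subr_ge0// lerB.
  - by rewrite -lez_nat !gez0_abs ?subr_ge0// lerB.
  move=> /(congr1 Posz); rewrite !gez0_abs ?subr_ge0// => /addIr.
  (* Reduction modulo [N] recovers the index of the arc from the floor. *)
  rewrite m3 m3' => /(congr1 (fun x => (x %% N%:Z)%Z)); rewrite !modzMDl.
  by rewrite !modz_small ?ltz_nat ?ltn_ord// => -[] /val_inj.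
have h1 : (#|reach i| <= L.+1)%N.
  by rewrite -(card_in_imset finj) -[X in (_ <= X)%N]card_ord max_card.
apply: (@le_trans _ _ L.+1%:R); first by rewrite ler_nat.
rewrite -natr1 LE rmorphB/= mulrBr.
have := ge_floor (N%:R * v); have := floor_itv (N%:R * u).
rewrite -/u -/v -/fu -/fv rmorphD/= => /andP[_ h3] h4; lra.
Qed.

End arc_counting.

Section arc_average.
Variable R : realType.
Local Notation unif := (@unif01 R).
Local Notation mR := (measurableTypeR R).
Local Notation leb := (@lebesgue_measure R).

Definition arc_average N (f : R -> R) (i : 'I_N.+1) : R :=
  N.+1%:R * \int[unif]_s (f s * \1_(arc i) (expi s)).

Let cell (t : R) (n : nat) : set R :=
  `[(Num.floor (n.+1%:R * t))%:~R / n.+1%:R, ((Num.floor (n.+1%:R * t))%:~R + 1) / n.+1%:R[%classic.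

Let cell_measure t n : leb (cell t n) = (n.+1%:R^-1)%:E.
Proof.
have NR : 0 < n.+1%:R :> R by rewrite ltr0n.
rewrite /cell lebesgue_measure_itv/= lte_fin ltr_pM2r ?invr_gt0// ltrDl ltr01.
by rewrite -EFinD -mulrBl addrAC subrr add0r mul1r.
Qed.

Let cell_nice t : nicely_shrinking t (cell t).
Proof.
split; first by move=> n; exact: measurable_itv.
have h n : 0 < n.+1%:R^-1 :> R by rewrite invr_gt0.
exists (2, fun n => PosNum (h n)); split => //=.
- exact: cvg_harmonic.
- move=> n y; rewrite /cell /= in_itv/= /ball/= => /andP[h1 h2].
  have NR : 0 < n.+1%:R :> R by rewrite ltr0n.
  rewrite ler_pdivrMr// in h1; rewrite ltr_pdivlMr// in h2.
  have /andP[] := floor_itv (n.+1%:R * t); rewrite rmorphD/= => h3 h4.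
  rewrite -(ltr_pM2l NR) divff ?gt_eqF// -[X in X * `|_|]ger0_norm// -normrM mulrBr ltr_norml.
  by apply/andP; split; lra.
- by move=> n; rewrite cell_measure lebesgue_measure_ball//= -EFinM lee_fin -[leLHS]mulr_natl lexx.
Qed.

Lemma ae_unif01_lebesgue (A : set R) : {ae leb, forall t, A t} -> {ae unif, forall t : mR, A t}.
Proof.
case=> N [mN N0 AN]; exists N; split => //.
rewrite /unif01 /mrestr; apply/eqP; rewrite -measure_le0 -N0 le_measure ?inE//.
exact: measurableI.
Qed.

Lemma bint_arc (f : R -> R) N (i : 'I_N.+1) : bmeas (f : mR -> R) ->
  ((\int[unif]_s (f s * \1_(arc i) (expi s)))%:E =
    \int[leb]_(s in `[(i%:R / N.+1%:R)%R, (i.+1%:R / N.+1%:R)%R[) (f s)%:E)%E.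
Proof.
move=> bf.
have bs : bmeas (fun s : mR => f s * \1_(arc i) (expi s)).
  apply: bmeasM => //; apply: (bmeas_comp (@measurable_expi R)).
  by apply: bmeas_indicator; exact: measurable_arc.
rewrite -bint_EFin// integral_unif01; last by apply/measurable_EFinP; have [] := bs.
rewrite integral_mkcond [RHS]integral_mkcond; apply: eq_integral => s _; rewrite !patchE.
have [s01|s01] := boolP (0 <= s < 1).
  have -> : s \in `[0%R, 1%R[%classic by rewrite inE /= in_itv.
  have [hs|hs] := boolP (i%:R / N.+1%:R <= s < i.+1%:R / N.+1%:R).
    by rewrite indicE !mem_set ?mulr1//=; apply/(arc_expi (ltn0Sn N)).
  rewrite indicE !memNset ?mulr0//=; first by rewrite in_itv; exact/negP.
  by move=> /(arc_expi (ltn0Sn N) _ s01); exact/negP.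
have -> : s \in `[0%R, 1%R[%classic = false by apply/negbTE; rewrite notin_setE /= in_itv; exact/negP.
by rewrite memNset//= in_itv => /(arc_sub01 (ltn0Sn N)); exact/negP.
Qed.

(** Lebesgue differentiation: the arcs of length 1 / (N + 1) containing a point are not nested but
    shrink nicely to it. *)
Lemma arc_average_cvg (f : R -> R) : bmeas (f : mR -> R) ->
  {ae unif, forall t : mR, forall i : forall N, 'I_N.+1, (forall N, arc (i N) (expi t)) ->
    (fun N => arc_average f (i N)) @ \oo --> f t}.
Proof.
move=> bf; have [mf [M hM]] := bf.
have lf : locally_integrable setT f.
  split => //; first exact: openT.
  move=> K _ cK.
  apply: (@le_lt_trans _ _ (\int[leb]_(x in K) M%:E)%E).
    apply: ge0_le_integral => //=.
    - exact: compact_measurable.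
    - by apply: measurable_funTS; apply/measurable_EFinP; exact: measurableT_comp.
    - by move=> x _; rewrite lee_fin hM.
  rewrite integral_cst//; last exact: compact_measurable.
  have KM := compact_finite_measure cK.
  by rewrite ltey_eq fin_numM// ge0_fin_numE.
have aef := ae_unif01_lebesgue (lebesgue_differentiation lf).
apply: (aeS2 aef (ae_unif01 R)) => t /(nice_lebesgue_differentiation cell_nice lf) hc t01 i hi.
have NR n : 0 < n.+1%:R :> R by rewrite ltr0n.
have hc2 := fine_cvg hc.
rewrite (_ : (fun N => arc_average f (i N)) =
  fine \o (fun n => ((leb (cell t n))^-1 * \int[leb]_(y in cell t n) (f y)%:E)%E)); first exact: hc2.
apply/funext => n /=.
rewrite /arc_average cell_measure inver gt_eqF ?invr_gt0// invrK.
rewrite (_ : cell t n = `[(i n)%:R / n.+1%:R, (i n).+1%:R / n.+1%:R[%classic) -?bint_arc//.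
have /andP[h1 h2] := (arc_expi (ltn0Sn n) (i n) t01).1 (hi n).
rewrite ler_pdivrMr// in h1; rewrite ltr_pdivlMr// -[(i n).+1%:R]natr1 in h2.
have fE : Num.floor (n.+1%:R * t) = i n :> int.
  by apply: floor_def; rewrite rmorphD/= mulrC; apply/andP; split.
by rewrite /cell fE (_ : (i n)%:~R + 1 = (i n).+1%:R :> R)// -[RHS]natr1.
Qed.

End arc_average.

(** * Moebius frames in which the fibre measures are uniform *)

Section moving_frame.
Context d (Omega : measurableType d) (R : realType).
Variables (sigma : Omega -> Omega) (T : blaschke_cocycle Omega R).
Variable mu : R.-pker Omega ~> R[i].
Local Notation unif := (@unif01 R).
Local Notation mR := (measurableTypeR R).
Local Notation leb := (@lebesgue_measure R).
Local Notation It := (cocycle_iter sigma T).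
Local Notation p := (kernel_prob mu).
Local Notation x w := (barycenter (p w)).

Definition frame w (t : R) : R[i] := mobius (- x w) (expi t).

Lemma modulusN (z : R[i]) : modulus (- z) = modulus z.
Proof. by case: z => a b /=; rewrite !sqrrN. Qed.

Lemma frame_circle w t : modulus (x w) < 1 -> modulus (frame w t) = 1.
Proof. by move=> x1; rewrite mobius_circle ?modulusN// expi_modulus. Qed.

Lemma frameK w t : modulus (x w) < 1 -> mobius (x w) (frame w t) = expi t.
Proof. by move=> x1; rewrite mobiusNK// expi_modulus. Qed.

Lemma measurable_frame w : measurable_fun [set: mR] (frame w).
Proof.
apply: measurable_mobius; first exact: measurable_cst.
exact: measurable_expi.
Qed.

Lemma frame_pushforward w B : good_fiber sigma T mu w -> measurable B ->
  p w B = unif (frame w @^-1` B).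
Proof.
move=> gw mB; have x1 : modulus (x w) < 1 := good_disk gw 0%N.
have mf : measurable (frame w @^-1` B).
  by rewrite -[X in measurable X]setTI; exact: measurable_frame.
have m1 : measurable_fun [set: R[i]] (fun z => (\1_B z)%:E : \bar R).
  by apply/measurable_EFinP; exact: measurable_indic.
have i0 (z : R[i]) : (0 <= (\1_B z)%:E :> \bar R)%E by rewrite lee_fin indicE.
have := good_poisson gw 0%N m1 i0; rewrite integral_indic// setIT => ->.
have m2 : measurable_fun [set: R[i]] (fun z => (\1_B (mobius (- x w) z))%:E : \bar R).
  apply: (measurableT_comp m1); apply: measurable_mobius; first exact: measurable_cst.
  exact: measurable_id.
have := full_lift_integral (ltn0Sn 0) (mobius_circle_lift x1) m2 (fun z => i0 _).
rewrite mul1e => h; rewrite -(setIT (frame w @^-1` B)) -integral_indic// -[RHS]h.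
by apply: eq_integral => t _; rewrite mobiusK ?expi_modulus.
Qed.

Lemma bint_frame w (F : R[i] -> R) : good_fiber sigma T mu w -> bmeas F ->
  \int[p w]_z F z = \int[unif]_t F (frame w t).
Proof.
move=> gw bF; apply: bint_pushforward bF; first exact: measurable_frame.
by move=> B mB; exact: frame_pushforward.
Qed.

Lemma poisson_frame w t : modulus (x w) < 1 ->
  poisson (- x w) (expi t) = (poisson (x w) (frame w t))^-1.
Proof.
move=> x1; have x1' : modulus (- x w) < 1 by rewrite modulusN.
set z := expi t; have z1 : modulus z = 1 := expi_modulus t.
set a := x w in x1 x1' *.
have zle : modulus z <= 1 by rewrite z1.
have conjcN : (- a)^* = - a^* by case: (a).
have d0 := mobius_den x1' zle; rewrite conjcN mulNr opprK in d0.
have dz : modulus (z + a) = modulus (1 + a^* * z).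
  have -> : z + a = z * (1 + a^* * z)^*.
    have -> : (1 + a^* * z)^* = 1 + a * z^*.
      by case: (a) (z) => a1 a2 [z2 z3]; apply: complex_eqP; rewrite /=; ring.
    by rewrite mulrDr mulr1 mulrCA mulJc z1 expr1n mulr1.
  by rewrite Normc.normcM z1 mul1r modulusJ.
have a0 := one_minus_sqr x1.
have e1 : frame w t - a = z * (1 - modulus a ^+ 2)%:C / (1 + a^* * z).
  rewrite /frame /mobius -/z -/a conjcN mulNr !opprK RtoCB -mulJc.
  by apply: (mulIf d0); rewrite mulrBl !divfK// (_ : 1%:C = 1)//; ring.
have D0 : 0 < modulus (1 + a^* * z) by rewrite modulus_gt0.
rewrite /poisson opprK dz e1 !Normc.normcM z1 Normc.normcV modulus_real modulusN.
rewrite ger0_norm ?ltW// mul1r; field.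
by rewrite !gt_eqF.
Qed.

Variable M : nat.

(* The derivative of [T^M] read in the frames in which the fibre measures are uniform. *)
Definition block_deriv w : R[i] -> R := on_circle (fun z =>
  iter_deriv T sigma M w z * poisson (x (iter M sigma w)) (It M w z) / poisson (x w) z).

Definition block_map w (z : R[i]) : R[i] :=
  mobius (x (iter M sigma w)) (It M w (mobius (- x w) z)).

Hypothesis ms : measurable_fun [set: Omega] sigma.
Variable w : Omega.
Hypothesis gw : good_fiber sigma T mu w.
Let x1 : modulus (x w) < 1 := good_disk gw 0%N.
Let x1' : modulus (x (iter M sigma w)) < 1 := good_disk gw M.

Lemma block_derivE z : modulus z = 1 -> block_deriv w z =
  iter_deriv T sigma M w z * poisson (x (iter M sigma w)) (It M w z) / poisson (x w) z.
Proof. by move=> z1; rewrite /block_deriv /on_circle z1 eqxx. Qed.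

Lemma block_lift : exists g,
  circle_lift (block_map w) g (fun t => block_deriv w (frame w t)) (iter_degree T sigma M w).
Proof.
have nx1 : modulus (- x w) < 1 by rewrite modulusN.
have [g hg] := iter_lift T sigma M w.
have h1 := mobius_circle_lift nx1.
have h := circle_lift_comp (circle_lift_comp h1 hg) (mobius_circle_lift x1').
exists (mobius_lift (x (iter M sigma w)) \o (g \o mobius_lift (- x w))).
move: h; rewrite mul1n muln1.
set dg := (fun t : R => _ * _); set dg' := (fun t => block_deriv w _).
suff -> : dg = dg' by [].
apply/funext => t; rewrite /dg /dg' block_derivE ?frame_circle//.
rewrite /= -(lift_expi hg) -(lift_expi h1) poisson_frame//.
by rewrite mulrA [poisson _ _ * _]mulrC.
Qed.

(** Boundary Schwarz-Pick iterated along the block. In the frames the barycenters sit at 0, so the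
    block is a Blaschke product fixing 0, and such a map never contracts the circle. *)
Lemma block_deriv_ge1 z : modulus z = 1 -> 1 <= block_deriv w z.
Proof.
move=> z1; rewrite block_derivE// ler_pdivlMr ?poisson_gt0// mul1r (good_iter gw M).
elim: M => [|n ih]; first by rewrite /iter_deriv big_ord0 mul1r.
apply: (le_trans ih).
have xn : modulus (It n w (x w)) < 1 by exact: iter_lt1.
have zn : modulus (It n w z) = 1 by exact: iter_circle.
rewrite /iter_deriv big_ord_recr/= -mulrA.
apply: ler_wpM2l; first exact: iter_deriv_ge0.
rewrite !blaschkeE; apply: bprod_deriv_ge => //; first exact: degree_gt0.
  exact: rotation_circle.
by move=> i hi; exact: zeros_disk.
Qed.

Lemma bmeas_block_deriv : bmeas (block_deriv w).
Proof.
split.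
  apply: measurable_on_circle; first exact: measurable_id.
  apply: measurable_funM; last first.
    by apply: measurable_funV; apply: measurable_poisson; [exact: measurable_cst|exact: measurable_id].
  apply: measurable_funM; first exact: (measurable_iter_deriv1 T ms).
  by apply: measurable_poisson; [exact: measurable_cst|exact: measurable_It].
have [C hC] : exists C : R, forall z, modulus z = 1 -> iter_deriv T sigma M w z <= C.
  exists (\prod_(i < M) deriv_bound T (iter i sigma w)) => z z1; apply: ler_prod => i _.
  by rewrite deriv_modulus_ge0/= deriv_modulus_le// iter_circle.
have C0 : 0 <= C by apply: le_trans (hC 1 (Normc.normc1 _)); exact: iter_deriv_ge0.
exists (C * ((1 - modulus (x (iter M sigma w)) ^+ 2) / (1 - modulus (x (iter M sigma w))) ^+ 2) *
  ((1 - modulus (x w) ^+ 2) / 4)^-1) => z.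
have hx := one_minus_sqr x1; have hx' := one_minus_sqr x1'.
rewrite /block_deriv /on_circle; case: eqP => [z1|_]; last first.
  rewrite normr0; apply: mulr_ge0; last by rewrite invr_ge0 divr_ge0// ltW.
  by apply: mulr_ge0 => //; rewrite divr_ge0 ?sqr_ge0// ltW.
have zM := iter_circle T sigma M w z1.
have p1 := poisson_gt0 x1 z1; have p2 := poisson_gt0 x1' zM.
have D0 := iter_deriv_ge0 sigma T M w z.
have h1 : 0 <= iter_deriv T sigma M w z * poisson (x (iter M sigma w)) (It M w z).
  by rewrite mulr_ge0// ltW.
rewrite ger0_norm; last by rewrite divr_ge0// ltW.
apply: ler_pM => //; first by rewrite invr_ge0 ltW.
  by apply: ler_pM; rewrite ?(ltW p2)//; [exact: hC|exact: poisson_le].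
have h4 : 0 < (1 - modulus (x w) ^+ 2) / 4 by rewrite divr_gt0.
by rewrite lef_pV2 ?posrE//; exact: poisson_ge.
Qed.

(* The coboundary [diff_entropy mu (iter M sigma w) - diff_entropy mu w] integrates to zero. *)
Lemma bint_ln_block_deriv : bmeas (fun z => ln (block_deriv w z)) /\
  \int[p w]_z ln (block_deriv w z) =
  \sum_(i < M) exponent T mu (iter i sigma w) + (diff_entropy mu (iter M sigma w) - diff_entropy mu w).
Proof.
have [mb [C hC]] := bmeas_block_deriv.
have bl : bmeas (fun z => ln (block_deriv w z)).
  split; first exact: measurable_ln_comp.
  exists (`|ln C|) => z; have [z1|z1] := eqVneq (modulus z) 1; last first.
    by rewrite /block_deriv /on_circle (negbTE z1) ln0// normr0.
  have h1 := block_deriv_ge1 z1; have h2 := le_trans (ler_norm _) (hC z).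
  have b0 := lt_le_trans ltr01 h1.
  rewrite ger0_norm ?ln_ge0//; apply: le_trans (ler_norm _).
  by rewrite ler_ln// posrE// (lt_le_trans b0).
split => //.
have b1 := bmeas_ln_iter_deriv_on T ms M w.
have b2 := bmeas_ln_poisson x1.
have b3 : bmeas (fun z => ln_poisson mu (iter M sigma w) (It M w z)).
  by apply: (bmeas_comp (measurable_It sigma T M w)); exact: bmeas_ln_poisson.
rewrite -(exponent_sum ms M gw) /diff_entropy (bint_good M gw (bmeas_ln_poisson x1')).
rewrite -bintB// -bintD//; last exact: bmeasB.
apply: bint_ae => //; first by apply: bmeasD => //; exact: bmeasB.
apply: (aeS (ae_circle (good_circle gw 0%N))) => z z1.
have zM := iter_circle T sigma M w z1.
rewrite block_derivE// /ln_iter_deriv_on /ln_poisson /on_circle z1 zM eqxx.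
have h1 := poisson_gt0 x1 z1; have h2 := poisson_gt0 x1' zM; have h3 := iter_deriv_gt0 T sigma M w z1.
have h4 := mulr_gt0 h3 h2.
by rewrite ln_div ?posrE// lnM ?posrE// addrA.
Qed.

End moving_frame.

(** * Costs of transitions and of symbols *)

Section fiber_coding.
Context d (Omega : measurableType d) (R : realType).
Variables (sigma : Omega -> Omega) (T : blaschke_cocycle Omega R).
Variable mu : R.-pker Omega ~> R[i].
Hypothesis ms : measurable_fun [set: Omega] sigma.
Hypothesis mu_circle : forall w, kernel_prob mu w (@circle R) = 1%E.
Local Notation unif := (@unif01 R).
Local Notation mR := (measurableTypeR R).
Local Notation It := (cocycle_iter sigma T).
Local Notation p := (kernel_prob mu).
Local Notation x w := (barycenter (p w)).
Variables (k : nat) (A : 'I_k -> set R[i]).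
Hypothesis hA : finite_partition (@circle R) A.
Variables (M : nat) (eps : R).
Hypothesis M0 : (0 < M)%N.
Hypothesis eps0 : 0 < eps.

Section fixed_resolution.
Variable N : nat.
Implicit Types (Q : 'I_N.+1) (w : Omega) (z : R[i]).

Definition frame_arc Q w z : R := \1_(arc Q) (mobius (x w) z).

(** On a good fibre this is the length of the lifted image of the arc [Q] under the block, in units
    of one arc ([arc_growth_lift]). *)
Definition arc_growth w Q : R :=
  N.+1%:R * \int[p w]_z (block_deriv sigma T mu M w z * frame_arc Q w z).

(** The code length of one transition: by [card_reach] at most [arc_growth + 2] arcs can follow the
    current one, and they are coded uniformly. *)
Definition growth_cost w z : R := \sum_Q ln (arc_growth w Q + 2) * frame_arc Q w z.

(* Conditional probability of the symbol [a] at time [i] given the arc,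
   smoothed by [eps] so that its logarithm stays bounded. *)
Definition symbol_prob i w Q a : R :=
  (N.+1%:R * \int[p w]_z (frame_arc Q w z * \1_(A a) (It i w z)) + eps) / (1 + k%:R * eps).

Definition symbol_cost i w z : R :=
  \sum_Q \sum_a - ln (symbol_prob i w Q a) * (frame_arc Q w z * \1_(A a) (It i w z)).

Lemma measurable_frame_arc2 Q : measurable_fun [set: Omega * R[i]] (fun u => frame_arc Q u.1 u.2).
Proof.
apply: (measurableT_comp (f := (\1_(arc Q) : R[i] -> R)) (g := fun u : Omega * R[i] => mobius (x u.1) u.2)).
  by apply: measurable_indic; exact: measurable_arc.
apply: measurable_mobius; last exact: measurable_snd.
exact: measurableT_comp (measurable_barycenter mu) measurable_fst.
Qed.

Lemma bmeas_frame_arc Q w : bmeas (frame_arc Q w).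
Proof.
split; first exact: (measurableT_comp (measurable_frame_arc2 Q) (measurable_pair1 w)).
by exists 1 => z; rewrite /frame_arc indicE; case: (_ \in _); rewrite ?normr1 ?normr0.
Qed.

Lemma measurable_symbol2 i a :
  measurable_fun [set: Omega * R[i]] (fun u => \1_(A a) (It i u.1 u.2) : R).
Proof.
apply: (measurableT_comp (f := (\1_(A a) : R[i] -> R)) (g := fun u : Omega * R[i] => It i u.1 u.2)).
  by apply: measurable_indic; case: hA.
exact: (measurable_cocycle_iter T ms measurable_fst measurable_snd).
Qed.

Lemma bmeas_symbol i w a : bmeas (fun z => \1_(A a) (It i w z) : R).
Proof.
split; first exact: (measurableT_comp (measurable_symbol2 i a) (measurable_pair1 w)).
by exists 1 => z; rewrite indicE; case: (_ \in _); rewrite ?normr1 ?normr0.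
Qed.

Lemma measurable_block_deriv2 :
  measurable_fun [set: Omega * R[i]] (fun u => block_deriv sigma T mu M u.1 u.2).
Proof.
apply: measurable_on_circle; first exact: measurable_snd.
have mb : measurable_fun [set: Omega * R[i]] (fun u => x u.1).
  exact: measurableT_comp (measurable_barycenter mu) measurable_fst.
have mbM : measurable_fun [set: Omega * R[i]] (fun u => x (iter M sigma u.1)).
  apply: (measurableT_comp (measurable_barycenter mu)).
  exact: measurableT_comp (measurable_iter ms M) measurable_fst.
apply: measurable_funM; last by apply: measurable_funV; exact: measurable_poisson mb measurable_snd.
apply: measurable_funM; first exact: (measurable_iter_deriv T M ms measurable_fst measurable_snd).
apply: measurable_poisson => //.
exact: (measurable_cocycle_iter T ms measurable_fst measurable_snd).
Qed.

Lemma measurable_growth_cost2 : measurable_fun [set: Omega * R[i]] (fun u => growth_cost u.1 u.2).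
Proof.
apply: measurable_sum => Q; apply: measurable_funM; last exact: measurable_frame_arc2.
apply: measurable_ln_comp; apply: measurable_funD => //.
apply: (measurableT_comp (f := fun w => arc_growth w Q)); last exact: measurable_fst.
apply: measurable_funM => //.
apply: (measurable_kernel_Rint mu (k := fun u => block_deriv sigma T mu M u.1 u.2 * frame_arc Q u.1 u.2)).
by apply: measurable_funM; [exact: measurable_block_deriv2|exact: measurable_frame_arc2].
Qed.

Lemma measurable_symbol_cost2 i :
  measurable_fun [set: Omega * R[i]] (fun u => symbol_cost i u.1 u.2).
Proof.
apply: measurable_sum => Q; apply: measurable_sum => a; apply: measurable_funM; last first.
  by apply: measurable_funM; [exact: measurable_frame_arc2|exact: measurable_symbol2].
apply: measurable_funN; apply: measurable_ln_comp; apply: measurable_funM => //.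
apply: measurable_funD => //.
apply: (measurableT_comp (f := fun w => N.+1%:R * \int[p w]_z (frame_arc Q w z * \1_(A a) (It i w z))));
  last exact: measurable_fst.
apply: measurable_funM => //.
apply: (measurable_kernel_Rint mu (k := fun u => frame_arc Q u.1 u.2 * \1_(A a) (It i u.1 u.2))).
by apply: measurable_funM; [exact: measurable_frame_arc2|exact: measurable_symbol2].
Qed.

Lemma bmeas_growth_cost w : bmeas (growth_cost w).
Proof.
by apply: bmeas_fsum => Q; apply: bmeasM; [exact: bmeas_cst|exact: bmeas_frame_arc].
Qed.

Lemma bmeas_symbol_cost i w : bmeas (symbol_cost i w).
Proof.
apply: bmeas_fsum => Q; apply: bmeas_fsum => a; apply: bmeasM; first exact: bmeas_cst.
by apply: bmeasM; [exact: bmeas_frame_arc|exact: bmeas_symbol].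
Qed.

Definition arc_index z : 'I_N.+1 := xget ord0 [set i | arc i z].

Lemma arc_indexP z : modulus z = 1 -> arc (arc_index z) z.
Proof.
move=> z1; have [i hi] := circle_cell (arc_partition R (ltn0Sn N)) z1.
by rewrite /arc_index; case: xgetP => // /(_ i).
Qed.

Lemma sum_frame_arc w z (F : 'I_N.+1 -> R) : modulus (x w) < 1 -> modulus z = 1 ->
  \sum_Q F Q * frame_arc Q w z = F (arc_index (mobius (x w) z)).
Proof.
move=> x1 z1; have z1' := mobius_circle x1 z1.
apply: sum_indicator; first exact: arc_indexP.
by move=> j hj; exact: (cell_unique (arc_partition R (ltn0Sn N)) hj (arc_indexP z1')).
Qed.

Lemma sum_symbol i w z a (F : 'I_k -> R) : A a (It i w z) ->
  \sum_b F b * \1_(A b) (It i w z) = F a.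
Proof.
by move=> ha; apply: sum_indicator => // j hj; exact: (cell_unique hA hj ha).
Qed.

Lemma growth_costE w z : modulus (x w) < 1 -> modulus z = 1 ->
  growth_cost w z = ln (arc_growth w (arc_index (mobius (x w) z)) + 2).
Proof. by move=> x1 z1; rewrite /growth_cost (sum_frame_arc (fun Q => ln (arc_growth w Q + 2))). Qed.

Lemma symbol_costE i w z a : modulus (x w) < 1 -> modulus z = 1 -> A a (It i w z) ->
  symbol_cost i w z = - ln (symbol_prob i w (arc_index (mobius (x w) z)) a).
Proof.
move=> x1 z1 ha; rewrite -(sum_frame_arc (fun Q => - ln (symbol_prob i w Q a)) x1 z1).
apply: eq_bigr => Q _; rewrite -(sum_symbol (fun b => - ln (symbol_prob i w Q b) * frame_arc Q w z) ha).
by apply: eq_bigr => b _; rewrite mulrA.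
Qed.

Lemma frame_arcE w Q t : modulus (x w) < 1 -> frame_arc Q w (frame mu w t) = \1_(arc Q) (expi t).
Proof. by move=> x1; rewrite /frame_arc frameK. Qed.

Lemma bint_frame_arc w (f : R[i] -> R) Q : good_fiber sigma T mu w -> bmeas f ->
  N.+1%:R * \int[p w]_z (f z * frame_arc Q w z) = arc_average (fun t => f (frame mu w t)) Q.
Proof.
move=> gw bf; have x1 : modulus (x w) < 1 := good_disk gw 0%N.
rewrite /arc_average (bint_frame gw); last by apply: bmeasM => //; exact: bmeas_frame_arc.
by congr (_ * _); apply: eq_Rintegral => t _; rewrite frame_arcE.
Qed.

Lemma arc_growthE w Q : good_fiber sigma T mu w ->
  arc_growth w Q = arc_average (fun t => block_deriv sigma T mu M w (frame mu w t)) Q.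
Proof. by move=> gw; apply: bint_frame_arc => //; exact: bmeas_block_deriv. Qed.

Lemma bmeas_framed w (f : R[i] -> R) : bmeas f -> bmeas (fun t : mR => f (frame mu w t)).
Proof. exact: bmeas_comp (measurable_frame mu w). Qed.

Lemma arc_growth_lift w Q g n : good_fiber sigma T mu w ->
  circle_lift (block_map sigma T mu M w) g (fun t => block_deriv sigma T mu M w (frame mu w t)) n ->
  arc_growth w Q = N.+1%:R * (g (Q.+1%:R / N.+1%:R) - g (Q%:R / N.+1%:R)).
Proof.
move=> gw hg; rewrite arc_growthE// /arc_average; congr (_ * _); apply: EFin_inj.
rewrite bint_arc; last by apply: bmeas_framed; exact: bmeas_block_deriv.
have ab : Q%:R / N.+1%:R <= Q.+1%:R / N.+1%:R :> R by rewrite ler_pM2r ?invr_gt0 ?ltr0n// ler_nat.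
rewrite -(integral_derivative ab (lift_derive hg) (lift_continuous hg)).
rewrite integral_itv_bndo_bndc//.
by apply: measurable_funTS; apply/measurable_EFinP; exact: measurable_lift_deriv hg.
Qed.

Lemma arc_average_cst (c : R) Q : arc_average (fun=> c) Q = c.
Proof.
rewrite /arc_average; have NR : 0 < N.+1%:R :> R by rewrite ltr0n.
suff -> : \int[unif]_s (c * \1_(arc Q) (expi s)) = c / N.+1%:R by rewrite mulrCA divff ?mulr1// gt_eqF.
apply: EFin_inj; rewrite bint_arc; last exact: bmeas_cst.
transitivity (c%:E * (N.+1%:R^-1)%:E)%E; last by [].
rewrite integral_cst//; congr (_ * _)%E.
have := @lebesgue_measure_itv R `[Q%:R / N.+1%:R, Q.+1%:R / N.+1%:R[.
rewrite /= lte_fin ltr_pM2r ?invr_gt0// ltr_nat ltnSn => ->.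
by rewrite -EFinD -mulrBl -natr1 addrAC subrr add0r mul1r.
Qed.

Lemma arc_average_le (f g : R -> R) Q : bmeas (f : mR -> R) -> bmeas (g : mR -> R) ->
  (forall t, f t <= g t) -> arc_average f Q <= arc_average g Q.
Proof.
move=> bf bg fg; rewrite /arc_average ler_pM2l ?ltr0n//.
have ba : bmeas (fun s : mR => \1_(arc Q) (expi s) : R).
  by apply: (bmeas_comp (@measurable_expi R)); apply: bmeas_indicator; exact: measurable_arc.
by apply: bint_le => [||t]; [exact: bmeasM|exact: bmeasM|rewrite ler_wpM2r// indicE].
Qed.

Lemma frame_arc_mass w Q : good_fiber sigma T mu w ->
  \int[p w]_z frame_arc Q w z = N.+1%:R^-1.
Proof.
move=> gw; have NR : 0 < N.+1%:R :> R by rewrite ltr0n.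
have := bint_frame_arc Q gw (bmeas_cst R[i] (1 : R)); rewrite arc_average_cst.
under eq_Rintegral do rewrite mul1r.
by move=> h; apply: (mulfI (lt0r_neq0 NR)); rewrite h divff// gt_eqF.
Qed.

Lemma arc_growth_ge0 w Q : good_fiber sigma T mu w -> 0 <= arc_growth w Q.
Proof.
move=> gw; rewrite arc_growthE// -(arc_average_cst 0 Q); apply: arc_average_le.
- exact: bmeas_cst.
- by apply: bmeas_framed; exact: bmeas_block_deriv.
move=> t; apply: (le_trans ler01); apply: block_deriv_ge1 => //.
exact: frame_circle (good_disk gw 0%N).
Qed.

Let keps : 0 < 1 + k%:R * eps.
Proof. by rewrite ltr_pwDl// mulr_ge0// ltW. Qed.

Lemma symbol_mass_ge0 i w Q a :
  0 <= N.+1%:R * \int[p w]_z (frame_arc Q w z * \1_(A a) (It i w z)).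
Proof.
rewrite mulr_ge0//; apply: Rintegral_ge0 => z _.
by rewrite mulr_ge0// /frame_arc indicE.
Qed.

Lemma symbol_prob_ge i w Q a : eps / (1 + k%:R * eps) <= symbol_prob i w Q a.
Proof. by rewrite ler_pM2r ?invr_gt0// lerDr symbol_mass_ge0. Qed.

Lemma symbol_prob_gt0 i w Q a : 0 < symbol_prob i w Q a.
Proof. by apply: lt_le_trans (symbol_prob_ge i w Q a); rewrite divr_gt0. Qed.

Lemma sum_symbol_prob i w Q : good_fiber sigma T mu w -> \sum_a symbol_prob i w Q a = 1.
Proof.
move=> gw; rewrite -mulr_suml big_split/= sumr_const card_ord -[eps *+ k]mulr_natl -mulr_sumr.
rewrite -bint_fsum; last by move=> a; apply: bmeasM; [exact: bmeas_frame_arc|exact: bmeas_symbol].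
rewrite (bint_ae (g := frame_arc Q w)).
- by rewrite frame_arc_mass// divff ?divff// gt_eqF.
- by apply: bmeas_fsum => a; apply: bmeasM; [exact: bmeas_frame_arc|exact: bmeas_symbol].
- exact: bmeas_frame_arc.
apply: (aeS (ae_circle (mu_circle w))) => z z1.
have [a ha] := circle_cell hA (iter_circle T sigma i w z1).
by rewrite (sum_symbol (fun=> frame_arc Q w z) ha).
Qed.

Lemma symbol_prob_le1 i w Q a : good_fiber sigma T mu w -> symbol_prob i w Q a <= 1.
Proof.
move=> gw; rewrite -(sum_symbol_prob i Q gw) (bigD1 a)//= lerDl sumr_ge0// => b _.
exact/ltW/symbol_prob_gt0.
Qed.

End fixed_resolution.
End fiber_coding.

(** * Markov coding of itineraries *)

Section coding_bound.
Context d (Omega : measurableType d) (R : realType).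
Variables (sigma : Omega -> Omega) (T : blaschke_cocycle Omega R).
Variable mu : R.-pker Omega ~> R[i].
Hypothesis ms : measurable_fun [set: Omega] sigma.
Hypothesis mu_circle : forall w, kernel_prob mu w (@circle R) = 1%E.
Local Notation unif := (@unif01 R).
Local Notation mR := (measurableTypeR R).
Local Notation It := (cocycle_iter sigma T).
Local Notation p := (kernel_prob mu).
Local Notation x w := (barycenter (p w)).
Variables (k : nat) (A : 'I_k -> set R[i]).
Hypothesis hA : finite_partition (@circle R) A.
Variables (M : nat) (eps : R).
Hypothesis M0 : (0 < M)%N.
Hypothesis eps0 : 0 < eps.
Local Notation growth := (growth_cost sigma T mu M).
Local Notation symbol N i := (symbol_cost sigma T mu A eps N i).

(** Use [entropy_code] with hidden path the arcs visited at multiples of [M] in the moving frames.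
    The initial arc costs ln (N + 1), each block a transition, and the l-th letter is coded given
    the arc at block l / M, at position l mod M inside it. *)
Lemma join_entropy_upper N n w : (forall m, good_fiber sigma T mu (iter m sigma w)) ->
  join_entropy sigma T mu A (n * M) w <= ln N.+1%:R +
    \sum_(j < n) \int[p (iter (j * M) sigma w)]_z growth N (iter (j * M) sigma w) z +
    \sum_(l < n * M) \int[p (iter (l %/ M * M)%N sigma w)]_z symbol N (l %% M)%N (iter (l %/ M * M)%N sigma w) z.
Proof.
move=> gws; have gw : good_fiber sigma T mu w := gws 0%N.
pose wj j := iter (j * M) sigma w.
have gwj j : good_fiber sigma T mu (wj j) := gws _.
have xj j : modulus (x (wj j)) < 1 := good_disk (gwj j) 0%N.
pose rch j (y : 'I_N.+1) := reach (block_map sigma T mu M (wj j)) y.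
(* Uniform transition on the arcs that the block can reach; the choice of law matters only through
   the count in [card_reach]. *)
pose q j (y y' : 'I_N.+1) : R := if y' \in rch j y then #|rch j y|%:R^-1 else 0.
pose r l (y : 'I_N.+1) a : R := symbol_prob sigma T mu A eps (l %% M)%N (wj (l %/ M)%N) y a.
pose V (b : {ffun 'I_(n * M) -> 'I_k}) (y : {ffun 'I_n.+1 -> 'I_N.+1}) : R :=
  N.+1%:R^-1 * \prod_(j < n) q j (y (inord j)) (y (inord j.+1)) *
    \prod_(l < n * M) r l (y (inord (l %/ M)%N)) (b l).
pose lab j z : 'I_N.+1 := arc_index N (mobius (x (wj j)) (It (j * M) w z)).
pose Y z : {ffun 'I_n.+1 -> 'I_N.+1} := [ffun j : 'I_n.+1 => lab j z].
pose c z := ln N.+1%:R + \sum_(j < n) growth N (wj j) (It (j * M) w z) +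
  \sum_(l < n * M) symbol N (l %% M)%N (wj (l %/ M)%N) (It (l %/ M * M)%N w z).
have q0 j y y' : 0 <= q j y y' by rewrite /q; case: ifP => // _; rewrite invr_ge0.
have q1 j y : \sum_y' q j y y' <= 1.
  rewrite /q -big_mkcond/= sumr_const -[_ *+ _]mulr_natl.
  by have [->|h] := eqVneq #|rch j y| 0%N; rewrite ?mul0r// divff// pnatr_eq0.
have r0 l y a : 0 <= r l y a by apply/ltW/symbol_prob_gt0.
have r1 l y : \sum_a r l y a <= 1 by rewrite /r sum_symbol_prob.
have V0 b y : 0 <= V b y by rewrite !mulr_ge0 ?invr_ge0 ?prodr_ge0.
have V1 : \sum_b \sum_y V b y <= 1 := code_sum_le1 n (n * M) (fun l => l %/ M)%N (ltn0Sn N) q0 q1 r0 r1.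
have bg (j : 'I_n) : bmeas (fun z => growth N (wj j) (It (j * M) w z)).
  by apply: (bmeas_comp (measurable_It sigma T (j * M) w)); exact: bmeas_growth_cost.
have bs (l : 'I_(n * M)) : bmeas (fun z => symbol N (l %% M)%N (wj (l %/ M)%N) (It (l %/ M * M)%N w z)).
  by apply: (bmeas_comp (measurable_It sigma T (l %/ M * M)%N w)); exact: bmeas_symbol_cost.
have b1 := bmeas_sum bg; have b2 := bmeas_sum bs; have b3 := bmeas_cst R[i] (ln N.+1%:R : R).
have bc : bmeas c by apply: bmeasD => //; exact: bmeasD.
have -> : ln N.+1%:R + \sum_(j < n) \int[p (wj j)]_z growth N (wj j) z +
    \sum_(l < n * M) \int[p (wj (l %/ M)%N)]_z symbol N (l %% M)%N (wj (l %/ M)%N) z = \int[p w]_z c z.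
  rewrite /c bintD//; last exact: bmeasD.
  rewrite bintD// bint_cst !bint_sum//; congr (_ + _ + _).
    apply: eq_bigr => j _; apply: (bint_good (j * M) gw); exact: bmeas_growth_cost.
  apply: eq_bigr => l _; apply: (bint_good (l %/ M * M)%N gw); exact: bmeas_symbol_cost.
apply: (entropy_code (join_partition sigma T hA (n * M) w (mu_circle w)) V0 V1 bc (Y := Y)).
apply: (aeS (ae_circle (mu_circle w))) => z z1 b hb.
have zj j := iter_circle T sigma j w z1.
have labj j : arc (lab j z) (mobius (x (wj j)) (It (j * M) w z)).
  by apply: arc_indexP; exact: mobius_circle.
have Yj j : (j <= n)%N -> Y z (inord j) = lab j z by move=> jn; rewrite ffunE inordK.
have qj (j : 'I_n) : 0 < q j (lab j z) (lab j.+1 z) /\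
    - ln (q j (lab j z) (lab j.+1 z)) <= growth N (wj j) (It (j * M) w z).
  have hr : lab j.+1 z \in rch j (lab j z).
    apply: (reachP (labj j)); rewrite /block_map mobiusK ?zj//.
    have ej : wj j.+1 = iter M sigma (wj j) by rewrite /wj mulSn iterD.
    have eI : It (j.+1 * M) w z = It M (wj j) (It (j * M) w z) by rewrite mulSn addnC cocycle_iterD.
    by have := labj j.+1; rewrite ej eI.
  have h0 : 0 < #|rch j (lab j z)|%:R :> R by rewrite ltr0n; apply/card_gt0P; exists (lab j.+1 z).
  rewrite /q hr; split; first by rewrite invr_gt0.
  rewrite growth_costE ?zj// lnV ?posrE// opprK.
  have [g hg] := block_lift M (gwj j).
  have h2 := card_reach (ltn0Sn N) hg (lab j z).
  rewrite -(arc_growth_lift ms _ (gwj j) hg) in h2.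
  by rewrite ler_ln// posrE (lt_le_trans h0).
have rl (l : 'I_(n * M)) : 0 < r l (lab (l %/ M)%N z) (b l) /\
    - ln (r l (lab (l %/ M)%N z) (b l)) = symbol N (l %% M)%N (wj (l %/ M)%N) (It (l %/ M * M)%N w z).
  split; first exact: symbol_prob_gt0.
  rewrite (symbol_costE hA eps N (a := b l))//; rewrite ?zj//.
  rewrite -cocycle_iterD -divn_eq; exact: (hb l I).
have lM (l : 'I_(n * M)) : (l %/ M <= n)%N by apply: ltnW; rewrite ltn_divLR.
have VE : V b (Y z) = N.+1%:R^-1 * \prod_(j < n) q j (lab j z) (lab j.+1 z) *
    \prod_(l < n * M) r l (lab (l %/ M)%N z) (b l).
  rewrite /V; congr (_ * _ * _); apply: eq_bigr => j _; rewrite !Yj//.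
  exact: ltnW.
have N0 : 0 < N.+1%:R^-1 :> R by rewrite invr_gt0.
have P1 : 0 < \prod_(j < n) q j (lab j z) (lab j.+1 z) by apply: prodr_gt0 => j _; have [] := qj j.
have P2 : 0 < \prod_(l < n * M) r l (lab (l %/ M)%N z) (b l) by apply: prodr_gt0 => j _; have [] := rl j.
have lnprod m (u : 'I_m -> R) : (forall i, 0 < u i) -> ln (\prod_i u i) = \sum_i ln (u i).
  elim: m u => [|m ih] u u0; first by rewrite !big_ord0 ln1.
  by rewrite !big_ord_recl lnM ?posrE// ?ih// prodr_gt0.
rewrite VE; split; first by rewrite !mulr_gt0.
rewrite lnM ?posrE ?mulr_gt0// lnM ?posrE// lnV ?posrE// !opprD opprK.
rewrite !lnprod; [|by move=> l; have [] := rl l|by move=> j; have [] := qj j].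
rewrite /c -!sumrN; apply: lerD; last by apply: ler_sum => l _; have [_ ->] := rl l.
by rewrite lerD2l; apply: ler_sum => j _; have [] := qj j.
Qed.

Section cost_bounds.
Variable w : Omega.
Hypothesis gw : good_fiber sigma T mu w.
Let x1 : modulus (x w) < 1 := good_disk gw 0%N.

Lemma growth_mean_ge0 N : 0 <= \int[p w]_z growth N w z.
Proof.
rewrite -(bint_cst (p w) 0); apply: circle_bint_le => //.
- exact: bmeas_cst.
- exact: bmeas_growth_cost.
move=> z z1; rewrite growth_costE// ln_ge0//.
by have := arc_growth_ge0 ms M (arc_index N (mobius (x w) z)) gw; lra.
Qed.

(** Concavity of ln, by its tangent line at D + 2: arcs have equal mass on a good fibre, and their
    growths average to the degree D of the block. The bound is uniform in [N] and serves as the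
    dominating function. *)
Lemma growth_mean_le N : \int[p w]_z growth N w z <= ln ((iter_degree T sigma M w)%:R + 2).
Proof.
set D : R := (iter_degree T sigma M w)%:R.
have D0 : 0 <= D by [].
have D2 : 0 < D + 2 by rewrite ltr_wpDl.
pose u z := \sum_Q ((arc_growth sigma T mu M w Q + 2) / (D + 2) - 1 + ln (D + 2)) * frame_arc mu (N := N) Q w z.
have bu : bmeas u by apply: bmeas_fsum => Q; apply: bmeasM; [exact: bmeas_cst|exact: bmeas_frame_arc].
apply: (@le_trans _ _ (\int[p w]_z u z)).
  apply: circle_bint_le => //; first exact: bmeas_growth_cost.
  move=> z z1; rewrite growth_costE// /u.
  rewrite (sum_frame_arc (fun Q => (arc_growth sigma T mu M w Q + 2) / (D + 2) - 1 + ln (D + 2)))//.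
  set Q := arc_index N _; have g0 := arc_growth_ge0 ms M Q gw.
  have g2 : 0 < arc_growth sigma T mu M w Q + 2 by rewrite ltr_wpDl.
  have := ln_le_sub1 (divr_gt0 g2 D2); rewrite ln_div ?posrE//; lra.
have NR : 0 < N.+1%:R :> R by rewrite ltr0n.
rewrite bint_fsum; last by move=> Q; apply: bmeasM; [exact: bmeas_cst|exact: bmeas_frame_arc].
have -> : \sum_(Q < N.+1) \int[p w]_z (((arc_growth sigma T mu M w Q + 2) / (D + 2) - 1 + ln (D + 2)) *
    frame_arc mu Q w z) = \sum_(Q < N.+1) ((arc_growth sigma T mu M w Q + 2) / (D + 2) - 1 + ln (D + 2)) / N.+1%:R.
  apply: eq_bigr => Q _; rewrite bintZ ?(frame_arc_mass _ gw)//; exact: bmeas_frame_arc.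
rewrite -mulr_suml big_split/= sumr_const card_ord big_split/= sumr_const card_ord -mulr_suml.
rewrite big_split/= sumr_const card_ord.
have -> : \sum_(Q < N.+1) arc_growth sigma T mu M w Q = N.+1%:R * D.
  rewrite /arc_growth -mulr_sumr -bint_fsum; last first.
    by move=> Q; apply: bmeasM; [exact: bmeas_block_deriv|exact: bmeas_frame_arc].
  congr (_ * _); rewrite (bint_ae (g := block_deriv sigma T mu M w)).
  - rewrite (bint_frame gw); last exact: bmeas_block_deriv.
    have [g hg] := block_lift M gw.
    have bd := bmeas_comp (measurable_frame mu w) (bmeas_block_deriv M ms gw).
    have e1 : exists C : R, forall t : R, `|(fun=> 1) (expi t : R[i])| <= C by exists 1 => t; rewrite normr1.
    have := circle_lift_bint (iter_degree_gt0 T sigma M w) hg bd (F := fun=> 1) (measurable_cst _) e1.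
    by under eq_Rintegral do rewrite mul1r; move=> ->; rewrite bint_cst mulr1.
  - apply: bmeas_fsum => Q; apply: bmeasM; [exact: bmeas_block_deriv|exact: bmeas_frame_arc].
  - exact: bmeas_block_deriv.
  - apply: (aeS (ae_circle (mu_circle w))) => z z1.
    exact: (sum_frame_arc (fun=> block_deriv sigma T mu M w z)).
rewrite -[2 *+ _]mulr_natl -mulrDr -[- 1 *+ _]mulr_natl -[ln _ *+ _]mulr_natl.
rewrite -mulrA -!mulrDr mulrAC divff ?gt_eqF// mul1r divff ?gt_eqF// subrr add0r//.
Qed.

End cost_bounds.
End coding_bound.

(** * Dominated convergence and coboundaries *)

Section dominated.
Context d (X : measurableType d) (R : realType) (P : probability X R).

Lemma dominated_cvg (f : nat -> X -> R) (g h : X -> R) :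
    (forall n, measurable_fun [set: X] (f n)) -> measurable_fun [set: X] g ->
    P.-integrable setT (EFin \o h) ->
    {ae P, forall x, forall n, `|f n x| <= h x} -> {ae P, forall x, f ^~ x @ \oo --> g x} ->
  P.-integrable setT (EFin \o g) /\ (fun n => \int[P]_x f n x) @ \oo --> \int[P]_x g x.
Proof.
move=> mf mg ih fh fg.
have mfE n : measurable_fun setT (EFin \o f n) by exact/measurable_EFinP.
have mgE : measurable_fun setT (EFin \o g) by exact/measurable_EFinP.
have fgE : {ae P, forall x, setT x -> (fun n => (EFin \o f n) x) @ \oo --> (EFin \o g) x}.
  by apply: (aeS fg) => x hx _; apply/fine_cvgP; split; [exact: nearW|exact: hx].
have fhE : {ae P, forall x, forall n, setT x -> (`|(EFin \o f n) x| <= (EFin \o h) x)%E}.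
  by apply: (aeS fh) => x hx n _; rewrite lee_fin.
have [ig _ hc] := dominated_convergence measurableT mfE mgE fgE ih fhE.
split; first exact: ig.
apply: fine_cvg; rewrite fineK ?integrable_fin_num//.
Qed.

Lemma integrable_le_ae (f h : X -> R) : measurable_fun [set: X] f ->
  P.-integrable setT (EFin \o h) -> {ae P, forall x, `|f x| <= h x} ->
  P.-integrable setT (EFin \o f).
Proof.
move=> mf ih fh; have [] // := @dominated_cvg (fun=> f) f h (fun=> mf) mf ih.
- by apply: (aeS fh) => x hx n.
- by apply: aeW => x; exact: cvg_cst.
Qed.

Variable s : X -> X.
Hypothesis ms : measurable_fun [set: X] s.
Hypothesis mp : measure_preserving P s.

(* A coboundary bounded below by an integrable function has nonpositive mean,
   whether or not its transfer function [e] is integrable. *)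
Lemma coboundary_le (E e : X -> R) : P.-integrable setT (EFin \o E) ->
    measurable_fun [set: X] e -> {ae P, forall x, 0 <= E x + (e (s x) - e x)} ->
  P.-integrable setT (EFin \o (fun x => E x + (e (s x) - e x))) /\
  \int[P]_x (E x + (e (s x) - e x)) <= \int[P]_x E x.
Proof.
move=> iE me Ee.
have mE : measurable_fun [set: X] E by apply/measurable_EFinP; exact: measurable_int iE.
have iN : P.-integrable setT (EFin \o (fun x => `|E x|)) := integrable_norm iE.
pose cl (K : nat) (y : R) : R := Num.max (- K%:R) (Num.min y K%:R).
have mcl K (f : X -> R) : measurable_fun [set: X] f -> measurable_fun [set: X] (fun x => cl K (f x)).
  by move=> mf; apply: measurable_maxr => //; exact: measurable_minr.
have clb K y : `|cl K y| <= K%:R.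
  have K0 : 0 <= K%:R :> R by [].
  rewrite ler_norml /cl le_max lexx/= ge_max ge_min lexx orbT andbT.
  by rewrite (le_trans _ K0)// oppr_le0.
have clE K y : `|y| <= K%:R -> cl K y = y.
  by move=> /ler_normlP[h1 h2]; rewrite /cl (min_idPl h2) max_r// lerNl.
have cl_lip K a b h : 0 <= h -> b - h <= a -> cl K b - h <= cl K a.
  move=> h0 hab; have K0 : 0 <= K%:R :> R by [].
  rewrite /cl !maxEle !minEle; do !case: ifP; move=> *; lra.
have mes : measurable_fun [set: X] (fun x => e (s x)) by exact: measurableT_comp me ms.
(* Truncating [e] at level K makes its coboundary integrate to 0, and [cl_lip] keeps [u K]
   nonnegative almost everywhere. Fatou's lemma then bounds the mean of |E| plus the full coboundary
   by that of |E|. *)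
pose u K x := `|E x| + (cl K (e (s x)) - cl K (e x)).
have bcl K : bmeas (fun x => cl K (e x)) by split; [exact: mcl|exists K%:R].
have bcls K : bmeas (fun x => cl K (e (s x))) by split; [exact: mcl|exists K%:R].
have iu K : P.-integrable setT (EFin \o u K).
  by apply: integrable_realD => //; apply: bmeas_integrable; exact: bmeasB.
have uE K : \int[P]_x u K x = \int[P]_x `|E x|.
  rewrite RintegralD//; last by apply: bmeas_integrable; exact: bmeasB.
  by rewrite bintB// (bint_iter ms mp 1 (bcl K)) subrr addr0.
have u0 : {ae P, forall x, forall K, 0 <= u K x}.
  apply: (aeS Ee) => x hx K; rewrite /u.
  have h1 : e x - `|E x| <= e (s x) by have := ler_norm (E x); lra.
  have := cl_lip K _ _ _ (normr_ge0 (E x)) h1; lra.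
pose v x := `|E x| + (e (s x) - e x).
have v0 : {ae P, forall x, 0 <= v x}.
  by apply: (aeS Ee) => x hx; rewrite /v; have := ler_norm (E x); lra.
have mu_ K : measurable_fun [set: X] (u K) by apply/measurable_EFinP; exact: measurable_int (iu K).
have mv : measurable_fun [set: X] v.
  by apply: measurable_funD; [exact: measurableT_comp|exact: measurable_funB].
have ucvg x : (fun K => (Num.max (u K x) 0)%:E) @ \oo --> (Num.max (v x) 0)%:E.
  apply: cvg_near_cst; exists (maxn (Num.truncn `|e x|).+1 (Num.truncn `|e (s x)|).+1) => // K /=.
  rewrite geq_max => /andP[h1 h2]; rewrite /u !clE//.
    by rewrite (le_trans (ltW (truncnS_gt _)))// ler_nat.
  by rewrite (le_trans (ltW (truncnS_gt _)))// ler_nat.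
have mm (f : X -> R) : measurable_fun [set: X] f ->
    measurable_fun [set: X] (fun x => (Num.max (f x) 0)%:E : \bar R).
  by move=> mf; apply/measurable_EFinP; exact: measurable_maxr.
have m0 (f : X -> R) x : (0 <= (Num.max (f x) 0)%:E :> \bar R)%E by rewrite lee_fin le_max lexx orbT.
have hf := fatou P measurableT (fun K => mm _ (mu_ K)) (fun K x _ => m0 (u K) x).
have aeint (f : X -> R) : measurable_fun [set: X] f -> {ae P, forall x, 0 <= f x} ->
    (\int[P]_x (Num.max (f x) 0)%:E = \int[P]_x `|(f x)%:E|)%E.
  move=> mf f0; apply: ae_eq_integral => //; first exact: mm.
    by apply: measurableT_comp => //; exact/measurable_EFinP.
  by apply: (aeS f0) => x hx _; rewrite max_l//= ger0_norm.
have hu K : (\int[P]_x (Num.max (u K x) 0)%:E = (\int[P]_x `|E x|)%:E)%E.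
  have -> : ((\int[P]_x `|E x|)%:E = \int[P]_x (u K x)%:E)%E by rewrite -(uE K) fineK// (integrable_fin_num measurableT (iu K)).
  apply: ae_eq_integral => //; first exact: mm.
    exact/measurable_EFinP.
  by apply: (aeS u0) => x /(_ K) hx _; rewrite max_l.
have hv : (\int[P]_x `|(v x)%:E| <= (\int[P]_x `|E x|)%:E)%E.
  rewrite -aeint//; apply: le_trans; last first.
    apply: le_trans hf _; rewrite (_ : (fun K => _) = fun=> (\int[P]_x `|E x|)%:E); last exact/funext.
    by rewrite (cvg_limn_einf_sup (cvg_cst _)).1.
  rewrite le_eqVlt; apply/orP; left; apply/eqP; apply: eq_integral => x _.
  by rewrite (cvg_limn_einf_sup (ucvg x)).1.
have iv : P.-integrable setT (EFin \o v).
  apply/integrableP; split; first exact/measurable_EFinP.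
  by apply: (le_lt_trans hv); rewrite ltry.
have ivE := integrable_realB iv iN; have iEv := integrable_realD iE ivE.
have e1 : (fun x => E x + (e (s x) - e x)) = (fun x => E x + (v x - `|E x|)).
  by apply/funext => x; rewrite /v; ring.
rewrite e1; split => //; rewrite RintegralD// RintegralB// gerDl subr_le0.
have : (\int[P]_x v x)%:E = (\int[P]_x `|(v x)%:E|)%E.
  rewrite fineK ?integrable_fin_num//; apply: ae_eq_integral => //.
  - exact/measurable_EFinP.
  - by apply: measurableT_comp => //; exact/measurable_EFinP.
  - by apply: (aeS v0) => x hx _; rewrite /= ger0_norm.
by move=> h; rewrite -lee_fin h.
Qed.

End dominated.

Lemma sum_modn (R : nmodType) (c : nat -> R) n M :
  \sum_(l < n * M) c (l %% M)%N = (\sum_(i < M) c i) *+ n.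
Proof.
elim: n => [|n ih]; first by rewrite mul0n big_ord0 mulr0n.
rewrite mulrS -ih mulSn big_split_ord/=; congr (_ + _); apply: eq_bigr => i _.
  by rewrite modn_small.
by rewrite modnDl.
Qed.

(** * Limits of the costs as the arcs shrink *)

Section cost_limits.
Context d (Omega : measurableType d) (R : realType).
Variables (sigma : Omega -> Omega) (T : blaschke_cocycle Omega R).
Variable mu : R.-pker Omega ~> R[i].
Hypothesis ms : measurable_fun [set: Omega] sigma.
Hypothesis mu_circle : forall w, kernel_prob mu w (@circle R) = 1%E.
Local Notation unif := (@unif01 R).
Local Notation mR := (measurableTypeR R).
Local Notation It := (cocycle_iter sigma T).
Local Notation p := (kernel_prob mu).
Local Notation x w := (barycenter (p w)).
Variables (k : nat) (A : 'I_k -> set R[i]).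
Hypothesis hA : finite_partition (@circle R) A.
Variables (M : nat) (eps : R).
Hypothesis eps0 : 0 < eps.
Local Notation growth := (growth_cost sigma T mu M).
Local Notation symbol N i := (symbol_cost sigma T mu A eps N i).
Variable w : Omega.
Hypothesis gw : good_fiber sigma T mu w.
Let x1 : modulus (x w) < 1 := good_disk gw 0%N.
Local Notation D := (block_deriv sigma T mu M w).

Let keps : 0 < 1 + k%:R * eps.
Proof. by rewrite ltr_pwDl// mulr_ge0// ltW. Qed.

Lemma symbol_cost_itv N i z : modulus z = 1 ->
  0 <= symbol N i w z <= - ln (eps / (1 + k%:R * eps)).
Proof.
move=> z1; have [a ha] := circle_cell hA (iter_circle T sigma i w z1).
rewrite (symbol_costE hA eps N x1 z1 ha) oppr_ge0.
have h1 := symbol_prob_gt0 sigma T mu A eps0 i w (arc_index N (mobius (x w) z)) a.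
apply/andP; split; first by apply: ln_le0; exact: symbol_prob_le1.
have h2 := divr_gt0 eps0 keps.
by rewrite lerN2 ler_ln ?posrE//; exact: symbol_prob_ge.
Qed.

Lemma symbol_mean_norm N i : `|\int[p w]_z symbol N i w z| <= - ln (eps / (1 + k%:R * eps)).
Proof.
rewrite ger0_norm.
  rewrite -(bint_cst (p w) (- _)); apply: circle_bint_le => //.
  - exact: bmeas_symbol_cost.
  - exact: bmeas_cst.
  - by move=> z /(symbol_cost_itv N i)/andP[].
rewrite -(bint_cst (p w) 0); apply: circle_bint_le => //.
- exact: bmeas_cst.
- exact: bmeas_symbol_cost.
- by move=> z /(symbol_cost_itv N i)/andP[].
Qed.

Let frame1 t : modulus (frame mu w t) = 1 := frame_circle t x1.

Let arc_frame N t : arc (arc_index N (mobius (x w) (frame mu w t))) (expi t).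
Proof. by rewrite frameK//; exact: arc_indexP (expi_modulus t). Qed.

(** In the frame, [arc_growth] is an average of the block derivative over the arc, so Lebesgue
    differentiation applies; boundedness of the derivative on one fibre gives domination. *)
Lemma growth_mean_cvg :
  (fun N => \int[p w]_z growth N w z) @ \oo --> \int[p w]_z ln (D z + 2).
Proof.
have bD := bmeas_block_deriv M ms gw; have [mD [C hC]] := bD.
have bfD := bmeas_framed mu w bD.
have C0 : 0 <= C := le_trans (normr_ge0 _) (hC 1).
have D0 t : 0 <= D (frame mu w t) := le_trans ler01 (block_deriv_ge1 M gw (frame1 t)).
have hav N Q : 0 <= arc_growth sigma T mu M w (N := N) Q <= C.
  rewrite arc_growth_ge0//= arc_growthE// -(arc_average_cst C Q).
  apply: arc_average_le => //; first exact: bmeas_cst.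
  by move=> t; exact: le_trans (ler_norm _) (hC _).
have lnb y : 0 <= y <= C -> `|ln (y + 2)| <= ln (C + 2).
  move=> /andP[y0 yC]; rewrite ger0_norm ?ln_ge0//; last by lra.
  by rewrite ler_ln ?posrE; lra.
have mlnD : measurable_fun [set: R[i]] (fun z => ln (D z + 2)).
  by apply: measurable_ln_comp; exact: measurable_funD.
have blD : bmeas (fun z => ln (D z + 2)).
  split => //; exists (ln (C + 2)) => z; apply: lnb.
  have := hC z; rewrite ler_norml => /andP[_ ->]; rewrite andbT.
  rewrite /block_deriv /on_circle; case: eqP => // z1.
  by rewrite -block_derivE// (le_trans ler01)// block_deriv_ge1.
rewrite (bint_frame gw blD) (_ : (fun N => _) = (fun N => \int[unif]_t growth N w (frame mu w t))); last first.
  by apply/funext => N; rewrite (bint_frame gw)//; exact: bmeas_growth_cost.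
apply: (@bounded_convergence _ _ _ unif _ _ (ln (C + 2))).
- by move=> N; have [] := bmeas_framed mu w (bmeas_growth_cost sigma T mu M N w).
- by have [] := bmeas_framed mu w blD.
- by move=> N t; rewrite growth_costE//; exact: lnb.
apply: (aeS (arc_average_cvg bfD)) => t ht.
have := ht (fun N => arc_index N (mobius (x w) (frame mu w t))) (arc_frame ^~ t).
set a := (fun N => arc_average _ _) => ha.
rewrite (_ : (fun N => _) = (fun N => ln (a N + 2))); last first.
  by apply/funext => N; rewrite growth_costE// arc_growthE.
apply: (@cvg_comp _ _ _ (fun N => a N + 2) (@ln R) _ (nbhs (D (frame mu w t) + 2))).
  by apply: cvgD => //; exact: cvg_cst.
by apply: continuous_ln; rewrite ltr_wpDl.
Qed.

(** At a density point of its cell the conditional probability of the observed symbol tends to 1, so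
    only the cost of the smoothing by [eps] survives. *)
Lemma symbol_mean_cvg i :
  (fun N => \int[p w]_z symbol N i w z) @ \oo --> - ln ((1 + eps) / (1 + k%:R * eps)).
Proof.
set c := - ln _; rewrite -(bint_cst unif c).
rewrite (_ : (fun N => _) = (fun N => \int[unif]_t symbol N i w (frame mu w t))); last first.
  by apply/funext => N; rewrite (bint_frame gw)//; exact: bmeas_symbol_cost.
apply: (@bounded_convergence _ _ _ unif _ _ (- ln (eps / (1 + k%:R * eps)))).
- by move=> N; have [] := bmeas_framed mu w (bmeas_symbol_cost T mu ms hA eps N i w).
- exact: measurable_cst.
- by move=> N t; have /andP[h1 h2] := symbol_cost_itv N i (frame1 t); rewrite ger0_norm.
(* Letters are enumerated by natural numbers so that the countable intersection of sets of full
   measure applies. *)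
have hall : {ae unif, forall t : mR, forall n, forall a : 'I_k, val a = n -> forall j : forall N, 'I_N.+1,
    (forall N, arc (j N) (expi t)) ->
    (fun N => arc_average (fun t => \1_(A a) (It i w (frame mu w t))) (j N)) @ \oo -->
      (\1_(A a) (It i w (frame mu w t)) : R)}.
  apply: ae_all_nat => n; have [nk|nk] := ltnP n k; last first.
    by apply: aeW => t a an; move: nk; rewrite -an leqNgt ltn_ord.
  have bf := bmeas_framed mu w (bmeas_symbol T ms hA i w (Ordinal nk)).
  apply: (aeS (arc_average_cvg bf)) => t ht a an j hj.
  by rewrite (_ : a = Ordinal nk); [exact: ht|exact: val_inj].
apply: (aeS hall) => t ht.
have [a ha] := circle_cell hA (iter_circle T sigma i w (frame1 t)).
have := ht a a erefl (fun N => arc_index N (mobius (x w) (frame mu w t))) (arc_frame ^~ t).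
set v := (fun N => arc_average _ _); rewrite indicE mem_set//= => hv.
rewrite (_ : (fun N => _) = (fun N => - ln ((v N + eps) / (1 + k%:R * eps)))); last first.
  apply/funext => N; rewrite (symbol_costE hA eps N x1 (frame1 t) ha).
  rewrite /symbol_prob /v.
  rewrite -(bint_frame_arc (arc_index N (mobius (x w) (frame mu w t))) gw (bmeas_symbol T ms hA i w a)).
  rewrite (@eq_Rintegral _ _ _ (p w) [set: R[i]] (fun z => \1_(A a) (It i w z) *
    frame_arc mu (arc_index N (mobius (x w) (frame mu w t))) w z))// => z _.
  exact: mulrC.
apply: cvgN; apply: (@cvg_comp _ _ _ (fun N => (v N + eps) / (1 + k%:R * eps)) (@ln R) _
  (nbhs ((1 + eps) / (1 + k%:R * eps)))).
  by apply: cvgMl; apply: cvgD => //; exact: cvg_cst.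
by apply: continuous_ln; rewrite divr_gt0// addr_gt0.
Qed.

End cost_limits.

(** * The entropy rate bounded through blocks *)

Section upper_bound.
Context d (Omega : measurableType d) (R : realType) (P : probability Omega R).
Variables (sigma : Omega -> Omega) (T : blaschke_cocycle Omega R).
Variable mu : R.-pker Omega ~> R[i].
Hypothesis ms : measurable_fun [set: Omega] sigma.
Hypothesis mp : measure_preserving P sigma.
Hypothesis mu_circle : forall w, kernel_prob mu w (@circle R) = 1%E.
Hypothesis ae_good : {ae P, forall w, good_fiber sigma T mu w}.
Local Notation It := (cocycle_iter sigma T).
Local Notation p := (kernel_prob mu).
Local Notation x w := (barycenter (p w)).
Hypothesis deg_lam : P.-integrable setT (EFin \o (fun w => (degree T w)%:R / inf_deriv T w)).

Section integrable_exponent.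
Hypothesis iexp : P.-integrable setT (EFin \o exponent T mu).

(** From ln (n / inf |T'|) <= n / inf |T'| - 1 and exponent >= ln inf |T'|. It makes ln of the
    degree integrable once the exponent is. *)
Lemma ln_degree_le w : 0 <= ln ((degree T w)%:R : R) <= (degree T w)%:R / inf_deriv T w + exponent T mu w.
Proof.
have l0 := inf_deriv_gt0 T w; have d0 : 0 < (degree T w)%:R :> R by rewrite ltr0n degree_gt0.
have h1 := exponent_ge T (mu_circle w).
apply/andP; split; first by rewrite ln_ge0// ler1n degree_gt0.
have := ln_le_sub1 (divr_gt0 d0 l0); rewrite ln_div ?posrE//; lra.
Qed.

Lemma integrable_ln_degree : P.-integrable setT (EFin \o (fun w => ln (degree T w)%:R : R)).
Proof.
apply: integrable_le (integrable_realD deg_lam iexp); first by apply: measurable_ln_comp; exact: measurable_degreeR.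
by move=> w; have /andP[h1 h2] := ln_degree_le w; rewrite ger0_norm.
Qed.

Variables (k : nat) (A : 'I_k -> set R[i]).
Hypothesis hA : finite_partition (@circle R) A.
Variables (M : nat) (eps : R).
Hypothesis M0 : (0 < M)%N.
Hypothesis eps0 : 0 < eps.
Local Notation growth := (growth_cost sigma T mu M).
Local Notation symbol N i := (symbol_cost sigma T mu A eps N i).

Let ae_goods : {ae P, forall w, forall m, good_fiber sigma T mu (iter m sigma w)} :=
  ae_preserving_iter ms mp ae_good.

Let K N w : R := \int[p w]_z growth N w z.
Let C N i w : R := \int[p w]_z symbol N i w z.
Let Koo w : R := \int[p w]_z ln (block_deriv sigma T mu M w z + 2).
Let Coo : R := - ln ((1 + eps) / (1 + k%:R * eps)).
Let h w : R := ln 3 + \sum_(i < M) ln (degree T (iter i sigma w))%:R.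

Let mK N : measurable_fun [set: Omega] (K N).
Proof.
exact: (measurable_kernel_Rint mu (k := fun u => growth N u.1 u.2) (measurable_growth_cost2 T mu ms M N)).
Qed.

Let mC N i : measurable_fun [set: Omega] (C N i).
Proof.
exact: (measurable_kernel_Rint mu (k := fun u => symbol N i u.1 u.2) (measurable_symbol_cost2 T mu ms hA eps N i)).
Qed.

Let mKoo : measurable_fun [set: Omega] Koo.
Proof.
apply: (measurable_kernel_Rint mu (k := fun u => ln (block_deriv sigma T mu M u.1 u.2 + 2))).
by apply: measurable_ln_comp; apply: measurable_funD => //; exact: measurable_block_deriv2.
Qed.

Let ih : P.-integrable setT (EFin \o h).
Proof.
apply: integrable_realD; first exact/bmeas_integrable/bmeas_cst.
by apply: (integrable_fsum (fun i : 'I_M => (integrable_iter ms mp i integrable_ln_degree).1)).1.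
Qed.

(** For a degree D >= 1 one has D + 2 <= 3 D, which turns the logarithm into a sum along the
    orbit. *)
Let ln_degree_h w : ln ((iter_degree T sigma M w)%:R + 2) <= h w.
Proof.
have d0 : 1 <= (iter_degree T sigma M w)%:R :> R by rewrite ler1n iter_degree_gt0.
have d1 := lt_le_trans ltr01 d0.
have -> : h w = ln (3 * (iter_degree T sigma M w)%:R).
  rewrite lnM ?posrE// /h; congr (_ + _).
  rewrite /iter_degree natr_prod; elim: M => [|n ihn]; first by rewrite !big_ord0 ln1.
  rewrite !big_ord_recr/= lnM ?ihn// posrE ?ltr0n ?degree_gt0//.
  by apply: prodr_gt0 => i _; rewrite ltr0n degree_gt0.
by rewrite ler_ln ?posrE; lra.
Qed.

Let Kcvg : P.-integrable setT (EFin \o Koo) /\ (fun N => \int[P]_w K N w) @ \oo --> \int[P]_w Koo w.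
Proof.
apply: (dominated_cvg mK mKoo ih).
  apply: (aeS ae_good) => w gw N.
  rewrite ger0_norm; last exact: (growth_mean_ge0 ms mu_circle M gw).
  by apply: le_trans (ln_degree_h w); exact: growth_mean_le.
by apply: (aeS ae_good) => w gw; exact: growth_mean_cvg.
Qed.

Let iK N : P.-integrable setT (EFin \o K N).
Proof.
apply: (integrable_le_ae (mK N) ih); apply: (aeS ae_good) => w gw.
rewrite ger0_norm; last exact: (growth_mean_ge0 ms mu_circle M gw).
by apply: le_trans (ln_degree_h w); exact: growth_mean_le.
Qed.

Let iB : P.-integrable setT (EFin \o (fun=> - ln (eps / (1 + k%:R * eps)))).
Proof. exact/bmeas_integrable/bmeas_cst. Qed.

Let iC N i : P.-integrable setT (EFin \o C N i).
Proof.
apply: (integrable_le_ae (mC N i) iB); apply: (aeS ae_good) => w gw.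
exact: symbol_mean_norm.
Qed.

Let Ccvg i : (fun N => \int[P]_w C N i w) @ \oo --> Coo.
Proof.
rewrite -(bint_cst P Coo).
apply: (dominated_cvg (mC ^~ i) (measurable_cst _) iB _ _).2.
  by apply: (aeS ae_good) => w gw N; exact: symbol_mean_norm.
by apply: (aeS ae_good) => w gw; exact: symbol_mean_cvg.
Qed.

Let mean_join_upper N n : mean_join_entropy P sigma T mu A (n * M) <=
  ln N.+1%:R + n%:R * (\int[P]_w K N w + \sum_(i < M) \int[P]_w C N i w).
Proof.
have hK (j : 'I_n) := integrable_iter ms mp (j * M) (iK N).
have hC (l : 'I_(n * M)) := integrable_iter ms mp (l %/ M * M)%N (iC N (l %% M)%N).
have [iK2 eK] := integrable_fsum (fun j => (hK j).1).
have [iC2 eC] := integrable_fsum (fun l => (hC l).1).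
have icst : P.-integrable setT (EFin \o (fun _ : Omega => ln N.+1%:R : R)) by exact/bmeas_integrable/bmeas_cst.
pose U w := ln N.+1%:R + \sum_(j < n) K N (iter (j * M) sigma w) +
  \sum_(l < n * M) C N (l %% M)%N (iter (l %/ M * M)%N sigma w).
have iU : P.-integrable setT (EFin \o U).
  by apply: integrable_realD => //; exact: integrable_realD.
have -> : ln N.+1%:R + n%:R * (\int[P]_w K N w + \sum_(i < M) \int[P]_w C N i w) = \int[P]_w U w.
  rewrite /U RintegralD//; last exact: integrable_realD.
  rewrite RintegralD// bint_cst eK eC.
  rewrite [X in _ = _ + X + _](eq_bigr (fun=> \int[P]_w K N w)) => [|j _]; last exact: (hK j).2.
  rewrite [X in _ = _ + _ + X](eq_bigr (fun l : 'I_(n * M) => \int[P]_w C N (l %% M)%N w)) => [|l _];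
    last exact: (hC l).2.
  by rewrite sumr_const card_ord (sum_modn (fun i => \int[P]_w C N i w)) mulrDr !mulr_natl addrA.
apply: Rint_le_ae => //; first by apply: bmeas_integrable; exact: bmeas_join_entropy.
by apply: (aeS ae_goods) => w gw; exact: (join_entropy_upper ms mu_circle hA M0 eps0 N n gw).
Qed.

(** The order of limits matters: n goes to infinity at fixed [N], which removes the initial cost ln
    (N + 1), and only then do the arcs shrink. *)
Lemma rate_le_block (l : R) : (forall n, (0 < n)%N -> l <= n%:R^-1 * mean_join_entropy P sigma T mu A n) ->
  M%:R * l <= \int[P]_w Koo w + M%:R * Coo.
Proof.
move=> hl; have MR : 0 < M%:R :> R by rewrite ltr0n.
have step N : M%:R * l <= \int[P]_w K N w + \sum_(i < M) \int[P]_w C N i w.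
  set B := \int[P]_w K N w + _; set a : R := ln N.+1%:R.
  have hc : (fun n => B + a * n.+1%:R^-1) @ \oo --> B.
    rewrite -[X in _ --> X]addr0 -[X in _ --> _ + X](mulr0 a).
    apply: cvgD; first exact: cvg_cst.
    by apply: cvgMr; exact: cvg_harmonic.
  apply: (ler_cvg_to (cvg_cst _) hc); apply: nearW => n.
  have nR : 0 < n.+1%:R :> R by rewrite ltr0n.
  have nM : (0 < n.+1 * M)%N by rewrite muln_gt0.
  have nMR : 0 < (n.+1 * M)%:R :> R by rewrite ltr0n.
  have h1 := hl _ nM; have h2 := mean_join_upper N n.+1.
  rewrite mulrC ler_pdivlMr// in h1.
  have h3 := le_trans h1 h2; rewrite natrM -/a -/B in h3.
  rewrite -(ler_pM2l nR) mulrDr [a * _]mulrC mulVKf ?gt_eqF// addrC.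
  by apply: le_trans h3; rewrite mulrA mulrC.
have hc2 : (fun N => \int[P]_w K N w + \sum_(i < M) \int[P]_w C N i w) @ \oo --> \int[P]_w Koo w + M%:R * Coo.
  apply: cvgD; first exact: Kcvg.2.
  have -> : M%:R * Coo = \sum_(i < M) Coo by rewrite sumr_const card_ord mulr_natl.
  elim: M => [|m ihm]; first by under eq_fun do rewrite big_ord0; rewrite big_ord0; exact: cvg_cst.
  under eq_fun do rewrite big_ord_recr; rewrite big_ord_recr/=; apply: cvgD; first exact: ihm.
  exact: Ccvg.
by apply: (ler_cvg_to (cvg_cst _) hc2); exact: nearW.
Qed.

(** As the block derivative D is at least 1, ln (D + 2) <= ln 3 + ln D. The fibre mean of ln D is a
    sum of exponents plus a coboundary, and it is nonnegative, which is what [coboundary_le] asks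
    for. *)
Lemma block_mean_le : \int[P]_w Koo w <= ln 3 + M%:R * \int[P]_w exponent T mu w.
Proof.
have hE (i : 'I_M) := integrable_iter ms mp i iexp.
have [iE eE] := integrable_fsum (fun i => (hE i).1).
pose E w := \sum_(i < M) exponent T mu (iter i sigma w).
pose e := diff_entropy mu.
have blockE w : good_fiber sigma T mu w ->
    [/\ bmeas (fun z => ln (block_deriv sigma T mu M w z)),
      0 <= E w + (e (iter M sigma w) - e w) & Koo w <= ln 3 + (E w + (e (iter M sigma w) - e w))].
  move=> gw; have [bl el] := bint_ln_block_deriv M ms gw; rewrite -/(E w) -/e in el.
  rewrite -el; split => //.
    rewrite -(bint_cst (p w) 0); apply: circle_bint_le => //; first exact: bmeas_cst.
    by move=> z z1; rewrite ln_ge0// block_deriv_ge1.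
  rewrite -(bint_cst (p w) (ln 3)) -bintD//; last exact: bmeas_cst.
  apply: circle_bint_le => //; last first.
  - move=> z z1; have h1 := block_deriv_ge1 M gw z1.
    have h2 := lt_le_trans ltr01 h1.
    by rewrite -lnM ?posrE// ler_ln ?posrE; lra.
  - by apply: bmeasD => //; exact: bmeas_cst.
  have [mD [B hB]] := bmeas_block_deriv M ms gw; split.
    by apply: measurable_ln_comp; exact: measurable_funD.
  exists (ln (B + 2)) => z.
  have b0 : 0 <= block_deriv sigma T mu M w z.
    rewrite /block_deriv /on_circle; case: eqP => // z1.
    by rewrite -block_derivE// (le_trans ler01)// block_deriv_ge1.
  have := hB z; rewrite ger0_norm// => hz.
  rewrite ger0_norm ?ln_ge0//; last by lra.
  by rewrite ler_ln ?posrE; lra.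
have [i1 i2] := @coboundary_le _ _ _ P (iter M sigma) (measurable_iter ms M)
  (measure_preserving_iter ms mp M) E e iE (measurable_diff_entropy mu)
  (aeS ae_good (fun w gw => let: And3 _ hw _ := blockE w gw in hw)).
apply: (@le_trans _ _ (\int[P]_w (ln 3 + (E w + (e (iter M sigma w) - e w))))).
  apply: Rint_le_ae; [exact: Kcvg.1| |].
    by apply: integrable_realD => //; exact/bmeas_integrable/bmeas_cst.
  by apply: (aeS ae_good) => w gw; have [] := blockE w gw.
rewrite RintegralD//; last exact/bmeas_integrable/bmeas_cst.
rewrite bint_cst lerD2l; apply: (le_trans i2); rewrite eE.
by under eq_bigr do rewrite (hE _).2; rewrite sumr_const card_ord mulr_natl.
Qed.

End integrable_exponent.
End upper_bound.

(** * Fibre entropy equals the mean exponent *)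

Section fiber_entropy_formula.
Context d (Omega : measurableType d) (R : realType) (P : probability Omega R).

Lemma integrable_below (f h : Omega -> R) : measurable_fun [set: Omega] f ->
  P.-integrable setT (EFin \o h) -> (forall w, - h w <= f w) ->
  (\int[P]_w (f w)%:E < +oo)%E -> P.-integrable setT (EFin \o f).
Proof.
move=> mf ih hf fin; have mfE : measurable_fun setT (EFin \o f) by exact/measurable_EFinP.
have mh := measurable_int _ ih.
have hneg : (\int[P]_w (EFin \o f)^\- w < +oo)%E.
  have /integrableP[_] := ih; apply: le_lt_trans; apply: ge0_le_integral => //.
  - exact: measurable_funeneg.
  - exact: measurableT_comp.
  move=> w _; rewrite funenegE ge_max abse_ge0 andbT lee_fin/= lerNl.
  by apply: le_trans (hf w); rewrite lerNl opprK ler_norm.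
apply/integrableP; split => //.
rewrite (eq_integral (fun w => (EFin \o f)^\+ w + (EFin \o f)^\- w)%E); last first.
  by move=> w _; rewrite -[LHS]/((abse \o (EFin \o f)) w) fune_abse.
rewrite ge0_integralD//; [|exact: measurable_funepos|exact: measurable_funeneg].
have fin2 : (\int[P]_w (EFin \o f)^\+ w - \int[P]_w (EFin \o f)^\- w < +oo)%E by rewrite -integralE.
have n0 : (0 <= \int[P]_w (EFin \o f)^\- w)%E by apply: integral_ge0 => w _; exact: funeneg_ge0.
rewrite lte_add_pinfty//; move: fin2 n0 hneg.
by case: (\int[P]_w (EFin \o f)^\+ w)%E => [r|//|//]; rewrite ?ltry//; case: (\int[P]_w _)%E.
Qed.

Variables (sigma : Omega -> Omega) (T : blaschke_cocycle Omega R).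
Variable mu : R.-pker Omega ~> R[i].
Hypothesis ms : measurable_fun [set: Omega] sigma.
Hypothesis mp : measure_preserving P sigma.
Hypothesis mu_circle : forall w, kernel_prob mu w (@circle R) = 1%E.
Hypothesis ae_good : {ae P, forall w, good_fiber sigma T mu w}.
Hypothesis lam_neg : P.-integrable setT (EFin \o (fun w => Num.max (- ln (inf_deriv T w)) 0)).
Hypothesis deg_lam : P.-integrable setT (EFin \o (fun w => (degree T w)%:R / inf_deriv T w)).

Lemma fiber_entropy_le : (fiber_entropy P sigma T mu <= \int[P]_w (exponent T mu w)%:E)%E.
Proof.
have [->|fin] := eqVneq (\int[P]_w (exponent T mu w)%:E)%E +oo%E; first exact: leey.
have iexp : P.-integrable setT (EFin \o exponent T mu).
  apply: (integrable_below (measurable_exponent T mu) (integrable_realD lam_neg deg_lam)).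
    by move=> w; exact: (exponent_ge_neg T mu_circle).
  by rewrite ltey.
rewrite (_ : (\int[P]_w (exponent T mu w)%:E)%E = (\int[P]_w exponent T mu w)%:E); last first.
  by rewrite fineK// integrable_fin_num.
apply: ge_ereal_sup => _ [k [A [hA ->]]].
have [l [-> _ l0 ll]] := partition_fiber_entropyE ms mp mu_circle ae_good hA.
rewrite lee_fin; apply/ler_addgt0Pl => e e0.
have k1 : 0 < k.+1%:R :> R by rewrite ltr0n.
(* The smoothing costs ln ((1 + k eps) / (1 + eps)) <= e / 2 per letter for this [eps], and the
   block length [M] brings the constant ln 3 below e / 2 per letter. *)
pose eps := e / 2 / k.+1%:R; have eps0 : 0 < eps by rewrite !divr_gt0.
pose M := (Num.truncn (ln 3 / (e / 2))).+1; have M0 : (0 < M)%N by [].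
have MR : 0 < M%:R :> R by rewrite ltr0n.
have h1 := rate_le_block ms mp mu_circle ae_good deg_lam iexp hA M0 eps0 ll.
have h2 := block_mean_le ms mp mu_circle ae_good deg_lam iexp M.
have hM : ln 3 <= M%:R * (e / 2).
  by rewrite -ler_pdivrMr ?divr_gt0// ltW// truncnS_gt.
have keps : 0 <= k%:R * eps by rewrite mulr_ge0// ltW.
have hC : - ln ((1 + eps) / (1 + k%:R * eps)) <= e / 2.
  have a0 : 0 < 1 + eps by rewrite addr_gt0.
  have b0 : 0 < 1 + k%:R * eps by rewrite ltr_pwDl.
  rewrite -lnV ?posrE ?divr_gt0// invfM invrK mulrC.
  apply: le_trans (ln_le_sub1 (divr_gt0 b0 a0)) _.
  have ke : k.+1%:R * eps = e / 2 by rewrite /eps mulrC divfK// gt_eqF.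
  rewrite -ke lerBlDr ler_pdivrMr// -natr1 mulrDl mul1r mulrDl mul1r !mulrDr mulr1.
  have := mulr_ge0 keps (ltW eps0); have := mulr_ge0 (ltW eps0) (ltW eps0); lra.
rewrite -(ler_pM2l MR); apply: (le_trans h1).
have h3 : M%:R * - ln ((1 + eps) / (1 + k%:R * eps)) <= M%:R * (e / 2) by rewrite ler_pM2l.
have -> : M%:R * (e + \int[P]_w exponent T mu w) =
  M%:R * (e / 2) + M%:R * \int[P]_w exponent T mu w + M%:R * (e / 2).
  by set u := Rintegral _ _ _; field.
apply: lerD => //; apply: (le_trans h2); exact: lerD.
Qed.

Lemma fiber_entropyE : fiber_entropy P sigma T mu = (\int[P]_w (exponent T mu w)%:E)%E.
Proof.
by apply/eqP; rewrite eq_le fiber_entropy_le (fiber_entropy_ge ms mp mu_circle ae_good lam_neg deg_lam).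
Qed.

End fiber_entropy_formula.

(** * Averaging over the rotation parameter *)

Section rotated_orbit.
Context d (Omega : measurableType d) (R : realType).
Variables (sigma : Omega -> Omega) (T : blaschke_cocycle Omega R).
Hypothesis ms : measurable_fun [set: Omega] sigma.
Local Notation unif := (@unif01 R).
Local Notation mR := (measurableTypeR R).

(** In 1 - |T z|^2 = (1 - |z|^2) times a sum of squares ([bprod_modulus]), the first square alone is
    at least (1 - |a|^2) / 4, where a is the first zero. The bound depends on z only through r. *)
Lemma blaschke_shrink w (r : R) : 0 <= r -> r < 1 ->
  exists2 r' : R, 0 <= r' < 1 & forall z, modulus z <= r -> modulus (T w z) <= r'.
Proof.
move=> r0 r1; set a := zeros T w 0; have a1 : modulus a < 1 := zero_disk0 T w.
have rr : 0 < 1 - r ^+ 2 by rewrite subr_gt0 expr_lt1.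
have rr1 : 1 - r ^+ 2 <= 1 by rewrite gerBl sqr_ge0.
have aa := one_minus_sqr a1; have aa1 : 1 - modulus a ^+ 2 <= 1 by rewrite gerBl sqr_ge0.
pose dl := (1 - r ^+ 2) * ((1 - modulus a ^+ 2) / 4).
have d0 : 0 < dl by rewrite mulr_gt0// divr_gt0.
have d1 : dl <= 1.
  rewrite -[leRHS]mulr1; apply: ler_pM => //; [exact: ltW|by rewrite divr_ge0// ltW|lra].
exists (1 - dl / 2) => [|z zr]; first by apply/andP; split; lra.
have z1 : modulus z <= 1 := le_trans zr (ltW r1).
have hz := bprod_modulus (rotation_circle T w) (@zeros_disk _ _ _ T w) z1.
have e0 : (1 - modulus a ^+ 2) / 4 <= \sum_(i < degree T w) modulus (takenaka (zeros T w) i z) ^+ 2.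
  rewrite (bigD1 (Ordinal (degree_gt0 T w)))//=; apply: ler_wpDr.
    by apply: sumr_ge0 => i _; exact: sqr_ge0.
  rewrite /takenaka big_ord0 mul1r Normc.normcM Normc.normcV modulus_real exprMn real_normK ?num_real//.
  rewrite sqr_sqrtr ?(ltW aa)// exprVn -/a.
  have dz : 0 < modulus (1 - a^* * z) by rewrite modulus_gt0 mobius_den.
  have d2 : modulus (1 - a^* * z) <= 2.
    apply: le_trans (le_normcD (1 : Rcomplex R) (- (a^* * z))) _.
    rewrite Normc.normc1 modulusN Normc.normcM modulusJ.
    have : modulus a * modulus z <= 1 by rewrite mulr_ile1// ?modulus_ge0// ltW.
    lra.
  rewrite ler_pM2l// lef_pV2 ?posrE ?exprn_gt0//.
  have -> : 4 = 2 ^+ 2 :> R by ring.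
  by rewrite lerXn2r ?nnegrE ?modulus_ge0.
have zz : 1 - r ^+ 2 <= 1 - modulus z ^+ 2.
  by rewrite lerD2l lerN2 lerXn2r ?nnegrE ?modulus_ge0.
have : dl <= 1 - modulus (T w z) ^+ 2.
  rewrite blaschkeE hz /dl; apply: ler_pM => //; [exact: ltW|by rewrite divr_ge0// ltW].
move=> h; rewrite -(@ler_pXn2r _ 2%N) ?nnegrE ?modulus_ge0//; last by lra.
have -> : (1 - dl / 2) ^+ 2 = 1 - dl + (dl / 2) ^+ 2 by field.
have := sqr_ge0 (dl / 2); move: h.
by set u := modulus _ ^+ 2; set v := (dl / 2) ^+ 2; lra.
Qed.

Definition rotated_orbit n w (theta : R[i]) : R[i] := cocycle_iter sigma (rotate theta T) n w 0.

(** Uniformity over the closed disk of parameters is what allows 1 - conj z times the orbit to be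
    inverted in the disk algebra. *)
Lemma rotated_orbit_disk n w : exists2 r : R, 0 <= r < 1 &
  forall theta, modulus theta <= 1 -> modulus (rotated_orbit n w theta) <= r.
Proof.
elim: n => [|n [r /andP[r0 r1] hr]].
  exists 0; first by rewrite lexx ltr01.
  by move=> theta _; rewrite /rotated_orbit [cocycle_iter _ _ _ _ _]/= Normc.normc0.
have [r' r'01 hr'] := blaschke_shrink (iter n sigma w) r0 r1.
exists r' => // theta t1; rewrite /rotated_orbit /= /rotate Normc.normcM.
rewrite -[leRHS]mul1r; apply: ler_pM => //; rewrite ?modulus_ge0//.
by apply: hr'; exact: hr.
Qed.

Lemma dalg_rotated_orbit n w : dalg (rotated_orbit n w).
Proof.
elim: n => [|n ih]; first exact: dalg_cst.
rewrite (_ : rotated_orbit n.+1 w = fun theta => theta * bprod (rotation T (iter n sigma w))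
    (zeros T (iter n sigma w)) (degree T (iter n sigma w)) (rotated_orbit n w theta)); last first.
  by apply/funext => theta; rewrite /rotated_orbit/= /rotate blaschkeE.
apply: dalgM; first exact: dalg_id.
apply: dalg_bprod => //; first by move=> i hi; exact: zeros_disk.
have [r /andP[_ r1] hr] := rotated_orbit_disk n w.
by move=> z z1; rewrite (le_trans (hr z z1))// ltW.
Qed.

Lemma rotated_orbit0 n w : rotated_orbit n w 0 = 0.
Proof. by case: n => [//|n]; rewrite /rotated_orbit/= /rotate mul0r. Qed.

Lemma measurable_rotated_orbit n :
  measurable_fun [set: Omega * R[i]] (fun u => rotated_orbit n u.1 u.2).
Proof.
elim: n => [|n ih]; first exact: measurable_cst.
apply: measurableC_mul; first exact: measurable_snd.
apply: measurable_blaschke => //.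
exact: measurableT_comp (measurable_iter ms n) measurable_fst.
Qed.

(* For a boundary point [z] the kernel [poisson (rotated_orbit n w theta) z] is
   the real part of an analytic function of [theta] with value 1 at 0. *)
Lemma poisson_rotated_orbit_mean n w z : modulus z = 1 ->
  \int[unif]_s poisson (rotated_orbit n w (expi s)) z = 1.
Proof.
move=> z1; have [r /andP[r0 r1] hr] := rotated_orbit_disk n w.
have dS := dalg_rotated_orbit n w.
have dz : dalg (fun t => z^* * rotated_orbit n w t) by apply: dalgM => //; exact: dalg_cst.
have hz t : modulus t <= 1 -> modulus (z^* * rotated_orbit n w t) <= r.
  by move=> t1; rewrite Normc.normcM modulusJ z1 mul1r hr.
pose F t := (1 + z^* * rotated_orbit n w t) * (1 - z^* * rotated_orbit n w t)^-1.
have dF : dalg F.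
  apply: dalgM; first by apply: dalgD => //; exact: dalg_cst.
  exact: dalg_inv1B dz r1 hz.
have := dalg_mean_value dF; rewrite {2}/F rotated_orbit0 mulr0 addr0 subr0 invr1 mulr1.
rewrite [RHS]/= => <-; apply: eq_Rintegral => t _; rewrite poissonE//.
by rewrite (le_lt_trans (hr _ _))// expi_modulus.
Qed.

End rotated_orbit.

(** * Rotated cocycles *)

Section rotated_cocycle.
Context d (Omega : measurableType d) (R : realType).
Variables (T : blaschke_cocycle Omega R) (theta : R[i]).
Hypothesis theta1 : circle theta.

Let rotation_rotated w : circle (theta * rotation T w).
Proof. by rewrite /circle /= Normc.normcM theta1 mul1r; exact: rotation_circle. Qed.

Let measurable_rotation_rotated : measurable_fun [set: Omega] (fun w => theta * rotation T w).
Proof. by apply: measurableC_mul; [exact: measurable_cst|exact: measurable_rotation]. Qed.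

Definition rotated_cocycle : blaschke_cocycle Omega R :=
  Build_blaschke_cocycle (degree_gt0 T) rotation_rotated (@zeros_disk _ _ _ T)
    (measurable_degree T) measurable_rotation_rotated (@measurable_zeros _ _ _ T).

Lemma rotated_cocycleE : blaschke_map rotated_cocycle = rotate theta T.
Proof. by apply/funext => w; apply/funext => z; rewrite /rotate /blaschke_map /= mulrA. Qed.

Lemma inf_deriv_rotated : inf_deriv rotated_cocycle = inf_deriv T.
Proof.
apply/funext => w.
have hE (S : blaschke_cocycle Omega R) : inf_deriv S w = inf [set deriv_modulus S w z | z in @circle R].
  rewrite /inf_deriv (_ : [set modulus _ | z in _] = [set deriv_modulus S w z | z in @circle R])//.
  by apply/seteqP; split => _ [z z1 <-]; exists z => //; rewrite blaschke_derivE.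
by rewrite !hE.
Qed.

End rotated_cocycle.

(** Linearity that survives an infinite integral of [f]: the positive part of the difference is then
    infinite and its negative part is dominated by |h|. *)
Lemma integral_subr_real d (X : measurableType d) (R : realType) (P : {measure set X -> \bar R})
    (f : X -> \bar R) (h : X -> R) : measurable_fun [set: X] f -> (forall x, 0 <= f x)%E ->
  P.-integrable setT (EFin \o h) ->
  (\int[P]_x (f x - (h x)%:E) = \int[P]_x f x - \int[P]_x (h x)%:E)%E.
Proof.
move=> mf f0 ih; have mh := measurable_int _ ih.
have [ffin|] := ltP (\int[P]_x f x)%E +oo%E.
  rewrite integralB//; apply/integrableP; split => //.
  by under eq_integral do rewrite gee0_abs//.
rewrite leye_eq => /eqP finf; rewrite finf.
have hfin : (\int[P]_x (h x)%:E)%E \is a fin_num by exact: integrable_fin_num.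
have habs : (\int[P]_x `|(h x)%:E| < +oo)%E by have /integrableP[] := ih.
have mg : measurable_fun [set: X] (fun x => f x - (h x)%:E)%E by exact: emeasurable_funB.
have ma : measurable_fun [set: X] (fun x => `|(h x)%:E|%E) by exact: measurableT_comp.
pose g x := (f x - (h x)%:E)%E.
have gpos : (\int[P]_x g^\+ x = +oo)%E.
  have h1 : (\int[P]_x f x <= \int[P]_x g^\+ x + \int[P]_x `|(h x)%:E|)%E.
    rewrite -ge0_integralD//; last exact: measurable_funepos.
    apply: ge0_le_integral => //.
      by apply: emeasurable_funD => //; exact: measurable_funepos.
    move=> x _; apply: (@le_trans _ _ (g x + `|(h x)%:E|)%E).
      rewrite /g -addeA -[leLHS]adde0 leeD2l// -EFinN -EFinD lee_fin addrC subr_ge0.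
      exact: ler_norm.
    by rewrite leeD2r// funeposE le_max lexx.
  have p0 : (0 <= \int[P]_x g^\+ x)%E by apply: integral_ge0 => x _; exact: funepos_ge0.
  move: h1 habs p0; rewrite finf; case: (\int[P]_x g^\+ x)%E => [r|//|//].
  by case: (\int[P]_x `|(h x)%:E|)%E => [r'|//|//]; rewrite leye_eq.
have gneg : (\int[P]_x g^\- x < +oo)%E.
  apply: le_lt_trans habs; apply: ge0_le_integral => //; first exact: measurable_funeneg.
  move=> x _; rewrite funenegE ge_max abse_ge0 andbT /g oppeB ?fin_num_adde_defl//.
  rewrite -[leRHS]add0e leeD ?oppe_le0//.
  by rewrite lee_fin ler_norm.
rewrite [LHS]integralE gpos addye ?addye//.
  by move: hfin; case: (\int[P]_x (h x)%:E)%E.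
by move: gneg; case: (\int[P]_x g^\- x)%E.
Qed.

(** * Averages of clipped exponents over theta *)

Section averaging.
Context d (Omega : measurableType d) (R : realType) (P : probability Omega R).
Variables (sigma : Omega -> Omega) (T : blaschke_cocycle Omega R).
Variable mu : R[i] -> R.-pker Omega ~> R[i].
Hypothesis ms : measurable_fun [set: Omega] sigma.
Hypothesis mp : measure_preserving P sigma.
Hypothesis mu_circle : forall theta w, circle theta -> kernel_prob (mu theta) w (@circle R) = 1%E.
Hypothesis ae_good : forall theta (h : circle theta),
  {ae P, forall w, good_fiber sigma (rotated_cocycle T h) (mu theta) w}.
Variable m : Omega -> R.
Hypothesis mm : measurable_fun [set: Omega] m.
Hypothesis m0 : forall w, 0 <= m w.
Hypothesis m_ge : forall w z, modulus z = 1 -> - m w <= ln (deriv_modulus T w z).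
Local Notation unif := (@unif01 R).
Local Notation mR := (measurableTypeR R).
Local Notation cm := (@circle_measure R).
Local Notation p theta := (kernel_prob (mu theta)).
Local Notation x theta w := (barycenter (p theta w)).

(** Adding [m] makes ln |T'| nonnegative, so that clipping from above is monotone and no
    integrability is asked of ln |T'| itself. *)
Definition shifted_ln_deriv w (z : R[i]) : R := ln_deriv T w z + m w.

Local Notation H := shifted_ln_deriv.

Definition clipped (K : nat) w (z : R[i]) : R := Num.min (H w z) K%:R.

Lemma shifted_ge0 w z : 0 <= H w z.
Proof.
rewrite /H /ln_deriv /on_circle; case: eqP => [z1|_]; last by rewrite add0r.
by rewrite -lerBlDr sub0r m_ge.
Qed.

Lemma bmeas_shifted w : bmeas (H w).
Proof. by apply: bmeasD; [exact: bmeas_ln_deriv|exact: bmeas_cst]. Qed.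

Lemma measurable_shifted2 : measurable_fun [set: Omega * R[i]] (fun u => H u.1 u.2).
Proof.
apply: measurable_funD; first exact: measurable_ln_deriv2.
exact: measurableT_comp mm measurable_fst.
Qed.

Lemma clipped_itv K w z : 0 <= clipped K w z <= K%:R.
Proof. by rewrite /clipped le_min shifted_ge0 ler0n ge_min lexx orbT. Qed.

Lemma measurable_clipped2 K : measurable_fun [set: Omega * R[i]] (fun u => clipped K u.1 u.2).
Proof. by apply: measurable_minr => //; exact: measurable_shifted2. Qed.

Lemma bmeas_clipped2 K : bmeas (fun u : Omega * R[i] => clipped K u.1 u.2).
Proof.
split; first exact: measurable_clipped2.
by exists K%:R => u; have /andP[h1 h2] := clipped_itv K u.1 u.2; rewrite ger0_norm.
Qed.

Lemma bmeas_clipped K w : bmeas (clipped K w).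
Proof. exact: (bmeas_section1 (bmeas_clipped2 K) w). Qed.

Lemma clippedE K w z : H w z <= K%:R -> clipped K w z = H w z.
Proof. by move=> h; rewrite /clipped (min_idPl h). Qed.

(** The value 0 off the circle keeps the point inside the disk for every complex theta, so that
    Poisson kernels at it are defined and jointly measurable everywhere. *)
Definition circle_orbit n w (theta : R[i]) : R[i] :=
  if modulus theta == 1 then rotated_orbit sigma T n w theta else 0.

Local Notation S := circle_orbit.

Lemma measurable_circle_orbit2 n : measurable_fun [set: Omega * R[i]] (fun u => S n u.1 u.2).
Proof.
apply: measurable_fun_if => //; first exact: (measurable_circle_pred measurable_snd).
by apply: measurable_funTS; exact: measurable_rotated_orbit.
Qed.

Lemma circle_orbit_disk n w : exists2 r : R, 0 <= r < 1 & forall theta, modulus (S n w theta) <= r.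
Proof.
have [r r01 hr] := rotated_orbit_disk sigma T n w; exists r => // theta.
rewrite /S; case: eqP => [h|_]; first by rewrite hr// h.
by have /andP[r0 _] := r01; rewrite Normc.normc0.
Qed.

Lemma circle_orbit_lt1 n w theta : modulus (S n w theta) < 1.
Proof. by have [r /andP[_ r1] hr] := circle_orbit_disk n w; exact: le_lt_trans (hr _) r1. Qed.

(** The fibre mean at time n with the fibre measure replaced by the Poisson measure at T_theta^n 0.
    Unlike the fibre mean, this is visibly measurable jointly in [w] and [theta]. *)
Definition orbit_mean K n w theta : R :=
  \int[unif]_t (clipped K (iter n sigma w) (expi t) * poisson (S n w theta) (expi t)).

Local Notation J := orbit_mean.

Lemma bmeas_clipped_expi K w : bmeas (fun t : mR => clipped K w (expi t)).
Proof. exact: (bmeas_comp (@measurable_expi R) (bmeas_clipped K w)). Qed.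

Lemma orbit_mean_itv K n w theta : 0 <= J K n w theta <= K%:R.
Proof.
have s1 := circle_orbit_lt1 n w theta; have bp := bmeas_poisson s1.
have p0 t := ltW (poisson_gt0 s1 (expi_modulus t)).
apply/andP; split.
  apply: Rintegral_ge0 => t _; rewrite mulr_ge0//.
  by have /andP[] := clipped_itv K (iter n sigma w) (expi t).
have -> : K%:R = \int[unif]_t (K%:R * poisson (S n w theta) (expi t)).
  by rewrite bintZ// poisson_int1// mulr1.
apply: bint_le => [||t]; [apply: bmeasM => //; exact: bmeas_clipped_expi|by apply: bmeasM => //; exact: bmeas_cst|].
by rewrite ler_wpM2r//; have /andP[] := clipped_itv K (iter n sigma w) (expi t).
Qed.

Lemma bmeas_orbit_mean2 K n : bmeas (fun u : Omega * R[i] => J K n u.1 u.2).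
Proof.
split; last first.
  by exists K%:R => u; have /andP[h1 h2] := orbit_mean_itv K n u.1 u.2; rewrite ger0_norm.
apply: (measurableT_comp (@fine_measurable R _ measurableT)).
pose f (v : (Omega * R[i]) * mR) : \bar R :=
  (clipped K (iter n sigma v.1.1) (expi v.2) * poisson (S n v.1.1 v.1.2) (expi v.2))%:E.
have m11 : measurable_fun [set: (Omega * R[i]) * mR] (fun v => v.1.1).
  exact: measurableT_comp measurable_fst measurable_fst.
have me : measurable_fun [set: (Omega * R[i]) * mR] (fun v => expi v.2).
  exact: measurableT_comp (@measurable_expi R) measurable_snd.
have mf : measurable_fun [set: (Omega * R[i]) * mR] f.
  apply/measurable_EFinP; apply: measurable_funM.
    apply: (measurableT_comp (measurable_clipped2 K) (g := fun v : (Omega * R[i]) * mR => (iter n sigma v.1.1, expi v.2))).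
    apply: measurable_fun_pair => //.
    exact: measurableT_comp (measurable_iter ms n) m11.
  apply: measurable_poisson => //.
  exact: measurableT_comp (measurable_circle_orbit2 n) measurable_fst.
have f0 v : (0 <= f v)%E.
  rewrite lee_fin mulr_ge0//; first by have /andP[] := clipped_itv K (iter n sigma v.1.1) (expi v.2).
  by rewrite ltW// poisson_gt0 ?expi_modulus// circle_orbit_lt1.
exact: (measurable_fun_fubini_tonelli_F (m2 := unif) f mf f0).
Qed.

Definition parameter_mean K n theta : R := \int[P]_w J K n w theta.

Local Notation I := parameter_mean.

Lemma bmeas_parameter_mean K n : bmeas (I K n).
Proof. exact: (bmeas_int2 P cm (bmeas_orbit_mean2 K n)). Qed.

Lemma parameter_mean_itv K n theta : 0 <= I K n theta <= K%:R.
Proof.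
have bJ := bmeas_section2 (bmeas_orbit_mean2 K n) theta.
apply/andP; split.
  by apply: Rintegral_ge0 => w _; have /andP[] := orbit_mean_itv K n w theta.
rewrite -(bint_cst P K%:R); apply: bint_le => //; first exact: bmeas_cst.
by move=> w; have /andP[] := orbit_mean_itv K n w theta.
Qed.

Definition circle_mean K : R := \int[P]_w \int[unif]_t clipped K w (expi t).

Lemma bmeas_circle_mean K : bmeas (fun w => \int[unif]_t clipped K w (expi t)).
Proof.
have b2 : bmeas (fun u : Omega * mR => clipped K u.1 (expi u.2)).
  apply: (bmeas_comp (h := fun u : Omega * mR => (u.1, expi u.2)) _ (bmeas_clipped2 K)).
  apply: measurable_fun_pair; first exact: measurable_fst.
  exact: measurableT_comp (@measurable_expi R) measurable_snd.
exact: (bmeas_int1 P unif b2).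
Qed.

(** After Fubini's theorem, the Poisson kernel averages to 1 over theta at each boundary point. *)
Lemma orbit_mean_average K n w :
  \int[cm]_theta J K n w theta = \int[unif]_t clipped K (iter n sigma w) (expi t).
Proof.
have bJ := bmeas_section1 (bmeas_orbit_mean2 K n) w.
rewrite (bint_pushforward (p := unif) (@measurable_expi R) _ bJ); last first.
  by move=> A mA; rewrite /circle_measure.
pose f (u : mR * mR) : R := clipped K (iter n sigma w) (expi u.2) * poisson (S n w (expi u.1)) (expi u.2).
have [r /andP[r0 r1] hr] := circle_orbit_disk n w.
have me2 : measurable_fun [set: mR * mR] (fun u => expi u.2 : R[i]).
  exact: measurableT_comp (@measurable_expi R) measurable_snd.
have bP : bmeas (fun u : mR * mR => poisson (S n w (expi u.1)) (expi u.2)).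
  split.
    apply: measurable_poisson => //.
    apply: (measurableT_comp (measurable_circle_orbit2 n) (g := fun u : mR * mR => (w, expi u.1))).
    apply: measurable_fun_pair => //.
    exact: measurableT_comp (@measurable_expi R) measurable_fst.
  exists ((1 - r) ^- 2) => u; have s1 := circle_orbit_lt1 n w (expi u.1); have e1 := expi_modulus u.2.
  rewrite ger0_norm ?(ltW (poisson_gt0 s1 e1))//.
  apply: le_trans (poisson_le s1 e1) _.
  rewrite -[leRHS]mul1r; apply: ler_pM => //.
  - by rewrite one_minus_sqr_ge0// ltW.
  - by rewrite invr_ge0 sqr_ge0.
  - by rewrite gerBl sqr_ge0.
  have hh := hr (expi u.1).
  by rewrite lef_pV2 ?posrE ?exprn_gt0 ?subr_gt0// lerXn2r ?nnegrE ?subr_ge0 ?(ltW r1) ?(ltW s1)// lerD2l lerN2.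
have bf : bmeas f by apply: bmeasM => //; exact: (bmeas_comp me2 (bmeas_clipped K (iter n sigma w))).
rewrite -[LHS]/(\int[unif]_s \int[unif]_t f (s, t)) (bint_fubini unif unif bf).
apply: eq_Rintegral => t _; rewrite /f/=.
have e1 := expi_modulus t.
rewrite bintZ; last exact: (bmeas_section2 bP t).
rewrite (_ : \int[unif]_s poisson (S n w (expi s)) (expi t) = 1) ?mulr1//.
rewrite -[RHS](poisson_rotated_orbit_mean sigma T n w e1).
by apply: eq_Rintegral => s _; rewrite /S expi_modulus eqxx.
Qed.

Lemma parameter_mean_average K n : \int[cm]_theta I K n theta = circle_mean K.
Proof.
rewrite /I -(bint_fubini P cm (bmeas_orbit_mean2 K n)).
under eq_Rintegral do rewrite orbit_mean_average.
exact: (bint_iter ms mp n (bmeas_circle_mean K)).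
Qed.

Section fixed_parameter.
Variable theta : R[i].
Hypothesis theta1 : circle theta.

Lemma bmeas_fiber_mean K : bmeas (fun w => \int[p theta w]_z clipped K w z).
Proof.
split; first exact: (measurable_kernel_Rint (mu theta) (measurable_clipped2 K)).
exists K%:R => w; apply: bint_norm_le; first exact: bmeas_clipped.
by move=> z; have /andP[h1 h2] := clipped_itv K w z; rewrite ger0_norm.
Qed.

(** On a good fibre the true barycenter and T_theta^n 0 are hyperbolically asymptotic, so Harnack's
    inequality makes their Poisson integrals of a bounded function merge. Stationarity removes n
    from the mean of the true one. *)
Lemma parameter_mean_cvg K :
  (fun n => I K n theta) @ \oo --> \int[P]_w \int[p theta w]_z clipped K w z.
Proof.
pose phi w := \int[p theta w]_z clipped K w z.
have bphi := bmeas_fiber_mean K.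
have phi_itv w : 0 <= phi w <= K%:R.
  have bc := bmeas_clipped K w.
  apply/andP; split; first by apply: Rintegral_ge0 => z _; have /andP[] := clipped_itv K w z.
  rewrite -(bint_cst (p theta w) K%:R); apply: bint_le => //; first exact: bmeas_cst.
  by move=> z; have /andP[] := clipped_itv K w z.
have bphin n : bmeas (fun w => phi (iter n sigma w)).
  exact: (bmeas_comp (measurable_iter ms n) bphi).
have bJ n : bmeas (fun w => J K n w theta) := bmeas_section2 (bmeas_orbit_mean2 K n) theta.
pose D n w := J K n w theta - phi (iter n sigma w).
have bD n : bmeas (D n) by apply: bmeasB.
have D0 : (fun n => \int[P]_w D n w) @ \oo --> (0 : R).
  rewrite -(bint_cst P 0); apply: (@bounded_convergence _ _ _ _ _ _ K%:R).
  - by move=> n; have [] := bD n.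
  - exact: measurable_cst.
  - move=> n w; have /andP[h1 h2] := orbit_mean_itv K n w theta.
    have /andP[h3 h4] := phi_itv (iter n sigma w).
    by rewrite /D ler_norml; apply/andP; split; lra.
  apply: (aeS (ae_good theta1)) => w gw.
  have hS n : S n w theta = cocycle_iter sigma (rotated_cocycle T theta1) n w 0.
    by rewrite /S theta1 eqxx /rotated_orbit rotated_cocycleE.
  have phiE n : phi (iter n sigma w) =
      \int[unif]_t (clipped K (iter n sigma w) (expi t) * poisson (x theta (iter n sigma w)) (expi t)).
    rewrite /phi /Rintegral; congr fine.
    have := good_poisson gw n (F := fun z => (clipped K (iter n sigma w) z)%:E).
    move=> ->.
    - by apply: eq_integral => t _.
    - by apply/measurable_EFinP; have [] := bmeas_clipped K (iter n sigma w).
    - by move=> z; rewrite lee_fin; have /andP[] := clipped_itv K (iter n sigma w) z.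
  have hb n : `|D n w| <= 2 * K%:R * (harnack_cst (hyp (x theta (iter n sigma w)) (S n w theta)) - 1).
    rewrite /D phiE /J distrC; apply: poisson_int_dist.
    - exact: good_disk gw n.
    - exact: circle_orbit_lt1.
    - by have [] := bmeas_clipped_expi K (iter n sigma w).
    - by move=> t; have /andP[h1 h2] := clipped_itv K (iter n sigma w) (expi t); rewrite ger0_norm.
  have hc : (fun n => 2 * K%:R * (harnack_cst (hyp (x theta (iter n sigma w)) (S n w theta)) - 1)) @ \oo --> (0 : R).
    rewrite -[X in _ --> X](mulr0 (2 * K%:R)); apply: cvgMr.
    apply: cvg_harnack_cst; under eq_fun do rewrite hS; exact: good_hyp gw.
  apply/norm_cvg0P; apply: (squeeze_cvgr _ (cvg_cst 0) hc).
  by apply: nearW => n; rewrite normr_ge0/= hb.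
have hI n : I K n theta = \int[P]_w D n w + \int[P]_w phi w.
  rewrite /D bintB// (bint_iter ms mp n bphi); by rewrite subrK.
rewrite (_ : (fun n => I K n theta) = (fun n => \int[P]_w D n w + \int[P]_w phi w)); last exact/funext.
by rewrite -[X in _ --> X]add0r; apply: cvgD => //; exact: cvg_cst.
Qed.

End fixed_parameter.

(** Off the circle the orbit point is 0 and the Poisson kernel is 1, which dictates the second
    value; the convergence of [parameter_mean] then holds for every theta and yields
    measurability. *)
Definition limit_mean K theta : R :=
  if modulus theta == 1 then \int[P]_w \int[p theta w]_z clipped K w z else circle_mean K.

Lemma limit_mean_cvg K theta : (fun n => I K n theta) @ \oo --> limit_mean K theta.
Proof.
rewrite /limit_mean; case: ifPn => [/eqP h|h].
  have := @parameter_mean_cvg theta h K; exact.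
apply: cvg_near_cst; apply: nearW => n; rewrite /I /circle_mean.
rewrite -[RHS](bint_iter ms mp n (bmeas_circle_mean K)).
apply: eq_Rintegral => w _; rewrite /J /S (negbTE h); apply: eq_Rintegral => t _.
by rewrite /poisson Normc.normc0 expr0n subr0 subr0 expi_modulus expr1n divr1 mulr1.
Qed.

Lemma measurable_limit_mean K : measurable_fun [set: R[i]] (limit_mean K).
Proof.
apply: (measurable_fun_cvg (h := I K)) => [n|theta _]; last exact: limit_mean_cvg.
by have [] := bmeas_parameter_mean K n.
Qed.

Lemma limit_mean_average K : \int[cm]_theta limit_mean K theta = circle_mean K.
Proof.
have h : (fun n => \int[cm]_theta I K n theta) @ \oo --> \int[cm]_theta limit_mean K theta.
  apply: (@bounded_convergence _ _ _ _ _ _ K%:R).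
  - by move=> n; have [] := bmeas_parameter_mean K n.
  - exact: measurable_limit_mean.
  - by move=> n theta; have /andP[h1 h2] := parameter_mean_itv K n theta; rewrite ger0_norm.
  - by apply: aeW => theta; exact: limit_mean_cvg.
rewrite -(cvg_lim (@Rhausdorff R) h) (_ : (fun n => _) = fun=> circle_mean K); last first.
  by apply/funext => n; rewrite parameter_mean_average.
by rewrite lim_cst.
Qed.

End averaging.

Lemma eventually_monotone_cvg d (X : measurableType d) (R : realType) (P : probability X R)
    (U : nat -> X -> R) (V : X -> R) :
    (forall K, measurable_fun [set: X] (U K)) -> (forall K x, 0 <= U K x) ->
    (forall x, {homo U ^~ x : a b / (a <= b)%N >-> a <= b}) ->
    (forall x, exists K0, forall K, (K0 <= K)%N -> U K x = V x) ->
  (fun K => \int[P]_x (U K x)%:E)%E @ \oo --> (\int[P]_x (V x)%:E)%E.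
Proof.
move=> mU U0 Umono UV.
rewrite (_ : (\int[P]_x (V x)%:E)%E = (\int[P]_x limn (fun K => (U K x)%:E))%E); last first.
  apply: eq_integral => x _; apply/esym/cvg_lim => //.
  by apply: cvg_near_cst; have [K0 h] := UV x; exists K0 => // K /= hK; rewrite h.
apply: (@cvg_monotone_convergence _ _ _ P setT measurableT (fun K x => (U K x)%:E)).
- by move=> K; exact/measurable_EFinP.
- by move=> K x _; rewrite lee_fin.
- by move=> x _ a b ab; rewrite lee_fin Umono.
Qed.

(** * Averaging the fibre entropies *)

Section average_of_fiber_entropies.
Context d (Omega : measurableType d) (R : realType) (P : probability Omega R).
Variables (sigma : Omega -> Omega) (T : blaschke_cocycle Omega R).
Variable mu : R[i] -> R.-pker Omega ~> R[i].
Hypothesis ms : measurable_fun [set: Omega] sigma.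
Hypothesis mp : measure_preserving P sigma.
Hypothesis mu_circle : forall theta w, circle theta -> kernel_prob (mu theta) w (@circle R) = 1%E.
Hypothesis ae_good : forall theta (h : circle theta),
  {ae P, forall w, good_fiber sigma (rotated_cocycle T h) (mu theta) w}.
Hypothesis lam_neg : P.-integrable setT (EFin \o (fun w => Num.max (- ln (inf_deriv T w)) 0)).
Hypothesis deg_lam : P.-integrable setT (EFin \o (fun w => (degree T w)%:R / inf_deriv T w)).
Local Notation unif := (@unif01 R).
Local Notation mR := (measurableTypeR R).
Local Notation cm := (@circle_measure R).
Local Notation p theta := (kernel_prob (mu theta)).

Let m w : R := Num.max (- ln (inf_deriv T w)) 0.

Let mm : measurable_fun [set: Omega] m.
Proof. by apply/measurable_EFinP; exact: measurable_int lam_neg. Qed.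

Let m0 w : 0 <= m w.
Proof. by rewrite le_max lexx orbT. Qed.

Let m_ge w z : modulus z = 1 -> - m w <= ln (deriv_modulus T w z).
Proof.
move=> z1; have l0 := inf_deriv_gt0 T w; have h := inf_deriv_le T w z1.
apply: (@le_trans _ _ (ln (inf_deriv T w))); first by rewrite lerNl le_max lexx.
by rewrite ler_ln// posrE (lt_le_trans l0).
Qed.

Local Notation H := (shifted_ln_deriv T m).
Local Notation clip := (clipped T m).
Local Notation lmean := (limit_mean P T mu m).
Local Notation cmean := (circle_mean P T m).

Let clip_mono w z : {homo (fun K => clip K w z) : a b / (a <= b)%N >-> a <= b}.
Proof.
move=> a b ab; rewrite /clipped le_min ge_min lexx/= ge_min.
by rewrite ler_nat ab orbT.
Qed.

(** On each fibre the integrand is bounded, so clipping becomes ineffective from some level on;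
    monotone convergence over [Omega] also covers an infinite limit. *)
Lemma clipped_integral_cvg (nu : Omega -> probability R[i] R) :
    (forall K, measurable_fun [set: Omega] (fun w => \int[nu w]_z clip K w z)) ->
  (fun K => \int[P]_w (\int[nu w]_z clip K w z)%:E)%E @ \oo --> (\int[P]_w (\int[nu w]_z H w z)%:E)%E.
Proof.
move=> mU; apply: eventually_monotone_cvg => //.
- by move=> K w; apply: Rintegral_ge0 => z _; have /andP[] := clipped_itv m0 m_ge K w z.
- move=> w a b ab; apply: bint_le; [exact: bmeas_clipped|exact: bmeas_clipped|].
  by move=> z; exact: clip_mono.
- move=> w; have [_ [C hC]] := bmeas_shifted T m w.
  exists (Num.truncn `|C|).+1 => K hK; apply: eq_Rintegral => z _; apply: clippedE.
  apply: (le_trans (ler_norm _)); apply: (le_trans (hC z)); apply: (le_trans (ler_norm _)).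
  by rewrite (le_trans (ltW (truncnS_gt _)))// ler_nat.
Qed.

Let c : R := \int[P]_w m w.

Let cE : (\int[P]_w (m w)%:E)%E = c%:E.
Proof. by rewrite fineK// integrable_fin_num. Qed.

Let bHfiber (nu : probability R[i] R) w : \int[nu]_z H w z = \int[nu]_z ln_deriv T w z + m w.
Proof.
have := bintD nu (bmeas_ln_deriv T w) (bmeas_cst R[i] (m w)).
by rewrite (bint_cst nu (m w)).
Qed.

Let mHmean (nu : Omega -> probability R[i] R) :
    (forall K, measurable_fun [set: Omega] (fun w => \int[nu w]_z clip K w z)) ->
  measurable_fun [set: Omega] (fun w => \int[nu w]_z H w z).
Proof.
move=> mU; apply: (measurable_fun_cvg (h := fun K w => \int[nu w]_z clip K w z)) => // w _.
apply: cvg_near_cst; have [_ [C hC]] := bmeas_shifted T m w.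
exists (Num.truncn `|C|).+1 => // K /= hK; apply: eq_Rintegral => z _; apply: clippedE.
apply: (le_trans (ler_norm _)); apply: (le_trans (hC z)); apply: (le_trans (ler_norm _)).
by rewrite (le_trans (ltW (truncnS_gt _)))// ler_nat.
Qed.

Let shift (nu : Omega -> probability R[i] R) :
    (forall K, measurable_fun [set: Omega] (fun w => \int[nu w]_z clip K w z)) ->
  (\int[P]_w (\int[nu w]_z ln_deriv T w z)%:E = \int[P]_w (\int[nu w]_z H w z)%:E - c%:E)%E.
Proof.
move=> mU; rewrite -cE -integral_subr_real//.
- by apply: eq_integral => w _; rewrite bHfiber EFinD addeK.
- by apply/measurable_EFinP; exact: mHmean.
- move=> w; rewrite lee_fin; apply: Rintegral_ge0 => z _; exact: shifted_ge0.
Qed.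

(** A function measurable in theta on the whole plane that, on the circle, is the fibre entropy
    shifted by the mean of [m]. *)
Definition total_mean theta : \bar R := limn (fun K => (lmean K theta)%:E).

Let lmean_mono theta : {homo (fun K => (lmean K theta)%:E) : a b / (a <= b)%N >-> (a <= b)%E}.
Proof.
move=> a b ab; rewrite lee_fin /limit_mean; case: ifP => _.
  apply: bint_le; [exact: bmeas_fiber_mean|exact: bmeas_fiber_mean|move=> w].
  by apply: bint_le; [exact: bmeas_clipped|exact: bmeas_clipped|move=> z; exact: clip_mono].
apply: bint_le; [exact: bmeas_circle_mean|exact: bmeas_circle_mean|move=> w].
by apply: bint_le; [exact: bmeas_clipped_expi|exact: bmeas_clipped_expi|move=> z; exact: clip_mono].
Qed.

Let lmean_ge0 K theta : 0 <= lmean K theta.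
Proof.
rewrite /limit_mean; case: ifP => _; apply: Rintegral_ge0 => w _; apply: Rintegral_ge0 => z _.
  by have /andP[] := clipped_itv m0 m_ge K w z.
by have /andP[] := clipped_itv m0 m_ge K w (expi z).
Qed.

Let mlmean K : measurable_fun [set: R[i]] (lmean K).
Proof. exact: (measurable_limit_mean ms mp ae_good mm m0 m_ge). Qed.

Let fiber_mean_measurable theta K : measurable_fun [set: Omega] (fun w => \int[p theta w]_z clip K w z).
Proof. by have [] := bmeas_fiber_mean mu mm m0 m_ge theta K. Qed.

Let cmE K w : \int[unif]_t clip K w (expi t) = \int[cm]_z clip K w z.
Proof.
rewrite (bint_pushforward (p := unif) (@measurable_expi R) _ (bmeas_clipped mm m0 m_ge K w))//.
Qed.

Let circle_mean_measurable K : measurable_fun [set: Omega] (fun w => \int[cm]_z clip K w z).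
Proof. by under eq_fun do rewrite -cmE; have [] := bmeas_circle_mean P mm m0 m_ge K. Qed.

Lemma total_mean_fiber theta (h : circle theta) :
  total_mean theta = (\int[P]_w (\int[p theta w]_z H w z)%:E)%E.
Proof.
apply/cvg_lim => //.
have := clipped_integral_cvg (nu := fun w => p theta w) (fiber_mean_measurable theta).
rewrite (_ : (fun K => \int[P]_w _)%E = (fun K => (lmean K theta)%:E))//.
apply/funext => K; rewrite /limit_mean h eqxx bint_EFin//; exact: bmeas_fiber_mean.
Qed.

Lemma total_mean_average :
  (\int[cm]_theta total_mean theta = \int[P]_w (\int[cm]_z H w z)%:E)%E.
Proof.
have h1 := @cvg_monotone_convergence _ _ _ cm setT measurableT (fun K theta => (lmean K theta)%:E)
  (fun K => proj2 (measurable_EFinP _ _) (mlmean K)) (fun K theta _ => lmean_ge0 K theta)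
  (fun theta _ => @lmean_mono theta).
rewrite -[LHS](cvg_lim _ h1)//; apply/cvg_lim => //.
have := clipped_integral_cvg (nu := fun=> cm) circle_mean_measurable.
rewrite (_ : (fun K => \int[P]_w _)%E = (fun K => \int[cm]_theta (lmean K theta)%:E)%E)//.
apply/funext => K.
have bl : bmeas (lmean K).
  split; first exact: mlmean.
  exists K%:R => theta; rewrite ger0_norm//.
  have hl : (fun n => parameter_mean P sigma T m K n theta) @ \oo --> lmean K theta.
    exact: (limit_mean_cvg ms mp ae_good mm m0 m_ge).
  have hk : (fun=> K%:R : R) n @[n --> \oo] --> (K%:R : R) by exact: cvg_cst.
  apply: (ler_cvg_to hl hk).
  by apply: nearW => n; have /andP[] := parameter_mean_itv P ms mm m0 m_ge K n theta.
rewrite (bint_EFin _ bl) (limit_mean_average ms mp ae_good mm m0 m_ge) /circle_mean.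
rewrite -bint_EFin; last exact: bmeas_circle_mean.
by apply: eq_integral => w _; rewrite cmE.
Qed.

Lemma fiber_entropy_rotated theta (h : circle theta) :
  fiber_entropy P sigma (rotate theta T) (mu theta) = (total_mean theta - c%:E)%E.
Proof.
rewrite total_mean_fiber// -(shift (nu := fun w => p theta w) (fiber_mean_measurable theta)).
rewrite -(rotated_cocycleE T h).
have := fiber_entropyE ms mp (fun w => mu_circle w h) (ae_good h).
by rewrite inf_deriv_rotated => /(_ lam_neg deg_lam) ->.
Qed.

Lemma average_fiber_entropy :
  (\int[cm]_(theta in @circle R) fiber_entropy P sigma (rotate theta T) (mu theta) =
   \int[P]_w \int[cm]_(z in @circle R) (ln (modulus (derive1 (T w) z)))%:E)%E.
Proof.
have mtot : measurable_fun [set: R[i]] total_mean.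
  apply: (emeasurable_fun_cvg (fun K theta => (lmean K theta)%:E)).
    by move=> K; exact/measurable_EFinP.
  move=> theta _; apply: ereal_nondecreasing_is_cvgn; exact: lmean_mono.
have tot0 theta : (0 <= total_mean theta)%E.
  apply: lime_ge; first exact: (ereal_nondecreasing_is_cvgn (@lmean_mono theta)).
  by apply: nearW => K; rewrite lee_fin.
have ic : cm.-integrable setT (EFin \o (fun=> c)) by exact/bmeas_integrable/bmeas_cst.
have mcirc := @measurable_circle R.
transitivity (\int[cm]_theta (total_mean theta - c%:E))%E.
  rewrite (eq_integral (fun theta => (total_mean theta - c%:E)%E)); last first.
    by move=> theta; rewrite inE => h; exact: fiber_entropy_rotated.
  have md : measurable_fun [set: R[i]] (fun theta => total_mean theta - c%:E)%E by exact: emeasurable_funB.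
  rewrite integral_mkcond; apply: ae_eq_integral => //.
    by apply: (measurable_restrictT _ mcirc).1; exact: measurable_funTS.
  have cm1 : cm (@circle R) = 1%E.
    rewrite /circle_measure /pushforward (_ : @expi R @^-1` (@circle R) = setT).
      exact: (@probability_setT _ _ _ unif).
    by apply/seteqP; split => // t _; exact: circle_expi.
  apply: (aeS (ae_circle cm1)) => z z1 _.
  by rewrite patchE mem_set.
rewrite integral_subr_real// total_mean_average integral_cst_prob.
rewrite -(shift (nu := fun=> cm) circle_mean_measurable).
apply: eq_integral => w _; rewrite -bint_EFin; last exact: bmeas_ln_deriv.
rewrite [RHS]integral_mkcond; apply: eq_integral => z _; rewrite patchE /ln_deriv /on_circle.
case: eqP => [z1|z1]; first by rewrite mem_set// blaschke_derivE.
by rewrite memNset.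
Qed.

End average_of_fiber_entropies.

(** * Consequences of admissibility *)

Section admissible_consequences.
Context d (Omega : measurableType d) (R : realType) (P : probability Omega R).
Variable T : blaschke_cocycle Omega R.
Hypothesis T_admissible : admissible P T.
Local Notation unif := (@unif01 R).
Local Notation lam := (inf_deriv T).

Lemma measurable_inf_deriv : measurable_fun [set: Omega] lam.
Proof. exact: (measurableT_comp measurable_fst (admissible_measurable T_admissible)). Qed.

Let mln : measurable_fun [set: Omega] (fun w => (ln (lam w))%:E : \bar R).
Proof. by apply/measurable_EFinP; apply: measurable_ln_comp; exact: measurable_inf_deriv. Qed.

(** A positive integral excludes an infinite negative part: in the extended reals subtracting +oo
    gives -oo, even from +oo. *)
Lemma integrable_ln_inf_deriv_neg : P.-integrable setT (EFin \o (fun w => Num.max (- ln (lam w)) 0)).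
Proof.
have negE w : ((fun w => (ln (lam w))%:E) : Omega -> \bar R)^\-%E w = (Num.max (- ln (lam w)) 0)%:E.
  by rewrite funenegE -EFinN -EFin_max.
apply/integrableP; split.
  apply/measurable_EFinP; apply: measurable_maxr => //; apply: measurable_funN.
  by apply: measurable_ln_comp; exact: measurable_inf_deriv.
under eq_integral do rewrite /= ger0_norm ?le_max ?lexx ?orbT// -negE.
pose f w : \bar R := (ln (lam w))%:E.
have : (0 < \int[P]_w f^\+ w - \int[P]_w f^\- w)%E.
  by rewrite -integralE; exact: admissible_expanding T_admissible.
rewrite -/(f^\-%E); case: (\int[P]_w f^\- w)%E => [r|//|//]; first by rewrite ltry.
by case: (\int[P]_w f^\+ w)%E.
Qed.

Lemma integrable_degree_inf_deriv : P.-integrable setT (EFin \o (fun w => (degree T w)%:R / lam w)).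
Proof.
apply/integrableP; split.
  apply/measurable_EFinP; apply: measurable_funM; first exact: measurable_degreeR.
  by apply: measurable_funV; exact: measurable_inf_deriv.
have := admissible_degree T_admissible; congr (_ < _)%E; apply: eq_integral => w _.
by rewrite /= ger0_norm// divr_ge0// ltW// inf_deriv_gt0.
Qed.

(** The mean of |T_w'| over the circle is the degree, and the infimum is at most the mean. *)
Lemma inf_deriv_le_degree w : lam w <= (degree T w)%:R.
Proof.
have [g hg] := blaschke_lift T w.
have bd : bmeas (fun t : measurableTypeR R => deriv_modulus T w (expi t)).
  split; first exact: (measurableT_comp (measurable_deriv_modulus1 T w) (@measurable_expi R)).
  exists (deriv_bound T w) => t; rewrite ger0_norm ?deriv_modulus_ge0//.
  exact: deriv_modulus_le (expi_modulus t).
have e1 : exists C : R, forall t : R, `|(fun=> 1) (expi t : R[i])| <= C by exists 1 => t; rewrite normr1.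
have := circle_lift_bint (degree_gt0 T w) hg bd (F := fun=> 1) (measurable_cst _) e1.
under eq_Rintegral do rewrite mul1r.
rewrite bint_cst mulr1 => <-; rewrite -(bint_cst unif (lam w)).
apply: bint_le => //; first exact: bmeas_cst.
by move=> t; apply: inf_deriv_le; exact: expi_modulus.
Qed.

(* A cocycle of Moebius maps is not expanding on average. *)
Lemma degree_gt1_pos : (0 < P [set w | (1 < degree T w)%N])%E.
Proof.
have mD : measurable [set w | (1 < degree T w)%N].
  rewrite (_ : [set w | _] = \bigcup_(j in [set j | (1 < j)%N]) [set w | degree T w = j]).
    by apply: bigcup_measurable => j _; exact: measurable_degree_set.
  by apply/seteqP; split => w /=; [move=> h; exists (degree T w)|move=> [j h /= ->]].
rewrite lt0e measure_ge0 andbT; apply/negP => /eqP P0.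
have := admissible_expanding T_admissible; rewrite ltNge => /negP; apply.
have ae1 : {ae P, forall w, ln (lam w) <= 0}.
  exists [set w | (1 < degree T w)%N]; split => // w /= hw; rewrite ltnNge; apply/negP => d1; apply: hw.
  apply: ln_le0; apply: (le_trans (inf_deriv_le_degree w)).
  by rewrite -[leRHS]/(1%:R) ler_nat.
have pos0 : (\int[P]_w (fun w => (ln (lam w))%:E)^\+ w = 0)%E.
  rewrite -(integral0 P setT); apply: ae_eq_integral => //; first exact: measurable_funepos.
  by apply: (aeS ae1) => w hw _; rewrite funeposE max_r// lee_fin.
rewrite integralE pos0 add0e oppe_le0; apply: integral_ge0 => w _; exact: funeneg_ge0.
Qed.

End admissible_consequences.

Theorem theorem1p3 (R : realType) (d : measure_display)
    (Omega : measurableType d) (P : probability Omega R)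
    (sigma : Omega -> Omega)
    (sigma_invertible : measurably_invertible sigma)
    (sigma_preserving : measure_preserving P sigma)
    (sigma_ergodic : ergodic P sigma)
    (T : blaschke_cocycle Omega R)
    (T_admissible : admissible P T)
    (mu : R[i] -> R.-pker Omega ~> R[i])
    (mu_acim : forall theta : R[i], circle theta ->
      random_acim P sigma (rotate theta T) (mu theta)) :
  average_entropy P sigma T mu =
  (\int[P]_w \int[@circle_measure R]_(z in @circle R)
      (ln (modulus (derive1 (T w) z)))%:E
    + ks_entropy P sigma)%E.
Proof.
have ms := sigma_invertible.1.
have acim theta (h : circle theta) : random_acim P sigma (rotated_cocycle T h) (mu theta).
  by rewrite rotated_cocycleE; exact: mu_acim.
rewrite /average_entropy; congr (_ + _)%E.
apply: (average_fiber_entropy ms sigma_preserving).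
- by move=> theta w h; exact: (kernel_circle (acim theta h)).
- move=> theta h; apply: (ae_good_fiber ms sigma_preserving sigma_ergodic (acim theta h)).
  exact: degree_gt1_pos T_admissible.
- exact: integrable_ln_inf_deriv_neg.
- exact: integrable_degree_inf_deriv.
Qed.
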